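(* Let $d\ge1$, let $m>d/2+1$ be an integer, and let $u_0\in H^m(\mathbb{T}^d)$ be pointwise positive. Then the unique solution $u$, in the class $C([0,\cdot);H^m(\mathbb{T}^d))\cap C^1([0,\cdot);H^{m-1}(\mathbb{T}^d))$, of $$u_t - u\,|\nabla| u + |\nabla|(u^2) = 0,\qquad u(\cdot,0)=u_0,$$ exists globally in time, i.e. on $[0,\infty)$. Furthermore, the solution is regularized instantly and satisfies the following bounds: for every $T>0$ and every $k\in\mathbb{N}$ (including $k=0$) there exists $\alpha_k\in(0,1)$ such that for every $0<t_0<T$, $$\|u\|_{C^{k+\alpha_k,\alpha_k}_{x,t}(\mathbb{T}^d\times(t_0,T))}\le C(d,k,t_0,T,\min u_0,\max u_0),$$ $$\|\nabla_x^k u\|_{\mathrm{Lip}(\mathbb{T}^d\times(t_0,T))}\le C(d,k,t_0,T,\min u_0,\max u_0),$$ where the constants $C$ depend only on the indicated quantities.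
   Context: $\mathbb{T}^d=(\mathbb{R}/2\pi\mathbb{Z})^d$. $|\nabla|=(-\Delta)^{1/2}$ is the Fourier multiplier with symbol $|\xi|$. $H^m$ is the usual ($L^2$-based, inhomogeneous, real-valued) Sobolev space. For such positive $u_0$ there is a unique local-in-time solution in $C([0,T_0);H^m(\mathbb{T}^d))\cap C^1([0,T_0);H^{m-1}(\mathbb{T}^d))$ for some $T_0>0$. $C^{k+\alpha,\alpha}_{x,t}$ denotes the (anisotropic) Hölder space of functions that are $C^{k+\alpha}$ in $x$ uniformly in $t$ and $C^{\alpha}$ in $t$ uniformly in $x$, with its natural norm $\sup_t\|u(\cdot,t)\|_{C^{k+\alpha}}+\sup_x\|u(x,\cdot)\|_{C^{\alpha}}$. $\mathrm{Lip}$ denotes the space of bounded functions that are Lipschitz in $(x,t)$ jointly, with norm equal to the supremum norm plus the Lipschitz constant. *)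

(* Defs.v *)
From HB Require Import structures.
From mathcomp Require Import all_boot all_order all_algebra.
From mathcomp Require Import complex.
From mathcomp Require Import all_classical all_reals all_analysis.

Set Implicit Arguments.
Unset Strict Implicit.
Unset Printing Implicit Defensive.

Import Order.TTheory GRing.Theory Num.Theory.
Import numFieldNormedType.Exports.

Local Open Scope classical_set_scope.
Local Open Scope ring_scope.

(* Points of the torus are represented by 'rV[R]_d and functions on the torus
   by functions on 'rV[R]_d that are 2*pi-periodic in every coordinate. *)

Section Torus.
Context {R : realType}.

Definition dot n (x y : 'rV[R]_n) : R := \sum_(i < n) x 0 i * y 0 i.

(* The Euclidean norm; the norm that the library puts on 'rV[R]_n is the
   sup norm. *)
Definition enorm n (x : 'rV[R]_n) : R := Num.sqrt (dot x x).

Definition periodic d (f : 'rV[R]_d -> R) : Prop :=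
  forall (i : 'I_d) x, f (x + (2 * pi) *: delta_mx 0 i) = f x.

(* Iterated Lebesgue integral over [0, 2 pi]^d; it is only applied to
   continuous functions, for which it is the d-dimensional integral. *)
Fixpoint torus_integral d : ('rV[R]_d -> R) -> R :=
  match d with
  | 0%N => fun f => f 0
  | d'.+1 => fun f => \int[lebesgue_measure]_(t in `[0, 2 * pi])
      torus_integral (fun y : 'rV[R]_d' => f (row_mx (const_mx t : 'rV_1) y))
  end.

Definition freq d (xi : 'rV[int]_d) : 'rV[R]_d := map_mx intr xi.

Definition fourier d (f : 'rV[R]_d -> R) (xi : 'rV[int]_d) : R[i] :=
  ((2 * pi) ^- d)%:C%C *
  (torus_integral (fun x => f x * cos (dot (freq xi) x)) +i*
   - torus_integral (fun x => f x * sin (dot (freq xi) x)))%C.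

Definition sobolev_norm d (m : nat) (f : 'rV[R]_d -> R) : \bar R :=
  ((\esum_(xi in [set: 'rV[int]_d])
     ((1 + enorm (freq xi) ^+ 2) ^+ m
      * ComplexField.Normc.normc (fourier f xi) ^+ 2)%:E) `^ 2^-1)%E.

(* Real-valued H^m on the torus for m > d/2: by Sobolev embedding every class
   has a unique continuous representative, and the elements are taken to be
   these representatives. *)
Definition sobolev d (m : nat) (f : 'rV[R]_d -> R) : Prop :=
  [/\ continuous f, periodic f & (sobolev_norm m f < +oo)%E].

(* g = |nabla| f as a Fourier multiplier, for a continuous g. *)
Definition is_abs_nabla d (f g : 'rV[R]_d -> R) : Prop :=
  [/\ continuous g, periodic g &
      forall xi, fourier g xi = (enorm (freq xi))%:C%C * fourier f xi].

(* u belongs to C(J; H^m). *)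
Definition sobolev_continuous d (m : nat) (J : set R)
    (u : R -> 'rV[R]_d -> R) : Prop :=
  (forall t, J t -> sobolev m (u t)) /\
  (forall t, J t ->
    sobolev_norm m (u s \- u t) @[s --> within J (nbhs t)] --> 0%E).

(* v is the time derivative of u in H^m, one-sided at endpoints of J. *)
Definition sobolev_derivative d (m : nat) (J : set R)
    (u v : R -> 'rV[R]_d -> R) : Prop :=
  forall t, J t ->
    sobolev_norm m (fun x => (u s x - u t x) / (s - t) - v t x)
      @[s --> within J t^'] --> 0%E.

Definition is_solution d (m : nat) (u0 : 'rV[R]_d -> R) (T : \bar R)
    (u : R -> 'rV[R]_d -> R) : Prop :=
  let J := [set t : R | 0 <= t /\ (t%:E < T)%E] in
  [/\ u 0 = u0,
      sobolev_continuous m J u &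
      exists ut : R -> 'rV[R]_d -> R,
        [/\ sobolev_continuous m.-1 J ut,
            sobolev_derivative m.-1 J u ut &
            forall t, J t -> exists w z : 'rV[R]_d -> R,
              [/\ is_abs_nabla (u t) w,
                  is_abs_nabla (fun x => u t x ^+ 2) z &
                  forall x, ut t x - u t x * w x + z x = 0]]].

Definition pderivs d (s : seq 'I_d) (f : 'rV[R]_d -> R) : 'rV[R]_d -> R :=
  foldr (fun i g x => 'D_(delta_mx 0 i) g x) f s.

Definition class_C d (k : nat) (f : 'rV[R]_d -> R) : Prop :=
  forall s : seq 'I_d,
    ((size s <= k)%N -> continuous (pderivs s f)) /\
    ((size s < k)%N -> forall i x, derivable (pderivs s f) x (delta_mx 0 i)).

(* The tensor nabla^k f, as the row vector of the d^k partial derivatives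
   indexed by 'I_d^k; its Euclidean norm is the Frobenius norm. *)
Definition nabla d (k : nat) (f : 'rV[R]_d -> R) (x : 'rV[R]_d) :
    'rV[R]_#|{: k.-tuple 'I_d}| :=
  \row_j pderivs (enum_val j : k.-tuple 'I_d) f x.

Definition sup_norm (X : Type) n (D : set X) (f : X -> 'rV[R]_n) : \bar R :=
  ereal_sup [set (enorm (f p))%:E | p in D].

(* Pairs with p = q contribute 0 because x / 0 = 0. *)
Definition holder_seminorm (X : Type) n (dist : X -> X -> R) (a : R)
    (D : set X) (f : X -> 'rV[R]_n) : \bar R :=
  ereal_sup [set (enorm (f pq.1 - f pq.2) / dist pq.1 pq.2 `^ a)%:E
            | pq in D `*` D].

Definition space_dist d (x y : 'rV[R]_d) : R := enorm (x - y).

Definition time_dist (s t : R) : R := `|s - t|.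

Definition spacetime_dist d (p q : 'rV[R]_d * R) : R :=
  Num.sqrt (enorm (p.1 - q.1) ^+ 2 + (p.2 - q.2) ^+ 2).

(* The norms below take the value +oo on functions without the required
   derivatives, so a finite bound includes membership in the space. *)

Definition holder_norm d (k : nat) (a : R) (f : 'rV[R]_d -> R) : \bar R :=
  if `[< class_C k f >] then
    (\sum_(j < k.+1) sup_norm setT (nabla j f)
     + holder_seminorm (@space_dist d) a setT (nabla k f))%E
  else +oo%E.

Definition holder_time_norm (a : R) (J : set R) (g : R -> R) : \bar R :=
  let g1 t : 'rV[R]_1 := const_mx (g t) in
  (sup_norm J g1 + holder_seminorm time_dist a J g1)%E.

(* The norm of C^{k+a,a}_{x,t} on T^d * J. *)
Definition holder_xt_norm d (k : nat) (a : R) (J : set R)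
    (u : R -> 'rV[R]_d -> R) : \bar R :=
  (ereal_sup [set holder_norm k a (u t) | t in J]
   + ereal_sup [set holder_time_norm a J (fun t => u t x)
               | x in [set: 'rV[R]_d]])%E.

(* The norm of nabla_x^k u in Lip(T^d * J). *)
Definition lip_nabla_norm d (k : nat) (J : set R)
    (u : R -> 'rV[R]_d -> R) : \bar R :=
  if `[< forall t, J t -> class_C k (u t) >] then
    let D := [set: 'rV[R]_d] `*` J in
    let g (p : 'rV[R]_d * R) := nabla k (u p.2) p.1 in
    (sup_norm D g + holder_seminorm (@spacetime_dist d) 1 D g)%E
  else +oo%E.

End Torus.

(* Main.v *)
(* Since f(x)(f(x) - f(y)) - (f(x)^2 - f(y)^2) = f(y)(f(y) - f(x)), the equation reads
   u_t(x) = int k(x - y) u(y) (u(y) - u(x)) dy, where k is the kernel of |nabla|: a nonlocal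
   diffusion whose coefficient u(y) stays in [min u0, max u0]. We discretize |nabla| on the
   lattices x + n^-1 Z^d by mixtures of binomial random walks and time by explicit Euler
   steps. On a lattice, doubling variables gives a modulus of continuity that improves with
   time; once oscillations at some scale are small, the same comparison for high-order
   differences, with Marchaud's inequality for the intermediate Leibniz terms, gives
   differences of every order. All constants depend only on t0, min u0 and max u0.

   The scheme has a local energy bound in H^m, because the symmetrized top-order term is
   controlled by the maximum principle (2 w |nabla| w - |nabla| (w^2) >= 0), so it converges
   along an ultrafilter to a local solution. Any solution is the limit of the scheme started
   from the same datum, which gives uniqueness, transfers the lattice regularity to the
   solution as decay of its Fourier coefficients, and allows continuation for all times. *)

From HB Require Import structures.
From mathcomp Require Import all_boot all_order all_algebra.
From mathcomp Require Import all_classical all_reals all_analysis.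
From mathcomp Require Import complex ring lra zify.
Require Import Defs.

Set Implicit Arguments.
Unset Strict Implicit.
Unset Printing Implicit Defensive.

Import Order.TTheory GRing.Theory Num.Theory.
Import numFieldNormedType.Exports.

Local Open Scope classical_set_scope.
Local Open Scope ring_scope.

Local Notation periodic := Defs.periodic.

Local Ltac clra := clear; lra.

(** On a mesh the jump kernel is a finite positive measure, so every comparison is a finite
    computation with bounded functions and needs no regularity in advance. Both lattice estimates
    are free at the scale of one mesh step: a fine mesh makes the datum oscillate little between
    neighbours, and nonzero lattice vectors have length at least 1. The scale at which they hold
    then grows linearly with the number of steps, so at any positive time it is a macroscopic
    length. The Lipschitz constant of the datum decides only how fine the mesh must be, which keeps
    it out of the constants.

    The obstacle in the first comparison is that the coefficient is as rough as the solution and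
    multiplies first-order terms of the modulus. Their odd part averages to zero, but the
    second-order part has a moment that diverges logarithmically. A doubly logarithmic modulus is
    chosen because its slope contains the matching inverse logarithm. *)

Section EuclideanNorm.
Context {R : realType} {d : nat}.
Implicit Types x y : 'rV[R]_d.

Lemma dotC x y : dot x y = dot y x.
Proof. by apply: eq_bigr => i _; rewrite mulrC. Qed.

Lemma dotDr x y z : dot x (y + z) = dot x y + dot x z.
Proof. by rewrite /dot -big_split; apply: eq_bigr => i _; rewrite mxE mulrDr. Qed.

Lemma dotNr x y : dot x (- y) = - dot x y.
Proof. by rewrite /dot -sumrN; apply: eq_bigr => i _; rewrite mxE mulrN. Qed.

Lemma dotZr (c : R) x y : dot x (c *: y) = c * dot x y.
Proof. by rewrite /dot mulr_sumr; apply: eq_bigr => i _; rewrite mxE mulrCA. Qed.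

Lemma dotDl x y z : dot (x + y) z = dot x z + dot y z.
Proof. by rewrite dotC dotDr !(dotC z). Qed.

Lemma dotNl x y : dot (- x) y = - dot x y.
Proof. by rewrite dotC dotNr dotC. Qed.

Lemma dotZl (c : R) x y : dot (c *: x) y = c * dot x y.
Proof. by rewrite dotC dotZr dotC. Qed.

Lemma dot_ge0 x : 0 <= dot x x.
Proof. by apply: sumr_ge0 => i _; rewrite -expr2 sqr_ge0. Qed.

Lemma dot_delta x i : dot x (delta_mx 0 i) = x 0 i.
Proof.
rewrite /dot (bigD1 i) //= mxE !eqxx mulr1 big1 ?addr0 // => j ji.
by rewrite mxE eqxx (negPf ji) mulr0.
Qed.

Lemma enorm_ge0 x : 0 <= enorm x.
Proof. exact: sqrtr_ge0. Qed.

Lemma sqr_enorm x : enorm x ^+ 2 = dot x x.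
Proof. by rewrite sqr_sqrtr // dot_ge0. Qed.

Lemma dot00 : dot (0 : 'rV[R]_d) 0 = 0.
Proof. by rewrite /dot big1 // => i _; rewrite mxE mul0r. Qed.

Lemma enorm0 : enorm (0 : 'rV[R]_d) = 0.
Proof. by rewrite /enorm dot00 sqrtr0. Qed.

Lemma enormN x : enorm (- x) = enorm x.
Proof. by rewrite /enorm dotNl dotNr opprK. Qed.

Lemma enormZ (c : R) x : enorm (c *: x) = `|c| * enorm x.
Proof.
by rewrite /enorm dotZl dotZr mulrA -expr2 sqrtrM ?sqr_ge0 // sqrtr_sqr.
Qed.

Lemma normr_le_enorm x i : `|x 0 i| <= enorm x.
Proof.
rewrite -ler_sqr ?nnegrE ?enorm_ge0 // sqr_enorm real_normK ?num_real //.
by rewrite /dot (bigD1 i) //= -expr2 lerDl sumr_ge0 // => j _; rewrite -expr2 sqr_ge0.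
Qed.

Lemma enorm_eq0 x : enorm x = 0 -> x = 0.
Proof.
move=> x0; apply/rowP => i; rewrite mxE; apply/eqP.
by rewrite -normr_le0 -x0 normr_le_enorm.
Qed.

Lemma dot_le x y : dot x y <= enorm x * enorm y.
Proof.
have := dot_ge0 (enorm y *: x - enorm x *: y).
rewrite dotDl !dotDr !dotNl !dotNr !dotZl !dotZr -!sqr_enorm (dotC y x).
set a := enorm x; set b := enorm y; set c := dot x y => h.
have a0 : 0 <= a := enorm_ge0 x.
have b0 : 0 <= b := enorm_ge0 y.
have [ab0|ab0] := eqVneq (a * b) 0.
  have : c = 0.
    move/eqP: ab0; rewrite mulf_eq0 => /orP[] /eqP /enorm_eq0 e0.
      by rewrite /c e0 -(scale0r 0) dotZl mul0r.
    by rewrite /c e0 -(scale0r 0) dotZr mul0r.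
  by rewrite ab0 => ->.
have ab : 0 < a * b by rewrite lt_neqAle eq_sym ab0 mulr_ge0.
rewrite -subr_ge0 -(pmulr_rge0 _ ab).
have -> : a * b * (a * b - c) = (b * (b * a ^+ 2) + - (b * (a * c)) + (- (a * (b * c)) - - (a * (a * b ^+ 2)))) / 2 by field.
lra.
Qed.

Lemma enormD x y : enorm (x + y) <= enorm x + enorm y.
Proof.
rewrite -ler_sqr ?nnegrE ?addr_ge0 ?enorm_ge0 // sqr_enorm.
rewrite dotDl !dotDr -!sqr_enorm (dotC y x).
have := dot_le x y; nra.
Qed.

Lemma enormB x y : enorm (x - y) <= enorm x + enorm y.
Proof. by rewrite (le_trans (enormD _ _)) // enormN. Qed.

Lemma enorm_le_sum x : enorm x <= \sum_i `|x 0 i|.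
Proof.
have s0 : 0 <= \sum_i `|x 0 i| by apply: sumr_ge0.
rewrite -ler_sqr ?nnegrE ?enorm_ge0 // sqr_enorm expr2 mulr_suml.
apply: ler_sum => i _; rewrite -expr2 -(real_normK (num_real _)) expr2.
by rewrite ler_wpM2l // (bigD1 i) //= lerDl sumr_ge0.
Qed.

Lemma sum_le_enorm x : \sum_i `|x 0 i| <= d%:R * enorm x.
Proof.
apply: (@le_trans _ _ (\sum_(i < d) enorm x)); first by apply: ler_sum => i _; exact: normr_le_enorm.
by rewrite sumr_const card_ord mulr_natl.
Qed.

Lemma enorm_delta i : enorm (delta_mx 0 i : 'rV[R]_d) = 1.
Proof. by rewrite /enorm dot_delta mxE !eqxx sqrtr1. Qed.

End EuclideanNorm.

(** * Integer vectors, as frequencies and as lattice displacements *)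

Section IntVectors.
Context {R : realType} {d : nat}.
Implicit Types k l : 'rV[int]_d.

Definition nz k : R := enorm (freq k).

Lemma freqD k l : freq (k + l) = freq k + freq l :> 'rV[R]_d.
Proof. by apply/rowP => i; rewrite !mxE intrD. Qed.

Lemma freqN k : freq (- k) = - freq k :> 'rV[R]_d.
Proof. by apply/rowP => i; rewrite !mxE mulrNz. Qed.

Lemma freqB k l : freq (k - l) = freq k - freq l :> 'rV[R]_d.
Proof. by rewrite freqD freqN. Qed.

Lemma freq0 : freq (0 : 'rV[int]_d) = 0 :> 'rV[R]_d.
Proof. by apply/rowP => i; rewrite !mxE. Qed.

Lemma freqMn k n : freq (k *+ n) = n%:R *: freq k :> 'rV[R]_d.
Proof.
elim: n => [|n IH]; first by rewrite mulr0n scale0r freq0.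
by rewrite mulrS freqD IH -natr1 scalerDl scale1r addrC.
Qed.

Lemma freq_delta i : freq (delta_mx 0 i : 'rV[int]_d) = delta_mx 0 i :> 'rV[R]_d.
Proof. by apply/rowP => j; rewrite !mxE; case: (_ && _). Qed.

Lemma nz_ge0 k : 0 <= nz k. Proof. exact: enorm_ge0. Qed.

Lemma nz0 : nz 0 = 0. Proof. by rewrite /nz freq0 enorm0. Qed.

Lemma nzN k : nz (- k) = nz k. Proof. by rewrite /nz freqN enormN. Qed.

Lemma nzD k l : nz (k + l) <= nz k + nz l.
Proof. by rewrite /nz freqD enormD. Qed.

Lemma nzB k l : nz (k - l) <= nz k + nz l.
Proof. by rewrite -(nzN l) nzD. Qed.

Lemma nzMn k n : nz (k *+ n) = n%:R * nz k.
Proof. by rewrite /nz freqMn enormZ ger0_norm. Qed.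

(** Some coordinate is a nonzero integer. This gap is what starts the estimate of high-order
    differences: at scale 1 the required bound follows from smallness of oscillations alone. *)
Lemma nz_ge1 k : k != 0 -> 1 <= nz k.
Proof.
move=> k0; have [i ki] : exists i, k 0 i != 0.
  apply/existsP; apply: contraNT k0; rewrite negb_exists => /forallP h.
  by apply/eqP/rowP => i; rewrite mxE; apply/eqP; move: (h i); rewrite negbK.
apply: le_trans (normr_le_enorm _ i); rewrite mxE -intr_norm -[leLHS]/(1%:~R) ler_int.
by rewrite -gtz0_ge1 normr_gt0.
Qed.

End IntVectors.

(** * Central binomial coefficients *)

Section CentralBinomial.
Context {R : realType}.

(** The return probability of the simple random walk after 2n steps, and the n-th Taylor coefficient
    of (1 - s)^(-1/2). *)
Definition aN (n : nat) : R := 'C(2 * n, n)%:R / 4 ^+ n.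

Lemma aN0 : aN 0 = 1. Proof. by rewrite /aN bin0 expr0 divr1. Qed.

Lemma aN_gt0 n : 0 < aN n.
Proof. by rewrite divr_gt0 ?exprn_gt0 // ltr0n bin_gt0 leq_pmull. Qed.

Lemma aN_rec n : (2 * n.+1)%:R * aN n.+1 = (2 * n).+1%:R * aN n.
Proof.
have e : (n.+1 * 'C(2 * n.+1, n.+1) = 2 * ((2 * n).+1 * 'C(2 * n, n)))%N.
  have -> : (2 * n.+1 = (2 * n).+2)%N by lia.
  rewrite -mul_bin_diag /=.
  have -> : 'C((2 * n).+1, n) = 'C((2 * n).+1, n.+1) by rewrite -bin_sub; [congr ('C(_, _)); lia | lia].
  have -> : (2 * n).+2 = (2 * n.+1)%N by lia.
  by rewrite -mulnA -mul_bin_diag.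
rewrite /aN exprS; apply: (@mulfI _ (4 ^+ n)); first by rewrite expf_neq0.
have e' : n.+1%:R * 'C(2 * n.+1, n.+1)%:R = 2 * ((2 * n).+1%:R * 'C(2 * n, n)%:R) :> R by rewrite -!natrM e.
have -> : 4 ^+ n * ((2 * n.+1)%:R * ('C(2 * n.+1, n.+1)%:R / (4 * 4 ^+ n))) =
   n.+1%:R * 'C(2 * n.+1, n.+1)%:R / 2 :> R.
  rewrite natrM; set x : R := 4 ^+ n; have : x != 0 by rewrite expf_neq0.
  by move=> ?; field.
rewrite e'; set x : R := 4 ^+ n; have : x != 0 by rewrite expf_neq0.
by move=> ?; field.
Qed.

Lemma aN_S n : aN n.+1 = aN n * ((n%:R + 2^-1) / n.+1%:R).
Proof.
have := aN_rec n; rewrite -[(2 * n).+1%:R]natr1 !natrM => h.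
have n0 : n.+1%:R != 0 :> R by rewrite pnatr_eq0.
apply: (@mulfI _ (2 * n.+1%:R)); first by rewrite mulf_neq0.
by rewrite h; field; rewrite -[1 + _]/(1%:R + n%:R) -natrD pnatr_eq0.
Qed.

Lemma aN_decr n : aN n.+1 <= aN n.
Proof.
rewrite aN_S ler_piMr ?(ltW (aN_gt0 _)) // ler_pdivrMr ?ltr0n // mul1r -(natr1 n); lra.
Qed.

(** The product is nonincreasing in n by [aN_S], and the one in [aN_sqr_ge] is nondecreasing.
    Together they fix the order n^(-1/2) of [aN n] with explicit constants. *)
Lemma aN_sqr_le n : aN n ^+ 2 * (2 * n%:R + 1) <= 1.
Proof.
elim: n => [|n IH]; first by rewrite aN0; lra.
apply: le_trans IH; rewrite aN_S exprMn -mulrA ler_wpM2l ?sqr_ge0 // -(natr1 n).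
have n0 : 0 <= n%:R :> R by [].
set x : R := n%:R in n0 *; have -> : ((x + 2^-1) / (x + 1)) ^+ 2 * (2 * (x + 1) + 1)
  = (x + 2^-1) ^+ 2 * (2 * x + 3) / (x + 1) ^+ 2 by field; lra.
by rewrite ler_pdivrMr ?exprn_gt0 //; [nra | lra].
Qed.

Lemma aN_sqr_ge n : (0 < n)%N -> 1 <= aN n ^+ 2 * (4 * n%:R).
Proof.
elim: n => // n IH _; have [->|n0] := posnP n.
  by rewrite aN_S aN0; lra.
apply: le_trans (IH n0) _; rewrite aN_S (exprMn _ (aN n)) -[leRHS]mulrA; apply: ler_wpM2l; rewrite ?sqr_ge0 // -(natr1 n).
have {}n0 : 0 < n%:R :> R by rewrite ltr0n.
set x : R := n%:R in n0 *; have -> : ((x + 2^-1) / (x + 1)) ^+ 2 * (4 * (x + 1))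
  = (x + 2^-1) ^+ 2 * 4 / (x + 1) by field; lra.
by rewrite ler_pdivlMr; [nra | lra].
Qed.

Lemma aN_le n (r : R) : 0 <= r -> r ^+ 2 <= n%:R + 1 -> aN n * r <= 1.
Proof.
move=> r0 rn; have a0 := ltW (aN_gt0 n).
rewrite -ler_sqr ?nnegrE ?mulr_ge0 // expr1n (exprMn _ (aN n)).
apply: le_trans (aN_sqr_le n); apply: ler_wpM2l; rewrite ?sqr_ge0 //.
by have : 0 <= n%:R :> R by []; lra.
Qed.

Lemma aN_ge n (r : R) : 0 <= r -> (0 < n)%N -> n%:R <= r ^+ 2 -> 1 <= aN n * (2 * r).
Proof.
move=> r0 n0 rn; have a0 := ltW (aN_gt0 n).
rewrite -ler_sqr ?nnegrE ?mulr_ge0 // expr1n.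
have -> : (aN n * (2 * r)) ^+ 2 = aN n ^+ 2 * (4 * r ^+ 2) by ring.
apply: le_trans (aN_sqr_ge n0) _; apply: ler_wpM2l; rewrite ?sqr_ge0 //; lra.
Qed.

(** The square of (1 - s)^(-1/2) is 1/(1 - s). In coefficients: the first moment of the convolution
    is computed once by the symmetry between i and n - i ([sw]) and once by the recursion for
    [aN]. *)
Lemma aN_conv n : \sum_(i < n.+1) aN i * aN (n - i)%N = 1.
Proof.
have aS k : k.+1%:R * aN k.+1 = (k%:R + 2^-1) * aN k.
  rewrite aN_S mulrCA [_ * (_ / _)]mulrC divfK ?pnatr_eq0 // mulrC //.
elim: n => [|n IH]; first by rewrite big_ord1 aN0 mulr1.
have sw m : \sum_(i < m.+1) i%:R * (aN i * aN (m - i)%N) =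
   m%:R / 2 * \sum_(i < m.+1) aN i * aN (m - i)%N.
  have e : \sum_(i < m.+1) i%:R * (aN i * aN (m - i)%N) =
    \sum_(i < m.+1) (m - i)%N%:R * (aN i * aN (m - i)%N).
    rewrite (reindex_inj rev_ord_inj) /=; apply: eq_bigr => i _.
    by rewrite subSS subKn ?leq_ord // [aN (m - i)%N * _]mulrC.
  have : \sum_(i < m.+1) i%:R * (aN i * aN (m - i)%N) + \sum_(i < m.+1) i%:R * (aN i * aN (m - i)%N)
    = m%:R * \sum_(i < m.+1) aN i * aN (m - i)%N.
    rewrite {2}e -big_split /= mulr_sumr; apply: eq_bigr => i _.
    by rewrite -mulrDl -natrD subnKC ?leq_ord.
  by move=> h; rewrite mulrAC -h; field.
have := sw n.+1; rewrite big_ord_recl mul0r add0r.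
under eq_bigr => i _ do rewrite lift0 subSS mulrA aS -mulrA mulrDl.
rewrite big_split /= sw -mulr_sumr IH => h.
have n1 : n.+1%:R / 2 != 0 :> R by rewrite mulf_neq0 ?invr_eq0 ?pnatr_eq0.
by apply: (mulfI n1); rewrite -h mulr1 -natr1; field.
Qed.

End CentralBinomial.

(** * The doubly logarithmic modulus of continuity *)

Section Modulus.
Context {R : realType}.
Implicit Types (x y e kap rho xi : R).

Lemma ln_tangent x y : 0 < x -> 0 < y -> ln y <= ln x + (y - x) / x.
Proof.
move=> x0 y0.
have h : -1 < (y - x) / x :> R by rewrite mulrBl divff ?gt_eqF // -subr_gt0; have := divr_gt0 y0 x0; lra.
have := le_ln1Dx h.
have -> : 1 + (y - x) / x = y / x by field; rewrite gt_eqF.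
by rewrite ln_div // lerBlDl.
Qed.

Lemma ln_ge0_1D x : 0 <= x -> 0 <= ln (1 + x).
Proof. by move=> x0; apply: ln_ge0; rewrite lerDl. Qed.

Lemma ln1D_mono x y : 0 <= x -> x <= y -> ln (1 + x) <= ln (1 + y).
Proof. by move=> x0 xy; rewrite ler_ln ?lerD2l // posrE; move: x0 xy; clra. Qed.

(** The jump [e0] at the origin means that only oscillations above this size are compared. The
    second term is unbounded, so beyond a multiple of [rho] the modulus exceeds the range of the
    solution and nothing remains to be compared. *)
Definition wm e0 kap rho xi := e0 + kap * ln (1 + ln (1 + xi / rho)).

(* The derivative of [wm] with respect to xi. *)
Definition wd kap rho xi := kap / ((1 + ln (1 + xi / rho)) * (rho + xi)).

Lemma wd_ge0 kap rho xi : 0 <= kap -> 0 < rho -> 0 <= xi -> 0 <= wd kap rho xi.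
Proof.
move=> k0 r0 x0; apply: divr_ge0 => //; apply: mulr_ge0; last by rewrite addr_ge0 // ltW.
by rewrite addr_ge0 // ln_ge0_1D // divr_ge0 // ltW.
Qed.

(** Concavity in the distance: each of the two logarithms lies below its tangent. *)
Lemma wm_tangent e0 kap rho xi y : 0 <= kap -> 0 < rho -> 0 <= xi -> 0 <= y ->
  wm e0 kap rho y <= wm e0 kap rho xi + wd kap rho xi * (y - xi).
Proof.
move=> k0 r0 x0 y0.
have [xr yr] : 0 <= xi / rho /\ 0 <= y / rho by rewrite !divr_ge0 // ltW.
have [lx ly] : 0 <= ln (1 + xi / rho) /\ 0 <= ln (1 + y / rho) by rewrite !ln_ge0_1D.
rewrite /wm /wd -addrA lerD2l.
set X := 1 + ln (1 + xi / rho).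
have X0 : 0 < X by rewrite ltr_wpDr.
have h1 : ln (1 + ln (1 + y / rho)) <= ln X + (ln (1 + y / rho) - ln (1 + xi / rho)) / X.
  have := @ln_tangent X (1 + ln (1 + y / rho)) X0; rewrite ltr_wpDr // => /(_ isT).
  by rewrite /X opprD addrACA subrr add0r.
have h2 : ln (1 + y / rho) - ln (1 + xi / rho) <= (y - xi) / (rho + xi).
  have := @ln_tangent (1 + xi / rho) (1 + y / rho); rewrite !ltr_wpDr // => /(_ isT isT).
  rewrite -lerBlDl => /le_trans; apply; rewrite le_eqVlt; apply/orP; left; apply/eqP.
  by field; rewrite !gt_eqF // ltr_wpDr.
have h3 : ln (1 + ln (1 + y / rho)) <= ln X + ((y - xi) / (rho + xi)) / X.
  by apply: le_trans h1 _; rewrite lerD2l ler_pM2r ?invr_gt0.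
apply: le_trans (ler_wpM2l k0 h3) _.
rewrite mulrDr lerD2l le_eqVlt; apply/orP; left; apply/eqP.
by field; rewrite !gt_eqF // ltr_wpDr.
Qed.

(** The price of improving the modulus by raising its scale, to be paid out of the dissipation of
    one time step. *)
Lemma wm_time e0 kap rho rho' xi : 0 <= kap -> 0 < rho -> rho <= rho' -> 0 <= xi ->
  wm e0 kap rho xi <= wm e0 kap rho' xi + kap * (rho' - rho) / rho.
Proof.
move=> k0 r0 rr x0; have r0' : 0 < rho' := lt_le_trans r0 rr.
have [xr yr] : 0 <= xi / rho /\ 0 <= xi / rho' by rewrite !divr_ge0 // ltW.
have [lx ly] : 0 <= ln (1 + xi / rho) /\ 0 <= ln (1 + xi / rho') by rewrite !ln_ge0_1D.
rewrite /wm -addrA lerD2l -mulrA -mulrDr; apply: ler_wpM2l => //.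
set X := 1 + ln (1 + xi / rho').
have X1 : 1 <= X by rewrite lerDl.
have h1 : ln (1 + ln (1 + xi / rho)) <= ln X + (ln (1 + xi / rho) - ln (1 + xi / rho')) / X.
  have := @ln_tangent X (1 + ln (1 + xi / rho)) (lt_le_trans ltr01 X1); rewrite ltr_wpDr // => /(_ isT).
  by rewrite /X opprD addrACA subrr add0r.
have h2 : ln (1 + xi / rho) - ln (1 + xi / rho') <= (rho' - rho) / rho.
  have := @ln_tangent (1 + xi / rho') (1 + xi / rho); rewrite !ltr_wpDr // => /(_ isT isT).
  rewrite -lerBlDl => /le_trans; apply.
  have -> : (1 + xi / rho - (1 + xi / rho')) / (1 + xi / rho') = (xi / (rho' + xi)) * ((rho' - rho) / rho).
    by field; rewrite !gt_eqF // ltr_wpDr.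
  apply: ler_piMl; first by rewrite divr_ge0 ?subr_ge0 // ltW.
  by rewrite ler_pdivrMr ?mul1r ?ltr_wpDr // lerDr ltW.
have h0 : 0 <= ln (1 + xi / rho) - ln (1 + xi / rho').
  by rewrite subr_ge0; apply: ln1D_mono => //; rewrite ler_wpM2l // lef_pV2.
apply: le_trans h1 _; rewrite lerD2l; apply: le_trans h2; apply: ler_piMr => //.
by rewrite invf_le1 // (lt_le_trans ltr01 X1).
Qed.

Lemma wm_ge e0 kap rho xi : 0 <= kap -> 0 < rho -> 0 <= xi -> e0 <= wm e0 kap rho xi.
Proof.
move=> k0 r0 x0; by rewrite lerDl mulr_ge0 ?ln_ge0_1D ?ln_ge0_1D ?divr_ge0 // ltW.
Qed.

Lemma wm_mono e0 kap rho x y : 0 <= kap -> 0 < rho -> 0 <= x -> x <= y ->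
  wm e0 kap rho x <= wm e0 kap rho y.
Proof.
move=> k0 r0 x0 xy; rewrite lerD2l ler_wpM2l // ln1D_mono ?ln1D_mono ?ln_ge0_1D // ?divr_ge0 // ?(ltW r0) //.
by rewrite ler_pM2r ?invr_gt0.
Qed.

Lemma wm_at e0 kap rho : 0 <= kap -> 0 < rho -> wm e0 kap rho rho <= e0 + kap.
Proof.
move=> k0 r0; rewrite lerD2l ler_piMr // divff ?gt_eqF //.
have h1 : ln (1 + 1) <= 1 :> R by apply: le_ln1Dx; lra.
have h0 : 0 <= ln (1 + 1) :> R by exact: ln_ge0_1D.
by apply: le_trans h1; apply: le_ln1Dx; move: h0; clra.
Qed.

(** Inverting both logarithms. It confines the comparison to distances of order [rho], with a doubly
    exponential factor. *)
Lemma wm_lt e0 kap rho xi M : 0 < kap -> 0 < rho -> 0 <= xi -> 0 <= e0 ->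
  wm e0 kap rho xi < M -> xi <= expR (expR (M / kap)) * rho.
Proof.
move=> k0 r0 x0 e00 h.
have xr : 0 <= xi / rho by rewrite divr_ge0 // ltW.
have lx := ln_ge0_1D xr.
have h1 : ln (1 + ln (1 + xi / rho)) < M / kap by rewrite ltr_pdivlMr // mulrC; move: h e00; rewrite /wm; clra.
have h2 : 1 + ln (1 + xi / rho) <= expR (M / kap) by rewrite -[leLHS]lnK ?posrE ?ltr_wpDr // ler_expR ltW.
have h3 : 1 + xi / rho <= expR (expR (M / kap)).
  rewrite -[leLHS]lnK ?posrE ?ltr_wpDr // ler_expR; move: h2; clra.
by rewrite -ler_pdivrMr //; move: h3; clra.
Qed.

End Modulus.

(** * The equation on the lattice *)

Section Lattice.
Context {R : realType} {d : nat}.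
Local Notation Z := 'rV[int]_d.
Local Notation nz := (@nz R d).

(** * Binomial random walks on the lattice *)

Section BinomialWalk.
Implicit Types (F G : Z -> R) (k v : Z).

(** The expectation of [F] after [M] independent steps from [k], each equal to 0 or [v] with
    probability 1/2. *)
Definition av M v F k : R :=
  \sum_(j < M.+1) 'C(M, j)%:R / 2 ^+ M * F (k + v *+ j).

Lemma av0 v F k : av 0 v F k = F k.
Proof. by rewrite /av big_ord1 bin0 expr0 divr1 mul1r mulr0n addr0. Qed.

Lemma avS M v F k : av M.+1 v F k = (av M v F k + av M v F (k + v)) / 2.
Proof.
have two : (2 : R) != 0 by rewrite pnatr_eq0.
pose t M j k : R := 'C(M, j)%:R / 2 ^+ M * F (k + v *+ j).
have e1 : av M v F (k + v) = \sum_(j < M.+1) 'C(M, j)%:R / 2 ^+ M * F (k + v *+ j.+1).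
  by apply: eq_bigr => j _; rewrite -addrA -mulrS.
have e2 : av M v F k = \sum_(j < M.+2) 'C(M, j)%:R / 2 ^+ M * F (k + v *+ j).
  by rewrite big_ord_recr /= bin_small // !mul0r addr0.
rewrite e1 e2 [in RHS]big_ord_recl /= [LHS]/av big_ord_recl /= addrAC -addrA -big_split /=.
rewrite mulrDl big_distrl /= !bin0; congr (_ + _).
  by rewrite exprS invfM mulr0n addr0; ring.
apply: eq_bigr => j _; rewrite /bump /= add1n binS natrD exprS invfM; ring.
Qed.

Lemma av_weight M : \sum_(j < M.+1) 'C(M, j)%:R / 2 ^+ M = 1 :> R.
Proof.
elim: M => [|M IH]; first by rewrite big_ord1 bin0 expr0 divr1.
have h N : \sum_(j < N.+1) 'C(N, j)%:R / 2 ^+ N = av N 0 (fun=> 1) 0 by apply: eq_bigr => j _; rewrite mulr1.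
by rewrite h avS addr0 -(h M) IH; field.
Qed.

Lemma av_mono M v F G k : (forall l, F l <= G l) -> av M v F k <= av M v G k.
Proof.
by move=> FG; apply: ler_sum => j _; apply: ler_wpM2l => //; rewrite divr_ge0 ?exprn_ge0.
Qed.

Lemma av_cst M v c k : av M v (fun=> c) k = c.
Proof. by rewrite /av -mulr_suml av_weight mul1r. Qed.

Lemma avD M v F G k : av M v (fun l => F l + G l) k = av M v F k + av M v G k.
Proof. by rewrite /av -big_split; apply: eq_bigr => j _; rewrite mulrDr. Qed.

Lemma avZ M v c F k : av M v (fun l => c * F l) k = c * av M v F k.
Proof. by rewrite /av mulr_sumr; apply: eq_bigr => j _; rewrite mulrCA. Qed.

Lemma av_shift M v F a k : av M v (fun l => F (l + a)) k = av M v F (k + a).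
Proof. by apply: eq_bigr => j _; rewrite addrAC. Qed.

Lemma av_rev M v F k : av M v F k = av M (- v) F (k + v *+ M).
Proof.
rewrite /av (reindex_inj rev_ord_inj); apply: eq_bigr => j _ /=.
rewrite subSS bin_sub ?leq_ord // mulNrn -addrA; congr (_ * F (_ + _)).
by rewrite mulrnBr ?leq_ord.
Qed.

Lemma av_opp M v F k : av M v (fun l => F (- l)) k = av M (- v) F (- k).
Proof. by apply: eq_bigr => j _; rewrite opprD mulNrn. Qed.

(** Averaging over one step multiplies a cosine by the cosine of the half angle and advances its
    phase by that half angle. *)
Lemma av_cos M v (x : 'rV[R]_d) b k :
  av M v (fun l => cos (dot x (freq l) + b)) k =
  cos (dot x (freq v) / 2) ^+ M * cos (dot x (freq k) + b + M%:R * (dot x (freq v) / 2)).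
Proof.
elim: M k => [|M IH] k; first by rewrite av0 expr0 !mul1r mul0r addr0.
rewrite avS !IH freqD dotDr -(natr1 M) exprS; set t := dot x (freq v) / 2.
set c := dot x (freq k); have -> : dot x (freq v) = t + t by rewrite /t -splitr.
set p := c + b + M%:R * t + t.
have -> : c + b + M%:R * t = p - t by rewrite addrK.
have -> : c + (t + t) + b + M%:R * t = p + t by rewrite /p; ring.
have -> : c + b + (M%:R + 1) * t = p by rewrite /p; ring.
by rewrite cosB cosD; field.
Qed.

(** An even number of steps, recentred by its mean, makes the walk symmetric and keeps it on the
    lattice. *)
Definition BN N v F k := av (2 * N) v F (k - v *+ N).

Definition EV N (s : seq Z) F : Z -> R := foldr (fun v G => BN N v G) F s.

Lemma EV_mono N s F G k : (forall l, F l <= G l) -> EV N s F k <= EV N s G k.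
Proof. by elim: s k => [|v s IH] k FG //=; apply: av_mono => l; exact: IH. Qed.

Lemma EV_ext N s F G k : (forall l, F l = G l) -> EV N s F k = EV N s G k.
Proof. by move=> FG; apply/eqP; rewrite eq_le !EV_mono // => l; rewrite FG. Qed.

Lemma EV_cst N s c k : EV N s (fun=> c) k = c.
Proof.
elim: s k => //= v s IH k; rewrite /BN -[RHS](av_cst (2 * N) v c (k - v *+ N)).
by apply: eq_bigr => j _; rewrite IH.
Qed.

Lemma EVD N s F G k : EV N s (fun l => F l + G l) k = EV N s F k + EV N s G k.
Proof.
elim: s k => //= v s IH k; rewrite /BN -avD; apply: eq_bigr => j _.
by rewrite IH.
Qed.

Lemma EVZ N s c F k : EV N s (fun l => c * F l) k = c * EV N s F k.
Proof.
by elim: s k => //= v s IH k; rewrite /BN -avZ; apply: eq_bigr => j _; rewrite IH.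
Qed.

Lemma EV_shift N s F a k : EV N s (fun l => F (l + a)) k = EV N s F (k + a).
Proof.
elim: s k => //= v s IH k; rewrite /BN.
transitivity (av (2 * N) v (fun l => EV N s F (l + a)) (k - v *+ N)).
  by apply: eq_bigr => j _; rewrite IH.
by rewrite av_shift addrAC.
Qed.

Lemma BN_opp N v F k : BN N v (fun l => F (- l)) k = BN N v F (- k).
Proof.
rewrite /BN av_opp opprB [v *+ N - k]addrC av_rev opprK; congr av.
by rewrite mulNrn mul2n -addnn mulrnDr opprD addrA addrK.
Qed.

Lemma EV_opp N s F k : EV N s (fun l => F (- l)) k = EV N s F (- k).
Proof.
elim: s k => //= v s IH k; rewrite -BN_opp; apply: eq_bigr => j _.
by rewrite IH.
Qed.

Lemma EV_cos N s (x : 'rV[R]_d) b k :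
  EV N s (fun l => cos (dot x (freq l) + b)) k =
  \prod_(v <- s) (cos (dot x (freq v) / 2) ^+ 2) ^+ N * cos (dot x (freq k) + b).
Proof.
elim: s k => [|v s IH] k /=; first by rewrite big_nil mul1r.
rewrite big_cons; set P := \prod_(j <- s) _.
transitivity (BN N v (fun l => P * cos (dot x (freq l) + b)) k).
  by apply: eq_bigr => j _; rewrite IH.
rewrite /BN avZ av_cos -exprM mulrCA mulrA; congr (_ * cos _).
by rewrite freqB dotDr dotNr freqMn dotZr natrM; field.
Qed.

(** Each of the 2N steps along a unit vector has variance 1/4, and the recentred walk has mean zero,
    so every direction adds N/2. *)
Lemma EV_sqr N s k : (forall v, v \in s -> exists i, v = delta_mx 0 i) ->
  EV N s (fun l => nz l ^+ 2) k = nz k ^+ 2 + (size s)%:R * (N%:R / 2).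
Proof.
have key M i l : av M (delta_mx 0 i) (fun l => nz l ^+ 2) l =
    nz l ^+ 2 + M%:R * (l 0 i)%:~R + M%:R * (M%:R + 1) / 4.
  elim: M l => [|M IH] l; first by rewrite av0 !mul0r !addr0.
  have e : nz (l + delta_mx 0 i) ^+ 2 = nz l ^+ 2 + 2 * (l 0 i)%:~R + 1 :> R.
    rewrite /nz freqD freq_delta !sqr_enorm dotDl !dotDr (dotC (delta_mx 0 i) (freq l)).
    by rewrite !dot_delta !mxE !eqxx /=; ring.
  by rewrite avS !IH e -(natr1 M) !mxE !eqxx /= intrD; field.
elim: s k => [|v s IH] k hs /=; first by rewrite mul0r addr0.
have [i ->] := hs v (mem_head _ _).
transitivity (BN N (delta_mx 0 i) (fun l => nz l ^+ 2 + (size s)%:R * (N%:R / 2)) k).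
  by apply: eq_bigr => j _; rewrite IH // => w ws; apply: hs; rewrite inE ws orbT.
rewrite /BN avD av_cst key -(natr1 (size s)).
have -> : nz (k - delta_mx 0 i *+ N) ^+ 2 = nz k ^+ 2 - 2 * N%:R * (k 0 i)%:~R + N%:R ^+ 2 :> R.
  rewrite /nz freqB freqMn freq_delta !sqr_enorm dotDl !dotDr dotNl !dotNr !dotNl.
  rewrite !dotZl !dotZr !(dotC (delta_mx 0 i) (freq k)) !dot_delta !mxE !eqxx /=; ring.
have -> : ((k - delta_mx 0 i *+ N) 0 i)%:~R = (k 0 i)%:~R - N%:R :> R.
  transitivity (freq (k - delta_mx 0 i *+ N) 0 i : R); first by rewrite [RHS]mxE.
  by rewrite freqB freqMn freq_delta !mxE !eqxx mulr1.
by rewrite natrM; field.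
Qed.

(** Summation by parts: the increments of a unimodal weight have one sign on each side of the peak,
    so their total telescopes to the peak value. The sum up to the peak is bounded first, with a
    boundary term that the other half consumes. *)
Lemma unimodal_grad (p G : nat -> R) N M lo hi : (forall j, 0 <= p j) ->
  (forall j, (j < N)%N -> p j <= p j.+1) -> (forall j, (N <= j)%N -> p j.+1 <= p j) ->
  (forall j, lo <= G j <= hi) -> (N <= M)%N ->
  \sum_(j < M) p j * (G j.+1 - G j) <= p N * (hi - lo).
Proof.
move=> p0 pi pd Gb NM.
have up m : (m <= N)%N -> \sum_(j < m) p j * (G j.+1 - G j) <= p m * (G m - lo).
  elim: m => [|m IH] mN.
    by rewrite big_ord0 mulr_ge0 // subr_ge0; case/andP: (Gb 0%N).
  rewrite big_ord_recr /=; have h := IH (ltnW mN); have h1 := pi _ mN.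
  have [h2 _] := andP (Gb m.+1); have : 0 <= (p m.+1 - p m) * (G m.+1 - lo) by rewrite mulr_ge0 // subr_ge0.
  lra.
suff : \sum_(j < M) p j * (G j.+1 - G j) + p M * (hi - G M) <= p N * (hi - lo).
  have [_ h2] := andP (Gb M); have : 0 <= p M * (hi - G M) by rewrite mulr_ge0 // subr_ge0.
  by move=> *; lra.
rewrite -(subnK NM); elim: (M - N)%N => [|m IH].
  by rewrite add0n; have := up N (leqnn N); lra.
rewrite addSn big_ord_recr /=; have h1 := pd (m + N)%N (leq_addl _ _).
have [_ h2] := andP (Gb (m + N).+1).
have : 0 <= (p (m + N)%N - p (m + N).+1) * (hi - G (m + N).+1) by rewrite mulr_ge0 // subr_ge0.
lra.
Qed.

(** Moving the start of the walk by one step costs only the mass of the central atom, [aN N],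
    because binomial weights are unimodal. *)
Lemma BN_grad_le N v F k lo hi : (forall l, lo <= F l <= hi) ->
  BN N v F (k + v) - BN N v F k <= aN N * (hi - lo).
Proof.
move=> Fb; pose p j : R := 'C(2 * N, j)%:R / 2 ^+ (2 * N).
pose G j := F (k - v *+ N + v *+ j).
have -> : BN N v F (k + v) - BN N v F k = \sum_(j < (2 * N).+1) p j * (G j.+1 - G j).
  rewrite /BN /av -sumrB; apply: eq_bigr => j _; rewrite /p /G mulrBr; congr (_ * F _ - _).
  by rewrite mulrS [k + v - _]addrAC addrA.
have -> : aN N = p N by rewrite /aN /p exprM; congr (_ / _ ^+ _); ring.
have binS1 j : j.+1%:R * 'C(2 * N, j.+1)%:R = (2 * N - j)%:R * 'C(2 * N, j)%:R :> R by rewrite -!natrM mul_bin_left.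
have c0 : 0 < (2 ^+ (2 * N))^-1 :> R by rewrite invr_gt0 exprn_gt0.
apply: unimodal_grad; rewrite ?leqW ?leq_pmull // => j; rewrite /p.
- by rewrite divr_ge0 ?exprn_ge0.
- move=> jN; rewrite ler_pM2r // ler_nat -(leq_pmul2l (ltn0Sn j)) mul_bin_left leq_mul2r; lia.
- move=> jN; rewrite ler_pM2r // ler_nat -(leq_pmul2l (ltn0Sn j)) mul_bin_left leq_mul2r; lia.
- exact: Fb.
Qed.

Lemma EV_oppF N s F k : EV N s (fun l => - F l) k = - EV N s F k.
Proof. by rewrite -[RHS]mulN1r -EVZ; apply: EV_ext => l; rewrite mulN1r. Qed.

Lemma BN_grad N v F k lo hi : (forall l, lo <= F l <= hi) ->
  `|BN N v F (k + v) - BN N v F k| <= aN N * (hi - lo).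
Proof.
move=> Fb; rewrite ler_norml BN_grad_le // andbT.
have Fb' l : - hi <= - F l <= - lo by rewrite !lerN2 andbC.
have e l : BN N v (fun l => - F l) l = - BN N v F l by exact: (EV_oppF N [:: v]).
by have := BN_grad_le N v k Fb'; rewrite !e; lra.
Qed.

Lemma EV_bnd N s F k lo hi : (forall l, lo <= F l <= hi) -> lo <= EV N s F k <= hi.
Proof.
move=> Fb; apply/andP; split.
  by rewrite -(EV_cst N s lo k); apply: EV_mono => l; case/andP: (Fb l).
by rewrite -(EV_cst N s hi k); apply: EV_mono => l; case/andP: (Fb l).
Qed.

Lemma EV_grad N s v F k lo hi : v \in s -> (forall l, lo <= F l <= hi) ->
  `|EV N s F (k + v) - EV N s F k| <= aN N * (hi - lo).
Proof.
move=> + Fb; elim: s k => //= w s IH k; rewrite inE => /orP[/eqP <-|vs].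
  by apply: BN_grad => l; exact: EV_bnd.
have -> : BN N w (EV N s F) (k + v) = av (2 * N) w (fun l => EV N s F (l + v)) (k - w *+ N) by rewrite av_shift addrAC.
rewrite /BN /av -sumrB.
apply: le_trans (ler_norm_sum _ _ _) _.
rewrite -[leRHS]mul1r -[X in _ <= X * _](av_weight (2 * N)) mulr_suml; apply: ler_sum => j _.
set p := 'C(2 * N, j)%:R / _; have p0 : 0 <= p by rewrite divr_ge0 ?exprn_ge0.
by rewrite -mulrBr normrM (ger0_norm p0); apply: ler_wpM2l => //; exact: IH.
Qed.

End BinomialWalk.

(** * The jump kernel of the discrete square root of the Laplacian *)

Section Kernel.
Implicit Types (F G : Z -> R) (k h z : Z).

Definition basis : seq Z := [seq delta_mx 0 i | i <- enum 'I_d].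

(* The expectation of F(X), where the coordinates of X are independent centred
   binomial variables with 2N trials. *)
Definition EN N F : R := EV N basis F 0.

Lemma basisP v : v \in basis -> exists i, v = delta_mx 0 i.
Proof. by case/mapP => i _ ->; exists i. Qed.

Lemma mem_basis i : delta_mx 0 i \in basis.
Proof. by apply: map_f; rewrite mem_enum. Qed.

Lemma EN_mono N F G : (forall z, F z <= G z) -> EN N F <= EN N G.
Proof. exact: EV_mono. Qed.

Lemma EN_ext N F G : (forall z, F z = G z) -> EN N F = EN N G.
Proof. exact: EV_ext. Qed.

Lemma EN_cst N c : EN N (fun=> c) = c. Proof. exact: EV_cst. Qed.

Lemma END N F G : EN N (fun z => F z + G z) = EN N F + EN N G.
Proof. exact: EVD. Qed.

Lemma ENZ N c F : EN N (fun z => c * F z) = c * EN N F.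
Proof. exact: EVZ. Qed.

Lemma ENN N F : EN N (fun z => - F z) = - EN N F.
Proof. exact: EV_oppF. Qed.

Lemma ENB N F G : EN N (fun z => F z - G z) = EN N F - EN N G.
Proof. by rewrite END ENN. Qed.

Lemma EN_shift N F a : EN N (fun z => F (z + a)) = EV N basis F a.
Proof. by rewrite /EN EV_shift add0r. Qed.

Lemma EN_even N F : EN N (fun z => F (- z)) = EN N F.
Proof. by rewrite /EN EV_opp oppr0. Qed.

Lemma EN_odd N F : (forall z, F (- z) = - F z) -> EN N F = 0.
Proof.
move=> Fo; have : EN N F = - EN N F by rewrite -ENN -(EN_even N F); apply: EN_ext.
by move=> h; lra.
Qed.

Lemma EN_sqr N : EN N (fun z => nz z ^+ 2) = d%:R * (N%:R / 2).
Proof.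
rewrite /EN EV_sqr; last exact: basisP.
by rewrite nz0 expr0n add0r /basis size_map size_enum_ord.
Qed.

Lemma EN_cos N (x : 'rV[R]_d) b : EN N (fun z => cos (dot x (freq z) + b)) =
  (\prod_(i < d) cos (x 0 i / 2) ^+ 2) ^+ N * cos b.
Proof.
rewrite /EN EV_cos freq0; have -> : dot x 0 = 0 by rewrite -(scale0r (0 : 'rV[R]_d)) dotZr mul0r.
rewrite add0r /basis big_map big_enum /= -prodrXl; congr (_ * _).
by apply: eq_bigr => i _; rewrite freq_delta dot_delta.
Qed.

(** A lattice displacement is a path of unit steps along the axes. *)
Lemma lip_sum_coord (G : Z -> R) (c : R) : (forall k i, `|G (k + delta_mx 0 i) - G k| <= c) ->
  forall h k, `|G (k + h) - G k| <= c * \sum_i `|(freq h : 'rV[R]_d) 0 i|.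
Proof.
move=> Gc h; have hE : \sum_i (delta_mx 0 i *~ h 0 i) = h.
  apply/rowP => j; rewrite summxE (bigD1 j) //= big1 => [|i ij].
    by rewrite addr0 -scaler_int mxE mxE !eqxx mulr1 intz.
  by rewrite -scaler_int mxE mxE eqxx eq_sym (negPf ij) mulr0.
rewrite mulr_sumr.
have tri (a b e x y : R) : `|a - b| <= x -> `|b - e| <= y -> `|a - e| <= y + x.
  move=> h1 h2; have -> : a - e = (b - e) + (a - b) by ring.
  exact: le_trans (ler_normD _ _) (lerD h2 h1).
have main : forall k, `|G (k + \sum_i (delta_mx 0 i *~ h 0 i)) - G k| <= \sum_i c * `|(h 0 i)%:~R : R|.
  apply: (@big_ind2 Z R (fun h r => forall k, `|G (k + h) - G k| <= r)).
  - by move=> k; rewrite addr0 subrr normr0.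
  - move=> x r y s hx hy k; apply: (tri _ (G (k + x))); last exact: hx.
    by rewrite addrA.
  - move=> i _; have up m k : `|G (k + delta_mx 0 i *+ m) - G k| <= c * m%:R.
      elim: m => [|m IH]; first by rewrite mulr0n addr0 subrr normr0 mulr0.
      rewrite mulrSr addrA -(natr1 m) mulrDr mulr1.
      by apply: (tri _ (G (k + delta_mx 0 i *+ m))); [exact: Gc | exact: IH].
    have nE n : `|(Posz n)%:~R| = n%:R :> R by rewrite -[_%:~R]/(n%:R) ger0_norm.
    move=> k; case: (h 0 i) => n.
      by rewrite nE -pmulrn; exact: up.
    rewrite NegzE !mulrNz normrN nE -pmulrn.
    by have := up n.+1 (k - delta_mx 0 i *+ n.+1); rewrite subrK distrC.
move=> k; rewrite -{1}hE; apply: le_trans (main k) _.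
by apply: ler_sum => i _; rewrite mxE.
Qed.

(** Since [aN N] is of order N^(-1/2), a walk of many more than |h|^2 steps forgets a shift of its
    start by [h]. This is the source of dissipation in both comparisons. *)
Lemma EN_grad N F h lo hi : (forall z, lo <= F z <= hi) ->
  `|EN N (fun z => F (z + h)) - EN N F| <= aN N * (hi - lo) * (d%:R * nz h).
Proof.
move=> Fb; rewrite EN_shift /EN -{1}(add0r h).
have c0 : 0 <= aN N * (hi - lo).
  rewrite mulr_ge0 ?(ltW (aN_gt0 N)) // subr_ge0.
  by have /andP[a b] := Fb 0; exact: le_trans a b.
have := @lip_sum_coord (EV N basis F) (aN N * (hi - lo)) _ h 0.
move=> /(_ _)/le_trans; apply.
  by move=> k i; apply: EV_grad => //; exact: mem_basis.
by apply: ler_wpM2l => //; exact: sum_le_enorm.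
Qed.

Definition bN N : R := aN N - aN N.+1.

Lemma bN_ge0 N : 0 <= bN N. Proof. by rewrite subr_ge0 aN_decr. Qed.

Lemma bNE N : bN N = aN N / (2 * N.+1%:R).
Proof. by rewrite /bN aN_S -natr1; field; rewrite nat1r pnatr_eq0. Qed.

Lemma sum_bN m n : (m <= n)%N -> \sum_(m <= N < n) bN N = aN m - aN n.
Proof.
by move=> mn; rewrite (@telescope_sumr_eq _ m n (fun i => - aN i)) //; [ring | move=> i _; rewrite /bN; ring].
Qed.

(* The weights [bN] are the Taylor coefficients of [1 - sqrt (1 - s)]: the jump kernel
   is that of the square root of a discrete Laplacian. *)
Definition LK K F : R := \sum_(0 <= N < K) bN N * EN N.+1 F.

Lemma LK_mono K F G : (forall z, F z <= G z) -> LK K F <= LK K G.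
Proof. by move=> FG; apply: ler_sum => N _; rewrite ler_wpM2l ?bN_ge0 ?EN_mono. Qed.

Lemma LK_ext K F G : (forall z, F z = G z) -> LK K F = LK K G.
Proof. by move=> FG; apply: eq_bigr => N _; rewrite (EN_ext _ FG). Qed.

Lemma LKD K F G : LK K (fun z => F z + G z) = LK K F + LK K G.
Proof. by rewrite /LK -big_split; apply: eq_bigr => N _; rewrite END mulrDr. Qed.

Lemma LKZ K c F : LK K (fun z => c * F z) = c * LK K F.
Proof. by rewrite /LK mulr_sumr; apply: eq_bigr => N _; rewrite ENZ mulrCA. Qed.

Lemma LKN K F : LK K (fun z => - F z) = - LK K F.
Proof. by rewrite /LK -sumrN; apply: eq_bigr => N _; rewrite ENN mulrN. Qed.

Lemma LKB K F G : LK K (fun z => F z - G z) = LK K F - LK K G.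
Proof. by rewrite LKD LKN. Qed.

Lemma LK_cst K c : LK K (fun=> c) = c * (1 - aN K).
Proof.
rewrite -aN0 -(sum_bN (leq0n K)) mulr_sumr; apply: eq_bigr => N _.
by rewrite EN_cst mulrC.
Qed.

Lemma LK_even K F : LK K (fun z => F (- z)) = LK K F.
Proof. by apply: eq_bigr => N _; rewrite EN_even. Qed.

Lemma LK_ge0 K F : (forall z, 0 <= F z) -> 0 <= LK K F.
Proof.
move=> F0; apply: le_trans (LK_mono K F0).
by rewrite LK_cst mul0r.
Qed.

Lemma LK_le_cst K F c : 0 <= c -> (forall z, F z <= c) -> LK K F <= c.
Proof.
move=> c0 Fc; apply: le_trans (LK_mono K Fc) _.
by rewrite LK_cst ler_piMr // gerBl (ltW (aN_gt0 K)).
Qed.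

Lemma LK_norm K F : `|LK K F| <= LK K (fun z => `|F z|).
Proof.
by rewrite ler_norml -LKN !LK_mono // => z; [exact: ler_norm | rewrite lerNl -normrN ler_norm].
Qed.

(** The power 3/2. The exponent exceeds 1, so that the kernel integrates the profile at scale r at
    cost 1/r, and is below 2, so that Marchaud's recursion contracts on second differences. *)
Definition phi (q : R) : R := Num.sqrt q ^+ 3.

Lemma phi_ge0 q : 0 <= phi q. Proof. by rewrite exprn_ge0. Qed.

Lemma phi_mono p q : p <= q -> phi p <= phi q.
Proof. by move=> pq; rewrite /phi lerXn2r ?nnegrE ?ler_wsqrtr. Qed.

Lemma phi1 : phi 1 = 1. Proof. by rewrite /phi sqrtr1 expr1n. Qed.

Lemma phi_ge q : 0 <= q <= 1 -> q ^+ 2 <= phi q.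
Proof.
move=> /andP[q0 q1]; have : Num.sqrt q <= 1 by rewrite -sqrtr1 ler_wsqrtr.
have s0 := sqrtr_ge0 q; rewrite -{2}(sqr_sqrtr q0) /phi; set s := Num.sqrt q in s0 * => s1.
have : 0 <= s ^+ 3 * (1 - s) by rewrite mulr_ge0 ?exprn_ge0 // subr_ge0.
by lra.
Qed.

(** The sum of N^(-3/4) against its integral. With fourth roots x and y of consecutive integers, x^4
    - y^4 = 1 replaces integration. *)
Lemma sum_sqrt4 n : \sum_(0 <= N < n) (Num.sqrt (Num.sqrt N.+1%:R) ^+ 3)^-1 <=
  4 * Num.sqrt (Num.sqrt n%:R) :> R.
Proof.
elim: n => [|n IH]; first by rewrite big_geq // !sqrtr0 mulr0.
rewrite big_nat_recr //=; apply: le_trans (lerD IH (lexx _)) _.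
set y := Num.sqrt (Num.sqrt n%:R); set x := Num.sqrt (Num.sqrt n.+1%:R).
have y0 : 0 <= y by exact: sqrtr_ge0.
have x0 : 0 < x by rewrite !sqrtr_gt0 ltr0n.
have yx : y <= x by rewrite !ler_wsqrtr // ler_nat.
have e : x ^+ 4 - y ^+ 4 = 1 by rewrite -[4%N]/(2 * 2)%N !exprM !sqr_sqrtr ?sqrtr_ge0 // -natr1; ring.
have : x ^- 3 <= 4 * (x - y).
  rewrite -[leLHS]mul1r ler_pdivrMr ?exprn_gt0 // -[leLHS]e.
  have xy : 0 <= x - y by rewrite subr_ge0.
  have h1 := mulr_ge0 xy (mulr_ge0 xy (sqr_ge0 x)).
  have h2 := mulr_ge0 xy (mulr_ge0 xy (mulr_ge0 (ltW x0) (addr_ge0 (ltW x0) y0))).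
  have h3 := mulr_ge0 xy (mulr_ge0 xy (addr_ge0 (addr_ge0 (sqr_ge0 x) (mulr_ge0 (ltW x0) y0)) (sqr_ge0 y))).
  lra.
by lra.
Qed.

Lemma EN_phi N r : 0 < r -> EN N.+1 (fun z => phi (nz z / r)) <=
  (d%:R / 2 + 1) * (Num.sqrt (Num.sqrt N.+1%:R) ^+ 3 / Num.sqrt r ^+ 3).
Proof.
move=> r0; set t := Num.sqrt (Num.sqrt N.+1%:R).
have t0 : 0 < t by rewrite !sqrtr_gt0 ltr0n.
have sr0 : 0 < Num.sqrt r by rewrite sqrtr_gt0.
(* Splitting at the typical size of the square root of |z|/r for this walk gives q^(3/2) <= q^2 / W
   + W^3, which needs only the second moment. *)
pose W := t / Num.sqrt r.
have W0 : 0 < W by rewrite divr_gt0.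
have : forall z : Z, phi (nz z / r) <= W^-1 / r ^+ 2 * nz z ^+ 2 + W ^+ 3.
  move=> z; set q := nz z / r; have q0 : 0 <= q by rewrite divr_ge0 ?nz_ge0 // ltW.
  have -> : W^-1 / r ^+ 2 * nz z ^+ 2 = q ^+ 2 / W by rewrite /q; field; rewrite !gt_eqF.
  rewrite /phi -{2}(sqr_sqrtr q0); set s := Num.sqrt q; have s0 : 0 <= s by exact: sqrtr_ge0.
  have [sW|Ws] := leP s W.
    rewrite ler_wpDl //; first by rewrite divr_ge0 ?exprn_ge0 ?(ltW W0).
    by rewrite lerXn2r ?nnegrE // ltW.
  rewrite ler_wpDr ?exprn_ge0 ?(ltW W0) // ler_pdivlMr //.
  have sW : 0 <= s - W by rewrite subr_ge0 ltW.
  by have := mulr_ge0 (exprn_ge0 3 s0) sW; lra.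
move/(EN_mono N.+1)/le_trans; apply; rewrite END ENZ EN_cst EN_sqr.
have -> : N.+1%:R = t ^+ 4 by rewrite -[4%N]/(2 * 2)%N !exprM !sqr_sqrtr ?sqrtr_ge0.
rewrite le_eqVlt; apply/orP; left; apply/eqP.
rewrite -{1}(sqr_sqrtr (ltW r0)) /W; field; rewrite !gt_eqF //.
Qed.

(** The sixth power of the fourth root is (N+1)^(3/2), the decay rate of the Taylor coefficients of
    1 - sqrt(1 - s). *)
Lemma bN_le N : bN N * Num.sqrt (Num.sqrt N.+1%:R) ^+ 6 <= 1 / 2.
Proof.
rewrite bNE; set t := Num.sqrt (Num.sqrt N.+1%:R).
have t0 : 0 < t by rewrite !sqrtr_gt0 ltr0n.
have e2 : t ^+ 2 = Num.sqrt N.+1%:R by rewrite sqr_sqrtr ?sqrtr_ge0.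
have -> : N.+1%:R = t ^+ 4 by rewrite -[4%N]/(2 * 2)%N !exprM e2 sqr_sqrtr.
have : aN N * t ^+ 2 <= 1 :> R by apply: aN_le; rewrite ?exprn_ge0 ?(ltW t0) // e2 sqr_sqrtr // natr1.
have -> : aN N / (2 * t ^+ 4) * t ^+ 6 = (aN N * t ^+ 2) / 2 by field; rewrite gt_eqF.
by lra.
Qed.

(** Walks of fewer than about r^2 steps are charged for their moment of order 3/2, longer ones for
    their total mass, which telescopes to [aN T]. Both parts are of order 1/r. *)
Lemma LK_phi K r : 0 < r -> LK K (fun z => Num.min 1 (phi (nz z / r))) <= (d%:R + 3) / r.
Proof.
move=> r0; have [r1|r1] := ltP r 1.
  apply: (@le_trans _ _ 1); first by apply: LK_le_cst => // z; rewrite ge_min lexx.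
  by rewrite ler_pdivlMr // mul1r; have : 0 <= d%:R :> R by []; lra.
have m1 N : EN N.+1 (fun z => Num.min 1 (phi (nz z / r))) <= 1.
  by rewrite -[leRHS](EN_cst N.+1); apply: EN_mono => z; rewrite ge_min lexx.
have m2 N : EN N.+1 (fun z => Num.min 1 (phi (nz z / r))) <=
    (d%:R / 2 + 1) * (Num.sqrt (Num.sqrt N.+1%:R) ^+ 3 / Num.sqrt r ^+ 3).
  by apply: le_trans (EN_phi N r0); apply: EN_mono => z; rewrite ge_min lexx orbT.
have [T [T1 T2]] : exists T : nat, T%:R <= r ^+ 2 /\ r ^+ 2 <= T%:R + 1.
  exists (Num.truncn (r ^+ 2)).
  have /andP[a b] := truncn_itv (sqr_ge0 r); split => //.
  by rewrite natr1 ltW.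
have sr0 : 0 < Num.sqrt r by rewrite sqrtr_gt0.
pose c : R := (d%:R / 2 + 1) / Num.sqrt r ^+ 3 / 2.
have c0 : 0 <= c by rewrite !divr_ge0 ?exprn_ge0 ?addr_ge0 ?divr_ge0 // ltW.
have small n : (n <= T)%N -> \sum_(0 <= N < n) bN N * EN N.+1 (fun z => Num.min 1 (phi (nz z / r)))
    <= (d%:R + 2) / r.
  move=> nT; apply: (@le_trans _ _ (c * \sum_(0 <= N < n) (Num.sqrt (Num.sqrt N.+1%:R) ^+ 3)^-1)).
    rewrite mulr_sumr; apply: ler_sum => N _.
    apply: le_trans (ler_wpM2l (bN_ge0 N) (m2 N)) _.
    have := bN_le N; set t := Num.sqrt _; have t0 : 0 < t by rewrite !sqrtr_gt0 ltr0n.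
    move=> h; rewrite -[leRHS]mulr1 -(@ler_pM2r _ (t ^+ 3)) ?exprn_gt0 //.
    have -> : c / t ^+ 3 * 1 * t ^+ 3 = c * 2 * (1 / 2) by field; rewrite gt_eqF.
    have -> : bN N * ((d%:R / 2 + 1) * (t ^+ 3 / Num.sqrt r ^+ 3)) * t ^+ 3 = c * 2 * (bN N * t ^+ 6).
      by rewrite /c; field; rewrite gt_eqF.
    by apply: ler_wpM2l => //; rewrite mulr_ge0.
  apply: le_trans (ler_wpM2l c0 (sum_sqrt4 n)) _.
  have : Num.sqrt (Num.sqrt n%:R) <= Num.sqrt r.
    rewrite ler_wsqrtr // -(ger0_norm (ltW r0)) -sqrtr_sqr ler_wsqrtr // (le_trans _ T1) // ler_nat //.
  move=> h; have -> : (d%:R + 2) / r = c * (4 * Num.sqrt r).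
    by rewrite /c -[X in _ / X = _](sqr_sqrtr (ltW r0)); field; rewrite gt_eqF.
  by apply: ler_wpM2l => //; rewrite ler_wpM2l.
have -> : (d%:R + 3) / r = (d%:R + 2) / r + 1 / r by field; rewrite gt_eqF.
have [KT|TK] := leqP K T.
  by rewrite ler_wpDr ?divr_ge0 ?(ltW r0) //; exact: small.
rewrite /LK (big_cat_nat (n := T)) //=; last exact: ltnW.
apply: lerD; first exact: small.
apply: (@le_trans _ _ (\sum_(T <= N < K) bN N)).
  by apply: ler_sum => N _; rewrite ler_piMr ?bN_ge0.
rewrite sum_bN ?(ltnW TK) //; apply: (@le_trans _ _ (aN T)); first by rewrite gerBl (ltW (aN_gt0 _)).
by rewrite ler_pdivlMr //; apply: aN_le => //; exact: ltW.
Qed.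

Lemma LK_sqr K r : 0 < r -> LK K (fun z => Num.min 1 ((nz z / r) ^+ 2)) <= (d%:R + 3) / r.
Proof.
move=> r0; apply: le_trans (LK_phi K r0); apply: LK_mono => z.
rewrite le_min ge_min lexx /=; set q := nz z / r.
have q0 : 0 <= q by rewrite divr_ge0 ?nz_ge0 // ltW.
have [q1|q1] := leP q 1; first by rewrite ge_min phi_ge ?q0 ?orbT.
by rewrite ge_min -phi1 phi_mono // ltW.
Qed.

End Kernel.

(** * Iterated differences and Marchaud's inequality *)

Section FiniteDifferences.
Implicit Types (f g : Z -> R) (x y z h a : Z).

Definition dl h f : Z -> R := fun x => f (x + h) - f x.

Definition dk l h f : Z -> R := iter l (dl h) f.

Definition sft a f : Z -> R := fun x => f (x + a).

Lemma dkS l h f : dk l.+1 h f = dl h (dk l h f). Proof. by []. Qed.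

Lemma dkSr l h f : dk l.+1 h f = dk l h (dl h f). Proof. exact: iterSr. Qed.

Lemma dl_sft h a f : dl h (sft a f) = sft a (dl h f).
Proof. by apply/funext => x; rewrite /dl /sft addrAC. Qed.

Lemma dk_sft l h a f : dk l h (sft a f) = sft a (dk l h f).
Proof. by elim: l => // l IH; rewrite !dkS IH dl_sft. Qed.

Lemma dlC h z f : dl h (dl z f) = dl z (dl h f).
Proof. by apply/funext => x; rewrite /dl [x + z + h]addrAC; ring. Qed.

Lemma dkC l h j z f : dk l h (dk j z f) = dk j z (dk l h f).
Proof.
have h1 i g : dk i z (dl h g) = dl h (dk i z g) by elim: i => // i IH; rewrite !dkS IH dlC.
by elim: l => // l IH; rewrite !dkS IH h1.
Qed.

Lemma dk_bnd l h f (F : R) : (forall x, `|f x| <= F) -> forall x, `|dk l h f x| <= 2 ^+ l * F.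
Proof.
move=> fF; elim: l => [|l IH] x; first by rewrite expr0 mul1r.
rewrite dkS /dl exprS -mulrA mulr2n mulrDl mul1r.
by apply: le_trans (ler_normB _ _) _; rewrite lerD.
Qed.

Lemma dk_osc l h f (e : R) : (forall x, `|dl h f x| <= e) -> forall x, `|dk l.+1 h f x| <= 2 ^+ l * e.
Proof. by move=> fe x; rewrite dkSr; exact: dk_bnd. Qed.

Lemma dk0 l f x : dk l.+1 0 f x = 0.
Proof. by rewrite dkS /dl addr0 subrr. Qed.

Lemma Leibniz k h f g x : dk k h (fun x => f x * g x) x =
  \sum_(l < k.+1) 'C(k, l)%:R * (dk l h f (x + h *+ (k - l)) * dk (k - l) h g x).
Proof.
elim: k x => [|k IH] x; first by rewrite big_ord1 bin0 mul1r /= mulr0n addr0.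
rewrite dkS /dl !IH.
pose t l : R := dk l h f (x + h *+ (k.+1 - l)) * dk (k.+1 - l) h g x.
have e (l : 'I_k.+1) : 'C(k, l)%:R * (dk l h f (x + h + h *+ (k - l)) * dk (k - l) h g (x + h)) -
    'C(k, l)%:R * (dk l h f (x + h *+ (k - l)) * dk (k - l) h g x) =
    'C(k, l)%:R * t l + 'C(k, l)%:R * t l.+1.
  have lk : (l <= k)%N by rewrite -ltnS.
  rewrite /t subSS subSn // !dkS /dl mulrS (addrA x h) [x + h *+ _ + h]addrAC.
  ring.
rewrite -sumrB (eq_bigr _ (fun l _ => e l)) big_split /=.
rewrite -[RHS]/(\sum_(l < k.+2) 'C(k.+1, l)%:R * t l).
have -> : \sum_(l < k.+1) 'C(k, l)%:R * t l = \sum_(l < k.+2) 'C(k, l)%:R * t l.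
  by rewrite [RHS]big_ord_recr /= bin_small // mul0r addr0.
rewrite big_ord_recl [RHS]big_ord_recl -addrA !bin0 -big_split; congr (_ + _).
by apply: eq_bigr => l _; rewrite !lift0 binS natrD mulrDl.
Qed.

(** A difference at step 2z is the difference at step z composed with 1 plus a shift, and the l-th
    power of that factor is 2^l times a binomial average. *)
Lemma dk_double l z f x : dk l (z + z) f x = 2 ^+ l * av l z (dk l z f) x.
Proof.
elim: l x => [|l IH] x; first by rewrite av0 mul1r.
have dd g : dl (z + z) g = dl z (fun y => g y + g (y + z)) by apply/funext => y; rewrite /dl addrA; ring.
rewrite dkS dd /dl !IH !dkS avS exprS.
have avl y : av l z (dl z (dk l z f)) y = av l z (dk l z f) (y + z) - av l z (dk l z f) y.
  by rewrite -av_shift -mulN1r -avZ -avD; apply: eq_bigr => j _; rewrite /dl mulN1r.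
by rewrite !avl; field.
Qed.

Lemma av_dist l z f x (B : R) : (forall y, `|dl z f y| <= B) -> `|av l z f x - f x| <= l%:R * B.
Proof.
move=> fB; have st j : `|f (x + z *+ j) - f x| <= j%:R * B.
  elim: j => [|j IH]; first by rewrite mulr0n addr0 subrr normr0 mul0r.
  have -> : f (x + z *+ j.+1) - f x = dl z f (x + z *+ j) + (f (x + z *+ j) - f x) by rewrite /dl mulrSr addrA; ring.
  by rewrite -natr1 mulrDl mul1r addrC (le_trans (ler_normD _ _)) // lerD.
have -> : av l z f x - f x = av l z f x + -1 * av l z (fun=> f x) x by rewrite av_cst mulN1r.
rewrite -avZ -avD.
apply: le_trans (ler_norm_sum _ _ _) _.
have -> : l%:R * B = \sum_(j < l.+1) 'C(l, j)%:R / 2 ^+ l * (l%:R * B) by rewrite -mulr_suml (@av_weight) mul1r.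
apply: ler_sum => j _.
rewrite mulN1r normrM; set p := 'C(l, j)%:R / _.
have p0 : 0 <= p by rewrite divr_ge0 ?exprn_ge0.
rewrite (ger0_norm p0); apply: ler_wpM2l => //; apply: le_trans (st j) _.
have B0 : 0 <= B by exact: le_trans (fB 0).
by apply: ler_wpM2r => //; rewrite ler_nat -ltnS.
Qed.

Lemma small_pow (t e : R) : 0 <= t -> t < 1 -> 0 < e -> exists n, t ^+ n < e.
Proof.
move=> t0 t1 e0; have /cvgrPdist_lt /(_ e e0) [n _ nP] : t ^+ n @[n --> \oo] --> (0 : R).
  by apply: cvg_expr; rewrite ger0_norm.
by exists n; have := nP n (leqnn n); rewrite /= sub0r normrN ger0_norm ?exprn_ge0.
Qed.

(* Marchaud's inequality: by dk_double, l-th differences at step z and 2z agree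
   up to (l+1)-th differences, and the doubling bound on psi makes the
   resulting recursion a contraction. *)
Lemma marchaud l f (psi : Z -> R) (F B c0 : R) : (0 < l)%N -> 0 <= B -> (forall x, `|f x| <= F) ->
  (forall z, 0 <= psi z) -> 0 < c0 -> (forall z, z != 0 -> c0 <= psi z) ->
  (forall z, psi (z + z) <= 6 / 7 * 2 ^+ l * psi z) ->
  (forall x z, `|dk l.+1 z f x| <= B * psi z) ->
  forall x z, `|dk l z f x| <= 7 * l%:R * B * psi z.
Proof.
move=> l0 B0 fF psi0 c00 psic psi2 fB.
pose P A := forall x z, `|dk l z f x| <= A * psi z.
have F0 : 0 <= F by exact: le_trans (fF 0).
pose A0 := 2 ^+ l * F / c0.
have A00 : 0 <= A0 by rewrite divr_ge0 ?mulr_ge0 ?exprn_ge0 // ltW.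
have PA0 : P A0.
  move=> x z; have [->|z0] := eqVneq z 0.
    by rewrite -(prednK l0) dk0 normr0 mulr_ge0.
  apply: le_trans (dk_bnd l z fF x) _; rewrite /A0 mulrAC ler_pdivlMr //.
  by rewrite ler_wpM2l ?mulr_ge0 ?exprn_ge0 ?psic.
have l2 : 0 < 2 ^+ l :> R by rewrite exprn_gt0.
have PS A : 0 <= A -> P A -> P (6 / 7 * A + l%:R * B).
  move=> A_ge PA x z; have fB' y : `|dl z (dk l z f) y| <= B * psi z by exact: fB.
  have h1 := av_dist l x fB'.
  have h2 := PA x (z + z); rewrite dk_double normrM ger0_norm ?(ltW l2) // in h2.
  have h3 : `|av l z (dk l z f) x| <= 6 / 7 * A * psi z.
    rewrite -(ler_pM2l l2); apply: le_trans h2 _.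
    have -> : 2 ^+ l * (6 / 7 * A * psi z) = A * (6 / 7 * 2 ^+ l * psi z) by ring.
    exact: ler_wpM2l.
  have -> : dk l z f x = av l z (dk l z f) x - (av l z (dk l z f) x - dk l z f x) by ring.
  apply: le_trans (ler_normB _ _) _; lra.
have lB0 : 0 <= 7 * l%:R * B by rewrite !mulr_ge0.
have Pn n : P ((6 / 7) ^+ n * A0 + 7 * l%:R * B).
  elim: n => [|n IH].
    move=> x z; apply: le_trans (PA0 x z) _.
    by rewrite expr0 mul1r ler_wpM2r // lerDl.
  have := PS _ _ IH; rewrite exprS; set q := (6 / 7) ^+ n.
  have -> : 6 / 7 * (q * A0 + 7 * l%:R * B) + l%:R * B = 6 / 7 * q * A0 + 7 * l%:R * B by field.
  by apply; rewrite addr_ge0 // mulr_ge0 // exprn_ge0 //; lra.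
move=> x z; apply/ler_addgt0Pl => e e0.
have c1 : 0 < A0 * psi z + 1 by rewrite ltr_wpDl // mulr_ge0.
have [|||n nP] := @small_pow (6 / 7) (e / (A0 * psi z + 1)); [lra | lra | by rewrite divr_gt0 |].
apply: le_trans (Pn n x z) _; rewrite mulrDl lerD2r.
rewrite ltr_pdivlMr // in nP; apply: le_trans (ltW nP).
by rewrite -mulrA ler_wpM2l ?lerDl // exprn_ge0 //; lra.
Qed.

(** Descent by one order at a time. The doubling condition at the lowest order [l0] implies it at
    every higher order. *)
Lemma marchaud_iter k l0 f (psi : Z -> R) (F B c0 : R) : (0 < l0)%N -> 0 <= B ->
  (forall x, `|f x| <= F) ->
  (forall z, 0 <= psi z) -> 0 < c0 -> (forall z, z != 0 -> c0 <= psi z) ->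
  (forall z, psi (z + z) <= 6 / 7 * 2 ^+ l0 * psi z) ->
  (forall x z, `|dk k z f x| <= B * psi z) ->
  forall l, (l0 <= l <= k)%N -> forall x z, `|dk l z f x| <= (7 * k%:R) ^+ (k - l) * B * psi z.
Proof.
move=> l00 B0 fF psi0 c00 psic psi2 fB.
suff h j : (l0 + j <= k)%N -> forall x z, `|dk (k - j) z f x| <= (7 * k%:R) ^+ j * B * psi z.
  move=> l /andP[l0l lk] x z; have := h (k - l)%N; rewrite subKn //; apply.
  by rewrite -leq_subRL ?leq_sub2l // (leq_trans l0l).
elim: j => [|j IH] jk x z; first by rewrite subn0 expr0 mul1r.
have l1 : (0 < k - j.+1)%N by lia.
have e : (k - j = (k - j.+1).+1)%N by lia.
have k7 : 0 <= (7 * k%:R) ^+ j * B by rewrite mulr_ge0 ?exprn_ge0 ?mulr_ge0.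
have jk' : (l0 + j <= k)%N by lia.
have psi2' z' : psi (z' + z') <= 6 / 7 * 2 ^+ (k - j.+1) * psi z'.
  apply: le_trans (psi2 z') _; apply: ler_wpM2r => //; apply: ler_wpM2l; first lra.
  by rewrite ler_weXn2l ?ler1n //; lia.
have IH' x' z' : `|dk (k - j.+1).+1 z' f x'| <= (7 * k%:R) ^+ j * B * psi z' by rewrite -e; exact: IH.
apply: le_trans (marchaud l1 k7 fF psi0 c00 psic psi2' IH' x z) _.
rewrite exprS; apply: ler_wpM2r => //.
have h : (k - j.+1)%:R <= k%:R :> R by rewrite ler_nat leq_subr.
by have := ler_wpM2r k7 h; lra.
Qed.

End FiniteDifferences.

(** * Intermediate differences at the exponents 3/2 and 3/4 *)

Section HolderBounds.
Implicit Types (f g : Z -> R) (x y z h a : Z).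

Lemma phi_double (q : R) : 0 <= q -> phi (2 * q) <= 6 / 7 * 2 ^+ 2 * phi q.
Proof.
move=> q0; rewrite /phi sqrtrM // exprMn; apply: ler_wpM2r; first by rewrite exprn_ge0.
have s2 : Num.sqrt 2 ^+ 2 = 2 :> R by rewrite sqr_sqrtr.
have : Num.sqrt 2 <= 12 / 7 :> R by rewrite -[leRHS]ger0_norm ?divr_ge0 // -sqrtr_sqr ler_wsqrtr //; lra.
by rewrite exprS s2; lra.
Qed.

(** The tightest use of the doubling condition: 2^(3/4) must lie below twice the contraction ratio,
    which is where 6/7 comes from. *)
Lemma sqrt_phi_double (q : R) : 0 <= q ->
  Num.sqrt (phi (2 * q)) <= 6 / 7 * 2 ^+ 1 * Num.sqrt (phi q).
Proof.
move=> q0; rewrite -[6 / 7 * _]ger0_norm; last lra.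
rewrite -sqrtr_sqr -sqrtrM ?sqr_ge0 // ler_wsqrtr // /phi sqrtrM // exprMn.
apply: ler_wpM2r; first by rewrite exprn_ge0.
have s2 : Num.sqrt 2 ^+ 2 = 2 :> R by rewrite sqr_sqrtr.
have : Num.sqrt 2 <= 142 / 100 :> R by rewrite -[leRHS]ger0_norm ?divr_ge0 // -sqrtr_sqr ler_wsqrtr //; lra.
by rewrite exprS s2; lra.
Qed.

Lemma phi_gt0 (q : R) : 0 < q -> 0 < phi q.
Proof. by move=> q0; rewrite exprn_gt0 // sqrtr_gt0. Qed.

Lemma nz_gt0 z : z != 0 -> 0 < nz z :> R.
Proof. by move=> /(@nz_ge1 R) h; exact: lt_le_trans h. Qed.

Lemma nz_double z : nz (z + z) = 2 * nz z :> R.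
Proof. by rewrite -mulr2n nzMn. Qed.

(* The profile of a function that is C^{3/2} at scale r. *)
Definition mu (r : R) z : R := Num.min 1 (phi (nz z / r)).

Lemma mu_ge0 r z : 0 <= mu r z. Proof. by rewrite le_min ler01 phi_ge0. Qed.

(** Collects a factor 7k for each order lost in [marchaud_iter] and one factor 2^k from the sup
    bound on k-th differences. *)
Definition Cd (k : nat) : R := (14 * k%:R) ^+ k.

Lemma Cd_ge1 k : 1 <= Cd k.
Proof.
case: k => [|k]; first by rewrite /Cd expr0.
by rewrite exprn_ege1 //; have : 0 <= k%:R :> R by []; rewrite -natr1; lra.
Qed.

Lemma Cd_split k j : (j <= k)%N -> (7 * k%:R) ^+ j * 2 ^+ k <= Cd k.
Proof.
move=> jk; rewrite /Cd; have -> : 14 * k%:R = (7 * k%:R) * 2 :> R by ring.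
rewrite [leRHS]exprMn; apply: ler_wpM2r; first by rewrite exprn_ge0.
case: k jk => [|k]; first by rewrite leqn0 => /eqP ->.
by move=> jk; rewrite ler_weXn2l // -natr1; have : 0 <= k%:R :> R by []; lra.
Qed.

(** Two profiles are run through Marchaud's inequality, [phi] down to order 2 and its square root
    down to order 1. The first controls the linear operator, the product of two of the second
    controls the bilinear remainder. *)
Lemma holder_bounds k s f (F T r : R) : (2 <= s)%N -> (2 <= k)%N -> 0 < r -> 0 <= T ->
  (forall x, `|f x| <= F) ->
  (forall x z, `|dk k z f x| <= T * (nz z / r) ^+ s) ->
  (forall x z, `|dk 2 z f x| <= Cd k * (F + T) * mu r z) /\
  (forall x z, `|dl z f x| <= Cd k * (F + T) * Num.sqrt (mu r z)).
Proof.
move=> s2 k2 r0 T0 fF fT; have F0 : 0 <= F by exact: le_trans (fF 0).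
pose B : R := 2 ^+ k * (F + T).
have B0 : 0 <= B by rewrite mulr_ge0 ?exprn_ge0 ?addr_ge0.
have k1 : 1 <= 2 ^+ k :> R by rewrite exprn_ege1 // ler1n.
have q0 z : 0 <= nz z / r by rewrite divr_ge0 ?nz_ge0 // ltW.
(* Up to the scale [r] the hypothesis on k-th differences is used, beyond it the sup bound. *)
have base (w : R -> R) : (forall q, 0 <= q <= 1 -> q ^+ 2 <= w q) ->
    (forall q, 1 <= q -> 1 <= w q) -> forall x z, `|dk k z f x| <= B * w (nz z / r).
  move=> w1 w2 x z; have [q1|q1] := leP (nz z / r) 1.
    apply: le_trans (fT x z) _; rewrite /B -mulrA.
    have h : (nz z / r) ^+ s <= w (nz z / r).
      apply: le_trans (w1 _ _); last by rewrite q0.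
      by rewrite ler_wiXn2l.
    have := ler_wpM2l T0 h; have h0 : 0 <= w (nz z / r) by apply: le_trans h; rewrite exprn_ge0.
    move=> hT; apply: (le_trans hT); have := mulr_ge0 F0 h0.
    have := mulr_ge0 (addr_ge0 F0 T0) h0; set A := _ * w _ => a1 a2.
    have : 0 <= (2 ^+ k - 1) * A by rewrite mulr_ge0 // subr_ge0.
    have eA : A = F * w (nz z / r) + T * w (nz z / r) by rewrite /A; ring.
    clearbody A; lra.
  apply: le_trans (dk_bnd k z fF x) _; rewrite /B -mulrA ler_wpM2l ?exprn_ge0 //.
  rewrite -[leLHS]mulr1; apply: ler_pM => //; first by rewrite lerDl.
  by apply: w2; rewrite ltW.
have ri : 0 < 1 / r by rewrite divr_gt0.
have CdB j : (j <= k)%N -> (7 * k%:R) ^+ j * B <= Cd k * (F + T).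
  by move=> jk; rewrite /B mulrA ler_wpM2r ?addr_ge0 ?Cd_split.
have fin l : (l <= 2)%N -> forall x z, `|dk l z f x| <= Cd k * (F + T).
  move=> l2 x z; apply: le_trans (dk_bnd l z fF x) _.
  apply: ler_pM; rewrite ?exprn_ge0 ?lerDl //; apply: le_trans (Cd_split (leq0n k)).
  by rewrite expr0 mul1r ler_weXn2l ?ler1n // (leq_trans l2).
have qi z : z != 0 -> 1 / r <= nz z / r by move=> z0; rewrite ler_pM2r ?invr_gt0 // nz_ge1.
split=> x z.
  have h := @marchaud_iter k 2 f (fun z => phi (nz z / r)) F B (phi (1 / r)).
  rewrite /mu minr_pMr ?mulr_ge0 ?addr_ge0 ?(le_trans ler01 (Cd_ge1 k)) // le_min mulr1 fin //=.
  apply: le_trans (h _ _ _ _ _ _ _ _ 2 _ x z) _ => //.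
  - by move=> ?; exact: phi_ge0.
  - exact: phi_gt0.
  - by move=> z' z0; apply: phi_mono; exact: qi.
  - by move=> z'; rewrite nz_double -mulrA; exact: phi_double.
  - apply: base => q; first exact: phi_ge.
    by move=> q1; rewrite -phi1 phi_mono.
  - by apply: ler_wpM2r; [exact: phi_ge0 | rewrite CdB // leq_subr].
have h := @marchaud_iter k 1 f (fun z => Num.sqrt (phi (nz z / r))) F B (Num.sqrt (phi (1 / r))).
have -> : Num.sqrt (mu r z) = Num.min 1 (Num.sqrt (phi (nz z / r))).
  rewrite /mu; have [p1|p1] := leP 1 (phi (nz z / r)).
    by rewrite sqrtr1 min_l // -sqrtr1 ler_wsqrtr.
  by rewrite min_r // -sqrtr1 ler_wsqrtr // ltW.
rewrite minr_pMr ?mulr_ge0 ?addr_ge0 ?(le_trans ler01 (Cd_ge1 k)) // le_min mulr1 (fin 1%N) //=.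
apply: le_trans (h _ _ _ _ _ _ _ _ 1%N _ x z) _ => //.
- by rewrite sqrtr_gt0 phi_gt0.
- by move=> z' z0; apply: ler_wsqrtr; apply: phi_mono; exact: qi.
- by move=> z'; rewrite nz_double -mulrA; exact: sqrt_phi_double.
- apply: (base (fun q => Num.sqrt (phi q))) => q; last by move=> q1; rewrite -sqrtr1 ler_wsqrtr // -phi1 phi_mono.
  move=> /andP[a b]; apply: le_trans (phi_ge _) _; first by rewrite a.
  have p1 : phi q <= 1 by rewrite -phi1 phi_mono.
  rewrite -{1}(sqr_sqrtr (phi_ge0 q)) expr2 -[leRHS]mulr1 ler_wpM2l ?sqrtr_ge0 //.
  by rewrite -sqrtr1 ler_wsqrtr.
- by move: k2; case: (k).
- by apply: ler_wpM2r; [exact: sqrtr_ge0 | rewrite CdB // leq_subr].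
Qed.

End HolderBounds.

(** * The bilinear jump form and its dissipation *)

Section Bilinear.
Implicit Types (f g u : Z -> R) (x y z h a : Z).

Lemma LK_sum K n (F : 'I_n -> Z -> R) :
  LK K (fun z => \sum_(i < n) F i z) = \sum_(i < n) LK K (F i).
Proof.
elim: n F => [|n IH] F.
  rewrite big_ord0 (@LK_ext _ _ (fun=> 0)) => [|z]; last by rewrite big_ord0.
  by rewrite LK_cst mul0r.
rewrite big_ord_recl -IH -LKD; apply: LK_ext => z; by rewrite big_ord_recl.
Qed.

Lemma dk_LK K k h (H : Z -> Z -> R) x :
  dk k h (fun x => LK K (fun z => H z x)) x = LK K (fun z => dk k h (H z) x).
Proof.
by elim: k x => // k IH x; rewrite dkS /dl !IH -LKB.
Qed.

(* The sign structure behind the maximum principle: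
   f(x) (f(x) - f(y)) - (f(x)^2 - f(y)^2) = f(y) (f(y) - f(x)). *)
Definition Q K f g : Z -> R := fun x => LK K (fun z => f (x + z) * (g (x + z) - g x)).

Lemma dk_Q k h K f g x : dk k h (Q K f g) x =
  \sum_(l < k.+1) 'C(k, l)%:R * Q K (sft (h *+ (k - l)) (dk l h f)) (dk (k - l) h g) x.
Proof.
rewrite /Q (dk_LK K k h (fun z x => sft z f x * dl z g x)).
under [RHS]eq_bigr => l _ do rewrite -LKZ.
rewrite -LK_sum; apply: LK_ext => z; rewrite Leibniz; apply: eq_bigr => l _.
rewrite dk_sft -[dl z g]/(dk 1 z g) dkC /sft.
by rewrite [x + _ + z]addrAC.
Qed.

(** The kernel is even, so a first difference may be replaced by half a centred second difference,
    whose profile of order 3/2 is integrable. *)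
Lemma LK_second K f x (B r : R) : 0 < r -> 0 <= B ->
  (forall y z, `|dk 2 z f y| <= B * mu r z) ->
  `|LK K (fun z => dl z f x)| <= B * ((d%:R + 3) / r).
Proof.
move=> r0 B0 fB.
have e : LK K (fun z => dl z f x) = LK K (fun z => dk 2 z f (x - z)) / 2.
  have := LK_even K (fun z => dl z f x); set a := LK K (fun z => dl z f x) => h.
  have -> : LK K (fun z => dk 2 z f (x - z)) = LK K (fun z => dl z f x + dl (- z) f x).
    by apply: LK_ext => z; rewrite /dk /= /dl subrK; ring.
  by rewrite LKD h -/a; field.
rewrite e normrM [`|2^-1|]ger0_norm // ler_pdivrMr //.
apply: le_trans (LK_norm _ _) _.
apply: le_trans (LK_mono K (fun z => fB (x - z) z)) _.
rewrite LKZ; have := ler_wpM2l B0 (@LK_phi K r r0).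
have : 0 <= B * ((d%:R + 3) / r) by rewrite mulr_ge0 // divr_ge0 ?addr_ge0 // ltW.
rewrite -/(mu r); lra.
Qed.

Lemma LK_prod K f g x (A B r : R) : 0 < r -> 0 <= A -> 0 <= B ->
  (forall y z, `|dl z f y| <= A * Num.sqrt (mu r z)) ->
  (forall y z, `|dl z g y| <= B * Num.sqrt (mu r z)) ->
  LK K (fun z => `|dl z f x| * `|dl z g x|) <= A * B * ((d%:R + 3) / r).
Proof.
move=> r0 A0 B0 fA gB.
have h z : `|dl z f x| * `|dl z g x| <= A * B * mu r z.
  have := ler_pM (normr_ge0 _) (normr_ge0 _) (fA x z) (gB x z).
  by rewrite mulrACA -expr2 sqr_sqrtr ?mu_ge0.
apply: le_trans (LK_mono K h) _; rewrite LKZ ler_wpM2l ?mulr_ge0 //; exact: LK_phi.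
Qed.

Lemma Q_holder K k s f g x (F G T r : R) : (2 <= s)%N -> (2 <= k)%N -> 0 < r -> 0 <= T ->
  (forall x, `|f x| <= F) -> (forall x z, `|dk k z f x| <= T * (nz z / r) ^+ s) ->
  (forall x, `|g x| <= G) -> (forall x z, `|dk k z g x| <= T * (nz z / r) ^+ s) ->
  `|Q K f g x| <= 2 * Cd k ^+ 2 * ((F + T) * (G + T)) * ((d%:R + 3) / r).
Proof.
move=> s2 k2 r0 T0 fF fT gG gT.
have F0 : 0 <= F by exact: le_trans (fF 0).
have G0 : 0 <= G by exact: le_trans (gG 0).
have C1 := @Cd_ge1 k; have C0 : 0 <= Cd k :> R by lra.
have [_ f1] := holder_bounds s2 k2 r0 T0 fF fT.
have [g2 g1] := holder_bounds s2 k2 r0 T0 gG gT.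
(* Freezing the coefficient at [x] leaves the linear operator on [g] and a product of two first
   differences. *)
have e : Q K f g x = f x * LK K (fun z => dl z g x) + LK K (fun z => dl z f x * dl z g x).
  by rewrite -LKZ -LKD; apply: LK_ext => z; rewrite /dl; ring.
have CF : 0 <= Cd k * (F + T) by rewrite mulr_ge0 ?addr_ge0.
have CG : 0 <= Cd k * (G + T) by rewrite mulr_ge0 ?addr_ge0.
have D0 : 0 <= (d%:R + 3) / r by rewrite divr_ge0 ?addr_ge0 // ltW.
rewrite e; apply: le_trans (ler_normD _ _) _; rewrite normrM.
have h1 := ler_pM (normr_ge0 _) (normr_ge0 _) (fF x) (LK_second K x r0 CG g2).
have h2 := LK_prod K x r0 CF CG f1 g1.
have h3 : `|LK K (fun z => dl z f x * dl z g x)| <= LK K (fun z => `|dl z f x| * `|dl z g x|).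
  by apply: le_trans (LK_norm _ _) _; apply: LK_mono => z; rewrite normrM.
set D := (_ + 3) / r in D0 h1 h2 *.
have h4 : F * (Cd k * (G + T) * D) <= Cd k ^+ 2 * ((F + T) * (G + T)) * D.
  have -> : Cd k ^+ 2 * ((F + T) * (G + T)) * D = (Cd k * (F + T)) * (Cd k * (G + T) * D) by ring.
  apply: ler_wpM2r; first by rewrite mulr_ge0.
  rewrite -[F]mul1r; apply: ler_pM => //; lra.
have -> : 2 * Cd k ^+ 2 * ((F + T) * (G + T)) * D = Cd k ^+ 2 * ((F + T) * (G + T)) * D + Cd k * (F + T) * (Cd k * (G + T)) * D by ring.
by apply: lerD; [exact: le_trans h1 h4 | exact: le_trans h3 h2].
Qed.

(** [dl h V] is a shift difference of a bounded function, so a walk longer than [N0] steps averages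
    it to at most S/4. Every such walk contributes at most g - 3S/4 with g = S - [dl h V x], and
    these walks have mass at least 1/(36 y). All others contribute at most g. *)
Lemma LK_diss K h (V : Z -> R) x (Cv S : R) : (0 < d)%N -> h != 0 -> 1 <= Cv -> 0 <= S ->
  (forall y, `|V y| <= Cv * S) -> (forall y, dl h V y <= S) ->
  (36 * (Cv * d%:R * nz h)) ^+ 2 <= K%:R + 1 ->
  LK K (fun z => dl h V (x + z) - dl h V x) <= (S - dl h V x) - S / (48 * (Cv * d%:R * nz h)).
Proof.
move=> d0 h0 Cv1 S0 VS WS; set y := Cv * d%:R * nz h => Ky.
have d1 : 1 <= d%:R :> R by rewrite ler1n.
have H1 : 1 <= nz h :> R by exact: nz_ge1.
have y1 : 1 <= y by rewrite /y -[X in X <= _]mulr1 ler_pM // -[X in X <= _]mulr1 ler_pM.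
have y0 : 0 < y by lra.
pose N0 := (Num.truncn ((8 * y) ^+ 2)).+1.
have [N0a N0b] : (8 * y) ^+ 2 <= N0%:R /\ N0%:R <= (9 * y) ^+ 2.
  have /andP[a b] := truncn_itv (sqr_ge0 (8 * y)); split; first exact: ltW.
  by rewrite /N0 -natr1; nra.
have N0K : (N0 <= K)%N by rewrite -(ler_nat R); nra.
have a0 : 1 / (18 * y) <= aN N0.
  by rewrite ler_pdivrMr ?mulr_gt0 //; have := @aN_ge R N0 (9 * y) _ _ N0b => /(_ _ isT); lra.
have aK : aN K <= 1 / (36 * y).
  have y36 : 0 < 36 * y by lra.
  rewrite ler_pdivlMr //; apply: (@aN_le R K (36 * y)); [lra | exact: Ky].
set W := dl h V; set g := S - W x.
have g0 : 0 <= g by rewrite subr_ge0 WS.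
have EW N : EN N.+1 (fun z => W (x + z) - W x) <= g by rewrite -(@EN_cst N.+1 g); apply: EN_mono => z; rewrite lerD2r WS.
have EW2 N : (N0 <= N)%N -> EN N.+1 (fun z => W (x + z) - W x) <= g - 3 / 4 * S.
  move=> NN; rewrite ENB EN_cst /g.
  suff : EN N.+1 (fun z => W (x + z)) <= S / 4 by lra.
  have -> : EN N.+1 (fun z => W (x + z)) =
      EN N.+1 (fun z => sft x V (z + h)) - EN N.+1 (sft x V).
    by rewrite -ENB; apply: EN_ext => z; rewrite /sft /W /dl [z + h + x]addrC [z + x]addrC addrA.
  apply: le_trans (ler_norm _) _.
  have Vb z : - (Cv * S) <= sft x V z <= Cv * S by rewrite -ler_norml; exact: VS.
  apply: le_trans (EN_grad N.+1 h Vb) _.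
  have : aN N.+1 * (8 * y) <= 1 :> R.
    apply: aN_le; first lra.
    have : N0%:R <= N%:R :> R by rewrite ler_nat.
    by rewrite -(natr1 N); lra.
  have -> : aN N.+1 * (Cv * S - - (Cv * S)) * (d%:R * nz h) = aN N.+1 * (8 * y) * (S / 4) by rewrite /y; field.
  move=> h1; have S4 : 0 <= S / 4 by lra.
  by have := ler_wpM2r S4 h1; rewrite mul1r.
rewrite /LK (big_cat_nat (n := N0)) //=.
have s1 : \sum_(0 <= N < N0) bN N * EN N.+1 (fun z => W (x + z) - W x) <= (aN 0 - aN N0) * g.
  rewrite -(sum_bN (leq0n _)) mulr_suml; apply: ler_sum => N _.
  by apply: ler_wpM2l; [exact: bN_ge0 | exact: EW].
have s2 : \sum_(N0 <= N < K) bN N * EN N.+1 (fun z => W (x + z) - W x) <= (aN N0 - aN K) * (g - 3 / 4 * S).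
  rewrite -(sum_bN N0K) mulr_suml; apply: ler_sum_nat => N /andP[NN _].
  by apply: ler_wpM2l; [exact: bN_ge0 | exact: EW2].
apply: le_trans (lerD s1 s2) _; rewrite aN0.
have aK0 : 0 <= aN K * g by rewrite mulr_ge0 // ltW // aN_gt0.
have h1 : 1 / (36 * y) <= aN N0 - aN K.
  have -> : 1 / (36 * y) = 1 / (18 * y) - 1 / (36 * y) by field; rewrite gt_eqF.
  lra.
have S4 : 0 <= 3 / 4 * S by lra.
have := ler_wpM2r S4 h1.
have -> : 1 / (36 * y) * (3 / 4 * S) = S / (48 * y) by field; rewrite gt_eqF.
lra.
Qed.

End Bilinear.

(** * Differences of order above s, and the linear operator at two scales *)

Section RegularityStep.
Implicit Types (f g u : Z -> R) (x y z h a : Z).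

Lemma nzX_double s z : nz (z + z) ^+ s = 2 ^+ s * nz z ^+ s :> R.
Proof. by rewrite nz_double exprMn. Qed.

(** The profile |z|^s doubles by 2^s, which contracts in Marchaud's recursion exactly at orders
    above s. The lower orders must be handled by the oscillation bound instead. *)
Lemma dk_high k s l f (F B r : R) : (s < l <= k)%N -> 0 <= B -> 0 < r ->
  (forall x, `|f x| <= F) ->
  (forall x z, `|dk k z f x| <= B * (nz z / r) ^+ s) ->
  forall x z, `|dk l z f x| <= Cd k * B * (nz z / r) ^+ s.
Proof.
move=> sl B0 r0 fF fB x z; have /andP[sl1 lk] := sl.
have r1 : 0 < r ^- s by rewrite invr_gt0 exprn_gt0.
have rs0 : r ^+ s != 0 by rewrite expf_neq0 // gt_eqF.
have fB' x' z' : `|dk k z' f x'| <= (B / r ^+ s) * nz z' ^+ s.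
  by apply: le_trans (fB x' z') _; rewrite exprMn exprVn mulrA mulrAC.
have B1 : 0 <= B / r ^+ s by rewrite mulr_ge0 // ltW.
have h := @marchaud_iter k s.+1 f (fun z => nz z ^+ s) F (B / r ^+ s) 1 (ltn0Sn s) B1 fF.
apply: le_trans (h _ _ _ _ fB' l sl x z) _ => //.
- by move=> z'; rewrite exprn_ge0 ?nz_ge0.
- by move=> z' z0; rewrite exprn_ege1 // nz_ge1.
- move=> z'; rewrite nzX_double; apply: ler_wpM2r; first by rewrite exprn_ge0 ?nz_ge0.
  by rewrite exprS; have : 0 <= 2 ^+ s :> R by []; lra.
have -> : Cd k * B * (nz z / r) ^+ s = Cd k * (B / r ^+ s) * nz z ^+ s by rewrite exprMn exprVn; ring.
rewrite ler_wpM2r ?exprn_ge0 ?nz_ge0 // ler_wpM2r // (le_trans _ (Cd_split (leq_subr l k))) //.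
by rewrite ler_peMr ?exprn_ege1 ?ler1n // exprn_ge0 ?mulr_ge0.
Qed.

(** The small oscillation [e1] is charged at the scale [r] and the full size [M] only at the large
    scale [rho]. A one-scale bound would cost M/r, which the dissipation cannot absorb. *)
Lemma LK_lap K k s u x (M e1 r rho : R) : (2 <= s)%N -> (2 <= k)%N -> 0 < r -> r <= rho ->
  0 < e1 -> 0 <= M ->
  (forall y, `|u y| <= M) ->
  (forall y z, nz z <= rho -> 2 ^+ k * `|dl z u y| <= e1) ->
  (forall y z, `|dk k z u y| <= 2 * e1 * (nz z / r) ^+ s) ->
  (forall y z, `|dk 2 z u y| <= Cd k * (e1 * mu r z + M * mu rho z)) /\
  `|LK K (fun z => dl z u x)| <= Cd k * (d%:R + 3) * (e1 / r + M / rho).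
Proof.
move=> s2 k2 r0 rr e10 M0 uM osc uk.
have rho0 : 0 < rho by exact: lt_le_trans rr.
have k1 : 4 <= 2 ^+ k :> R by have -> : 4 = 2 ^+ 2 :> R by [rewrite expr2; ring]; rewrite ler_weXn2l ?ler1n.
have C1 : 2 ^+ k <= Cd k :> R by have := @Cd_split k 0 (leq0n k); rewrite expr0 mul1r.
have k0 : (0 < k)%N by exact: ltn_trans k2.
have oscl l y z : nz z <= rho -> (0 < l <= k)%N -> `|dk l z u y| <= e1.
  move=> zr /andP[l0 lk]; rewrite -(prednK l0).
  have l1 : 2 ^+ l.-1 <= 2 ^+ k :> R by rewrite ler_weXn2l ?ler1n //; lia.
  have := @dk_osc l.-1 z u (e1 / 2 ^+ k).
  move=> /(_ _ y)/le_trans; apply.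
    by move=> y'; rewrite ler_pdivlMr ?exprn_gt0 // mulrC; exact: osc.
  by rewrite mulrCA ler_piMr ?(ltW e10) // ler_pdivrMr ?exprn_gt0 // mul1r.
have q0 (t : R) z : 0 < t -> 0 <= nz z / t by move=> t0; rewrite divr_ge0 ?nz_ge0 // ltW.
pose psi z := e1 * phi (nz z / r) + M * phi (nz z / rho).
have psi0 z : 0 <= psi z by rewrite addr_ge0 // mulr_ge0 ?phi_ge0 // ltW.
have uk' y z : `|dk k z u y| <= 2 ^+ k * psi z.
  have [zr|zr] := leP (nz z) r.
    apply: le_trans (uk y z) _; have z1 : nz z / r <= 1 by rewrite ler_pdivrMr // mul1r.
    have h : (nz z / r) ^+ s <= phi (nz z / r) by apply: le_trans (phi_ge _); [rewrite ler_wiXn2l ?q0 | rewrite q0].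
    have h1 := ler_wpM2l (ltW e10) h.
    have h2 : 0 <= M * phi (nz z / rho) by rewrite mulr_ge0 ?phi_ge0.
    have h3 : 0 <= (2 ^+ k - 2) * psi z by rewrite mulr_ge0 // subr_ge0; lra.
    have h4 : psi z = e1 * phi (nz z / r) + M * phi (nz z / rho) by [].
    have h5 := psi0 z.
    clearbody psi; lra.
  have z1 : 1 <= phi (nz z / r) by rewrite -phi1 phi_mono // ler_pdivlMr // mul1r ltW.
  have [zrho|zrho] := leP (nz z) rho.
    apply: le_trans (oscl k y z zrho _) _; first by rewrite k0 leqnn.
    have h1 := ler_wpM2l (ltW e10) z1.
    have h2 : 0 <= M * phi (nz z / rho) by rewrite mulr_ge0 ?phi_ge0.
    have h3 : 0 <= (2 ^+ k - 1) * psi z by rewrite mulr_ge0 // subr_ge0; lra.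
    have h4 : psi z = e1 * phi (nz z / r) + M * phi (nz z / rho) by [].
    clearbody psi; lra.
  apply: le_trans (dk_bnd k z uM y) _; apply: ler_wpM2l; first by [].
  have z2 : 1 <= phi (nz z / rho) by rewrite -phi1 phi_mono // ler_pdivlMr // mul1r ltW.
  have h1 := ler_wpM2l M0 z2.
  have h2 : 0 <= e1 * phi (nz z / r) by rewrite mulr_ge0 ?phi_ge0 // ltW.
  by rewrite /psi; lra.
have main y z : `|dk 2 z u y| <= Cd k * (e1 * mu r z + M * mu rho z).
  have C0 : 0 <= Cd k :> R by lra.
  have [zr|zr] := leP (nz z) r.
    have m1 (t : R) : 0 < t -> nz z <= t -> mu t z = phi (nz z / t).
      by move=> t0 zt; rewrite /mu min_r // -phi1 phi_mono // ler_pdivrMr // mul1r.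
    rewrite !m1 //; last exact: le_trans rr.
    have p0 : 0 < e1 * phi (1 / r) by rewrite mulr_gt0 // phi_gt0 // divr_gt0.
    have k20 : 0 <= 2 ^+ k :> R by lra.
    have h := @marchaud_iter k 2 u psi M (2 ^+ k) _ isT k20 uM psi0 p0.
    apply: le_trans (h _ _ uk' 2 _ y z) _ => //.
    - move=> z' z0; apply: (@le_trans _ _ (e1 * phi (nz z' / r))).
        by apply: ler_wpM2l; [exact: ltW | apply: phi_mono; rewrite ler_pM2r ?invr_gt0 // nz_ge1].
      by rewrite /psi lerDl mulr_ge0 ?phi_ge0.
    - move=> z'; rewrite /psi nz_double -!mulrA.
      have h1 := ler_wpM2l (ltW e10) (phi_double (q0 r z' r0)).
      have h2 := ler_wpM2l M0 (phi_double (q0 rho z' rho0)).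
      lra.
    - by rewrite -/(psi z); apply: ler_wpM2r; [exact: psi0 | apply: Cd_split; exact: leq_subr].
  have m1 : mu r z = 1 by rewrite /mu min_l // -phi1 phi_mono // ler_pdivlMr // mul1r ltW.
  rewrite m1 mulr1; have mp := mulr_ge0 M0 (mu_ge0 rho z).
  have [zrho|zrho] := leP (nz z) rho.
    apply: le_trans (oscl 2 y z zrho _) _; first by rewrite /= k2.
    have : 0 <= (Cd k - 1) * (e1 + M * mu rho z) by rewrite mulr_ge0 ?subr_ge0 ?addr_ge0 ?(ltW e10) ?Cd_ge1.
    by lra.
  have -> : mu rho z = 1 by rewrite /mu min_l // -phi1 phi_mono // ler_pdivlMr // mul1r ltW.
  apply: le_trans (dk_bnd 2 z uM y) _; rewrite mulr1.
  apply: ler_pM => //; first by rewrite (le_trans _ C1) // expr2; lra.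
  by rewrite lerDr ltW.
split=> //.
have h0 : LK K (fun z => dl z u x) = LK K (fun z => dk 2 z u (x - z)) / 2.
  have := LK_even K (fun z => dl z u x); set a := LK K (fun z => dl z u x) => h.
  have -> : LK K (fun z => dk 2 z u (x - z)) = LK K (fun z => dl z u x + dl (- z) u x).
    by apply: LK_ext => z; rewrite /dk /= /dl subrK; ring.
  by rewrite LKD h -/a; field.
have C0 : 0 <= Cd k :> R by lra.
have h1 : `|LK K (fun z => dk 2 z u (x - z))| <= Cd k * (d%:R + 3) * (e1 / r + M / rho).
  apply: le_trans (LK_norm _ _) _.
  apply: le_trans (LK_mono K (fun z => main (x - z) z)) _.
  rewrite LKZ LKD !LKZ -mulrA; apply: ler_wpM2l => //.
  have a1 := ler_wpM2l (ltW e10) (@LK_phi K r r0).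
  have a2 := ler_wpM2l M0 (@LK_phi K rho rho0).
  have -> : (d%:R + 3) * (e1 / r + M / rho) = e1 * ((d%:R + 3) / r) + M * ((d%:R + 3) / rho) by ring.
  exact: lerD.
rewrite h0 normrM [`|2^-1|]ger0_norm // ler_pdivrMr //.
have : 0 <= `|LK K (fun z => dk 2 z u (x - z))| by []; lra.
Qed.

End RegularityStep.

(** * Propagation of the bound on high-order differences over one step *)

Section RegularityUpdate.
Implicit Types (f g u : Z -> R) (x y z h a : Z).

Lemma bernoulli_le s (t : R) : 0 <= t <= 1 -> 1 - s%:R * t <= (1 - t) ^+ s.
Proof.
move=> /andP[t0 t1]; elim: s => [|s IH]; first by rewrite mul0r subr0 expr0.
rewrite exprS -natr1; have t1' : 0 <= 1 - t by lra.
have := ler_wpM2l t1' IH; have : 0 <= s%:R * t * t by rewrite !mulr_ge0.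
lra.
Qed.

Lemma dk_low k l h u y (e1 : R) : (0 < l <= k)%N -> 0 <= e1 ->
  (forall y, 2 ^+ k * `|dl h u y| <= e1) -> `|dk l h u y| <= e1.
Proof.
move=> /andP[l0 lk] e10 osc; rewrite -(prednK l0).
have l1 : 2 ^+ l.-1 <= 2 ^+ k :> R by rewrite ler_weXn2l ?ler1n //; lia.
have := @dk_osc l.-1 h u (e1 / 2 ^+ k).
move=> /(_ _ y)/le_trans; apply.
  by move=> y'; rewrite ler_pdivlMr ?exprn_gt0 // mulrC; exact: osc.
by rewrite mulrCA ler_piMr // ler_pdivrMr ?exprn_gt0 // mul1r.
Qed.

(** [D] is the jump of the top difference and [A] its coefficient. Where A >= m/2, the excess A -
    m/2 multiplies g - D >= 0. Where the coefficient may be too small or negative, the jump is long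
    and q >= 1 pays. *)
Lemma weighted_jump (m M S A D g q : R) (near : bool) : 0 <= m -> m <= M -> 0 <= S ->
  D <= g -> - (2 * S) <= D -> - M <= A <= 2 * M -> (near -> m / 2 <= A) -> 0 <= g ->
  (~~ near -> 1 <= q) -> 0 <= q ->
  A * D <= m / 2 * D + 3 * M * g + 8 * M * S * q.
Proof.
move=> m0 mM S0 Dg DS /andP[A1 A2] An g0 q1 q0; have M0 : 0 <= M by lra.
have MSq : 0 <= M * S * q by rewrite !mulr_ge0.
have Mg : 0 <= M * g by rewrite mulr_ge0.
case: near An q1 => [/(_ isT) An _|_ /(_ isT) q1].
  have h1 : 0 <= (A - m / 2) * (g - D) by rewrite mulr_ge0 //; lra.
  have h2 : 0 <= (2 * M - (A - m / 2)) * g by rewrite mulr_ge0 //; lra.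
  lra.
have MS : 0 <= M * S * (q - 1) by rewrite mulr_ge0 ?mulr_ge0 //; lra.
have MS0 : 0 <= M * S by rewrite mulr_ge0.
have [Am|Am] := leP (m / 2) A.
  have h1 : 0 <= (A - m / 2) * (g - D) by rewrite mulr_ge0 //; lra.
  have h2 : 0 <= (2 * M - (A - m / 2)) * g by rewrite mulr_ge0 //; lra.
  lra.
have h1 : 0 <= (m / 2 - A) * (D + 2 * S) by rewrite mulr_ge0 //; lra.
have h2 : 0 <= (2 * M - (m / 2 - A)) * S by rewrite mulr_ge0 //; lra.
lra.
Qed.

(** The errors fall into two groups, one proportional to M/rho and one to e1/H. Each is below half
    of the allowance on the right. *)
Lemma final_bound k (q2 dd H rho muu' S e1 m M C D : R) : 0 < q2 -> 1 <= dd -> 1 <= H -> 0 < rho -> H <= muu' ->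
  0 <= S -> 0 < e1 -> 0 < M -> 1 <= C -> 1 <= D -> 1 <= 2 ^+ k :> R ->
  13 * 2 ^+ k * C ^+ 4 * D * e1 * (2 * q2 * C * dd) <= m ->
  9 * C * M * D * muu' * (2 * q2 * C * dd) <= m * rho ->
  8 * M * S * (D / rho) + S * (C * D * (e1 / H + M / rho)) + 2 ^+ k * (12 * C ^+ 4 * e1 * S * (D / H))
   <= m * S / (q2 * (C * dd * H)).
Proof.
move=> q20 dd1 H1 rho0 Hmu S0 e10 M0 C1 D1 k1.
have H0 : 0 < H by lra.
have C0 : 0 < C by lra.
have dd0 : 0 < dd by lra.
have D0 : 0 < D by lra.
have [q [q0 qE]] : exists q, 0 < q /\ 2 * q2 * C * dd = q by exists (2 * q2 * C * dd); rewrite !mulr_gt0.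
rewrite qE => He Hc.
have e1b : 13 * 2 ^+ k * C ^+ 4 * D * e1 / H <= m / q / H.
  apply: ler_wpM2r; first by rewrite invr_ge0 ltW.
  by rewrite ler_pdivlMr.
have Mb : 9 * C * M * D / rho <= m / q / H.
  rewrite ler_pdivrMr //.
  have -> : m / q / H * rho = m * rho / (q * H) by field; rewrite !gt_eqF.
  rewrite ler_pdivlMr; last by rewrite mulr_gt0.
  apply: le_trans Hc; set Y := 9 * C * M * D.
  have Y0 : 0 <= Y * q by rewrite mulr_ge0 ?(ltW q0) // !mulr_ge0 // ltW.
  have -> : Y * (q * H) = Y * q * H by ring.
  have -> : Y * muu' * q = Y * q * muu' by ring.
  exact: ler_wpM2l.
have p1 : 8 * M * (D / rho) + C * D * (M / rho) <= 9 * C * M * D / rho.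
  have : 0 <= (C - 1) * (M * D / rho) by rewrite mulr_ge0 ?subr_ge0 // divr_ge0 ?mulr_ge0 // ltW.
  clra.
have C4 : C <= 2 ^+ k * C ^+ 4.
  rewrite -[X in X <= _]mul1r; apply: ler_pM => //; first exact: ltW.
  by rewrite exprS ler_peMr ?exprn_ege1 // ltW.
have p2 : C * D * (e1 / H) + 2 ^+ k * (12 * C ^+ 4 * e1 * (D / H)) <= 13 * 2 ^+ k * C ^+ 4 * D * e1 / H.
  have : 0 <= (2 ^+ k * C ^+ 4 - C) * (D * e1 / H) by rewrite mulr_ge0 ?subr_ge0 // divr_ge0 ?mulr_ge0 // ltW.
  clra.
have -> : m * S / (q2 * (C * dd * H)) = S * (m / q / H + m / q / H) by rewrite -qE; field; rewrite !gt_eqF.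
have -> : 8 * M * S * (D / rho) + S * (C * D * (e1 / H + M / rho)) + 2 ^+ k * (12 * C ^+ 4 * e1 * S * (D / H)) =
  S * ((8 * M * (D / rho) + C * D * (M / rho)) + (C * D * (e1 / H) + 2 ^+ k * (12 * C ^+ 4 * e1 * (D / H)))) by ring.
apply: ler_wpM2l => //; apply: lerD; [exact: le_trans p1 Mb | exact: le_trans p2 e1b].
Qed.

(** The 48 is that of [LK_diss]. With the coefficient m/2 the dissipation is 2t for t = m S / (q2 C
    dd H): one t absorbs the errors [X], the other pays for the growth of the scale. *)
Lemma final_step (q2 lam m M S g X C dd H muu' : R) : q2 = 4 * 48 ->
  0 <= lam -> 0 < m -> m <= M -> 4 * M * lam <= 1 ->
  0 <= S -> 0 <= g -> 1 <= C -> 1 <= dd -> 1 <= H -> H <= muu' ->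
  X <= m * S / (q2 * (C * dd * H)) ->
  S - g + lam * (m / 2 * (g - S / (48 * (C * dd * H))) + 3 * M * g + X) <=
  S * (1 - lam * (m / (q2 * C * dd)) / muu').
Proof.
move=> q2E lam0 m0 mM cfl S0 g0 C1 dd1 H1 Hmu HX.
have q20 : 0 < q2 by rewrite q2E mulr_gt0.
have H0 : 0 < H by move: H1; clra.
have C0 : 0 < C by move: C1; clra.
have dd0 : 0 < dd by move: dd1; clra.
have a1 : lam * ((m / 2 + 3 * M) * g) <= g.
  have : 0 <= (1 - 4 * M * lam) * g by rewrite mulr_ge0 // subr_ge0.
  have : 0 <= (M - m) * (lam * g) by rewrite !mulr_ge0 // subr_ge0.
  have : 0 <= m * (lam * g) by rewrite !mulr_ge0 // ltW.
  clra.
set t := m * S / (q2 * (C * dd * H)) in HX.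
have p0 : 0 < q2 * (C * dd * H) by rewrite !mulr_gt0.
have t0 : 0 <= t by rewrite divr_ge0 ?(ltW p0) // mulr_ge0 // ltW.
have e1 : m / 2 * (S / (48 * (C * dd * H))) = 2 * t by rewrite /t q2E; field; rewrite !gt_eqF.
have a2 : S * (lam * (m / (q2 * C * dd)) / muu') <= lam * t.
  have -> : lam * t = S * (lam * (m / (q2 * C * dd)) / H) by rewrite /t; field; rewrite !gt_eqF.
  have c0 : 0 < q2 * C * dd by rewrite !mulr_gt0.
  apply: ler_wpM2l => //; apply: ler_wpM2l; first by rewrite mulr_ge0 // divr_ge0 ?(ltW m0) ?(ltW c0).
  by rewrite lef_pV2 ?posrE //; exact: lt_le_trans Hmu.
have a3 := ler_wpM2l lam0 HX.
have e2 : m / 2 * (g - S / (48 * (C * dd * H))) = m / 2 * g - 2 * t by rewrite mulrBr e1.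
by rewrite e2; move: a1 a2 a3; clra.
Qed.

(** A maximum principle for k-th differences at a pair (x, h). The two extreme Leibniz terms form a
    jump operator on the top difference plus a multiple of that difference. In every other term, k =
    2s + 1 forces exactly one of the orders l and k - l above s: that factor is of size [S h], the
    other of size [e1], so the product is a small multiple of [S h]. *)
Lemma regularity_step (s k K : nat) (q2 m M e1 rho muu muu' lam c3 C D : R) (u u' : Z -> R) (S : Z -> R) :
  q2 = 4 * 48 -> k = (2 * s).+1 -> C = Cd k -> D = d%:R + 3 ->
  (forall h, S h = e1 * (nz h / muu) ^+ s) ->
  (0 < d)%N -> (2 <= s)%N -> 0 < m -> m <= M -> 0 < e1 ->
  13 * 2 ^+ k * C ^+ 4 * D * e1 * (2 * q2 * C * d%:R) <= m ->
  9 * C * M * D * muu' * (2 * q2 * C * d%:R) <= m * rho ->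
  2 ^+ k * M * muu' <= e1 * rho ->
  0 <= lam -> 4 * M * lam <= 1 -> 1 <= muu -> muu <= muu' ->
  0 <= c3 -> q2 * s%:R * C * d%:R * c3 <= m -> muu' <= muu + lam * c3 ->
  (36 * (C * d%:R * rho)) ^+ 2 <= K%:R + 1 ->
  (forall y, m <= u y <= M) -> (forall y, m <= u' y <= M) ->
  (forall y z, nz z <= rho -> 2 ^+ k * `|dl z u y| <= e1) ->
  (forall y z, nz z <= rho -> 2 ^+ k * `|dl z u' y| <= e1) ->
  (forall x, u' x = u x + lam * Q K u u x) ->
  (forall y z, `|dk k z u y| <= e1 * (nz z / muu) ^+ s) ->
  (forall y z, `|dk k z u' y| <= e1 * (nz z / muu') ^+ s).
Proof.
move=> q2E kE CE DE SE d0 s2 m0 mM e10 He Hc Hc2 lam0 cfl mu1 mu' c30 Hc3 muS HK ub ub' uosc uosc' uE uk.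
have d1 : 1 <= d%:R :> R by rewrite ler1n.
have C1 : 1 <= C by rewrite CE; exact: Cd_ge1.
have k2C : 2 ^+ k <= C by rewrite CE; have := @Cd_split k 0 (leq0n k); rewrite expr0 mul1r.
have k2 : 2 <= 2 ^+ k :> R by rewrite -[leLHS]expr1 ler_weXn2l ?ler1n // kE.
have M0 : 0 < M by exact: lt_le_trans mM.
have uM y : `|u y| <= M by have /andP[a b] := ub y; rewrite ger0_norm // ltW // (lt_le_trans m0).
have u'M y : `|u' y| <= M by have /andP[a b] := ub' y; rewrite ger0_norm // ltW // (lt_le_trans m0).
have D1 : 1 <= D by rewrite DE; move: d1; clra.
have mu0 : 0 < muu by move: mu1; clra.
have mu0' : 0 < muu' by move: mu0 mu'; clra.
have q21 : 1 <= q2 by rewrite q2E; clra.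
have q20 : 0 < q2 by rewrite q2E; clra.
have CD0 : 0 < q2 * C * d%:R by rewrite !mulr_gt0 //; move: d1 C1; clra.
have e1m : e1 <= m.
  apply: le_trans He.
  have a1 : 1 <= 13 * 2 ^+ k * C ^+ 4 * D * (2 * q2 * C * d%:R).
    rewrite -[leLHS]mulr1; apply: ler_pM => //; last first.
      rewrite -[leLHS]mulr1; apply: ler_pM => //; rewrite -[leLHS]mulr1; apply: ler_pM => //.
      by move: q21; clra.
    rewrite -[leLHS]mulr1; apply: ler_pM => //.
    rewrite -[leLHS]mulr1; apply: ler_pM => //; last by rewrite exprn_ege1.
    by move: k2; clra.
  by have := ler_wpM2r (ltW e10) a1; clra.
have rho0 : 0 < rho.
  have : 0 < 2 ^+ k * M * muu' by rewrite !mulr_gt0 ?exprn_gt0.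
  by move=> h; have := lt_le_trans h Hc2; rewrite pmulr_rgt0.
have mu'rho : muu' <= rho.
  rewrite -(ler_pM2l e10); apply: le_trans Hc2; apply: ler_wpM2r; first exact: ltW.
  have : 0 <= (2 ^+ k - 1) * M by rewrite mulr_ge0 ?(ltW M0) //; move: k2; clra.
  by move: e1m mM M0; clra.
(* Raising the scale lowers the bound by the factor on the right; Bernoulli's inequality shows that
   this asks for no more decay than the dissipation provides. *)
have ratio : 1 - lam * (m / (q2 * C * d%:R)) / muu' <= (muu / muu') ^+ s.
  have -> : muu / muu' = 1 - (muu' - muu) / muu' by field; rewrite gt_eqF.
  apply: le_trans (bernoulli_le s _); last first.
    by rewrite divr_ge0 ?subr_ge0 ?(ltW mu0') //= ler_pdivrMr // mul1r; move: mu0; clra.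
  rewrite lerD2l lerN2 mulrA ler_pM2r ?invr_gt0 //.
  have h1 : s%:R * (muu' - muu) <= s%:R * (lam * c3) by rewrite ler_wpM2l //; move: muS; clra.
  apply: le_trans h1 _; rewrite mulrCA ler_wpM2l // ler_pdivlMr //.
  have -> : s%:R * c3 * (q2 * C * d%:R) = q2 * s%:R * C * d%:R * c3 by clear; ring.
  exact: Hc3.
have S_ge0 h : 0 <= S h by rewrite SE mulr_ge0 ?exprn_ge0 ?divr_ge0 ?nz_ge0 ?(ltW mu0) ?(ltW e10).
have lamm : lam * (m / (q2 * C * d%:R)) <= 1 / 2.
  have h : 4 <= q2 * C * d%:R.
    rewrite -[leLHS]mulr1; apply: ler_pM => //; rewrite -[leLHS]mulr1; apply: ler_pM => //.
    by rewrite q2E; clra.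
  rewrite mulrA ler_pdivrMr //.
  have : 0 <= lam * (M - m) by rewrite mulr_ge0 // subr_ge0.
  by move: cfl h; clra.
have Se h : S h * (muu / muu') ^+ s = e1 * (nz h / muu') ^+ s.
  rewrite SE -mulrA -exprMn; congr (_ * _ ^+ _).
  by rewrite mulrA divfK ?gt_eqF.
have S_le2 h : nz h <= muu' -> S h <= 2 * e1.
  move=> hmu; have h1 : e1 * (nz h / muu') ^+ s <= e1.
    rewrite ler_piMr ?(ltW e10) // exprn_ile1 ?divr_ge0 ?nz_ge0 ?(ltW mu0') //.
    by rewrite ler_pdivrMr // mul1r.
  have h2 : 1 / 2 <= (muu / muu') ^+ s.
    apply: le_trans ratio; have : lam * (m / (q2 * C * d%:R)) / muu' <= 1 / 2.
      by rewrite ler_pdivrMr //; apply: le_trans lamm _; move: mu1 mu'; clra.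
    by clra.
  by have := ler_wpM2l (S_ge0 h) h2; rewrite Se; move: h1; clra.
have ukS h : h != 0 -> forall y z, `|dk k z u y| <= S h * (nz z / nz h) ^+ s.
  move=> h0 y z; apply: le_trans (uk y z) _; rewrite SE -mulrA -exprMn.
  have H0 : 0 < nz h :> R by exact: nz_gt0.
  by rewrite [nz h / muu * _]mulrC mulrA divfK ?gt_eqF.
have low h j y : nz h < muu' -> (0 < j <= k)%N -> `|dk j h u y| <= e1.
  move=> hmu jk; apply: (@dk_low k) => //; first exact: ltW.
  by move=> y'; apply: uosc; apply: ltW; apply: lt_le_trans mu'rho.
have high h j y : h != 0 -> (s < j <= k)%N -> `|dk j h u y| <= C * S h.
  move=> h0 jk; have H0 : 0 < nz h :> R by exact: nz_gt0.
  have := @dk_high k s j u M (S h) (nz h) jk (S_ge0 h) H0 uM (ukS h h0) y h.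
  by rewrite -CE divff ?gt_eqF // expr1n mulr1.
have mid h x l : h != 0 -> nz h < muu' -> (0 < l < k)%N ->
  `|Q K (sft (h *+ (k - l)) (dk l h u)) (dk (k - l) h u) x| <= 12 * C ^+ 4 * e1 * S h * (D / nz h).
  move=> h0 hmu lk; have H0 : 0 < nz h :> R by exact: nz_gt0.
  have S2 := S_le2 h (ltW hmu); have S0 := S_ge0 h.
  pose T := 2 ^+ k * S h.
  have T0 : 0 <= T by rewrite mulr_ge0.
  have hT j y z : (j <= k)%N -> `|dk k z (dk j h u) y| <= T * (nz z / nz h) ^+ s.
    move=> jk; rewrite dkC; apply: le_trans (dk_bnd j h (fun y => ukS h h0 y z) y) _.
    rewrite /T -[leRHS]mulrA; apply: ler_wpM2r; last by rewrite ler_weXn2l ?ler1n.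
    by rewrite mulr_ge0 ?exprn_ge0 ?divr_ge0 ?nz_ge0.
  have bb (F G : R) : (forall y, `|dk l h u y| <= F) -> (forall y, `|dk (k - l) h u y| <= G) ->
     (F + T) * (G + T) <= 6 * C ^+ 2 * e1 * S h ->
     `|Q K (sft (h *+ (k - l)) (dk l h u)) (dk (k - l) h u) x| <= 12 * C ^+ 4 * e1 * S h * (D / nz h).
    move=> hF hG hFG.
    have k2' : (2 <= k)%N by rewrite kE; move: s2; clear; lia.
    have := @Q_holder K k s (sft (h *+ (k - l)) (dk l h u)) (dk (k - l) h u) x F G T (nz h) s2 k2' H0 T0.
    move=> /(_ _ _ _ _)/le_trans; apply => //.
    - by move=> y; exact: hF.
    - by move=> y z; rewrite dk_sft; apply: hT; move: lk; clear; lia.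
    - by move=> y z; apply: hT; exact: leq_subr.
    - rewrite -DE -CE; apply: ler_wpM2r.
        by rewrite divr_ge0 ?(ltW H0) //; move: D1; clra.
      have C2 : 0 <= 2 * C ^+ 2 by rewrite mulr_ge0 ?exprn_ge0 //; move: C1; clra.
      apply: le_trans (ler_wpM2l C2 hFG) _; rewrite le_eqVlt; apply/orP; left; apply/eqP.
      by clear; ring.
  have C0 : 0 <= C by move: C1; clra.
  have Tb : T <= C * S h by rewrite ler_wpM2r.
  have Te : e1 + T <= 3 * C * e1.
    have : 0 <= C * (2 * e1 - S h) by rewrite mulr_ge0 ?subr_ge0.
    have : 0 <= (C - 1) * e1 by rewrite mulr_ge0 ?subr_ge0 // ltW.
    by move: Tb; clra.
  have CS0 : 0 <= C * S h by rewrite mulr_ge0.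
  have e10' := ltW e10.
  have Th : C * S h + T <= 2 * (C * S h) by move: Tb; clra.
  (* Either [l] is the low order and k - l the high one, or conversely. *)
  have [ls|sl] := leqP l s.
    apply: (bb e1 (C * S h)).
    - by move=> y; apply: low => //; move: lk; clear; lia.
    - by move=> y; apply: high => //; move: ls lk; rewrite kE; clear; lia.
    - have -> : 6 * C ^+ 2 * e1 * S h = (3 * C * e1) * (2 * (C * S h)) by clear; ring.
      by apply: ler_pM => //; rewrite addr_ge0.
  apply: (bb (C * S h) e1).
  - by move=> y; apply: high => //; move: sl lk; clear; lia.
  - by move=> y; apply: low => //; move: sl lk; clear; lia.
  - have -> : 6 * C ^+ 2 * e1 * S h = (2 * (C * S h)) * (3 * C * e1) by clear; ring.
    by apply: ler_pM => //; rewrite addr_ge0.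
(* The sign [c] reduces the two-sided bound to a one-sided comparison. *)
have sgn x h (c : R) : c ^+ 2 = 1 -> h != 0 -> nz h < muu' -> c * dk k h u' x <= e1 * (nz h / muu') ^+ s.
  move=> c2 h0 hmu; have H0 : 0 < nz h :> R by exact: nz_gt0.
  have H1 : 1 <= nz h :> R by exact: nz_ge1.
  have cn : `|c| = 1 by apply/eqP; rewrite -sqrp_eq1 // real_normK ?num_real // c2.
  have S2 := S_le2 h (ltW hmu); have S0 := S_ge0 h.
  (* The top difference is a first difference of [V], whose order 2s exceeds s; hence [V] is at most
     [C * S h] and [LK_diss] applies. *)
  pose V y := c * dk (2 * s) h u y.
  have VW : dl h V = fun y => c * dk k h u y by apply/funext => y; rewrite kE dkS /dl /V mulrBr.
  have VS y : `|V y| <= C * S h.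
    rewrite /V normrM cn mul1r; apply: high => //; move: s2; rewrite kE; clear; lia.
  have WSn y : `|c * dk k h u y| <= S h by rewrite normrM cn mul1r; apply: le_trans (uk y h) _; rewrite SE.
  have WS y : dl h V y <= S h by rewrite VW; exact: le_trans (ler_norm _) (WSn y).
  have hrho : nz h <= rho by apply: le_trans (ltW hmu) mu'rho.
  have HK' : (36 * (C * d%:R * nz h)) ^+ 2 <= K%:R + 1.
    have Cd0 : 0 <= C * d%:R by rewrite mulr_ge0 //; move: C1; clra.
    apply: le_trans HK; rewrite ler_sqr ?nnegrE ?mulr_ge0 ?nz_ge0 ?(ltW rho0) //;
      try by move: C1; clra.
    by rewrite ler_wpM2l // ler_wpM2l.
  have diss := @LK_diss K h V x C (S h) d0 h0 C1 S0 VS WS HK'.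
  rewrite VW in diss; pose W y := c * dk k h u y; pose g := S h - W x.
  have g0 : 0 <= g by have := WS x; rewrite VW subr_ge0.
  (* The coefficient of the jump of [W] collected from the terms l = 0 and l = k. For short jumps it
     is at least m/2 by the oscillation bound. *)
  pose A z := u (x + z + h *+ k) + (u (x + z) - u x).
  have jump : LK K (fun z => A z * (W (x + z) - W x)) <=
      m / 2 * (g - S h / (48 * (C * d%:R * nz h))) + 3 * M * g + 8 * M * S h * (D / rho).
    have pw z : A z * (W (x + z) - W x) <=
        m / 2 * (W (x + z) - W x) + (3 * M * g + 8 * M * S h * Num.min 1 ((nz z / rho) ^+ 2)).
      rewrite addrA; have /andP[a1 a2] := ub x; have /andP[a3 a4] := ub (x + z).
      have /andP[a5 a6] := ub (x + z + h *+ k).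
      have /andP[b3 b4] : - S h <= W (x + z) <= S h by rewrite -ler_norml; exact: WSn.
      have /andP[b1 b2] : - S h <= W x <= S h by rewrite -ler_norml; exact: WSn.
      apply: (@weighted_jump m M (S h) (A z) _ g _ (nz z <= rho)) => //.
      - exact: ltW.
      - by rewrite /g lerD2r.
      - by move: b2 b3; clra.
      - by move: m0 a1 a2 a3 a4 a5 a6; rewrite /A; clear => *; apply/andP; split; lra.
      - move=> zr; have ho := uosc x z zr; rewrite /dl in ho.
        have h3 : - (m / 2) <= u (x + z) - u x.
          have h2 : 2 * `|u (x + z) - u x| <= m.
            apply: le_trans e1m; apply: le_trans ho; exact: ler_wpM2r.
          by have := ler_norm (- (u (x + z) - u x)); rewrite normrN; move: h2; clra.
        by move: h3 a5; rewrite /A; clra.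
      - by rewrite -ltNge => zr; rewrite le_min lexx /= exprn_ege1 // ler_pdivlMr // mul1r ltW.
      - by rewrite le_min ler01 sqr_ge0.
    apply: le_trans (LK_mono K pw) _; rewrite (LKD K (fun z => m / 2 * (W (x + z) - W x))) LKZ (LKD K (fun=> 3 * M * g)) (LKZ K (8 * M * S h)) -addrA.
    apply: lerD; first by apply: ler_wpM2l; [rewrite divr_ge0 // ltW | exact: diss].
    apply: lerD; first by apply: LK_le_cst => //; rewrite !mulr_ge0 // ltW.
    apply: ler_wpM2l; first by rewrite !mulr_ge0 // ltW.
    by rewrite DE; exact: LK_sqr.
  have lap : `|LK K (fun z => dl z u x)| <= C * D * (e1 / nz h + M / rho).
    rewrite CE DE; have k2' : (2 <= k)%N by rewrite kE; move: s2; clear; lia.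
    apply: (@LK_lap K k s u x M e1 (nz h) rho s2 k2' H0 hrho e10 (ltW M0) uM uosc _).2.
    move=> y z; apply: le_trans (ukS h h0 y z) _; apply: ler_wpM2r => //.
    by rewrite exprn_ge0 // divr_ge0 ?nz_ge0.
  pose X l := 'C(k, l)%:R * Q K (sft (h *+ (k - l)) (dk l h u)) (dk (k - l) h u) x.
  have splitQ : c * dk k h (Q K u u) x = LK K (fun z => A z * (W (x + z) - W x)) +
      W x * LK K (fun z => dl z u x) + c * \sum_(l < 2 * s) X l.+1.
    have -> : dk k h (Q K u u) x = \sum_(l < (2 * s).+2) X l by rewrite dk_Q -kE.
    rewrite big_ord_recr big_ord_recl /= !mulrDr addrAC; congr (_ + _).
    rewrite -kE /X bin0 binn !mul1r subn0 subnn mulr0n /Q -!LKZ -!LKD.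
    by apply: LK_ext => z; rewrite /A /W /sft /dl /= addr0; clear; ring.
  have Y0 : 0 <= 12 * C ^+ 4 * e1 * S h * (D / nz h).
    by rewrite mulr_ge0 ?divr_ge0 ?(ltW H0) ?mulr_ge0 ?exprn_ge0 ?(ltW e10) //; move: C1 D1; clra.
  have midS : `|\sum_(l < 2 * s) X l.+1| <= 2 ^+ k * (12 * C ^+ 4 * e1 * S h * (D / nz h)).
    apply: le_trans (ler_norm_sum _ _ _) _.
    apply: (@le_trans _ _ (\sum_(l < 2 * s) 'C(k, l.+1)%:R * (12 * C ^+ 4 * e1 * S h * (D / nz h)))).
      apply: ler_sum => l _; rewrite /X normrM ger0_norm //; apply: ler_wpM2l => //.
      by apply: mid => //; rewrite kE /= ltnS; exact: ltn_ord.
    rewrite -mulr_suml; apply: ler_wpM2r => //.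
    have -> : 2 ^+ k = \sum_(l < k.+1) 'C(k, l)%:R :> R.
      rewrite -natrX -[2%N]/(1 + 1)%N expnDn natr_sum; apply: eq_bigr => l _.
      by rewrite !exp1n !muln1.
    rewrite big_ord_recl /= -[leLHS]add0r; apply: lerD => //.
    by rewrite [in leRHS]kE big_ord_recr /= -kE -[leLHS]addr0; apply: lerD.
  have tot : c * dk k h u' x <= S h - g + lam * (m / 2 * (g - S h / (48 * (C * d%:R * nz h))) + 3 * M * g
      + (8 * M * S h * (D / rho) + S h * (C * D * (e1 / nz h + M / rho))
      + 2 ^+ k * (12 * C ^+ 4 * e1 * S h * (D / nz h)))).
    have -> : c * dk k h u' x = W x + lam * (c * dk k h (Q K u u) x).
      have dkl f1 f2 l y : dk l h (fun x => f1 x + lam * f2 x) y = dk l h f1 y + lam * dk l h f2 y.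
        by elim: l y => // l IH y; rewrite !dkS /dl !IH; clear; ring.
      have -> : u' = fun x => u x + lam * Q K u u x by apply/funext.
      by rewrite dkl /W; clear; ring.
    have -> : S h - g = W x by rewrite /g; clear; ring.
    rewrite lerD2l; apply: ler_wpM2l => //; rewrite splitQ !addrA.
    apply: lerD; first apply: lerD => //.
      by apply: le_trans (ler_norm _) _; rewrite normrM; apply: ler_pM => //; exact: WSn.
    by apply: le_trans (ler_norm _) _; rewrite normrM cn mul1r.
  apply: le_trans tot _; rewrite -Se; apply: le_trans (ler_wpM2l S0 ratio).
  have k1 : 1 <= 2 ^+ k :> R by move: k2; clra.
  by apply: final_step => //; [exact: ltW | apply: (@final_bound k q2 _ _ _ muu') => //; exact: ltW].
move=> x h; have [->|h0] := eqVneq h 0.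
  by rewrite kE dk0 normr0 mulr_ge0 ?exprn_ge0 ?divr_ge0 ?nz_ge0 ?(ltW mu0') ?(ltW e10).
have [hmu|hmu] := ltP (nz h) muu'.
  rewrite ler_norml; have h1 := sgn x h 1 (expr1n _ _) h0 hmu.
  have h2 := sgn x h (-1) _ h0 hmu; rewrite sqrrN expr1n in h2.
  by move: h1 (h2 erefl); clear => *; apply/andP; split; lra.
(* Beyond the scale the bound exceeds [e1]: up to [rho] small oscillation suffices, further out the
   sup bound does. *)
have r1 : 1 <= (nz h / muu') ^+ s by rewrite exprn_ege1 // ler_pdivlMr // mul1r.
have [hr|hr] := leP (nz h) rho.
  apply: (@le_trans _ _ e1); last by rewrite ler_peMr // ltW.
  by apply: (@dk_low k) => //; [rewrite kE leqnn | exact: ltW | move=> y; exact: uosc'].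
apply: le_trans (dk_bnd k h u'M x) _.
have h3 : 2 ^+ k * M <= e1 * (rho / muu') by rewrite mulrA ler_pdivlMr.
apply: le_trans h3 _; rewrite ler_pM2l //.
apply: (@le_trans _ _ (nz h / muu')); first by rewrite ler_pM2r ?invr_gt0 // ltW.
have r2 : 1 <= nz h / muu' by rewrite ler_pdivlMr // mul1r.
by rewrite -[leLHS]expr1 ler_weXn2l //; move: s2; case: (s).
Qed.

End RegularityUpdate.

(** * The logarithmic moment of the jump kernel *)

Section LogarithmicMoment.
(** Half of an upper bound for the second-order remainder of the norm at a vector of length at least
    [s]; see [norm_second]. *)
Definition qm (s : R) (z : Z) : R := Num.min (nz z) (nz z ^+ 2 / s).

Lemma qm_ge0 s z : 0 < s -> 0 <= qm s z.
Proof. by move=> s0; rewrite le_min nz_ge0 divr_ge0 ?exprn_ge0 ?nz_ge0 // ltW. Qed.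

Lemma bN_le_inv N : @bN N * N.+1%:R * Num.sqrt N.+1%:R <= 1 / 2.
Proof.
rewrite bNE; set a := aN N; set q := Num.sqrt _.
have h : a * q <= 1 by apply: aN_le; rewrite ?sqrtr_ge0 // sqr_sqrtr // -(natr1 N).
set n1 : R := N.+1%:R.
have -> : a / (2 * n1) * n1 * q = a * q / 2 by field.
by rewrite ler_pM2r.
Qed.

Lemma EN_qm1 N s : 0 < s -> bN N * EN N.+1 (qm s) <= d%:R / (4 * s * Num.sqrt N.+1%:R).
Proof.
move=> s0; have hb := bN_le_inv N; move: hb.
have q0 : 0 < Num.sqrt N.+1%:R :> R by rewrite sqrtr_gt0 ltr0n.
have h : EN N.+1 (qm s) <= s^-1 * (d%:R * (N.+1%:R / 2)).
  by rewrite -EN_sqr -ENZ; apply: EN_mono => z; rewrite ge_min [_^-1 * _]mulrC lexx orbT.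
set q := Num.sqrt _ in q0 *; set n1 := N.+1%:R : R in h * => hb.
have b0 : 0 <= bN N := @bN_ge0 N.
apply: le_trans (ler_wpM2l b0 h) _.
have -> : bN N * (s^-1 * (d%:R * (n1 / 2))) = (bN N * n1 * q) * (d%:R / (2 * s * q)) by field; rewrite !gt_eqF.
have -> : d%:R / (4 * s * q) = 1 / 2 * (d%:R / (2 * s * q)) by field; rewrite !gt_eqF.
by apply: ler_wpM2r => //; rewrite divr_ge0 // !mulr_ge0 // ltW.
Qed.

(** The first moment of the walk is of order N^(1/2) and [bN] of order N^(-3/2). The resulting 1/N
    is the origin of the logarithm. *)
Lemma EN_qm2 N s : (0 < d)%N -> 0 < s -> bN N * EN N.+1 (qm s) <= d%:R / (2 * N.+1%:R).
Proof.
move=> d0 s0; have hb := bN_le_inv N; move: hb.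
have q0 : 0 < Num.sqrt N.+1%:R :> R by rewrite sqrtr_gt0 ltr0n.
have qq : Num.sqrt N.+1%:R ^+ 2 = N.+1%:R :> R by rewrite sqr_sqrtr.
set q := Num.sqrt _ in q0 qq * => hb.
have d1 : 1 <= d%:R :> R by rewrite ler1n.
have h : EN N.+1 (qm s) <= q * d%:R.
  apply: (@le_trans _ _ (EN N.+1 (fun z : Z => (2 * q)^-1 * nz z ^+ 2 + q / 2))).
    apply: EN_mono => z; rewrite ge_min; apply/orP; left.
    have -> : (2 * q)^-1 * nz z ^+ 2 + q / 2 = nz z + (nz z - q) ^+ 2 / (2 * q) by field; rewrite gt_eqF.
    by rewrite lerDl divr_ge0 ?sqr_ge0 // mulr_ge0 // ltW.
  rewrite END ENZ EN_cst EN_sqr -qq.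
  have -> : (2 * q)^-1 * (d%:R * (q ^+ 2 / 2)) + q / 2 = q * (d%:R / 4 + 1 / 2) by field; rewrite gt_eqF.
  by apply: ler_wpM2l; [exact: ltW | move: d1; clra].
have b0 : 0 <= bN N := @bN_ge0 N.
apply: le_trans (ler_wpM2l b0 h) _.
have n0 : 0 < N.+1%:R :> R by rewrite ltr0n.
set n1 := N.+1%:R : R in hb n0 *.
have -> : bN N * (q * d%:R) = (bN N * n1 * q) * (d%:R / n1) by field; rewrite !gt_eqF.
have -> : d%:R / (2 * n1) = 1 / 2 * (d%:R / n1) by field; rewrite !gt_eqF.
by apply: ler_wpM2r => //; rewrite divr_ge0 // ltW.
Qed.

Lemma sum_qm n s : (0 < d)%N -> 0 < s ->
  \sum_(0 <= N < n) bN N * EN N.+1 (qm s) <= d%:R * (1 + ln (1 + n%:R / s ^+ 2)).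
Proof.
move=> d0 s0; have s20 : 0 < s ^+ 2 by rewrite exprn_gt0.
(* The induction needs the finer term min(1, sqrt n / s), which records the contribution of walks
   shorter than s^2 steps, where the quadratic branch is used. *)
suff H : \sum_(0 <= N < n) bN N * EN N.+1 (qm s) <=
    d%:R * (Num.min 1 (Num.sqrt n%:R / s) + ln (1 + n%:R / s ^+ 2)).
  by apply: le_trans H _; rewrite ler_wpM2l // lerD2r ge_min lexx.
elim: n => [|n IH].
  by rewrite big_nil mulr_ge0 // addr_ge0 ?ln_ge0_1D ?divr_ge0 // ?le_min ?ler01 ?divr_ge0 ?sqrtr_ge0 // ltW.
rewrite big_nat_recr //=.
have lm : ln (1 + n%:R / s ^+ 2) <= ln (1 + n.+1%:R / s ^+ 2).
  by rewrite ln1D_mono ?divr_ge0 // ?(ltW s20) // ler_pM2r ?invr_gt0 // ler_nat.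
have mm : Num.min 1 (Num.sqrt n%:R / s) <= Num.min 1 (Num.sqrt n.+1%:R / s).
  rewrite le_min !ge_min lexx /=; apply/orP; right.
  by rewrite ler_pM2r ?invr_gt0 // ler_wsqrtr // ler_nat.
have [ns|ns] := leP (n.+1%:R) (s ^+ 2).
  have q0 : 0 < Num.sqrt n.+1%:R :> R by rewrite sqrtr_gt0.
  have qs : Num.sqrt n.+1%:R <= s by rewrite -(ger0_norm (ltW s0)) -sqrtr_sqr ler_wsqrtr.
  have rq : 0 <= Num.sqrt n%:R :> R := sqrtr_ge0 _.
  have rr : Num.sqrt n%:R ^+ 2 = n%:R :> R by rewrite sqr_sqrtr.
  have qq : Num.sqrt n.+1%:R ^+ 2 = n%:R + 1 :> R by rewrite sqr_sqrtr // -natr1.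
  have h := EN_qm1 n s0; move: h lm IH mm.
  set q := Num.sqrt n.+1%:R in q0 qs qq *; set r := Num.sqrt n%:R in rq rr *.
  have rle : r <= q - 1 / (2 * q).
    rewrite -[leLHS](ger0_norm rq) -[leRHS]ger0_norm.
      rewrite -ler_sqr ?nnegrE // !real_normK ?num_real // rr.
      have -> : (q - 1 / (2 * q)) ^+ 2 = q ^+ 2 - 1 + (1 / (2 * q)) ^+ 2 by field; rewrite gt_eqF.
      by rewrite qq; have := sqr_ge0 (1 / (2 * q)); clra.
    rewrite subr_ge0 ler_pdivrMr ?mulr_gt0 //.
    have := ler0n R n; move: qq; clra.
  have rs1 : r / s <= 1.
    rewrite ler_pdivrMr // mul1r; apply: le_trans qs; apply: le_trans rle _.
    by rewrite gerBl divr_ge0 // mulr_ge0 // ltW.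
  have qs1 : q / s <= 1 by rewrite ler_pdivrMr // mul1r.
  rewrite (min_idPr rs1) (min_idPr qs1) => h lm IH _.
  apply: le_trans (lerD IH h) _.
  have hr : r / s + 1 / (4 * s * q) <= q / s.
    have -> : q / s = (q - 1 / (2 * q)) / s + 1 / (2 * s * q) by field; rewrite !gt_eqF.
    apply: lerD; first by rewrite ler_pM2r ?invr_gt0.
    rewrite ler_pM2l // lef_pV2 ?posrE ?mulr_gt0 // !ler_pM2r //; clra.
  have -> : d%:R * (r / s + ln (1 + n%:R / s ^+ 2)) + d%:R / (4 * s * q) =
     d%:R * (r / s + 1 / (4 * s * q) + ln (1 + n%:R / s ^+ 2)) by rewrite mul1r; ring.
  by apply: ler_wpM2l => //; exact: lerD.
have h := EN_qm2 n d0 s0.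
apply: le_trans (lerD IH h) _.
have -> : d%:R * (Num.min 1 (Num.sqrt n%:R / s) + ln (1 + n%:R / s ^+ 2)) + d%:R / (2 * n.+1%:R) =
  d%:R * (Num.min 1 (Num.sqrt n%:R / s) + (ln (1 + n%:R / s ^+ 2) + (2 * n.+1%:R)^-1)) by ring.
apply: ler_wpM2l => //; apply: lerD => //.
have p1 : 0 < 1 + n.+1%:R / s ^+ 2 by rewrite ltr_wpDr // divr_ge0 // ltW.
have p2 : 0 < 1 + n%:R / s ^+ 2 by rewrite ltr_wpDr // divr_ge0 // ltW.
have := ln_tangent p1 p2; set e := (_ - _) / _.
have -> : e = - (s ^+ 2 + n.+1%:R)^-1.
  rewrite /e; have ne : s ^+ 2 + n.+1%:R != 0 by rewrite gt_eqF // addr_gt0.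
  move: p1 ne; rewrite -natr1 => p1 ne; field; first by rewrite ne (gt_eqF s0).
have : (2 * n.+1%:R)^-1 <= (s ^+ 2 + n.+1%:R)^-1 by rewrite lef_pV2 ?posrE ?addr_gt0 ?mulr_gt0 //; move: ns; clra.
by move=> h1 h2; apply: le_trans (lerD h2 h1) _; rewrite subrK.
Qed.

End LogarithmicMoment.

(** * Propagation of the modulus of continuity over one step *)

Section ModulusStep.
Implicit Types (u v : Z -> R).

(** With D = A - B - (a - b), the left side equals (A + B - a) D + (a - b)(A - a). Of the first
    product only m/2 times [D] is kept for dissipation, since D <= g. The second contains the slope
    [p] times the linear part [t] and the remainder [q]. For long jumps, where A + B - a may be
    small, q = n makes the crude first-order bounds sufficient. *)
Lemma jump_pointwise (m M a b A B g p q n t : R) : 0 < m -> 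
  m <= a <= M -> m <= b <= M -> m <= A <= M -> m <= B <= M ->
  0 <= g -> 0 <= p -> 0 <= q -> 0 <= n -> - n <= t -> b <= a ->
  A - B - (a - b) <= g -> A - a <= g + p * (t + 2 * q) ->
  A - a <= g + p * n -> b - B <= g + p * n -> (- (m / 2) <= A - a \/ q = n) ->
  A * (A - a) - B * (B - b) <= m / 2 * (A - B - (a - b)) + 3 * M * g + (a - b) * p * t + 2 * M * p * q.
Proof.
move=> m0 /andP[a1 a2] /andP[b1 b2] /andP[A1 A2] /andP[B1 B2] g0 p0 q0 n0 tn ab hD hA hA2 hB2 nf.
have M0 : 0 < M by move: m0 a1 a2; clra.
have pq := mulr_ge0 p0 q0.
case: nf => [near|far].
  have e1 : (A + B - a - m / 2) * (g - (A - B - (a - b))) >= 0 by apply: mulr_ge0; move: near B1 hD; clra.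
  have e2 : (a - b) * (g + p * (t + 2 * q) - (A - a)) >= 0 by apply: mulr_ge0; move: ab hA; clra.
  have e3 : (M - (a - b)) * (p * q) >= 0 by apply: mulr_ge0 => //; move: m0 a2 b1; clra.
  have e4 : (M - (a - b)) * g >= 0 by apply: mulr_ge0 => //; move: m0 a2 b1; clra.
  have e5 : (2 * M + m / 2 - (A + B - a)) * g >= 0 by apply: mulr_ge0 => //; move: m0 A2 B2 a1; clra.
  move: e1 e2 e3 e4 e5; clra.
subst q.
have e0 : (a - b) * p * (t + n) >= 0 by apply: mulr_ge0; [apply: mulr_ge0 => //|]; move: ab tn; clra.
have e3 : (M - (a - b)) * (p * n) >= 0 by apply: mulr_ge0 => //; move: m0 a2 b1; clra.
have Mg : 0 <= M * g by apply: mulr_ge0 => //; exact: ltW.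
have [AB|AB] := leP B A.
  have e1 : (B - m / 2) * (g - (A - B - (a - b))) >= 0 by apply: mulr_ge0; move: m0 B1 hD; clra.
  have e2 : (A - B) * (g + p * n - (A - a)) >= 0 by apply: mulr_ge0; move: AB hA2; clra.
  have e4 : (M - (A - B)) * (g + p * n) >= 0 by apply: mulr_ge0; [move: m0 A2 B1; clra | apply: addr_ge0 => //].
  have e5 : (M - (B - m / 2)) * g >= 0 by apply: mulr_ge0 => //; move: m0 B2; clra.
  move: e0 e1 e2 e3 e4 e5 Mg; clra.
have e1 : (A - m / 2) * (g - (A - B - (a - b))) >= 0 by apply: mulr_ge0; move: m0 A1 hD; clra.
have e2 : (B - A) * (g + p * n - (b - B)) >= 0 by apply: mulr_ge0; move: AB hB2; clra.
have e4 : (M - (B - A)) * (g + p * n) >= 0 by apply: mulr_ge0; [move: m0 A1 B2; clra | apply: addr_ge0 => //].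
have e5 : (M - (A - m / 2)) * g >= 0 by apply: mulr_ge0 => //; move: m0 A2; clra.
move: e0 e1 e2 e3 e4 e5 Mg; clra.
Qed.

(** For |z| <= s both sides are squared; for longer [z] the remainder is |z| itself and the triangle
    inequality is enough. *)
Lemma norm_second (h z : Z) (s : R) : 0 < s -> s <= nz h ->
  nz (h + z) - nz h <= dot (freq h) (freq z) / nz h + 2 * qm s z.
Proof.
move=> s0 sh; have h0 := lt_le_trans s0 sh.
have cs : `|dot (freq h) (freq z)| <= nz h * nz z.
  rewrite ler_norml dot_le andbT lerNl -dotNr; apply: le_trans (dot_le _ _) _.
  by rewrite enormN.
have t1 : - nz z <= dot (freq h) (freq z) / nz h.
  by rewrite ler_pdivlMr // mulNr mulrC; move: cs; rewrite ler_norml => /andP[].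
have [zs|zs] := leP (nz z) s.
  have -> : qm s z = nz z ^+ 2 / s by apply/min_idPr; rewrite ler_pdivrMr // expr2 ler_wpM2l ?nz_ge0.
  set D := dot _ _ in cs t1 *.
  have e : nz (h + z) ^+ 2 = nz h ^+ 2 + 2 * D + nz z ^+ 2.
    rewrite /nz !sqr_enorm freqD dotDl !dotDr (dotC (freq z) (freq h)) -/D; ring.
  have r0 : 0 <= nz h + D / nz h + 2 * (nz z ^+ 2 / s).
    have : 0 <= nz z ^+ 2 / s by rewrite divr_ge0 ?sqr_ge0 // ltW.
    move: t1 zs sh; clra.
  suff : nz (h + z) <= nz h + D / nz h + 2 * (nz z ^+ 2 / s) by clra.
  rewrite -[leLHS](ger0_norm (nz_ge0 _)) -[leRHS](ger0_norm r0) -ler_sqr ?nnegrE //.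
  rewrite !real_normK ?num_real // e.
  have qh : nz z ^+ 2 / nz h <= nz z ^+ 2 / s by rewrite ler_wpM2l ?sqr_ge0 // lef_pV2.
  have qn : nz z ^+ 2 / s <= nz z by rewrite ler_pdivrMr // expr2 ler_wpM2l ?nz_ge0.
  set k := nz z ^+ 2 / s in qh qn r0 *; set T := D / nz h in t1 r0 *.
  have eD : D = T * nz h by rewrite /T divfK ?gt_eqF.
  have ez : nz z ^+ 2 = nz z ^+ 2 / nz h * nz h by rewrite divfK ?gt_eqF.
  have k0 : 0 <= nz z ^+ 2 / nz h by rewrite divr_ge0 ?sqr_ge0 ?nz_ge0.
  rewrite eD ez; set j := nz z ^+ 2 / nz h in qh k0 *.
  have f1 : 0 <= (k - j) * nz h by rewrite mulr_ge0 ?nz_ge0 // subr_ge0.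
  have f3 : 0 <= k * nz h by rewrite mulr_ge0 ?nz_ge0 // (le_trans k0).
  have f4 := sqr_ge0 (T + 2 * k).
  move: f1 f3 f4; clra.
have -> : qm s z = nz z by apply/min_idPl; rewrite ler_pdivlMr // expr2 ler_wpM2l ?nz_ge0 // ltW.
by have := @nzD R d h z; move: t1; clra.
Qed.

(** Walks of at least about y^2 steps forget the shift, so the two averages of [V] differ by at most
    e/4 while [dl0] is at least 3e/4. The odd term [T] averages to zero. Beyond about (L y)^2 steps
    the logarithmic moment would keep growing, so there only the bound 2M^2 and the small mass
    [aN N1] are used. *)
Lemma LK_modulus (K : nat) (m M e y L g c dl0 p s : R) (F T : Z -> R) (V : Z -> R) (h : Z) :
  (0 < d)%N -> 0 < m -> m <= M -> 0 < e -> e <= M -> 0 <= g -> 0 <= c -> 0 <= p -> 0 < s -> 1 <= y ->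
  4 * (M * (d%:R * nz h)) = y * e -> L * (m * e) = 64 * M ^+ 2 -> (L * y) ^+ 2 + 2 <= K%:R ->
  (forall z, m <= V z <= M) -> (forall z, V (z + h) - V z - dl0 <= g) -> 3 * e / 4 <= dl0 ->
  (forall z, T (- z) = - T z) -> (forall z, F z <= 2 * M ^+ 2) ->
  (forall z, F z <= m / 2 * (V (z + h) - V z - dl0) + c + T z + 2 * M * p * qm s z) ->
  LK K F <= c + m / 2 * g - m * e / (64 * y) + 2 * M * p * (d%:R * (1 + ln (1 + 2 * (L * y) ^+ 2 / s ^+ 2))).
Proof.
move=> d0 m0 mM e0 eM g0 c0 p0 s0 y1 ye Lme hK Vb Vg dle Todd FM Fp.
have M0 := lt_le_trans m0 mM.
have y0 := lt_le_trans ltr01 y1.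
have L0 : 0 < L.
  rewrite -(pmulr_lgt0 _ (mulr_gt0 m0 e0)) Lme mulr_gt0 ?exprn_gt0 //.
have L64 : 64 <= L.
  rewrite -(ler_pM2r (mulr_gt0 m0 e0)) Lme ler_pM2l // expr2.
  by apply: ler_pM => //; exact: ltW.
have Ly0 : 0 < L * y by exact: mulr_gt0.
pose N0 := (Num.truncn (y ^+ 2)).+1; pose N1 := (Num.truncn ((L * y) ^+ 2)).+1.
have N0a : y ^+ 2 <= N0%:R by rewrite ltW // truncnS_gt.
have N0b : N0%:R <= (2 * y) ^+ 2.
  rewrite /N0 -natr1; have := truncn_le (y ^+ 2); rewrite sqr_ge0 => h1.
  have := exprn_ege1 2 y1; move: h1; rewrite exprMn; clra.
have N1a : (L * y) ^+ 2 <= N1%:R by rewrite ltW // truncnS_gt.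
have Ly1 : 1 <= L * y by apply: mulr_ege1 => //; move: L64; clra.
have N1c : N1%:R <= (L * y) ^+ 2 + 1 by rewrite /N1 -natr1 lerD2r; have := truncn_le ((L * y) ^+ 2); rewrite sqr_ge0.
have N1b : N1%:R <= 2 * (L * y) ^+ 2 by have := exprn_ege1 2 Ly1; move: N1c; clra.
have N1K : (N1 <= K)%N by rewrite -(ler_nat R); move: hK N1c; clra.
have N01 : (N0 <= N1)%N.
  rewrite /N0 /N1 ltnS le_truncn // exprMn ler_peMl ?sqr_ge0 // exprn_ege1 //.
  by move: L64; clra.
have EV N : EN N.+1 (fun z => V (z + h) - V z - dl0) <= aN N * y * (e / 4) - dl0.
  rewrite ENB EN_cst lerD2r ENB; apply: le_trans (ler_norm _) _.
  apply: le_trans (EN_grad _ _ Vb) _.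
  have -> : aN N * y * (e / 4) = aN N * (M * (d%:R * nz h)) by rewrite -mulrA; congr (_ * _); move: ye; clra.
  rewrite -mulrA; apply: ler_pM => //; first exact: ltW (aN_gt0 _).
  - by rewrite mulr_ge0 ?mulr_ge0 ?nz_ge0 // subr_ge0.
  - exact: aN_decr.
  - by rewrite ler_wpM2r ?mulr_ge0 ?nz_ge0 // gerBl ltW.
have EF N : EN N.+1 F <= m / 2 * EN N.+1 (fun z => V (z + h) - V z - dl0) + c + 2 * M * p * EN N.+1 (qm s).
  apply: le_trans (EN_mono _ Fp) _.
  rewrite (END _ (fun z => m / 2 * (V (z + h) - V z - dl0) + c + T z) (fun z => 2 * M * p * qm s z)).
  rewrite (END _ (fun z => m / 2 * (V (z + h) - V z - dl0) + c) T).
  rewrite (END _ (fun z => m / 2 * (V (z + h) - V z - dl0)) (fun=> c)).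
  by rewrite !ENZ EN_cst (EN_odd _ Todd) addr0.
have m20 : 0 <= m / 2 by rewrite divr_ge0 // ltW.
have A1 N : EN N.+1 F <= m / 2 * g + c + 2 * M * p * EN N.+1 (qm s).
  apply: le_trans (EF N) _; rewrite !lerD2r ler_wpM2l //.
  by rewrite -(@EN_cst N.+1 g); exact: EN_mono.
have A2 N : (N0 <= N)%N -> EN N.+1 F <= m / 2 * g + c + 2 * M * p * EN N.+1 (qm s) - m * e / 4.
  move=> NN; apply: le_trans (EF N) _.
  have h1 : aN N * y <= 1.
    apply: aN_le; first exact: ltW.
    have h2 : N0%:R <= N%:R :> R by rewrite ler_nat.
    move: N0a h2; clra.
  have h3 : aN N * y * (e / 4) <= e / 4 by apply: ler_piMl => //; rewrite divr_ge0 // ltW.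
  have h4 : m / 2 * EN N.+1 (fun z => V (z + h) - V z - dl0) <= m / 2 * (- e / 2).
    by apply: ler_wpM2l => //; have := EV N; move: h3 dle; clra.
  have h5 : 0 <= m / 2 * g by exact: mulr_ge0.
  move: h4 h5; clra.
have S1 : \sum_(0 <= N < N0) bN N * EN N.+1 F <= \sum_(0 <= N < N0) bN N * (m / 2 * g + c) +
     \sum_(0 <= N < N0) 2 * M * p * (bN N * EN N.+1 (qm s)).
  rewrite -big_split /=; apply: ler_sum => N _.
  apply: le_trans (ler_wpM2l (bN_ge0 N) (A1 N)) _.
  by rewrite le_eqVlt; apply/orP; left; apply/eqP; ring.
have S2 : \sum_(N0 <= N < N1) bN N * EN N.+1 F <= \sum_(N0 <= N < N1) bN N * (m / 2 * g + c) +
     \sum_(N0 <= N < N1) 2 * M * p * (bN N * EN N.+1 (qm s)) - (aN N0 - aN N1) * (m * e / 4).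
  rewrite -(sum_bN N01) mulr_suml -sumrN -!big_split /=.
  apply: ler_sum_nat => N /andP[NN _].
  apply: le_trans (ler_wpM2l (bN_ge0 N) (A2 N NN)) _.
  by rewrite le_eqVlt; apply/orP; left; apply/eqP; ring.
have S3 : \sum_(N1 <= N < K) bN N * EN N.+1 F <= aN N1 * (2 * M ^+ 2).
  apply: (@le_trans _ _ (\sum_(N1 <= N < K) bN N * (2 * M ^+ 2))).
    apply: ler_sum => N _; rewrite ler_wpM2l ?bN_ge0 //.
    by rewrite -(@EN_cst N.+1 (2 * M ^+ 2)); exact: EN_mono.
  rewrite -mulr_suml sum_bN //; apply: ler_wpM2r; first by rewrite mulr_ge0 ?sqr_ge0.
  by rewrite gerBl ltW // aN_gt0.
have S4 : \sum_(0 <= N < N1) bN N * (m / 2 * g + c) <= m / 2 * g + c.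
  rewrite -mulr_suml sum_bN // aN0 ler_piMl //; last by have := @aN_gt0 R N1; clra.
  exact: addr_ge0 (mulr_ge0 m20 g0) c0.
have S5 : \sum_(0 <= N < N1) 2 * M * p * (bN N * EN N.+1 (qm s)) <= 
   2 * M * p * (d%:R * (1 + ln (1 + 2 * (L * y) ^+ 2 / s ^+ 2))).
  rewrite -mulr_sumr ler_wpM2l ?mulr_ge0 ?(ltW M0) //.
  apply: le_trans (sum_qm _ d0 s0) _.
  rewrite ler_wpM2l // lerD2l ln1D_mono ?divr_ge0 ?exprn_ge0 ?(ltW s0) //.
  by rewrite ler_wpM2r ?invr_ge0 ?exprn_ge0 // ltW.
(* The relation defining [L] makes the discarded long walks cost at most 2 units of m e / (64 y). *)
have S6 : aN N1 * (2 * M ^+ 2) <= m * e / (32 * y).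
  have h1 : aN N1 * (L * y) <= 1 by apply: aN_le; rewrite ?(ltW Ly0) //; move: N1a; clra.
  have -> : m * e / (32 * y) = (m * e * (L * y)) / (32 * y * (L * y)) by field; rewrite !gt_eqF.
  have -> : m * e * (L * y) = 64 * M ^+ 2 * y by rewrite -Lme; ring.
  have -> : 64 * M ^+ 2 * y / (32 * y * (L * y)) = (2 * M ^+ 2) / (L * y) by field; rewrite !gt_eqF.
  by rewrite ler_pdivlMr // mulrAC ler_piMl // mulr_ge0 ?sqr_ge0.
(* In the same unit the gain is 7/2, so more than one unit of dissipation remains. *)
have S7 : 7 / 8 * (m * e / (16 * y)) <= (aN N0 - aN N1) * (m * e / 4).
  have h1 : aN N1 * (L * y) <= 1 by apply: aN_le; rewrite ?(ltW Ly0) //; move: N1a; clra.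
  have h2 : 1 <= aN N0 * (2 * (2 * y)) by apply: aN_ge => //; rewrite mulr_ge0 // ltW.
  have h1' : aN N1 <= (64 * y)^-1.
    rewrite -[leRHS]mul1r ler_pdivlMr ?mulr_gt0 //; apply: le_trans h1.
    by rewrite ler_wpM2l ?ler_wpM2r ?(ltW y0) // ltW // aN_gt0.
  have h2' : (4 * y)^-1 <= aN N0 by rewrite -[leLHS]mul1r ler_pdivrMr ?mulr_gt0 //; move: h2; clra.
  have -> : 7 / 8 * (m * e / (16 * y)) = (7 / 8 * (4 * y)^-1) * (m * e / 4) by field; rewrite gt_eqF.
  apply: ler_wpM2r; first by rewrite divr_ge0 ?mulr_ge0 // ltW.
  move: h1' h2'; rewrite !invfM; set Y := y^-1; have : 0 <= Y by rewrite invr_ge0 ltW.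
  clra.
rewrite /LK (@big_cat_nat _ _ _ N0) ?(leq_trans N01) //= (@big_cat_nat _ _ _ N1 N0 K) //=.
move: S4 S5; rewrite !(@big_cat_nat _ _ _ N0 0 N1) //= => S4 S5.
have k1 : m * e / (32 * y) = 2 * (m * e / (64 * y)) by field; rewrite gt_eqF.
have k2 : m * e / (16 * y) = 4 * (m * e / (64 * y)) by field; rewrite gt_eqF.
have k3 : 0 <= m * e / (64 * y) by rewrite divr_ge0 ?mulr_ge0 // ltW.
rewrite k1 in S6; rewrite k2 in S7.
move: S1 S2 S3 S4 S5 S6 S7 k3; clra.
Qed.

(** The reason for the double logarithm: the factor 1/(1 + ln(1 + xi/rho)) of the slope cancels the
    logarithmic moment, and what is left is of the order 1/xi of the dissipation, with the small
    factor [kap]. *)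
Lemma wd_log_le (kap rho xi c : R) : 0 <= kap -> 0 < rho -> 0 < xi -> 0 <= c ->
  wd kap rho xi * (1 + ln (1 + c * (xi / Num.min xi rho) ^+ 2)) <= kap * (3 + ln (1 + c)) / xi.
Proof.
move=> k0 r0 x0 c0.
have X0 : 0 <= ln (1 + xi / rho) by rewrite ln_ge0_1D // divr_ge0 // ltW.
have lc : 0 <= ln (1 + c) by exact: ln_ge0_1D.
rewrite /wd; set X := ln (1 + xi / rho) in X0 *.
have key : ln (1 + c * (xi / Num.min xi rho) ^+ 2) <= ln (1 + c) + 2 * X.
  have [xr|xr] := leP xi rho.
    by rewrite divff ?gt_eqF // expr1n mulr1 lerDl mulr_ge0.
  have xp : 0 < 1 + xi / rho by rewrite ltr_wpDr // divr_ge0 // ltW.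
  have c1 : 0 < 1 + c by rewrite ltr_wpDr.
  have -> : ln (1 + c) + 2 * X = ln ((1 + c) * (1 + xi / rho) ^+ 2).
    by rewrite lnM ?posrE ?exprn_gt0 // lnXn // -/X mulr2n; ring.
  have q1 : 0 < 1 + c * (xi / rho) ^+ 2 by rewrite ltr_wpDr // mulr_ge0 // sqr_ge0.
  rewrite ler_ln ?posrE ?mulr_gt0 ?exprn_gt0 //.
  have xr0 : 0 <= xi / rho by rewrite divr_ge0 // ltW.
  have : 0 <= c * (xi / rho) by exact: mulr_ge0.
  have := sqr_ge0 (xi / rho); move: xr0 c0; set q := xi / rho; clra.
set l := ln (1 + c * _) in key *.
have h1 : kap / ((1 + X) * (rho + xi)) <= kap / ((1 + X) * xi).
  have X1 : 0 < 1 + X by rewrite ltr_wpDr.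
  apply: ler_wpM2l => //; rewrite lef_pV2 ?posrE ?mulr_gt0 // ?addr_gt0 //.
  by apply: ler_wpM2l; [exact: ltW | rewrite lerDr ltW].
have l0 : 0 <= l by rewrite ln_ge0_1D // mulr_ge0 // sqr_ge0.
apply: (@le_trans _ _ (kap / ((1 + X) * xi) * ((3 + ln (1 + c)) * (1 + X)))).
  apply: ler_pM => //; first by rewrite divr_ge0 ?mulr_ge0 ?addr_ge0 // ltW.
    by rewrite addr_ge0.
  have := mulr_ge0 lc X0; move: key X0; clra.
by rewrite le_eqVlt; apply/orP; left; apply/eqP; field; rewrite !gt_eqF // ltr_wpDr.
Qed.

(** Doubling of variables without a touching point: the gap [g] between modulus and difference is
    kept as a variable, and its contribution is returned by the condition on [lam]. The dissipation
    is C7/|h|; one half covers the slope terms, the other the growth of [rho]. *)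
Lemma modulus_step (K : nat) (m M e kap rho rho' lam c2 L c6 Rc C7 : R) (u u' : Z -> R) :
  (0 < d)%N -> 0 < m -> m <= M -> 0 < e -> e <= M -> 0 < kap -> e + kap <= m / 2 ->
  1 <= rho -> rho <= rho' -> rho' <= rho + lam * c2 -> 0 <= c2 -> 0 <= lam -> 4 * M * lam <= 1 ->
  2 * M ^+ 2 * lam <= e / 8 -> kap * (lam * c2) <= e / 8 -> lam * c2 <= 1 ->
  L * (m * e) = 64 * M ^+ 2 -> c6 * e ^+ 2 = 2 * (4 * L * M * d%:R) ^+ 2 -> Rc = expR (expR (M / kap)) ->
  C7 * (4 * 64 * M * d%:R) = m * e ^+ 2 ->
  2 * M * d%:R * (kap * (3 + ln (1 + c6))) <= C7 / 2 -> 2 * kap * c2 * Rc <= C7 / 2 ->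
  (L * (4 * M * d%:R * (Rc * rho'))) ^+ 2 + 2 * e ^+ 2 <= K%:R * e ^+ 2 ->
  (forall x, m <= u x <= M) -> (forall x, m <= u' x <= M) ->
  (forall x h, u (x + h) - u x <= wm e kap rho (nz h)) ->
  (forall x, u' x = u x + lam * Q K u u x) ->
  forall x h, u' (x + h) - u' x <= wm e kap rho' (nz h).
Proof.
move=> d0 m0 mM e0 eM k0 ek r1 rr rr' c20 l0 cfl cfl2 cfl3 cfl4 eL ec6 eRc eC7 H1 H2 HK ub ub' uw ue p h.
have M0 := lt_le_trans m0 mM.
have rp : 0 < rho := lt_le_trans ltr01 r1.
have rp' : 0 < rho' := lt_le_trans rp rr.
have kw := ltW k0.
have xi0 : 0 <= nz h := nz_ge0 h.
have [h0|hn0] := eqVneq h 0.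
  by rewrite h0 addr0 subrr; apply: le_trans (wm_ge _ _ _ _) => //; [exact: ltW | exact: nz_ge0].
have xi1 := @nz_ge1 R d h hn0; have xp : 0 < nz h := lt_le_trans ltr01 xi1.
have [Mw|wM] := leP M (wm e kap rho' (nz h)).
  apply: le_trans Mw; have /andP[_ a1] := ub' (p + h); have /andP[b1 _] := ub' p.
  by move: a1 b1 m0; clra.
set a := u (p + h); set b := u p.
set W := wm e kap rho (nz h); set g := W - (a - b).
have g0 : 0 <= g by rewrite subr_ge0; exact: uw.
have Fexp : u' (p + h) - u' p = a - b + lam *
    LK K (fun z => u (p + z + h) * (u (p + z + h) - a) - u (p + z) * (u (p + z) - b)).
  rewrite !ue LKB /Q -/a -/b.
  have -> : LK K (fun z => u (p + h + z) * (u (p + h + z) - a)) =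
            LK K (fun z => u (p + z + h) * (u (p + z + h) - a)).
    by apply: LK_ext => z; rewrite addrAC.
  ring.
rewrite Fexp.
have FM z : u (p + z + h) * (u (p + z + h) - a) - u (p + z) * (u (p + z) - b) <= 2 * M ^+ 2.
  have /andP[a1 a2] := ub (p + h); have /andP[b1 b2] := ub p.
  have /andP[A1 A2] := ub (p + z + h); have /andP[B1 B2] := ub (p + z).
  rewrite -/a -/b in a1 a2 b1 b2.
  have f1 : 0 <= (M - u (p + z + h)) * (M + u (p + z + h)) by apply: mulr_ge0; move: A2 A1 M0 m0; clra.
  have f2 : 0 <= u (p + z + h) * a by apply: mulr_ge0; move: A1 a1 m0; clra.
  have f3 : 0 <= (M - u (p + z)) * b by apply: mulr_ge0; move: B2 b1 m0; clra.
  have f4 : 0 <= (M - b) * M by apply: mulr_ge0; move: b2 M0; clra.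
  have f5 := sqr_ge0 (u (p + z)).
  move: f1 f2 f3 f4 f5; clra.
have wt : W <= wm e kap rho' (nz h) + kap * (lam * c2) / rho.
  apply: le_trans (wm_time _ kw rp rr xi0) _; rewrite lerD2l ler_pM2r ?invr_gt0 // ler_pM2l //.
  by move: rr'; clra.
(* If the gap is at least e/4, the operator term adds at most e/8 and the rise of [rho] costs at
   most e/8, so one step cannot close it. *)
have [ge|ge] := leP (e / 4) g.
  have M20 : 0 <= 2 * M ^+ 2 by rewrite mulr_ge0 ?sqr_ge0.
  have := LK_le_cst K M20 FM.
  set X := LK _ _ => hX.
  have h1 : lam * X <= e / 8 by apply: le_trans (ler_wpM2l l0 hX) _; rewrite mulrC.
  have h2 : kap * (lam * c2) / rho <= e / 8 by apply: le_trans cfl3; apply: ler_piMr; rewrite ?invf_le1 // !mulr_ge0.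
  by move: h1 h2 wt ge; rewrite /g; clra.
have ew : e <= W by exact: wm_ge.
have ab : b <= a by move: ge ew; rewrite /g; clear -e0; lra.
have xiR : nz h <= Rc * rho' by rewrite eRc; apply: wm_lt wM => //; exact: ltW.
set P := wd kap rho (nz h); have P0 : 0 <= P by exact: wd_ge0.
set s := Num.min (nz h) rho.
have s0 : 0 < s by rewrite lt_min xp.
have sx : s <= nz h by rewrite ge_min lexx.
pose t z := dot (freq h) (freq z) / nz h.
have tz z : - nz z <= t z.
  rewrite ler_pdivlMr // mulNr lerNl -dotNr mulrC; apply: le_trans (dot_le _ _) _.
  by rewrite enormN.
have hW z y : u (y + z) - u y <= W + P * (nz z - nz h).
  by apply: le_trans (uw _ _) _; apply: wm_tangent => //; exact: nz_ge0.
have Fp z : u (p + z + h) * (u (p + z + h) - a) - u (p + z) * (u (p + z) - b) <=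
   m / 2 * (u (p + z + h) - u (p + z) - (a - b)) + 3 * M * g + (a - b) * P * t z + 2 * M * P * qm s z.
  apply: (@jump_pointwise m M a b _ _ g P (qm s z) (nz z) (t z)) => //;
    rewrite ?nz_ge0 ?qm_ge0 ?ub //.
  - by rewrite /g lerD2r; exact: uw.
  - have h1 := hW (h + z) p; have h2 := ler_wpM2l P0 (@norm_second h z s s0 sx).
    rewrite -/(t z) in h2; rewrite addrA in h1; rewrite (addrAC p z h); move: h1 h2; rewrite /g -/b; clra.
  - have h1 := hW (h + z) p; have h2 : nz (h + z) - nz h <= nz z by have := @nzD R d h z; clra.
    have := ler_wpM2l P0 h2.
    rewrite addrA in h1; rewrite (addrAC p z h); move: h1; rewrite /g -/b; clra.
  - have h1 := hW (h - z) (p + z); have h2 : nz (h - z) - nz h <= nz z by have := @nzB R d h z; clra.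
    have := ler_wpM2l P0 h2; move: h1.
    have -> : p + z + (h - z) = p + h by rewrite addrACA subrr addr0.
    by rewrite /g -/a; clra.
  (* Jumps within [rho] change the value by at most e + kap <= m/2. Longer ones exceed s = min(|h|,
     rho), where [qm] is linear. *)
  - have [zr|zr] := leP (nz z) rho.
      left; have h1 := uw (p + z + h) (- z); rewrite nzN addrAC addrK -/a in h1.
      have h2 := @wm_mono R e kap rho (nz z) rho kw rp (nz_ge0 z) zr.
      have h3 := @wm_at R e kap rho kw rp.
      by move: h1 h2 h3 ek; clra.
    right; apply/min_idPl; rewrite ler_pdivlMr // expr2 ler_wpM2l ?nz_ge0 //.
    by apply: le_trans (ltW zr); rewrite ge_min lexx orbT.
pose y := 4 * M * d%:R * nz h / e.
have d1 : 1 <= d%:R :> R by rewrite ler1n.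
have ye : 4 * (M * (d%:R * nz h)) = y * e by rewrite /y divfK ?gt_eqF //; ring.
have Mdx : M <= M * (d%:R * nz h) by rewrite ler_pMr // mulr_ege1.
have y1 : 1 <= y by rewrite -(ler_pM2r e0) -ye mul1r; move: Mdx eM; clear -e0; lra.
have L0 : 0 < L by rewrite -(pmulr_lgt0 _ (mulr_gt0 m0 e0)) eL mulr_gt0 ?exprn_gt0.
have y0 : 0 <= y := le_trans ler01 y1.
have Rr0 : 0 <= Rc * rho' := le_trans xi0 xiR.
have HK' : (L * y) ^+ 2 + 2 <= K%:R.
  rewrite -(ler_pM2r (exprn_gt0 2 e0)); apply: le_trans HK.
  rewrite mulrDl -exprMn lerD2r ler_sqr ?nnegrE; last 2 first.
  - exact: mulr_ge0 (mulr_ge0 (ltW L0) y0) (ltW e0).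
  - by apply: mulr_ge0; [exact: ltW | apply: mulr_ge0 => //; rewrite !mulr_ge0 // ltW].
  rewrite -(mulrA L y) -ye; apply: ler_wpM2l; first exact: ltW.
  by rewrite -!mulrA ler_pM2l // ler_pM2l // ler_wpM2l.
have tle : 3 * e / 4 <= a - b by move: ge ew; rewrite /g; clra.
have c0 : 0 <= 3 * M * g by rewrite !mulr_ge0 // ltW.
have Todd z : (a - b) * P * t (- z) = - ((a - b) * P * t z) by rewrite /t freqN dotNr mulNr mulrN.
have Vb z : m <= u (p + z) <= M by exact: ub.
have Vg z : u (p + (z + h)) - u (p + z) - (a - b) <= g by rewrite addrA /g lerD2r; exact: uw.
have Fp' z : u (p + z + h) * (u (p + z + h) - a) - u (p + z) * (u (p + z) - b) <=
   m / 2 * (u (p + (z + h)) - u (p + z) - (a - b)) + 3 * M * g + (a - b) * P * t z + 2 * M * P * qm s z.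
  by rewrite addrA; exact: Fp.
have := @LK_modulus K m M e y L g (3 * M * g) (a - b) P s _ _ (fun z => u (p + z)) h
  d0 m0 mM e0 eM g0 c0 P0 s0 y1 ye eL HK' Vb Vg tle Todd FM Fp'.
set X := LK _ _ => hX.
have wdl := @wd_log_le kap rho (nz h) c6 kw rp xp.
have c60 : 0 <= c6 by rewrite -(pmulr_lge0 _ (exprn_gt0 2 e0)) ec6 mulr_ge0 // sqr_ge0.
have eln : 2 * (L * y) ^+ 2 / s ^+ 2 = c6 * (nz h / s) ^+ 2.
  apply: (mulIf (expf_neq0 2 (lt0r_neq0 e0))).
  rewrite [RHS]mulrAC ec6; transitivity (2 * (L * (y * e)) ^+ 2 / s ^+ 2); first by rewrite !exprMn; ring.
  by rewrite -ye expr_div_n; field; rewrite gt_eqF.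
have {wdl} := wdl c60; rewrite -/s -/P -eln => wdl.
have q0 : 0 < 4 * 64 * M * d%:R by rewrite !mulr_gt0 // ltr0n.
have diss : m * e / (64 * y) = C7 / nz h.
  have y00 : 0 < y := lt_le_trans ltr01 y1.
  have y6 : 64 * y != 0 by rewrite mulf_neq0 // gt_eqF.
  apply/eqP; rewrite eqr_div ?(gt_eqF xp) //; apply/eqP/(mulIf (lt0r_neq0 e0)).
  rewrite (_ : C7 * (64 * y) * e = C7 * 64 * (y * e)); last by ring.
  rewrite -ye (_ : C7 * 64 * _ = C7 * (4 * 64 * M * d%:R) * nz h); last by ring.
  by rewrite eC7; ring.
have err : 2 * M * P * (d%:R * (1 + ln (1 + 2 * (L * y) ^+ 2 / s ^+ 2))) <= C7 / 2 / nz h.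
  apply: (@le_trans _ _ (2 * M * d%:R * (kap * (3 + ln (1 + c6)) / nz h))).
    rewrite (_ : 2 * M * P * _ = 2 * M * d%:R * (P * (1 + ln (1 + 2 * (L * y) ^+ 2 / s ^+ 2)))); last by ring.
    by apply: ler_wpM2l => //; rewrite !mulr_ge0 // ltW.
  by rewrite mulrA ler_pM2r ?invr_gt0.
have tim : kap * (lam * c2) / rho <= lam * (C7 / 2 / nz h).
  rewrite ler_pdivrMr // (_ : lam * (C7 / 2 / nz h) * rho = lam * C7 / 2 * rho / nz h); last by ring.
  rewrite ler_pdivlMr // mulrA.
  have r2 : rho' <= 2 * rho by move: rr' cfl4 r1; clra.
  have Rc0 : 0 <= Rc by rewrite eRc expR_ge0.
  have h1 : nz h <= Rc * (2 * rho) by apply: le_trans xiR _; rewrite ler_wpM2l.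
  have klc : 0 <= kap * lam * c2 by rewrite !mulr_ge0.
  apply: le_trans (ler_wpM2l klc h1) _.
  rewrite (_ : kap * lam * c2 * _ = lam * rho * (2 * kap * c2 * Rc)); last by ring.
  rewrite (_ : lam * C7 / 2 * rho = lam * rho * (C7 / 2)); last by ring.
  by apply: ler_wpM2l => //; rewrite mulr_ge0 // ltW.
have hX2 : lam * X <= lam * (3 * M * g + m / 2 * g - C7 / nz h + C7 / 2 / nz h).
  apply: ler_wpM2l => //; apply: le_trans hX _; rewrite diss.
  by apply: lerD.
(* The terms in [g] are returned by the gap itself. *)
have cg : lam * (3 * M * g + m / 2 * g) <= g.
  have f1 : 0 <= (1 - 4 * M * lam) * g by apply: mulr_ge0 => //; move: cfl; clra.
  have f2 : 0 <= (M - m / 2) * (lam * g) by apply: mulr_ge0; [move: mM m0; clra | exact: mulr_ge0].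
  by move: f1 f2; clra.
have k1 : C7 / nz h = 2 * (C7 / 2 / nz h) by field; rewrite gt_eqF.
rewrite k1 in hX2.
have := wt; rewrite /g in cg; rewrite /g in hX2.
move: hX2 cg tim; set Y := C7 / 2 / nz h; rewrite /g; clra.
Qed.

End ModulusStep.

(** * Regularity on the lattice with constants independent of the mesh *)

Section LatticeRegularity.
(** Each pair encodes one linear condition on a parameter. Listing the pairs settles all conditions
    on a constant at once, here and in [ex_small] and [ex_large_nat]. *)
Lemma ex_large (l : seq (R * R)) : all (fun p => 0 < p.2) l ->
  exists2 X : R, 1 <= X & forall Y, X <= Y -> all (fun p => p.1 <= p.2 * Y) l.
Proof.
elim: l => [_|[a b] l IH /= /andP[b0 /IH[X X1 HX]]]; first by exists 1.
exists (Num.max X (a / b)) => [|Y]; first by rewrite le_max X1.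
rewrite ge_max => /andP[XY aY]; rewrite (HX _ XY) andbT.
by rewrite mulrC -ler_pdivrMr.
Qed.

Lemma ex_small (l : seq (R * R)) : all (fun p => 0 < p.2) l ->
  exists2 e : R, 0 < e & all (fun p => p.1 * e <= p.2) l.
Proof.
move=> /ex_large[X X1 HX]; have X0 := lt_le_trans ltr01 X1.
exists X^-1; first by rewrite invr_gt0.
by apply/allP => p pl; rewrite ler_pdivrMr //; exact: (allP (HX _ (lexx X))).
Qed.

Lemma ex_large_nat (l : seq (R * R)) : all (fun p => 0 < p.2) l ->
  exists n0 : nat, forall n, (n0 <= n)%N -> 1 <= n%:R :> R /\ all (fun p => p.1 <= p.2 * n%:R) l.
Proof.
move=> /ex_large[X X1 HX]; exists (Num.truncn X).+1 => n nX.
have Xn : X <= n%:R by apply: ltW; apply: lt_le_trans (truncnS_gt X) _; rewrite ler_nat.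
by split; [exact: le_trans Xn | exact: HX].
Qed.

(** The jump term lies between -M (a - m) and M (M - a), where [a] is the current value, so a short
    step cannot cross either end. *)
Lemma max_principle K (m M lam : R) (u u' : Z -> R) : 0 < m -> m <= M -> 0 <= lam -> lam * M <= 1 ->
  (forall x, m <= u x <= M) -> (forall x, u' x = u x + lam * Q K u u x) -> forall x, m <= u' x <= M.
Proof.
move=> m0 mM l0 lM ub uE x; rewrite uE; have /andP[a1 a2] := ub x.
have M0 : 0 <= M by exact: ltW (lt_le_trans m0 mM).
set a := u x in a1 a2 *.
have hi : Q K u u x <= M * (M - a).
  apply: LK_le_cst => [|z]; first by rewrite mulr_ge0 // subr_ge0.
  have /andP[A1 A2] := ub (x + z); rewrite -/a.
  have A0 : 0 <= u (x + z) by exact: le_trans (ltW m0) A1.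
  apply: (@le_trans _ _ (u (x + z) * (M - a))); first by rewrite ler_wpM2l // lerD2r.
  by rewrite ler_wpM2r // subr_ge0.
have lo : - Q K u u x <= M * (a - m).
  rewrite /Q -LKN; apply: LK_le_cst => [|z]; first by rewrite mulr_ge0 // subr_ge0.
  have /andP[A1 A2] := ub (x + z); rewrite -/a.
  have A0 : 0 <= u (x + z) by exact: le_trans (ltW m0) A1.
  rewrite -mulrN opprB; apply: (@le_trans _ _ (u (x + z) * (a - m))).
    by rewrite ler_wpM2l // lerD2l lerN2.
  by rewrite ler_wpM2r // subr_ge0.
have h1 := ler_wpM2l l0 hi; have h2 := ler_wpM2l l0 lo.
have h3 : lam * M * (M - a) <= 1 * (M - a) by rewrite ler_wpM2r // subr_ge0.
have h4 : lam * M * (a - m) <= 1 * (a - m) by rewrite ler_wpM2r // subr_ge0.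
by apply/andP; split; move: h1 h2 h3 h4; clra.
Qed.

(** At scale 1 the modulus exceeds [M] beyond a fixed distance, and within that distance a fine mesh
    makes the datum vary by less than [e]. Only here does the Lipschitz constant [l] enter. *)
Lemma wm_initial (e kap l M n : R) (v : Z -> R) : (0 < d)%N -> 0 < e -> 0 < kap -> 0 <= l -> 0 < n ->
  l * expR (expR (M / kap)) <= e * n -> (forall x h, v (x + h) - v x <= M) ->
  (forall x h, v (x + h) - v x <= l * (nz h / n)) ->
  forall x h, v (x + h) - v x <= wm e kap 1 (nz h).
Proof.
move=> d0 e0 k0 l0 n0 hn vM vl x h.
have kw := ltW k0.
have [small|big] := leP (nz h) (expR (expR (M / kap))).
  apply: le_trans (vl x h) _; apply: (@le_trans _ _ e); last by apply: wm_ge => //; exact: nz_ge0.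
  rewrite mulrA ler_pdivrMr //; apply: le_trans hn; exact: ler_wpM2l.
apply: le_trans (vM x h) _; rewrite /wm divr1.
set E := expR _ in big.
have E1 : expR (M / kap) <= ln (1 + nz h).
  rewrite -[leLHS]expRK ler_ln ?posrE ?expR_gt0 ?ltr_wpDr ?nz_ge0 // -/E.
  by move: big; clra.
have E2 : M / kap <= ln (1 + ln (1 + nz h)).
  rewrite -[leLHS]expRK ler_ln ?posrE ?expR_gt0 ?ltr_wpDr ?ln_ge0_1D ?nz_ge0 //.
  by move: E1; clra.
have := ler_wpM2l kw E2; rewrite mulrC divfK ?gt_eqF //.
by move: e0; clra.
Qed.

(** The scale is capped at [rcap] because the dissipation needs walks of length of the order of its
    square, and only [K] are available. *)
Lemma modulus_iter (m M e kap c2 L c6 Rc C7 rcap lam : R) (K : nat) (u : nat -> Z -> R) :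
  (0 < d)%N -> 0 < m -> m <= M -> 0 < e -> e <= M -> 0 < kap -> e + kap <= m / 2 ->
  1 <= rcap -> 0 <= c2 -> 0 <= lam -> 4 * M * lam <= 1 ->
  2 * M ^+ 2 * lam <= e / 8 -> kap * (lam * c2) <= e / 8 -> lam * c2 <= 1 ->
  L * (m * e) = 64 * M ^+ 2 -> c6 * e ^+ 2 = 2 * (4 * L * M * d%:R) ^+ 2 -> Rc = expR (expR (M / kap)) ->
  C7 * (4 * 64 * M * d%:R) = m * e ^+ 2 ->
  2 * M * d%:R * (kap * (3 + ln (1 + c6))) <= C7 / 2 -> 2 * kap * c2 * Rc <= C7 / 2 ->
  (L * (4 * M * d%:R * (Rc * rcap))) ^+ 2 + 2 * e ^+ 2 <= K%:R * e ^+ 2 ->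
  (forall j x, m <= u j x <= M) ->
  (forall x h, u 0%N (x + h) - u 0%N x <= wm e kap 1 (nz h)) ->
  (forall j x, u j.+1 x = u j x + lam * Q K (u j) (u j) x) ->
  forall j x h, u j (x + h) - u j x <= wm e kap (Num.min rcap (1 + c2 * lam * j%:R)) (nz h).
Proof.
move=> d0 m0 mM e0 eM k0 ek r1 c20 l0 cfl cfl2 cfl3 cfl4 eL ec6 eRc eC7 H1 H2 HK ub u0 uE.
have cl : 0 <= c2 * lam by exact: mulr_ge0.
have rj j : 1 <= 1 + c2 * lam * j%:R by rewrite lerDl mulr_ge0.
elim=> [|j IH]; first by rewrite mulr0 addr0 (min_idPr r1).
have M0 := lt_le_trans m0 mM.
have L0 : 0 < L by rewrite -(pmulr_lgt0 _ (mulr_gt0 m0 e0)) eL mulr_gt0 ?exprn_gt0.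
set rho' := Num.min rcap (1 + c2 * lam * j.+1%:R).
have rr : rho' <= rcap by rewrite ge_min lexx.
have HK' : (L * (4 * M * d%:R * (Rc * rho'))) ^+ 2 + 2 * e ^+ 2 <= K%:R * e ^+ 2.
  apply: le_trans HK; rewrite lerD2r.
  have Rc0 : 0 <= Rc by rewrite eRc expR_ge0.
  have rh : 0 <= rho' by rewrite le_min (le_trans ler01 r1) (le_trans ler01 (rj _)).
  have q0 : 0 <= 4 * M * d%:R by rewrite !mulr_ge0 // ltW.
  have a0 : 0 <= L * (4 * M * d%:R * (Rc * rho')) by rewrite (mulr_ge0 (ltW L0)) // (mulr_ge0 q0) // mulr_ge0.
  have ab : L * (4 * M * d%:R * (Rc * rho')) <= L * (4 * M * d%:R * (Rc * rcap)).
    apply: ler_wpM2l; first exact: ltW.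
    by apply: ler_wpM2l => //; exact: ler_wpM2l.
  by rewrite ler_sqr ?nnegrE // (le_trans a0).
apply: (@modulus_step K m M e kap (Num.min rcap (1 + c2 * lam * j%:R)) rho' lam c2 L c6 Rc C7 (u j) (u j.+1)) => //.
- by rewrite le_min r1 rj.
- by rewrite le_min !ge_min lexx /= lerD2l ler_wpM2l ?ler_nat // orbT.
- rewrite /rho' -(natr1 j); have [h|h] := leP rcap (1 + c2 * lam * j%:R).
    by rewrite ge_min lerDl mulr_ge0.
  by rewrite ge_min; apply/orP; right; rewrite mulrDr addrA mulr1 (mulrC lam).
Qed.

Lemma regularity_iter (s k K : nat) (q2 m M e1 rho mcap lam c3 C D : R) (u : nat -> Z -> R) :
  q2 = 4 * 48 -> k = (2 * s).+1 -> C = Cd k -> D = d%:R + 3 ->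
  (0 < d)%N -> (2 <= s)%N -> 0 < m -> m <= M -> 0 < e1 ->
  13 * 2 ^+ k * C ^+ 4 * D * e1 * (2 * q2 * C * d%:R) <= m ->
  9 * C * M * D * mcap * (2 * q2 * C * d%:R) <= m * rho ->
  2 ^+ k * M * mcap <= e1 * rho -> 
  0 <= lam -> 4 * M * lam <= 1 -> 1 <= mcap ->
  0 <= c3 -> q2 * s%:R * C * d%:R * c3 <= m -> 
  (36 * (C * d%:R * rho)) ^+ 2 <= K%:R + 1 ->
  (forall j y, m <= u j y <= M) ->
  (forall j y z, nz z <= rho -> 2 ^+ k * `|dl z (u j) y| <= e1) ->
  (forall j x, u j.+1 x = u j x + lam * Q K (u j) (u j) x) ->
  forall j y z, `|dk k z (u j) y| <= e1 * (nz z / Num.min mcap (1 + c3 * lam * j%:R)) ^+ s.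
Proof.
move=> q2E kE CE DE d0 s2 m0 mM e10 He Hc Hc2 lam0 cfl mu1 c30 Hc3 HK ub uosc uE.
have cl : 0 <= c3 * lam by exact: mulr_ge0.
have rj j : 1 <= 1 + c3 * lam * j%:R by rewrite lerDl mulr_ge0.
have M0 : 0 < M by exact: lt_le_trans mM.
have C1 : 1 <= C by rewrite CE; exact: Cd_ge1.
elim=> [y z|j IH].
  rewrite mulr0 addr0 (min_idPr mu1) divr1.
  have [->|zn] := eqVneq z 0; first by rewrite kE dk0 normr0 mulr_ge0 ?exprn_ge0 ?nz_ge0 // ltW.
  have z1 := @nz_ge1 R d z zn.
  (* At scale 1 the bound is free: nonzero vectors have |z|^s >= |z| >= 1, so small oscillation
     suffices up to [rho] and the sup bound beyond it. *)
  have zs : nz z <= nz z ^+ s by rewrite -[leLHS]expr1 ler_weXn2l // (leq_trans _ s2).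
  have [zr|zr] := leP (nz z) rho.
    have h0 y' : `|dl z (u 0%N) y'| <= e1 / 2 ^+ k by rewrite ler_pdivlMr ?exprn_gt0 // mulrC; exact: uosc.
    rewrite {1}kE; apply: le_trans (@dk_osc (2 * s) z (u 0%N) _ h0 y) _.
    apply: (@le_trans _ _ e1); last by apply: ler_peMr; [exact: ltW | exact: le_trans zs].
    rewrite mulrCA; apply: ler_piMr; first exact: ltW.
    by rewrite ler_pdivrMr ?exprn_gt0 // mul1r ler_weXn2l ?ler1n // kE.
  have h0 y' : `|u 0%N y'| <= M by have /andP[a b] := ub 0%N y'; rewrite ger0_norm // (le_trans (ltW m0)).
  apply: le_trans (dk_bnd k z h0 y) _.
  apply: (@le_trans _ _ (e1 * rho)).
    by apply: le_trans Hc2; rewrite ler_peMr // mulr_ge0 ?exprn_ge0 // ltW.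
  by rewrite ler_pM2l //; apply: le_trans zs; exact: ltW.
pose mu := Num.min mcap (1 + c3 * lam * j%:R).
pose mu' := Num.min mcap (1 + c3 * lam * j.+1%:R).
have mc : mu' <= mcap by rewrite ge_min lexx.
have D0 : 0 <= D by rewrite DE addr_ge0.
have q0 : 0 < q2 by rewrite q2E mulr_gt0.
have C0 := lt_le_trans ltr01 C1.
apply: (@regularity_step s k K q2 m M e1 rho mu mu' lam c3 C D (u j) (u j.+1)
   (fun h => e1 * (nz h / mu) ^+ s)) => //.
- apply: le_trans Hc; apply: ler_wpM2r; first by rewrite !mulr_ge0 // ltW.
  by apply: ler_wpM2l => //; rewrite !mulr_ge0 // ltW.
- by apply: le_trans Hc2; rewrite ler_wpM2l // mulr_ge0 ?exprn_ge0 // ltW.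
- by rewrite le_min mu1 rj.
- by rewrite le_min !ge_min lexx /= lerD2l ler_wpM2l ?ler_nat // orbT.
- rewrite /mu /mu' -(natr1 j); have [h|h] := leP mcap (1 + c3 * lam * j%:R).
    by rewrite ge_min lerDl mulr_ge0.
  by rewrite ge_min; apply/orP; right; rewrite mulrDr addrA mulr1 (mulrC lam).
- exact: uosc.
- exact: uosc.
Qed.

(** About half of [t0] is spent on making oscillations small at the macroscopic scale [rho], the
    rest on raising the scale of the difference bound. [Cs] is fixed before [l], which only enters
    [n0]. *)
Lemma lattice_regularity (s : nat) (m M t0 : R) :
  (0 < d)%N -> (2 <= s)%N -> 0 < m -> m <= M -> 0 < t0 ->
  exists2 Cs : R, 0 <= Cs & forall l : R, 0 <= l -> exists n0 : nat,
  forall (n K : nat) (tau : R) (u : nat -> Z -> R), (n0 <= n)%N -> 0 < tau -> tau * n%:R ^+ 3 <= 1 ->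
  (n ^ 4 <= K)%N -> (forall x, m <= u 0%N x <= M) ->
  (forall x h, u 0%N (x + h) - u 0%N x <= l * (nz h / n%:R)) ->
  (forall j x, u j.+1 x = u j x + 2 * n%:R * tau * Q K (u j) (u j) x) ->
  forall j, t0 <= j%:R * tau -> forall y z, `|dk (2 * s).+1 z (u j) y| <= Cs * (nz z / n%:R) ^+ s.
Proof.
move=> d0 s2 m0 mM t00.
have M0 : 0 < M := lt_le_trans m0 mM.
have dp : 0 < d%:R :> R by rewrite ltr0n.
set k := (2 * s).+1; pose C : R := Cd k; pose D : R := d%:R + 3.
(* The number is kept abstract so that later arithmetic treats it as a symbol. *)
have [q2 q2E] : exists q2 : R, q2 = 4 * 48 by exists (4 * 48).
have k0 : 0 < 2 ^+ k :> R by exact: exprn_gt0.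
have [e1 e10] := @ex_small [:: (13 * 2 ^+ k * C ^+ 4 * D * (2 * q2 * C * d%:R), m)] ltac:(by rewrite /= m0).
rewrite /= andbT => He1.
have [e e0] := @ex_small [:: (2 ^+ k * 2, e1); (2, m / 2); (1, M)]
  ltac:(by rewrite /= e10 M0 divr_gt0).
rewrite /= andbT mul1r => /and3P[ek em eM].
have me0 : 0 < m * e by exact: mulr_gt0.
pose L := 64 * M ^+ 2 / (m * e).
have eL : L * (m * e) = 64 * M ^+ 2 by rewrite /L divfK ?gt_eqF.
pose c6 := 2 * (4 * L * M * d%:R) ^+ 2 / e ^+ 2.
have ec6 : c6 * e ^+ 2 = 2 * (4 * L * M * d%:R) ^+ 2 by rewrite /c6 divfK ?gt_eqF ?exprn_gt0.
pose C7 := m * e ^+ 2 / (4 * 64 * M * d%:R).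
have q0 : 0 < 4 * 64 * M * d%:R by rewrite !mulr_gt0.
have eC7 : C7 * (4 * 64 * M * d%:R) = m * e ^+ 2 by rewrite /C7 divfK ?gt_eqF.
have C70 : 0 < C7 by rewrite divr_gt0 // mulr_gt0 ?exprn_gt0.
have [kap kap0] := @ex_small [:: (2 * M * d%:R * (3 + ln (1 + c6)), C7 / 2); (1, e)]
  ltac:(by rewrite /= e0 divr_gt0).
rewrite /= andbT mul1r => /andP[Hkap kape].
pose Rc := expR (expR (M / kap)).
have [c2 c20] := @ex_small [:: (2 * kap * Rc, C7 / 2)] ltac:(by rewrite /= divr_gt0).
rewrite /= andbT => Hc2.
have [c3 c30] := @ex_small [:: (q2 * s%:R * C * d%:R, m)] ltac:(by rewrite /= m0).
rewrite /= andbT => Hc3.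
pose r := c2 * t0; have r0 : 0 < r by exact: mulr_gt0.
have [r2 r20] := @ex_small [:: (9 * C * M * D * (2 * q2 * C * d%:R), m); (2 ^+ k * M, e1)]
  ltac:(by rewrite /= m0 e10).
rewrite /= andbT => /andP[Hr2 Hr2'].
(* In physical length, the scale reached at time [t0]: either the cap, or what growth at rate [c3]
   yields in the remaining steps. *)
pose r3 := Num.min (r2 * r) (c3 * t0 / 2).
have r30 : 0 < r3 by rewrite lt_min !(mulr_gt0, divr_gt0).
exists (e1 / r3 ^+ s) => [|l l0]; first by rewrite divr_ge0 ?exprn_ge0 // ltW.
have e20 : 0 < e ^+ 2 by exact: exprn_gt0.
have [n0 Hn0] := @ex_large_nat [:: (1, r); (1, r2 * r); (8 * M, 1); (2 * M ^+ 2 * 2, e / 8);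
   (kap * (2 * c2), e / 8); (2 * c2, 1); (l * Rc, e); ((L * (4 * M * d%:R * (Rc * r))) ^+ 2 + 2 * e ^+ 2, e ^+ 2);
   ((36 * (C * d%:R * r)) ^+ 2, 1); (4, t0)]
  ltac:(by rewrite /= r0 e0 t00 !mulr_gt0 ?exprn_gt0 ?ltr01 ?invr_gt0).
exists n0 => n K tau u /Hn0 [n1]; rewrite /= andbT !mul1r.
move=> /and5P[G1 G2 G3 G4 /and5P[G5 G6 G7 G8 /andP[G9 G10]]] tau0 taun nK ub ul uE.
have np : 0 < n%:R :> R := lt_le_trans ltr01 n1.
set lam := 2 * n%:R * tau in uE.
have lam0 : 0 <= lam by rewrite !mulr_ge0 // ltW.
have taun1 : tau * n%:R <= 1.
  apply: le_trans taun; rewrite ler_pM2l // -[leLHS]expr1 ler_weXn2l //.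
have lamn : lam * n%:R <= 2.
  rewrite /lam; have : tau * n%:R ^+ 2 <= 1 by apply: le_trans taun; rewrite ler_pM2l // ler_weXn2l.
  clear; rewrite expr2; lra.
have lamle A B : 0 <= A -> 2 * A <= B * n%:R -> A * lam <= B.
  move=> A0 AB; rewrite -(ler_pM2r np) -mulrA; apply: le_trans AB.
  by rewrite mulrC ler_wpM2r.
have K4 : n%:R ^+ 4 <= K%:R :> R by rewrite -natrX ler_nat.
have n34 : n%:R ^+ 2 * n%:R <= n%:R ^+ 4 :> R by rewrite -exprSr ler_weXn2l.
pose rho := r * n%:R.
have cfl : 4 * M * lam <= 1 by apply: lamle; [rewrite mulr_ge0 // ltW | move: G3; clra].
have ubj j x : m <= u j x <= M.
  elim: j x => [|j IH] //; apply: (@max_principle K m M lam (u j)) => //.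
  move: cfl; have : 0 <= M * lam by rewrite mulr_ge0 // ltW.
  clear; rewrite (mulrC lam); lra.
have umod := @modulus_iter m M e kap c2 L c6 Rc C7 rho lam K u d0 m0 mM e0 eM kap0.
have ekm : e + kap <= m / 2 by move: em kape; clra.
have h1 : 2 * M ^+ 2 * lam <= e / 8 by apply: lamle; [rewrite mulr_ge0 ?sqr_ge0 | move: G4; clra].
have h2 : kap * (lam * c2) <= e / 8.
  rewrite mulrCA mulrC; apply: lamle; first by rewrite mulr_ge0 // ltW.
  by move: G5; clra.
have h3 : lam * c2 <= 1 by rewrite mulrC; apply: lamle; [exact: ltW | move: G6; clra].
have h4 : (L * (4 * M * d%:R * (Rc * rho))) ^+ 2 + 2 * e ^+ 2 <= K%:R * e ^+ 2.
  have k4 := ler_wpM2r (ltW e20) (le_trans n34 K4).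
  apply: le_trans k4.
  have n2 : 1 <= n%:R ^+ 2 :> R by rewrite exprn_ege1.
  have -> : (L * (4 * M * d%:R * (Rc * rho))) ^+ 2 = (L * (4 * M * d%:R * (Rc * r))) ^+ 2 * n%:R ^+ 2.
    by rewrite -exprMn /rho; congr (_ ^+ 2); ring.
  move: G8; set A := (_ ^+ 2) => G8.
  have f1 := ler_wpM2l (le_trans ler01 n2) G8.
  have f2 : 2 * e ^+ 2 * 1 <= 2 * e ^+ 2 * n%:R ^+ 2 by rewrite ler_wpM2l // mulr_ge0 // ltW.
  by move: f1 f2; clra.
have HkapE : 2 * M * d%:R * (kap * (3 + ln (1 + c6))) <= C7 / 2 by move: Hkap; clra.
have Hc2E : 2 * kap * c2 * Rc <= C7 / 2 by move: Hc2; clra.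
have u0M x h : u 0%N (x + h) - u 0%N x <= M.
  have /andP[_ a] := ub (x + h); have /andP[b _] := ub x.
  by move: a b m0; clra.
have {}umod := umod ekm G1 (ltW c20) lam0 cfl h1 h2 h3 eL ec6 erefl eC7 HkapE Hc2E h4 ubj
  (@wm_initial e kap l M n%:R (u 0%N) d0 e0 kap0 l0 np G7 u0M ul) uE.
have rho0 : 0 < rho by exact: mulr_gt0.
(* The first step strictly after t0/2. There the scale of the modulus has reached its cap, since r =
   c2 t0 and lam = 2 n tau. *)
pose j1 := (Num.truncn (t0 / 2 / tau)).+1.
have j1a : t0 / 2 <= j1%:R * tau by rewrite -ler_pdivrMr // ltW // truncnS_gt.
have j1b : j1%:R * tau <= t0 / 2 + tau.
  rewrite /j1 -natr1 mulrDl mul1r lerD2r -ler_pdivlMr // truncn_le divr_ge0 ?divr_ge0 // ltW //.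
have osc i y z : nz z <= rho -> 2 ^+ k * `|dl z (u (j1 + i)%N) y| <= e1.
  move=> zr; set j := (j1 + i)%N.
  have rj : Num.min rho (1 + c2 * lam * j%:R) = rho.
    apply/min_idPl; rewrite /rho /r /lam.
    have jj : j1%:R <= j%:R :> R by rewrite ler_nat leq_addr.
    have t2 : t0 / 2 <= j%:R * tau by apply: le_trans j1a _; rewrite ler_wpM2r // ltW.
    have := ler_wpM2l (ltW (mulr_gt0 c20 np)) t2; clra.
  have wr : wm e kap rho (nz z) <= e + kap.
    by apply: le_trans (wm_at _ (ltW kap0) rho0); apply: wm_mono => //; [exact: ltW | exact: nz_ge0].
  have a1 := umod j y z; have a2 := umod j (y + z) (- z).
  rewrite rj in a1 a2; rewrite nzN addrK in a2.
  have ab : `|dl z (u j) y| <= e + kap by rewrite /dl ler_norml; apply/andP; split; move: a1 a2 wr; clra.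
  apply: le_trans (ler_wpM2l (ltW k0) ab) _.
  apply: le_trans ek; rewrite -mulrA ler_pM2l //; move: kape; clra.
have regu := @regularity_iter s k K q2 m M e1 rho (r2 * rho) lam c3 C D (fun i => u (j1 + i)%N)
  q2E erefl erefl erefl d0 s2 m0 mM e10.
have g1 : 13 * 2 ^+ k * C ^+ 4 * D * e1 * (2 * q2 * C * d%:R) <= m by move: He1; clra.
have g2 : 9 * C * M * D * (r2 * rho) * (2 * q2 * C * d%:R) <= m * rho by have := ler_wpM2r (ltW rho0) Hr2; clra.
have g3 : 2 ^+ k * M * (r2 * rho) <= e1 * rho by have := ler_wpM2r (ltW rho0) Hr2'; clra.
have g4 : 1 <= r2 * rho by rewrite mulrA.
have g5 : q2 * s%:R * C * d%:R * c3 <= m by [].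
have g6 : (36 * (C * d%:R * rho)) ^+ 2 <= K%:R + 1.
  apply: (@le_trans _ _ (K%:R)); last by rewrite lerDl.
  apply: le_trans K4; apply: le_trans n34.
  have -> : (36 * (C * d%:R * rho)) ^+ 2 = n%:R ^+ 2 * (36 * (C * d%:R * r)) ^+ 2.
    by rewrite -exprMn /rho; congr (_ ^+ 2); ring.
  by rewrite ler_wpM2l // exprn_ge0 // ltW.
have {}regu := regu g1 g2 g3 lam0 cfl g4 (ltW c30) g5 g6 (fun i => ubj _) osc.
have {}regu := regu (fun i x => ltac:(by rewrite addnS; exact: uE)).
move=> j jt y z.
have jj1 : (j1 <= j)%N.
  rewrite -(ler_nat R) -(ler_pM2r tau0); apply: le_trans j1b _; apply: le_trans jt.
  have : tau * 4 <= t0 * 1.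
    apply: (@le_trans _ _ (tau * (t0 * n%:R))); first by rewrite ler_pM2l.
    by rewrite mulrCA ler_pM2l.
  by move: tau0; clra.
have := regu (j - j1)%N y z; rewrite subnKC // => /le_trans; apply.
rewrite -[leRHS]mulrA [_^-1 * _]mulrC -expr_div_n ler_pM2l //.
have r3n : 0 < r3 * n%:R by exact: mulr_gt0.
have mi : r3 * n%:R <= Num.min (r2 * rho) (1 + c3 * lam * (j - j1)%:R).
  rewrite le_min; apply/andP; split.
    by rewrite /rho mulrA ler_pM2r // ge_min lexx.
  have a1 : r3 <= c3 * t0 / 2 by rewrite ge_min lexx orbT.
  have a2 : t0 / 4 <= (j - j1)%:R * tau.
    have : tau * 4 <= t0 * 1.
      apply: (@le_trans _ _ (tau * (t0 * n%:R))); first by rewrite ler_pM2l.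
      by rewrite mulrCA ler_pM2l.
    by rewrite natrB // mulrBl; move: j1b jt; clra.
  have a3 := ler_wpM2l (ltW (mulr_gt0 c30 np)) a2.
  have a4 := ler_wpM2r (ltW np) a1.
  by rewrite /lam; move: a3 a4; clra.
have -> : nz z / n%:R / r3 = nz z / (r3 * n%:R) by field; rewrite !gt_eqF.
have m0' := lt_le_trans r3n mi.
rewrite ler_pXn2r ?nnegrE ?(leq_trans _ s2) //; last 2 first.
- by rewrite divr_ge0 ?nz_ge0 // ltW.
- by rewrite divr_ge0 ?nz_ge0 // ltW.
by rewrite ler_wpM2l ?nz_ge0 // lef_pV2.
Qed.

End LatticeRegularity.

End Lattice.

(** * Fourier analysis on the torus *)

Section Continuity.
Context {R : realType}.

Lemma mxnorm_enorm d (x : 'rV[R]_d) : `|x| <= enorm x.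
Proof.
rewrite [leLHS]/Num.Def.normr /= mx_normrE; apply/bigmax_leP; split; first exact: enorm_ge0.
by move=> [i j] _ /=; rewrite (ord1 i); exact: normr_le_enorm.
Qed.

Lemma coord_mxnorm d (x : 'rV[R]_d) i : `|x 0 i| <= `|x|.
Proof. by rewrite [leRHS]/Num.Def.normr /= mx_normrE; apply/bigmax_geP; right => /=; exists (0, i). Qed.

Lemma enorm_mxnorm d (x : 'rV[R]_d) : enorm x <= d%:R * `|x|.
Proof.
apply: le_trans (enorm_le_sum x) _.
apply: (@le_trans _ _ (\sum_(i < d) `|x|)); first by apply: ler_sum => i _; exact: coord_mxnorm.
by rewrite sumr_const card_ord mulr_natl.
Qed.

Lemma near_enorm d (x : 'rV[R]_d) (dl : R) : 0 < dl -> \forall y \near x, enorm (y - x) < dl.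
Proof.
move=> d0; apply/nbhs_normP; exists (dl / d.+1%:R) => /=; first by rewrite divr_gt0.
move=> y /= xy; apply: le_lt_trans (enorm_mxnorm _) _.
rewrite distrC in xy; rewrite ltr_pdivlMr // in xy; apply: le_lt_trans xy.
by rewrite mulrC ler_wpM2l // ler_nat.
Qed.

Lemma contP d (f : 'rV[R]_d -> R) : continuous f <->
  forall x e, 0 < e -> exists2 dl : R, 0 < dl & forall y, enorm (y - x) < dl -> `|f y - f x| < e.
Proof.
split=> [cf x e e0|H x].
  have /cvgrPdist_lt/(_ e e0) := cf x.
  move=> /nbhs_normP[dl /= d0 H]; exists dl => // y yx; rewrite distrC; apply: H => /=.
  by rewrite distrC; apply: le_lt_trans yx; exact: mxnorm_enorm.
apply/(@cvgrPdist_lt _ _ _ (nbhs x)) => e e0; have [dl d0 Hd] := H x e e0.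
by apply: filterS (near_enorm x d0) => y xy; rewrite distrC; exact: Hd.
Qed.

Definition box d : set 'rV[R]_d := [set x | forall i, 0 <= x 0 i <= 2 * pi].

Lemma box_compact d : compact (@box d).
Proof.
have -> : @box d = [set v : 'rV[R]_d | forall i, `[0, 2 * pi]%classic (v 0 i)].
  by apply/seteqP; split=> v H i; have := H i; rewrite /= in_itv.
by apply: (@rV_compact _ _ (fun=> `[0, 2 * pi]%classic)) => i; exact: segment_compact.
Qed.

(** Heine-Cantor by the covering form of compactness. Only one of the two points has to lie in the
    box. *)
Lemma unif_box d (f : 'rV[R]_d -> R) (e : R) : continuous f -> 0 < e ->
  exists2 dl : R, 0 < dl & forall x y, box x -> enorm (y - x) < dl -> `|f y - f x| < e.
Proof.
move=> /contP cf e0.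
pose P (dl : R) (x : 'rV[R]_d) := forall y, enorm (y - x) < dl -> `|f y - f x| < e.
have /compact_near_coveringP/(_ R (0^'+) P _) := @box_compact d.
case=> [x _|dl dl0 H]; last first.
  exists (dl / 2); first by rewrite divr_gt0.
  move=> x y bx xy; apply: (H (dl / 2)) => //=; last by rewrite divr_gt0.
  rewrite sub0r normrN gtr0_norm ?divr_gt0 // ltr_pdivrMr //; move: dl0 => /=; clra.
have [dl d0 Hd] := cf x (e / 2) (divr_gt0 e0 (ltr0Sn R 1)).
have h1 : \forall x' \near x, enorm (x' - x) < dl / 2. by apply: near_enorm; rewrite divr_gt0.
have h2 : \forall i \near (0:R)^'+, i < dl / 2 by apply: nbhs_right_lt; rewrite divr_gt0.
exists ([set x' | enorm (x' - x) < dl / 2], [set i | i < dl / 2]); first by split.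
move=> [x' i] /= [a b] y yx.
have c1 : `|f x' - f x| < e / 2 by apply: Hd; move: a d0; clra.
have c2 : `|f y - f x| < e / 2.
  apply: Hd; have := enormD (y - x') (x' - x); rewrite addrA subrK; move: a b yx; clra.
have -> : f y - f x' = (f y - f x) - (f x' - f x) by ring.
by have := ler_normB (f y - f x) (f x' - f x); move: c1 c2; clra.
Qed.

Lemma pi2_gt0 : 0 < 2 * pi :> R. Proof. by rewrite mulr_gt0 // pi_gt0. Qed.

Lemma periodic_freq d (f : 'rV[R]_d -> R) k x : periodic f -> f (x + (2 * pi) *: freq k) = f x.
Proof.
move=> pf.
have nat_step i n y : f (y + (n%:R * (2 * pi)) *: delta_mx 0 i) = f y.
  elim: n y => [|n IH] y; first by rewrite mul0r scale0r addr0.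
  by rewrite -(natr1 n) mulrDl mul1r scalerDl addrA pf IH.
have int_step i (n : int) y : f (y + (n%:~R * (2 * pi)) *: delta_mx 0 i) = f y.
  case: n => n; first exact: nat_step.
  rewrite NegzE mulrNz mulNr scaleNr -pmulrn -[RHS](nat_step i n.+1) -[in RHS](nat_step i n.+1).
  rewrite -[in LHS](nat_step i n.+1) subrK; by rewrite !nat_step.
have -> : (2 * pi) *: freq k = \sum_i ((k 0 i)%:~R * (2 * pi)) *: (delta_mx 0 i : 'rV[R]_d).
  rewrite [LHS]row_sum_delta; apply: eq_bigr => i _; congr (_ *: _).
  by rewrite !mxE mulrC.
elim/big_rec : _ => [|i y _ IH]; first by rewrite addr0.
by rewrite addrCA [_ + (x + y)]addrC int_step.
Qed.

Lemma mod_box d (x : 'rV[R]_d) : exists k : 'rV[int]_d, box (x + (2 * pi) *: freq k).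
Proof.
have p0 := pi2_gt0.
exists (\row_i - Num.floor (x 0 i / (2 * pi))) => i; rewrite !mxE rmorphN /=.
set q := x 0 i / (2 * pi).
have xE : x 0 i = q * (2 * pi) by rewrite /q divfK ?gt_eqF.
have h1 : (Num.floor q)%:~R <= q by exact: floor_le_tmp.
have h2 : q < (Num.floor q + 1)%:~R by exact: floorD1_gt.
rewrite intrD in h2.
rewrite xE mulrN [2 * pi * _]mulrC -mulrBl; apply/andP; split.
  by rewrite mulr_ge0 ?subr_ge0 // ltW.
by rewrite ler_piMl //; [exact: ltW | move: h2; clra].
Qed.

Definition cp d (f : 'rV[R]_d -> R) := continuous f /\ periodic f.

Lemma box_bounded d (f : 'rV[R]_d -> R) : continuous f -> exists2 B : R, 0 <= B & forall x, box x -> `|f x| <= B.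
Proof.
move=> cf.
have cA : compact (f @` @box d) by apply: continuous_compact (@box_compact d); exact: continuous_subspaceT.
have [M [_ HM]] := compact_bounded cA.
exists (`|M| + 1) => [|x bx]; first by rewrite addr_ge0.
by apply: HM; [have := ler_norm M; clra | exists x].
Qed.

Lemma cp_bounded d (f : 'rV[R]_d -> R) : cp f -> exists2 B : R, 0 <= B & forall x, `|f x| <= B.
Proof.
move=> [cf pf]; have [B B0 HB] := box_bounded cf; exists B => // x.
by have [k bk] := mod_box x; rewrite -(periodic_freq k x pf); exact: HB.
Qed.

Lemma cont_cst d (c : R) : continuous (fun _ : 'rV[R]_d => c).
Proof. by move=> x; exact: (@cvg_cst _ _ _ (nbhs x)). Qed.

Lemma contZl d (f : 'rV[R]_d -> R) c : continuous f -> continuous (fun x => c * f x).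
Proof. by move=> cf x; exact: (cvgM (@cvg_cst _ _ _ (nbhs x) _) (cf x)). Qed.

Lemma contD d (f g : 'rV[R]_d -> R) : continuous f -> continuous g -> continuous (fun x => f x + g x).
Proof. by move=> cf cg x; exact: (cvgD (cf x) (cg x)). Qed.

Lemma contB d (f g : 'rV[R]_d -> R) : continuous f -> continuous g -> continuous (fun x => f x - g x).
Proof. by move=> cf cg x; exact: (cvgB (cf x) (cg x)). Qed.

Lemma contM d (f g : 'rV[R]_d -> R) : continuous f -> continuous g -> continuous (fun x => f x * g x).
Proof. by move=> cf cg x; exact: (cvgM (cf x) (cg x)). Qed.

Lemma cont_dot d (v : 'rV[R]_d) : continuous (dot v).
Proof.
apply/contP => x e e0; exists (e / (enorm v + 1)) => [|y yx].
  by rewrite divr_gt0 // ltr_wpDl // enorm_ge0.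
have v0 := enorm_ge0 v; have v1 : 0 < enorm v + 1 by rewrite ltr_wpDl.
rewrite -dotNr -dotDr.
apply: (@le_lt_trans _ _ (enorm v * enorm (y - x))).
  rewrite ler_norml dot_le andbT lerNl -dotNr; apply: le_trans (dot_le _ _) _.
  by rewrite enormN.
rewrite ltr_pdivlMr // in yx; apply: le_lt_trans yx.
by rewrite mulrC ler_wpM2l ?enorm_ge0 // lerDl.
Qed.

Lemma cont_cosdot d (v : 'rV[R]_d) b : continuous (fun x => cos (dot v x + b)).
Proof.
have cd := contD (@cont_dot d v) (@cont_cst d b).
by move=> x; exact: (continuous_comp (cd x) (@continuous_cos R _)).
Qed.

End Continuity.

(** * The iterated integral over the torus *)

Section TorusIntegral.
Context {R : realType}.
Local Notation mu := (@lebesgue_measure R).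
Local Notation I := (`[0, 2 * pi : R]%classic).
Local Notation T := (@torus_integral R _).

Lemma integrable_cont (g : R -> R) : continuous g -> mu.-integrable I (EFin \o g).
Proof.
move=> cg; apply: continuous_compact_integrable; first exact: segment_compact.
exact: continuous_subspaceT.
Qed.

Lemma int_cst (c : R) : \int[mu]_(t in I) c = 2 * pi * c.
Proof.
rewrite Rintegral_cst //= lebesgue_measure_itv /= lte_fin (@pi2_gt0 R) /=.
by rewrite subr0 mulrC.
Qed.

Definition slice d (f : 'rV[R]_(1 + d) -> R) (t : R) (y : 'rV[R]_d) := f (row_mx (const_mx t : 'rV_1) y).

Lemma enorm_row d (t : R) (y : 'rV[R]_d) : enorm (row_mx (const_mx t : 'rV_1) y) ^+ 2 = t ^+ 2 + enorm y ^+ 2.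
Proof.
rewrite !sqr_enorm /dot big_split_ord /= big_ord1 row_mxEl mxE -expr2; congr (_ + _).
by apply: eq_bigr => i _; rewrite row_mxEr.
Qed.

Lemma row_sub d (s t : R) (x y : 'rV[R]_d) : row_mx (const_mx s : 'rV_1) x - row_mx (const_mx t) y =
  row_mx (const_mx (s - t)) (x - y).
Proof.
by rewrite opp_row_mx add_row_mx; congr row_mx; apply/matrixP => i j; rewrite !mxE.
Qed.

Lemma slice_cont d (f : 'rV[R]_(1 + d) -> R) t : continuous f -> continuous (slice f t).
Proof.
move=> /contP cf; apply/contP => x e e0.
have [dl d0 H] := cf (row_mx (const_mx t) x) e e0; exists dl => // y yx.
apply: H; rewrite row_sub subrr.
have : enorm (row_mx (const_mx 0 : 'rV_1) (y - x)) ^+ 2 = enorm (y - x) ^+ 2 by rewrite enorm_row expr0n add0r.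
by move/(pexpIrn (ltn0Sn 1)) => -> //; rewrite nnegrE enorm_ge0.
Qed.

Lemma box_row d t (y : 'rV[R]_d) : 0 <= t <= 2 * pi -> box y -> box (row_mx (const_mx t : 'rV_1) y).
Proof. by move=> t0 by0 i; rewrite mxE; case: splitP => j _; rewrite ?mxE // by0. Qed.

(** The properties are carried together through the induction on the dimension: integrability of the
    slices comes from their continuity, whose proof uses linearity, positivity and the total mass
    one dimension below. *)
Definition T_ok d := [/\ forall f g : 'rV[R]_d -> R, continuous f -> continuous g ->
    T (fun x => f x + g x) = T f + T g,
  forall (c : R) (f : 'rV[R]_d -> R), continuous f -> T (fun x => c * f x) = c * T f,
  forall f : 'rV[R]_d -> R, continuous f -> (forall x, box x -> 0 <= f x) -> 0 <= T f &
  T (fun _ : 'rV[R]_d => 1) = (2 * pi) ^+ d].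

Lemma T_bound d (f : 'rV[R]_d -> R) (e : R) : T_ok d -> continuous f -> (forall x, box x -> `|f x| <= e) ->
  `|T f| <= (2 * pi) ^+ d * e.
Proof.
move=> [TD TZ T0 T1] cf fe.
have ce := @cont_cst R d 1.
have h1 : 0 <= T (fun x => e * 1 + 1 * f x).
  apply: T0 => [|x bx]; first by apply: contD; apply: contZl.
  by have := fe x bx; rewrite ler_norml => /andP[a _]; move: a; clra.
have h2 : 0 <= T (fun x => e * 1 + (- 1) * f x).
  apply: T0 => [|x bx]; first by apply: contD; apply: contZl.
  by have := fe x bx; rewrite ler_norml => /andP[_ a]; move: a; clra.
move: h1 h2; rewrite !TD ?TZ ?T1 //; try exact: contZl.
by rewrite ler_norml => a b; apply/andP; split; move: a b; set X := _ ^+ d; clra.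
Qed.

Lemma T_slice_cont d (f : 'rV[R]_(1 + d) -> R) : T_ok d -> continuous f -> {within I, continuous (fun t => T (slice f t))}.
Proof.
move=> ok cf; apply/subspace_continuousP => t; rewrite /= in_itv /= => tI.
apply/cvgrPdist_lt => e e0.
have P0 : 0 < (2 * pi) ^+ d + 1 :> R by rewrite ltr_wpDl // exprn_ge0 // ltW // pi2_gt0.
have [dl d0 H] := unif_box cf (divr_gt0 e0 P0).
have near_t : \forall s \near t, `|s - t| < dl by apply/nbhs_normP; exists dl => //= s /=; rewrite distrC.
rewrite near_withinE; apply: filterS near_t => s st _ /=.
have [TD TZ T0 T1] := ok.
have -> : T (slice f t) - T (slice f s) = T (fun y => slice f t y + (- 1) * slice f s y).
  have ct := @slice_cont d f t cf; have cs := @slice_cont d f s cf.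
  by rewrite TD ?TZ ?mulN1r //; exact: contZl.
apply: (@le_lt_trans _ _ ((2 * pi) ^+ d * (e / ((2 * pi) ^+ d + 1)))).
  apply: T_bound => // [|y by0].
    by apply: contD; [exact: slice_cont | apply: contZl; exact: slice_cont].
  rewrite mulN1r distrC ltW // /slice; apply: H; first exact: box_row.
  rewrite row_sub subrr.
  have : enorm (row_mx (const_mx (s - t) : 'rV_1) (0 : 'rV[R]_d)) ^+ 2 = `|s - t| ^+ 2.
    by rewrite enorm_row enorm0 expr0n addr0 real_normK ?num_real.
  by move/(pexpIrn (ltn0Sn 1)) => -> //; rewrite nnegrE ?enorm_ge0.
by rewrite mulrA ltr_pdivrMr //; move: e0; set P := _ ^+ d; clra.
Qed.

Lemma T_all d : T_ok d.
Proof.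
elim: d => [|d IH].
  by split=> [//|//|f _ H|//]; apply: H => -[].
have [TD TZ T0 T1] := IH.
have intf (f : 'rV[R]_(1 + d) -> R) : continuous f -> mu.-integrable I (EFin \o (fun t => T (slice f t))).
  move=> cf; apply: continuous_compact_integrable; first exact: segment_compact.
  exact: T_slice_cont.
split=> [f g cf cg|c f cf|f cf f0|].
- rewrite /= -/(slice f) -RintegralD //; try exact: intf.
  by apply: eq_Rintegral => t _; rewrite -TD //; exact: slice_cont.
- rewrite /= -RintegralZl //; last exact: intf.
  by apply: eq_Rintegral => t _; rewrite -TZ //; exact: slice_cont.
- rewrite /=; apply: Rintegral_ge0 => t; rewrite /= in_itv /= => tI; apply: T0; first exact: slice_cont.
  by move=> y by0; apply: f0; exact: box_row.
- by rewrite /= T1 int_cst exprS.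
Qed.

Lemma cosD2pi_int (x : R) (n : int) : cos (x + n%:~R * (2 * pi)) = cos x.
Proof.
have nat_step k y : cos (y + k%:R * (2 * pi)) = cos y :> R.
  have := periodicn (@cosD2pi R) k y; rewrite -mulrnA => <-.
  by congr (cos (y + _)); rewrite -(mulr_natl pi (2 * k)) natrM; ring.
case: n => k; first exact: nat_step.
by rewrite NegzE mulrNz mulNr -pmulrn -(nat_step k.+1) subrK.
Qed.

Lemma cont_aff (a b : R) : continuous (fun t : R => a * t + b).
Proof. by move=> t; apply: cvgD; [apply: cvgM; [exact: cvg_cst | exact: cvg_id] | exact: cvg_cst]. Qed.

Lemma is_derive_sin_aff (a b t : R) : is_derive t (1:R) (fun t => sin (a * t + b)) (a * cos (a * t + b)).
Proof.
have h : is_derive t (1:R) (fun t => a * t + b) a.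
  have -> : (fun t => a * t + b) = a \*: (@id R) + cst b by [].
  by apply: is_derive_eq; rewrite addr0 scaler1.
have := @is_derive1_comp R sin (fun t => a * t + b) t.
by move=> /(_ _ _ (is_derive_sin (a * t + b)) h); rewrite mulrC.
Qed.

Lemma is_deriveMr (f : R -> R) (c l t : R) : is_derive t (1:R) f l -> is_derive t (1:R) (fun t => f t * c) (l * c).
Proof.
move=> h; have -> : (fun t => f t * c) = c \*: f by apply/funext => s; rewrite /= mulrC.
by apply: is_derive_eq; rewrite mulrC.
Qed.

Lemma cont_cos_aff (a b : R) : continuous (fun t : R => cos (a * t + b)).
Proof. by move=> t; exact: (continuous_comp (@cont_aff a b t) (@continuous_cos R _)). Qed.

Lemma int_cos (n : int) (b : R) :
  \int[mu]_(t in I) cos (n%:~R * t + b) = if n == 0 then 2 * pi * cos b else 0.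
Proof.
case: eqVneq => [->|n0].
  by rewrite -int_cst; apply: eq_Rintegral => t _; rewrite mul0r add0r.
have nR : n%:~R != 0 :> R by rewrite intr_eq0.
pose a : R := n%:~R; pose F (t : R) := sin (a * t + b) / a.
have dF (t : R) : is_derive t 1 F (cos (a * t + b)).
  have := is_deriveMr a^-1 (@is_derive_sin_aff a b t).
  by rewrite mulrAC divff // mul1r.
have dd (t : R) : derivable F t 1 by exact: ex_derive.
have cF : continuous F by move=> t; apply: differentiable_continuous; apply/derivable1_diffP.
rewrite /Rintegral (@continuous_FTC2 _ _ F).
- have e1 : a * (2 * pi) + b = b + n%:~R * (2 * pi) by rewrite addrC.
  rewrite /F mulr0 add0r e1 -!(cosBpihalf _) addrAC cosD2pi_int /=; ring.
- exact: pi2_gt0.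
- by apply: continuous_subspaceT; exact: cont_cos_aff.
- split=> [t _||]; first exact: dd.
    by apply: cvg_at_right_filter; exact: cF.
  by apply: cvg_at_left_filter; exact: cF.
- by move=> t _; rewrite derive1E; exact: derive_val.
Qed.

Lemma T_cos d (k : 'rV[int]_d) b :
  T (fun x => cos (dot (freq k) x + b)) = if k == 0 then (2 * pi) ^+ d * cos b else 0.
Proof.
elim: d k b => [|d IH] k b.
  by rewrite (thinmx0 k) eqxx /= /dot big_ord0 add0r expr0 mul1r.
pose k0 : int := k 0 0; pose k' : 'rV[int]_d := \row_j k 0 (lift 0 j).
have dotE t (y : 'rV[R]_d) : dot (freq k) (row_mx (const_mx t : 'rV_1) y) = k0%:~R * t + dot (freq k') y.
  rewrite /dot big_ord_recl; congr (_ + _).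
    rewrite !mxE; case: splitP => [j _|j /=]; rewrite ?mxE //.
  apply: eq_bigr => i _; rewrite !mxE; case: splitP => [j|j]; rewrite /= /bump /= add1n.
    by move=> E; have := ltn_ord j; rewrite -E.
  by move=> [E]; congr (_ * y _ _); apply: val_inj.
have kE : (k == 0) = (k' == 0) && (k0 == 0).
  apply/idP/idP => [/eqP kz|/andP[/eqP h1 /eqP h2]].
    by apply/andP; split; apply/eqP; rewrite /k0 /k' kz ?mxE //; apply/rowP => j; rewrite !mxE.
  apply/eqP.
  apply/rowP => j; rewrite [RHS]mxE; have [->|[i ->]] : j = 0 \/ exists i, j = lift 0 i.
      by case: (unliftP 0 j) => [i ->|->]; [right; exists i | left].
    exact: h2.
  by have /rowP/(_ i) := h1; rewrite !mxE.
rewrite /= kE.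
under eq_Rintegral => t _.
  under eq_fun => y do rewrite dotE addrAC addrC.
  over.
rewrite /= (_ : (fun t => _) = (fun t => if k' == 0 then (2 * pi) ^+ d * cos (k0%:~R * t + b) else 0)); last first.
  by apply/funext => t; rewrite IH.
case: (k' == 0) => /=; last by rewrite int_cst mulr0.
rewrite RintegralZl //; last first.
  by apply: integrable_cont; exact: cont_cos_aff.
by rewrite int_cos; case: ifP => _; rewrite ?mulr0 // exprS; ring.
Qed.

End TorusIntegral.

Section Torus.
Context {R : realType} {d : nat}.
Local Notation Z := 'rV[int]_d.
Local Notation V := 'rV[R]_d.
Local Notation C := (R[i]).
Local Notation normc := (@ComplexField.Normc.normc R).
Local Notation nz := (@nz R d).
Implicit Types (f g : V -> R) (x h : V) (p q xi z : Z) (n K P : nat).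

(** * Means over the torus *)

Section Mean.

Definition mean f : R := (2 * pi) ^- d * torus_integral f.

Lemma pi2d_gt0 : 0 < (2 * pi) ^+ d :> R. Proof. by rewrite exprn_gt0 // pi2_gt0. Qed.

Lemma meanD f g : continuous f -> continuous g -> mean (fun x => f x + g x) = mean f + mean g.
Proof. by move=> cf cg; rewrite /mean; have [TD _ _ _] := @T_all R d; rewrite TD // mulrDr. Qed.

Lemma meanZ c f : continuous f -> mean (fun x => c * f x) = c * mean f.
Proof. by move=> cf; rewrite /mean; have [_ -> // _ _] := @T_all R d; rewrite mulrCA. Qed.

Lemma meanB f g : continuous f -> continuous g -> mean (fun x => f x - g x) = mean f - mean g.
Proof.
move=> cf cg; rewrite -mulN1r -meanZ // -meanD //; last exact: contZl.
by congr mean; apply/funext => x; rewrite mulN1r.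
Qed.

Lemma mean_ge0 f : continuous f -> (forall x, 0 <= f x) -> 0 <= mean f.
Proof.
move=> cf f0; rewrite mulr_ge0 ?invr_ge0 ?(ltW pi2d_gt0) //.
by have [_ _ h _] := @T_all R d; apply: h.
Qed.

Lemma mean_cst c : mean (fun=> c) = c.
Proof.
have -> : (fun _ : V => c) = (fun x => c * (fun=> 1) x) by apply/funext => x; rewrite mulr1.
rewrite meanZ; last exact: cont_cst.
by rewrite /mean; have [_ _ _ ->] := @T_all R d; rewrite mulVf ?mulr1 // gt_eqF // pi2d_gt0.
Qed.

Lemma mean_le f g : continuous f -> continuous g -> (forall x, f x <= g x) -> mean f <= mean g.
Proof.
move=> cf cg fg; rewrite -subr_ge0 -meanB //; apply: mean_ge0; first exact: contB.
by move=> x; rewrite subr_ge0.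
Qed.

Lemma mean_norm f e : continuous f -> (forall x, `|f x| <= e) -> `|mean f| <= e.
Proof.
move=> cf fe; rewrite ler_norml; apply/andP; split.
  by rewrite -(mean_cst (- e)); apply: mean_le => //; [exact: cont_cst | move=> x; have := fe x; rewrite ler_norml => /andP[]].
by rewrite -(mean_cst e); apply: mean_le => //; [exact: cont_cst | move=> x; have := fe x; rewrite ler_norml => /andP[]].
Qed.

Lemma cont_sum (I : Type) (r : seq I) (F : I -> V -> R) : (forall i, continuous (F i)) ->
  continuous (fun x => \sum_(i <- r) F i x).
Proof.
move=> cF; elim: r => [|i r IH].
  have -> : (fun x => \sum_(i <- [::]) F i x) = (fun=> 0) by apply/funext => x; rewrite big_nil.
  exact: cont_cst.
have -> : (fun x => \sum_(j <- i :: r) F j x) = (fun x => F i x + (fun y => \sum_(j <- r) F j y) x).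
  by apply/funext => x; rewrite big_cons.
exact: contD.
Qed.

Lemma mean_sum (I : Type) (r : seq I) (F : I -> V -> R) : (forall i, continuous (F i)) ->
  mean (fun x => \sum_(i <- r) F i x) = \sum_(i <- r) mean (F i).
Proof.
move=> cF; elim: r => [|i r IH].
  rewrite big_nil -[RHS](mean_cst 0); congr mean; apply/funext => x; exact: big_nil.
rewrite big_cons -IH -meanD //; last exact: cont_sum.
by congr mean; apply/funext => x; rewrite big_cons.
Qed.

Lemma mean_cos p b : mean (fun x => cos (dot (freq p) x + b)) = if p == 0 then cos b else 0.
Proof.
rewrite /mean T_cos; case: ifP; rewrite ?mulr0 // mulrA mulVf ?mul1r //.
by rewrite gt_eqF // pi2d_gt0.
Qed.

Lemma cont_cos p : continuous (fun x : V => cos (dot (freq p) x)).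
Proof.
have -> : (fun x : V => cos (dot (freq p) x)) = (fun x => cos (dot (freq p) x + 0)) by apply/funext => x; rewrite addr0.
exact: cont_cosdot.
Qed.

Lemma cont_sin p : continuous (fun x : V => sin (dot (freq p) x)).
Proof.
have -> : (fun x : V => sin (dot (freq p) x)) = (fun x => cos (dot (freq p) x + - (pi / 2))).
  by apply/funext => x; rewrite cosBpihalf.
exact: cont_cosdot.
Qed.

Lemma periodic_cos p b : periodic (fun x : V => cos (dot (freq p) x + b)).
Proof.
move=> i x; rewrite dotDr dotZr dot_delta mxE addrAC [2 * pi * _]mulrC.
exact: cosD2pi_int.
Qed.

End Mean.

(** * Fourier coefficients of continuous periodic functions *)

Section FourierCoefficients.
Definition ft f xi : C := fourier f xi.

Lemma ftE f xi : ft f xi = (mean (fun x => f x * cos (dot (freq xi) x)) +i*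
   - mean (fun x => f x * sin (dot (freq xi) x)))%C.
Proof.
rewrite /ft /fourier.
by apply/eqP; rewrite eq_complex /= !mul0r subr0 addr0 mulrN !eqxx.
Qed.

Lemma complexP (z w : C) : complex.Re z = complex.Re w -> complex.Im z = complex.Im w -> z = w.
Proof. by case: z w => a b [a' b'] /= -> ->. Qed.

Lemma ReJ (z : C) : complex.Re (z^*)%C = complex.Re z. Proof. by case: z. Qed.

Lemma ImJ (z : C) : complex.Im (z^*)%C = - complex.Im z. Proof. by case: z. Qed.

Lemma normcJ (z : C) : normc (z^*)%C = normc z. Proof. by case: z => a b /=; rewrite sqrrN. Qed.

Lemma half2 : ((2 : R)^-1)%:C%C * 2 = 1 :> C.
Proof. by rewrite -(rmorph_nat (real_complex R)) -rmorphM mulVf ?rmorph1. Qed.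

Lemma half_dbl (S : C) : ((2 : R)^-1)%:C%C * (S + S) = S.
Proof.
transitivity (((2 : R)^-1)%:C%C * 2 * S); first by ring.
by rewrite half2 mul1r.
Qed.

Lemma ftD f g xi : continuous f -> continuous g -> ft (fun x => f x + g x) xi = ft f xi + ft g xi.
Proof.
move=> cf cg; have cc := @cont_cos xi; have cs := @cont_sin xi.
have cfc := contM cf cc; have cgc := contM cg cc; have cfs := contM cf cs; have cgs := contM cg cs.
rewrite !ftE; apply: complexP => /=.
  by rewrite -meanD //; congr mean; apply/funext => x; rewrite mulrDl.
by rewrite -opprD -meanD //; congr (- mean _); apply/funext => x; rewrite mulrDl.
Qed.

Lemma ftZ (c : R) f xi : continuous f -> ft (fun x => c * f x) xi = c%:C%C * ft f xi.
Proof.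
move=> cf; have cc := @cont_cos xi; have cs := @cont_sin xi.
have cfc := contM cf cc; have cfs := contM cf cs.
rewrite !ftE; apply: complexP => /=; rewrite mul0r ?subr0 ?addr0.
  by rewrite -meanZ //; congr mean; apply/funext => x; rewrite mulrA.
by rewrite mulrN -meanZ //; congr (- mean _); apply/funext => x; rewrite mulrA.
Qed.

Lemma ftB f g xi : continuous f -> continuous g -> ft (fun x => f x - g x) xi = ft f xi - ft g xi.
Proof.
move=> cf cg; rewrite (_ : (fun x => f x - g x) = (fun x => f x + (fun x => -1 * g x) x)).
  by rewrite ftD ?ftZ //; [rewrite rmorphN rmorph1 mulN1r | exact: contZl].
by apply/funext => x; rewrite mulN1r.
Qed.

Lemma ft_sum (I : Type) (r : seq I) (F : I -> V -> R) xi : (forall i, continuous (F i)) ->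
  ft (fun x => \sum_(i <- r) F i x) xi = \sum_(i <- r) ft (F i) xi.
Proof.
move=> cF; elim: r => [|i r IH].
  rewrite big_nil (_ : (fun x => _) = (fun x : V => 0 * (fun=> 0) x)).
    by rewrite ftZ ?mul0r //; exact: cont_cst.
  by apply/funext => x; rewrite big_nil mul0r.
rewrite big_cons -IH -ftD //; last exact: cont_sum.
by congr ft; apply/funext => x; rewrite big_cons.
Qed.

Lemma ft_opp f xi : continuous f -> ft f (- xi) = ((ft f xi)^*)%C.
Proof.
move=> cf; rewrite !ftE; apply: complexP => /=.
  by congr mean; apply/funext => x; rewrite freqN dotNl cosN.
rewrite opprK -[RHS]opprK -mulN1r -[- _ in RHS]mulN1r -meanZ.
  by rewrite mulN1r opprK; congr mean; apply/funext => x; rewrite freqN dotNl sinN mulrN mulN1r opprK.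
by apply: contM => //; exact: cont_sin.
Qed.

Definition ex (b : R) : C := (cos b +i* sin b)%C.

Definition pr (c : C) p (x : V) : R := complex.Re (c * ex (dot (freq p) x)).

Lemma prE c p x : pr c p x = complex.Re c * cos (dot (freq p) x) - complex.Im c * sin (dot (freq p) x).
Proof. by case: c. Qed.

Lemma pr_cont c p : continuous (pr c p).
Proof.
have -> : pr c p = (fun x => complex.Re c * cos (dot (freq p) x) - complex.Im c * sin (dot (freq p) x)).
  by apply/funext => x; rewrite prE.
by apply: contB; apply: contZl; [exact: cont_cos | exact: cont_sin].
Qed.

Lemma pr_periodic c p : periodic (pr c p).
Proof.
move=> i x; rewrite !prE -!cosBpihalf periodic_cos.
by have := @periodic_cos p 0 i x; rewrite !addr0 => ->.
Qed.

Lemma mean_lin a b f g : continuous f -> continuous g ->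
  mean (fun x => a * f x + b * g x) = a * mean f + b * mean g.
Proof. by move=> cf cg; rewrite meanD ?meanZ //; exact: contZl. Qed.

Lemma ft_pr_mul c p g xi : continuous g ->
  ft (fun x => pr c p x * g x) xi = (2^-1)%:C%C * (c * ft g (xi - p) + (c^*)%C * ft g (xi + p)).
Proof.
move=> cg.
have cc := @cont_cos xi; have cs := @cont_sin xi.
have dc := @cont_cos p; have ds := @cont_sin p.
pose CC x := g x * cos (dot (freq xi) x) * cos (dot (freq p) x).
pose CS x := g x * cos (dot (freq xi) x) * sin (dot (freq p) x).
pose SC x := g x * sin (dot (freq xi) x) * cos (dot (freq p) x).
pose SS x := g x * sin (dot (freq xi) x) * sin (dot (freq p) x).
have cCC : continuous CC by apply: contM => //; exact: contM.
have cCS : continuous CS by apply: contM => //; exact: contM.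
have cSC : continuous SC by apply: contM => //; exact: contM.
have cSS : continuous SS by apply: contM => //; exact: contM.
case: c => a b; rewrite !ftE.
have e1 : mean (fun x => g x * cos (dot (freq (xi - p)) x)) = mean CC + mean SS.
  rewrite -meanD //; congr mean; apply/funext => x.
  by rewrite freqB dotDl dotNl cosB /CC /SS; ring.
have e2 : mean (fun x => g x * sin (dot (freq (xi - p)) x)) = mean SC - mean CS.
  rewrite -meanB //; congr mean; apply/funext => x.
  by rewrite freqB dotDl dotNl sinB /SC /CS; ring.
have e3 : mean (fun x => g x * cos (dot (freq (xi + p)) x)) = mean CC - mean SS.
  rewrite -meanB //; congr mean; apply/funext => x.
  by rewrite freqD dotDl cosD /CC /SS; ring.
have e4 : mean (fun x => g x * sin (dot (freq (xi + p)) x)) = mean SC + mean CS.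
  rewrite -meanD //; congr mean; apply/funext => x.
  by rewrite freqD dotDl sinD /SC /CS; ring.
have e5 : mean (fun x => pr (a +i* b)%C p x * g x * cos (dot (freq xi) x)) = a * mean CC + (- b) * mean CS.
  rewrite -mean_lin //; congr mean; apply/funext => x.
  by rewrite prE /= /CC /CS; ring.
have e6 : mean (fun x => pr (a +i* b)%C p x * g x * sin (dot (freq xi) x)) = a * mean SC + (- b) * mean SS.
  rewrite -mean_lin //; congr mean; apply/funext => x.
  by rewrite prE /= /SC /SS; ring.
by rewrite e1 e2 e3 e4 e5 e6; apply: complexP => /=; field.
Qed.

Lemma normcE (z : C) : normc z ^+ 2 = complex.Re z ^+ 2 + complex.Im z ^+ 2.
Proof. by case: z => a b /=; rewrite sqr_sqrtr // addr_ge0 ?sqr_ge0. Qed.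

Lemma normc_ge0 (z : C) : 0 <= normc z. Proof. by case: z => a b; exact: sqrtr_ge0. Qed.

Lemma pr_norm c p x : `|pr c p x| <= normc c.
Proof.
rewrite prE -[leRHS](ger0_norm (normc_ge0 c)) -ler_sqr ?nnegrE // !real_normK ?num_real // normcE.
set a := complex.Re c; set b := complex.Im c; set u := cos _; set v := sin _.
have h : u ^+ 2 + v ^+ 2 = 1 by exact: cos2Dsin2.
have -> : a ^+ 2 + b ^+ 2 = (a ^+ 2 + b ^+ 2) * (u ^+ 2 + v ^+ 2) by rewrite h mulr1.
by have := sqr_ge0 (a * v + b * u); clra.
Qed.

(** Testing [f] against the real mode built from its own coefficient c gives |c|^2 <= e |c|, without
    the loss of bounding real and imaginary parts separately. *)
Lemma ft_norm f xi e : continuous f -> (forall x, `|f x| <= e) -> normc (ft f xi) <= e.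
Proof.
move=> cf fe; have e0 : 0 <= e by apply: le_trans (fe 0).
have cc := @cont_cos xi; have cs := @cont_sin xi.
set c := ft f xi; pose a := complex.Re c; pose b := complex.Im c.
have h : normc c ^+ 2 = mean (fun x => f x * pr ((c^*)%C) (- xi) x).
  rewrite normcE -/a -/b (_ : (fun x => f x * _) =
    (fun x => a * (f x * cos (dot (freq xi) x)) + (- b) * (f x * sin (dot (freq xi) x)))); last first.
    apply/funext => x; rewrite prE freqN dotNl cosN sinN ReJ ImJ -/a -/b; ring.
  by rewrite mean_lin; [rewrite /a /b /c ftE /=; ring | exact: contM | exact: contM].
have h2 : normc c ^+ 2 <= e * normc c.
  rewrite h; apply: le_trans (ler_norm _) _; apply: mean_norm.
    by apply: contM => //; exact: pr_cont.
  move=> x; rewrite normrM; apply: ler_pM => //; apply: le_trans (pr_norm _ _ _) _.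
  by rewrite normcJ.
have := normc_ge0 c; rewrite le_eqVlt => /predU1P[<- //|c0].
by rewrite expr2 ler_pM2r in h2.
Qed.

Lemma ft1 xi : ft (fun=> 1) xi = if xi == 0 then 1 else 0.
Proof.
rewrite ftE.
have -> : (fun x : V => 1 * cos (dot (freq xi) x)) = (fun x => cos (dot (freq xi) x + 0)).
  by apply/funext => x; rewrite mul1r addr0.
have -> : (fun x : V => 1 * sin (dot (freq xi) x)) = (fun x => cos (dot (freq xi) x + - (pi / 2))).
  by apply/funext => x; rewrite mul1r cosBpihalf.
by rewrite !mean_cos cos0 cosN cos_pihalf; case: ifP => _; rewrite oppr0.
Qed.

Definition bx P : seq Z :=
  [seq \row_i ((t i : nat)%:Z - P%:Z) | t : {ffun 'I_d -> 'I_(2 * P).+1}].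

Lemma bx_uniq P : uniq (bx P).
Proof.
rewrite map_inj_uniq ?enum_uniq // => t t' /rowP h; apply/ffunP => i; apply: val_inj.
by have := h i; rewrite !mxE => /addIr[].
Qed.

Lemma mem_bx P xi : (xi \in bx P) = [forall i, (absz (xi 0%R i) <= P)%N].
Proof.
apply/mapP/forallP => [[t _ ->] i|h].
  rewrite mxE; have := ltn_ord (t i); move: (t i : nat) => k; clear; lia.
have hlt i : (absz (xi 0%R i + P%:Z)%R < (2 * P).+1)%N by have := h i; move: (xi 0%R i) => k; clear; lia.
exists [ffun i => Ordinal (hlt i)]; first by rewrite mem_enum.
apply/rowP => i; rewrite mxE ffunE /=.
by have := h i; move: (xi 0%R i) => k; clear; lia.
Qed.

Lemma bx_opp P xi : (- xi \in bx P) = (xi \in bx P).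
Proof. by rewrite !mem_bx; apply: eq_forallb => i; rewrite mxE abszN. Qed.

Lemma bx_sum_opp P (A : nmodType) (F : Z -> A) : \sum_(p <- bx P) F (- p) = \sum_(p <- bx P) F p.
Proof.
rewrite -(big_map (fun p => - p) predT F); apply: perm_big; apply: uniq_perm; rewrite ?bx_uniq //.
  by rewrite map_inj_uniq ?bx_uniq //; exact: oppr_inj.
move=> xi; apply/mapP/idP => [[p pP ->]|xP]; first by rewrite bx_opp.
by exists (- xi); rewrite ?opprK ?bx_opp.
Qed.

Definition herm (c : Z -> C) := forall p, c (- p) = ((c p)^*)%C.

(** The real part is taken mode by mode, which keeps the function real. For Hermitian coefficients
    it is the usual partial sum, because the box is symmetric. *)
Definition syn (c : Z -> C) P (x : V) : R := \sum_(p <- bx P) pr (c p) p x.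

Lemma syn_cont c P : continuous (syn c P). Proof. by apply: cont_sum => p; exact: pr_cont. Qed.

Lemma syn_cp c P : cp (syn c P).
Proof.
split; first exact: syn_cont.
by move=> i x; apply: eq_bigr => p _; exact: pr_periodic.
Qed.

Lemma ft_syn_mul c P g xi : herm c -> continuous g ->
  ft (fun x => syn c P x * g x) xi = \sum_(p <- bx P) c p * ft g (xi - p).
Proof.
move=> hc cg.
rewrite (_ : (fun x => _) = (fun x => \sum_(p <- bx P) (pr (c p) p x * g x))); last first.
  by apply/funext => x; rewrite mulr_suml.
rewrite ft_sum; last by move=> p; apply: contM => //; exact: pr_cont.
under eq_bigr => p _ do rewrite ft_pr_mul //.
rewrite -mulr_sumr big_split /=.
rewrite -(bx_sum_opp P (fun p => (c p)^*%C * ft g (xi + p))) /=.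
under [X in _ + X]eq_bigr => p _ do rewrite hc conjcK.
exact: half_dbl.
Qed.

Lemma ft_syn c P xi : herm c -> ft (syn c P) xi = if xi \in bx P then c xi else 0.
Proof.
move=> hc; have := ft_syn_mul P xi hc (@cont_cst R d 1).
rewrite (_ : (fun x => _) = syn c P); last by apply/funext => x; rewrite mulr1.
move=> ->; case: ifP => xP.
  rewrite (bigD1_seq xi) ?bx_uniq //= subrr ft1 eqxx mulr1 big1 ?addr0 // => p px.
  by rewrite ft1 subr_eq0 eq_sym (negbTE px) mulr0.
rewrite big_seq big1 // => p pP; rewrite ft1 subr_eq0; case: eqP => [E|_]; last by rewrite mulr0.
by rewrite E pP in xP.
Qed.

Lemma ft_herm f : continuous f -> herm (ft f).
Proof. by move=> cf p; exact: ft_opp. Qed.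

Lemma mean_EN N (G : V -> Z -> R) : (forall z, continuous (fun x => G x z)) ->
  mean (fun x => EN N (G x)) = EN N (fun z => mean (fun x => G x z)) /\ continuous (fun x => EN N (G x)).
Proof.
move=> cG; rewrite /EN.
have AV M v (H : V -> Z -> R) : (forall z, continuous (fun x => H x z)) -> forall z,
   continuous (fun x => av M v (H x) z) /\ mean (fun x => av M v (H x) z) = av M v (fun z => mean (fun x => H x z)) z.
  move=> cH z; rewrite /av.
  have ce : forall i : 'I_M.+1, continuous (fun x => 'C(M, i)%:R / 2 ^+ M * H x (z + v *+ i)).
    by move=> i; exact: contZl.
  split; first exact: cont_sum.
  rewrite mean_sum //; apply: eq_bigr => i _; exact: meanZ.
suff H : forall s z, mean (fun x => EV N s (G x) z) = EV N s (fun z => mean (fun x => G x z)) z /\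
   continuous (fun x => EV N s (G x) z) by exact: (H _ 0).
elim=> [|v s IH] z /=; first by split.
have [c1 m1] := AV (2 * N)%N v (fun x => EV N s (G x)) (fun z => (IH z).2) (z - v *+ N).
split=> //; rewrite /BN m1; congr (av _ _ _ _); apply/funext => k; exact: (IH k).1.
Qed.

(** Writing s = q^2 splits the decay: one q^N absorbs a factor N, the other is left for the
    induction hypothesis. *)
Lemma pow_decay_bounded k (s : R) : 0 <= s < 1 -> exists2 B : R, 0 < B & forall N, N%:R ^+ k * s ^+ N <= B.
Proof.
elim: k s => [|k IH] s /andP[s0 s1].
  by exists 1 => // N; rewrite expr0 mul1r exprn_ile1 // ltW.
have q0 : 0 <= Num.sqrt s := sqrtr_ge0 s.
have q1 : Num.sqrt s < 1 by rewrite -sqrtr1 ltr_sqrt.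
have qq : Num.sqrt s ^+ 2 = s by rewrite sqr_sqrtr.
set q := Num.sqrt s in q0 q1 qq.
have [|B B0 HB] := IH q; first by rewrite q0.
exists ((1 - q)^-1 * B) => [|N]; first by rewrite mulr_gt0 // invr_gt0 subr_gt0.
have h1 : N%:R * q ^+ N <= (1 - q)^-1.
  rewrite -[leRHS]mul1r ler_pdivlMr ?subr_gt0 //.
  suff h n : n%:R * q ^+ n * (1 - q) <= 1 - q ^+ n.
    by apply: le_trans (h N) _; rewrite lerBlDr lerDl exprn_ge0.
  elim: n => [|n IHn]; first by rewrite !mul0r expr0 subrr.
  have f1 := ler_wpM2r q0 IHn.
  have f2 : 0 <= q ^+ n by exact: exprn_ge0.
  have f4 : q ^+ n * q * (1 - q) <= 1 * (1 - q).
    by rewrite ler_wpM2r ?subr_ge0 ?(ltW q1) // mulr_ile1 ?exprn_ile1 // ltW.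
  by rewrite exprSr -(natr1 n); move: f1 f4; clra.
rewrite exprS -qq -exprM mulnC exprM.
rewrite (_ : N%:R * N%:R ^+ k * (q ^+ N) ^+ 2 = (N%:R * q ^+ N) * (N%:R ^+ k * q ^+ N)); last by ring.
by apply: ler_pM => //; rewrite mulr_ge0 // exprn_ge0.
Qed.

Lemma pow_decay k (s e : R) : 0 <= s < 1 -> 0 < e -> exists2 N, (0 < N)%N & N%:R ^+ k * s ^+ N <= e.
Proof.
move=> s01 e0; have [B B0 HB] := @pow_decay_bounded k.+1 s s01.
exists (Num.truncn (B / e)).+1 => //; set N := _.+1.
have N0 : 0 < N%:R :> R by [].
have h : B <= e * N%:R by rewrite mulrC -ler_pdivrMr // ltW // truncnS_gt.
rewrite -(ler_pM2r N0); apply: le_trans h; apply: le_trans (HB N).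
by rewrite exprS mulrAC [_ ^+ k * _]mulrC.
Qed.

Lemma EV_at0 N s (F : Z -> R) : (forall z, 0 <= F z) -> aN N ^+ size s * F 0 <= EV N s F 0.
Proof.
move=> F0; elim: s => [|v s IH] /=; first by rewrite expr0 mul1r.
have G0 z : 0 <= EV N s F z by rewrite -(@EV_cst R d N s 0 z); exact: EV_mono.
apply: (@le_trans _ _ (aN N * EV N s F 0)).
  by rewrite exprS -mulrA ler_wpM2l // ltW // aN_gt0.
have h : (N < (2 * N).+1)%N by rewrite ltnS leq_pmull.
rewrite /BN /av (bigD1 (Ordinal h)) //= sub0r addNr.
have -> : 'C(2 * N, N)%:R / 2 ^+ (2 * N) = aN N :> R by rewrite /aN exprM; congr (_ / _ ^+ N); ring.
rewrite lerDl.
by apply: sumr_ge0 => i _; rewrite mulr_ge0 // divr_ge0 // exprn_ge0.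
Qed.

Lemma cos_half (t : R) : cos t = 2 * cos (t / 2) ^+ 2 - 1.
Proof.
have := cos_mulr2n (t / 2); have -> : (t / 2) *+ 2 = t by rewrite -mulr_natr divfK.
by move=> ->; rewrite -mulr_natr; ring.
Qed.

Lemma cont_norm f : continuous f -> continuous (fun x => `|f x|).
Proof. by move=> cf x; exact: (continuous_comp (cf x) (@norm_continuous _ _ _)). Qed.

Lemma cos_eq1 (t : R) : cos t = 1 -> exists n : int, t = n%:~R * (2 * pi).
Proof.
move=> ct; have p0 := @pi2_gt0 R; exists (Num.floor (t / (2 * pi))).
set n := Num.floor _; set u := t - n%:~R * (2 * pi).
have u0 : 0 <= u by rewrite subr_ge0 -ler_pdivlMr // floor_le_tmp.
have u2 : u < 2 * pi by have := floorD1_gt (t / (2 * pi)); rewrite intrD ltr_pdivrMr // mulrDl mul1r ltrBlDl.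
have cu : cos u = 1 by rewrite -ct -(cosD2pi_int u n) subrK.
have [u00|un] := eqVneq u 0; first by apply/eqP; rewrite -subr_eq0; apply/eqP.
have up : 0 < u by rewrite lt_neqAle eq_sym un.
have su : 0 < sin (u / 2) by apply: sin_gt0_pi; rewrite divr_gt0 //= ltr_pdivrMr // mulrC.
have : cos u = 1 - 2 * sin (u / 2) ^+ 2 by rewrite cos_half cos2sin2; ring.
by rewrite cu; have := exprn_gt0 2 su; clra.
Qed.

(* The kernel [prod_i cos(x_i/2)^(2N)] is the characteristic function of the
   binomial walk, so convolving with it is a finite combination of Fourier modes. *)
Lemma ft_eq0 f : cp f -> (forall xi, ft f xi = 0) -> forall x, f x = 0.
Proof.
move=> cpf f0 x; have [cf pf] := cpf; apply/eqP; rewrite -normr_le0; apply/ler_addgt0Pr => e e0.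
rewrite add0r.
pose k1 (y : V) := \prod_(i < d) cos ((x - y) 0 i / 2) ^+ 2.
have k1_ge0 y : 0 <= k1 y by apply: prodr_ge0 => i _; exact: sqr_ge0.
have c2le1 t : cos t ^+ 2 <= 1 :> R by have := sqr_ge0 (sin t); have := cos2Dsin2 t; clra.
have k1_le1 y : k1 y <= 1.
  rewrite -[leRHS](_ : \prod_(i < d) (1 : R) = 1); last by rewrite big1.
  by apply: ler_prod => i _; rewrite sqr_ge0 c2le1.
have kE N y : k1 y ^+ N = EN N (fun z => cos (dot (x - y) (freq z) + 0)) by rewrite EN_cos cos0 mulr1.
have cterm z : continuous (fun y : V => cos (dot (x - y) (freq z) + 0)).
  have -> : (fun y : V => cos (dot (x - y) (freq z) + 0)) = (fun y => cos (dot (freq (- z)) y + dot x (freq z))).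
    by apply/funext => y; congr cos; rewrite addr0 dotDl dotNl freqN dotNl (dotC (freq z)) addrC.
  exact: cont_cosdot.
have kN N : (fun y => k1 y ^+ N) = fun y => EN N (fun z => cos (dot (x - y) (freq z) + 0)) by apply/funext => y; rewrite kE.
have ck N : continuous (fun y => k1 y ^+ N).
  by rewrite kN; have [_] := @mean_EN N (fun y z => cos (dot (x - y) (freq z) + 0)) cterm.
have mlow N : aN N ^+ d <= mean (fun y => k1 y ^+ N).
  rewrite kN (@mean_EN N (fun y z => cos (dot (x - y) (freq z) + 0)) cterm).1.
  set F := (fun z => _); have FE z : F z = (if z == 0 then 1 else 0).
    rewrite /F (_ : (fun y => _) = (fun y => cos (dot (freq (- z)) y + dot x (freq z)))).
      by rewrite mean_cos oppr_eq0; case: eqP => // ->; rewrite freq0 dotC /dot big1 ?cos0 // => i _; rewrite mxE mul0r.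
    by apply/funext => y; congr cos; rewrite addr0 dotDl dotNl freqN dotNl (dotC (freq z)) addrC.
  have F0 z : 0 <= F z by rewrite FE; case: ifP.
  apply: le_trans (EV_at0 N _ F0); rewrite FE eqxx mulr1 [X in _ <= _ ^+ X](_ : _ = d) //.
  exact: etrans (size_map _ _) (size_enum_ord _).
have mf0 N : mean (fun y => f y * k1 y ^+ N) = 0.
  rewrite (_ : (fun y => _) = (fun y => EN N (fun z => f y * cos (dot (x - y) (freq z) + 0)))); last first.
    by apply/funext => y; rewrite kE ENZ.
  rewrite (@mean_EN N (fun y z => f y * cos (dot (x - y) (freq z) + 0)) _).1; last by move=> z; exact: contM.
  transitivity (EN N (fun _ : Z => 0 : R)); last exact: EN_cst.
  apply: EN_ext => z.
  have := f0 z; rewrite ftE => /eqP; rewrite eq_complex /= oppr_eq0 => /andP[/eqP h1 /eqP h2].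
  rewrite (_ : (fun y => _) = (fun y => cos (dot (freq z) x) * (f y * cos (dot (freq z) y)) + sin (dot (freq z) x) * (f y * sin (dot (freq z) y)))).
    rewrite mean_lin ?h1 ?h2 ?mulr0 ?addr0 //; apply: contM => //; [exact: cont_cos|exact: cont_sin].
  by apply/funext => y; rewrite addr0 dotDl dotNl (dotC x) (dotC y) cosB; ring.
have [B B0 HB] := cp_bounded cpf.
(* The kernel equals 1 only at translates of [x] by periods, where f = f x. On the compact set where
   [f] differs from f x by e/2, its maximum is therefore below 1. *)
have [s s01 Hs] : exists2 s : R, 0 <= s < 1 & forall y, box y -> e / 2 <= `|f y - f x| -> k1 y <= s.
  pose A := box (d := d) `&` [set y | e / 2 <= `|f y - f x|].
  have [A0|/set0P A0] := eqVneq A set0.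
    exists 0 => [|y bly fy]; first by rewrite lexx ltr01.
    have : A y by []. 
    by rewrite A0.
  have cA : compact A.
    apply: compact_closedI; first exact: box_compact.
    pose g (y : V) := `|f y - f x|.
    have cg : continuous g by apply: cont_norm; apply: contB => //; exact: cont_cst.
    rewrite (_ : [set y | _] = g @^-1` [set t | e / 2 <= t]) //.
    by apply: closed_comp => [y _|]; [exact: cg | exact: closed_ge].
  have ck1 : {within A, continuous k1}.
    apply: continuous_subspaceT; have := ck 1%N.
    by rewrite (_ : (fun y => k1 y ^+ 1) = k1) //; apply/funext => y; rewrite expr1.
  have [c cA' cmax] := EVT_max_rV A0 cA ck1; rewrite inE in cA'.
  exists (k1 c) => [|y bly fy]; last by apply: cmax; rewrite inE.
  rewrite k1_ge0 /= lt_neqAle k1_le1 andbT; apply/negP => /eqP k1c.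
  have all1 i : cos ((x - c) 0 i) = 1.
    have : cos ((x - c) 0 i / 2) ^+ 2 = 1.
      apply/eqP; rewrite eq_le c2le1 /=; move: k1c; rewrite /k1 (bigD1 i) //= => k1c.
      rewrite -[leLHS]k1c; apply: ler_piMr; first exact: sqr_ge0.
      rewrite -[leRHS](_ : \prod_(j < d | j != i) (1 : R) = 1); last by rewrite big1.
      by apply: ler_prod => j _; rewrite sqr_ge0 c2le1.
    by move=> h; rewrite cos_half h; ring.
  have fc : f c = f x.
    pose n (i : 'I_d) := projT1 (cid (cos_eq1 (all1 i))).
    rewrite -(periodic_freq (\row_i n i) c pf); congr f; apply/rowP => i; rewrite !mxE.
    have := projT2 (cid (cos_eq1 (all1 i))); rewrite -/(n i) !mxE => E.
    by rewrite mulrC -E addrC subrK.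
  have [_] := cA'; rewrite /= fc subrr normr0; move: e0; clra.
(* The kernel's mean is at least (2N)^(-d), while the contribution from far points decays like
   s^N. *)
have e20 : 0 < e / 2 / (2 ^+ d * (2 * B + 1)) by rewrite !divr_gt0 // mulr_gt0 ?exprn_gt0 // ltr_wpDl // mulr_ge0.
have [N N0 HN] := @pow_decay d s _ s01 e20.
have N0R : 1 <= N%:R :> R by rewrite ler1n.
set pN := mean (fun y => k1 y ^+ N).
have a0 : 0 < aN N ^+ d :> R by rewrite exprn_gt0 // aN_gt0.
have pN0 : 0 < pN by exact: lt_le_trans a0 (mlow N).
have aNN : 1 <= aN N * (2 * N%:R) :> R.
  apply: aN_ge => //; rewrite expr2; exact: ler_peMr.
have fx : f x * pN = - mean (fun y => (f y - f x) * k1 y ^+ N).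
  rewrite (_ : (fun y => (f y - f x) * _) = (fun y => f y * k1 y ^+ N - f x * k1 y ^+ N)); last first.
    by apply/funext => y; rewrite mulrBl.
  rewrite meanB; [|exact: contM|exact: contZl].
  by rewrite mf0 meanZ // sub0r opprK.
have bound : `|f x * pN| <= e / 2 * pN + 2 * B * s ^+ N.
  rewrite fx normrN.
  have cb : continuous (fun y => (f y - f x) * k1 y ^+ N) by apply: contM => //; apply: contB => //; exact: cont_cst.
  have ptw y : `|(f y - f x) * k1 y ^+ N| <= e / 2 * k1 y ^+ N + 2 * B * s ^+ N.
    have [k bk] := mod_box y.
    have kper : k1 (y + (2 * pi) *: freq k) ^+ N = k1 y ^+ N.
      rewrite !kE; apply: EN_ext => z; rewrite !addr0.
      have -> : dot (x - (y + (2 * pi) *: freq k)) (freq z) = dot (x - y) (freq z) + (- \sum_i k 0 i * z 0 i)%:~R * (2 * pi).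
        have -> : x - (y + (2 * pi) *: freq k) = (x - y) + (- (2 * pi)) *: freq k by rewrite opprD addrA scaleNr.
        rewrite dotDl dotZl; congr (_ + _).
        rewrite rmorphN /= !mulNr mulrC; congr (- (_ * _)); rewrite /dot rmorph_sum /=.
        by apply: eq_bigr => i _; rewrite !mxE rmorphM.
      exact: cosD2pi_int.
    rewrite -kper -(periodic_freq k y pf); set y' := y + _ in bk *.
    have kN0 : 0 <= k1 y' ^+ N by rewrite exprn_ge0.
    have s0 : 0 <= s ^+ N by rewrite exprn_ge0 //; case/andP: s01.
    rewrite normrM (ger0_norm kN0).
    have [h|h] := leP (e / 2) `|f y' - f x|.
      apply: (@le_trans _ _ (2 * B * s ^+ N)).
        apply: ler_pM => //.
          by apply: le_trans (ler_normB _ _) _; have := HB y'; have := HB x; clra.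
        by apply: lerXn2r; rewrite ?nnegrE //; [case/andP: s01 | exact: Hs].
      by rewrite lerDr mulr_ge0 // divr_ge0 // ltW.
    apply: (@le_trans _ _ (e / 2 * k1 y' ^+ N)); first by rewrite ler_wpM2r // ltW.
    by rewrite lerDl mulr_ge0 // mulr_ge0.
  have cr : continuous (fun y => e / 2 * k1 y ^+ N + 2 * B * s ^+ N).
    by apply: contD; [exact: contZl | exact: cont_cst].
  have up : mean (fun y => e / 2 * k1 y ^+ N + 2 * B * s ^+ N) = e / 2 * pN + 2 * B * s ^+ N.
    by rewrite meanD; [rewrite mean_cst meanZ | exact: contZl | exact: cont_cst].
  rewrite -up ler_norml; apply/andP; split.
    rewrite lerNl -mulN1r -meanZ //; apply: mean_le => //; first exact: contZl.
    by move=> y; apply: le_trans (ptw y); rewrite mulN1r -normrN ler_norm.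
  by apply: mean_le => // y; apply: le_trans (ptw y); exact: ler_norm.
rewrite -(ler_pM2r pN0) -{1}(ger0_norm (ltW pN0)) -normrM; apply: le_trans bound _.
suff h : 2 * B * s ^+ N <= e / 2 * pN by move: h; clra.
apply: (@le_trans _ _ (e / 2 * aN N ^+ d)); last by rewrite ler_wpM2l ?mlow // divr_ge0 // ltW.
rewrite -(ler_pM2r (_ : 0 < (2 * N%:R) ^+ d)); last by rewrite exprn_gt0 // mulr_gt0 // (lt_le_trans ltr01 N0R).
rewrite -[2 * B * _ * _]mulrA -[leRHS]mulrA -exprMn.
apply: (@le_trans _ _ (e / 2)); last first.
  by rewrite ler_peMr ?exprn_ege1 // divr_ge0 // ltW.
have B1 : 0 < 2 * B + 1 by rewrite ltr_wpDl // mulr_ge0.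
apply: (@le_trans _ _ ((2 * B + 1) * (s ^+ N * (2 * N%:R) ^+ d))).
  apply: ler_wpM2r; last by rewrite lerDl.
  by rewrite mulr_ge0 // exprn_ge0 // ?mulr_ge0 //; case/andP: s01.
have := ler_wpM2l (ltW (mulr_gt0 (exprn_gt0 d (ltr0Sn R 1)) B1)) HN.
rewrite [leRHS]mulrC divfK ?gt_eqF ?mulr_gt0 ?exprn_gt0 // => h.
by apply: le_trans h; rewrite exprMn le_eqVlt; apply/orP; left; apply/eqP; ring.
Qed.

End FourierCoefficients.

(** * Sobolev weights and their sums over frequency boxes *)

Section Weights.
Lemma ler_psum (I : eqType) (r : seq I) (P Q : pred I) (F : I -> R) :
  (forall i, i \in r -> P i -> Q i) -> (forall i, i \in r -> 0 <= F i) ->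
  \sum_(i <- r | P i) F i <= \sum_(i <- r | Q i) F i.
Proof.
move=> PQ F0; rewrite [leRHS](bigID P) /=.
have -> : \sum_(i <- r | Q i && P i) F i = \sum_(i <- r | P i) F i.
  rewrite big_seq_cond [RHS]big_seq_cond; apply: eq_bigl => i.
  by case ri : (i \in r) => //=; case Pi : (P i); rewrite ?andbF // andbT PQ.
by rewrite lerDl big_seq_cond; apply: sumr_ge0 => i /andP[ri _]; exact: F0.
Qed.

Lemma ler_sum_sub (I : eqType) (r s : seq I) (F : I -> R) :
  uniq r -> uniq s -> {subset r <= s} -> (forall i, 0 <= F i) ->
  \sum_(i <- r) F i <= \sum_(i <- s) F i.
Proof.
move=> ur us rs F0.
have -> : \sum_(i <- r) F i = \sum_(i <- s | i \in r) F i.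
  rewrite -[RHS]big_filter; apply: perm_big; apply: uniq_perm => //; first exact: filter_uniq.
  by move=> i; rewrite mem_filter; case ri : (i \in r) => //=; rewrite rs.
by apply: ler_psum.
Qed.

(** The quadratic form with coefficients A, C, B is nonnegative; its value at (C, -A) is A (AB -
    C^2). When A = 0, the value at ((B + 1)/C, -1) is negative unless C = 0. *)
Lemma cauchy_schwarz (I : Type) (r : seq I) (P : pred I) (a b : I -> R) :
  (\sum_(i <- r | P i) a i * b i) ^+ 2 <= (\sum_(i <- r | P i) a i ^+ 2) * (\sum_(i <- r | P i) b i ^+ 2).
Proof.
set A := \sum_(i <- r | P i) a i ^+ 2; set B := \sum_(i <- r | P i) b i ^+ 2; set C := \sum_(i <- r | P i) _.
have key (u v : R) : 0 <= u ^+ 2 * A + 2 * u * v * C + v ^+ 2 * B.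
  have -> : u ^+ 2 * A + 2 * u * v * C + v ^+ 2 * B = \sum_(i <- r | P i) (u * a i + v * b i) ^+ 2.
    rewrite /A /B /C !mulr_sumr -!big_split /=; apply: eq_bigr => i _; ring.
  by apply: sumr_ge0 => i _; exact: sqr_ge0.
have A0 : 0 <= A by apply: sumr_ge0 => i _; exact: sqr_ge0.
have [Ap|An] := ltP 0 A.
  have := key C (- A); rewrite (_ : _ + _ = A * (A * B - C ^+ 2)); last by ring.
  by rewrite pmulr_rge0 // subr_ge0.
have AE : A = 0 by apply/eqP; rewrite eq_le An A0.
have h1 := key (C * (B + 1)) (- 1 : R); move: h1; rewrite AE mulr0 add0r mul0r => h1.
have B0 : 0 <= B by apply: sumr_ge0 => i _; exact: sqr_ge0.
have h2 : 0 <= C ^+ 2 * B by rewrite mulr_ge0 ?sqr_ge0.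
have h3 := key (C * (B + 2)) (- 1 : R); rewrite AE mulr0 add0r in h3.
have [C0|Cn] := eqVneq C 0; first by rewrite C0 expr0n.
have C2 : 0 < C ^+ 2 by rewrite exprn_even_gt0.
have h4 := key (C^-1 * (B + 1)) (- 1 : R); rewrite AE mulr0 add0r in h4.
have : 2 * (C^-1 * (B + 1)) * -1 * C + (-1) ^+ 2 * B = - B - 2 by field.
move=> E; rewrite E in h4; move: h4 B0; clra.
Qed.

Definition jw xi : R := 1 + nz xi ^+ 2.
Definition jn xi : R := Num.sqrt (jw xi).

Lemma jw_ge1 xi : 1 <= jw xi. Proof. by rewrite lerDl sqr_ge0. Qed.
Lemma jw_gt0 xi : 0 < jw xi. Proof. exact: lt_le_trans ltr01 (jw_ge1 xi). Qed.
Lemma jwX_ge0 n xi : 0 <= jw xi ^+ n. Proof. by rewrite exprn_ge0 // ltW // jw_gt0. Qed.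
Lemma jn_sqr xi : jn xi ^+ 2 = jw xi. Proof. by rewrite sqr_sqrtr // ltW // jw_gt0. Qed.
Lemma jn_ge1 xi : 1 <= jn xi. Proof. by rewrite -sqrtr1 ler_wsqrtr // jw_ge1. Qed.
Lemma jn_gt0 xi : 0 < jn xi. Proof. exact: lt_le_trans ltr01 (jn_ge1 xi). Qed.
Lemma jn_ge0 xi : 0 <= jn xi. Proof. exact: ltW (jn_gt0 xi). Qed.
Lemma nz_le_jn xi : nz xi <= jn xi.
Proof.
by rewrite -(ger0_norm (nz_ge0 xi)) -sqrtr_sqr ler_wsqrtr // /jw lerDr.
Qed.
Lemma jwN xi : jw (- xi) = jw xi. Proof. by rewrite /jw nzN. Qed.
Lemma jnN xi : jn (- xi) = jn xi. Proof. by rewrite /jn jwN. Qed.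

Lemma jnD p q : jn (p + q) <= jn p + jn q.
Proof.
rewrite -(ger0_norm (jn_ge0 (p + q))) -(ger0_norm (addr_ge0 (jn_ge0 p) (jn_ge0 q))).
rewrite -ler_sqr ?nnegrE // !real_normK ?num_real // sqrrD !jn_sqr /jw.
have h1 : nz p * nz q <= jn p * jn q by apply: ler_pM; rewrite ?nz_ge0 ?nz_le_jn.
have h2 : nz (p + q) ^+ 2 <= (nz p + nz q) ^+ 2 by apply: lerXn2r; rewrite ?nnegrE ?addr_ge0 ?nz_ge0 ?nzD.
move: h1 h2; rewrite sqrrD; clra.
Qed.

Lemma jwD s p q : jw (p + q) ^+ s <= 4 ^+ s * (jw p ^+ s + jw q ^+ s).
Proof.
wlog pq : p q / jw p <= jw q.
  by move=> H; have [/H//|/ltW/H] := leP (jw p) (jw q); rewrite addrC [jw p ^+ s + _]addrC.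
apply: (@le_trans _ _ ((4 * jw q) ^+ s)).
  apply: lerXn2r; rewrite ?nnegrE ?mulr_ge0 ?(ltW (jw_gt0 _)) //.
  rewrite -!jn_sqr (_ : 4 * _ = (jn q + jn q) ^+ 2); last by ring.
  apply: lerXn2r; rewrite ?nnegrE ?addr_ge0 ?jn_ge0 //; apply: le_trans (jnD p q) _.
  by rewrite lerD2r ler_wsqrtr.
by rewrite exprMn ler_wpM2l ?exprn_ge0 // lerDr jwX_ge0.
Qed.

Definition Bx j := bx (2 ^ j).

Lemma bx_sub P Q : (P <= Q)%N -> {subset bx P <= bx Q}.
Proof.
by move=> PQ xi; rewrite !mem_bx => /forallP h; apply/forallP => i; apply: leq_trans (h i) PQ.
Qed.

Lemma Bx_sub i j : (i <= j)%N -> {subset Bx i <= Bx j}.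
Proof. by move=> ij; apply: bx_sub; rewrite leq_exp2l. Qed.

Lemma size_bx P : size (bx P) = ((2 * P).+1 ^ d)%N.
Proof. by rewrite size_map -cardE card_ffun !card_ord. Qed.

Lemma mem_Bx_ex (s : seq Z) : exists j, {subset s <= Bx j}.
Proof.
elim: s => [|xi s [j IH]]; first by exists 0%N.
pose N := (\sum_i absz (xi 0%R i))%N.
exists (maxn j N) => q; rewrite inE => /predU1P[->|/IH]; last by apply: Bx_sub; rewrite leq_maxl.
rewrite /Bx mem_bx; apply/forallP => i; apply: (@leq_trans N).
  by rewrite /N (bigD1 i) //= leq_addr.
by apply: leq_trans (leq_maxr j N) _; apply: ltnW; exact: ltn_expl.
Qed.

(** Outside the box of radius 2^j the weight is at most 4^(-ja), and the next box has at most (5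
    2^j)^d points. Since d < 2a are integers, d + 1 <= 2a, which leaves a full factor 2^(-j). *)
Lemma shell_sum a j : (d < 2 * a)%N ->
  \sum_(xi <- Bx j.+1 | xi \notin Bx j) (jw xi ^+ a)^-1 <= 5 ^+ d * 2^-1 ^+ j.
Proof.
move=> da.
apply: (@le_trans _ _ (\sum_(xi <- Bx j.+1) (4 ^+ (j * a))^-1)).
  apply: (@le_trans _ _ (\sum_(xi <- Bx j.+1 | xi \notin Bx j) (4 ^+ (j * a))^-1)); last first.
    by apply: ler_psum => // xi _; rewrite invr_ge0 exprn_ge0.
  apply: ler_sum => xi.
    move=> h; have [i hi] : exists i, (2 ^ j < absz (xi 0%R i))%N.
      have [//|nh] := pselect (exists i, (2 ^ j < absz (xi 0%R i))%N).
      case/negP: h; rewrite /Bx mem_bx; apply/forallP => i; rewrite leqNgt; apply/negP => hi.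
      by apply: nh; exists i.
    rewrite lef_pV2 ?posrE ?exprn_gt0 ?jw_gt0 // exprM; apply: lerXn2r.
    - by rewrite nnegrE exprn_ge0.
    - by rewrite nnegrE ltW // jw_gt0.
    apply: (@le_trans _ _ (nz xi ^+ 2)); last by rewrite lerDr.
    have -> : 4 ^+ j = (2 ^+ j) ^+ 2 :> R by rewrite -exprM mulnC exprM; congr (_ ^+ j); ring.
    apply: lerXn2r; rewrite ?nnegrE ?exprn_ge0 ?nz_ge0 //.
    apply: le_trans (normr_le_enorm _ i); rewrite mxE -intr_norm -abszE -natrX -pmulrn ler_nat.
    exact: ltnW.
rewrite big_const_seq count_predT size_bx iter_addr_0 -(mulr_natl _ ((2 * 2 ^ j.+1).+1 ^ d)) natrX.
have h4 : 2 ^+ (j * d.+1) <= 4 ^+ (j * a) :> R.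
  have -> : 4 = 2 ^+ 2 :> R by ring.
  by rewrite -exprM ler_weXn2l ?ler1n // mulnCA leq_mul2l da orbT.
rewrite ler_pdivrMr ?exprn_gt0 //.
apply: (@le_trans _ _ (5 ^+ d * 2^-1 ^+ j * 2 ^+ (j * d.+1))); last first.
  by rewrite ler_wpM2l // mulr_ge0 ?exprn_ge0 // invr_ge0.
have -> : 5 ^+ d * 2^-1 ^+ j * 2 ^+ (j * d.+1) = (5 * 2 ^+ j) ^+ d :> R.
  have h : 2^-1 ^+ j * 2 ^+ j = 1 :> R by rewrite -exprMn mulVf ?expr1n.
  rewrite mulnS exprD exprM exprMn; set A := 5 ^+ d; set B := 2 ^+ j in h *.
  by rewrite -mulrA [_ * (B * _)]mulrA h mul1r.
apply: lerXn2r; rewrite ?nnegrE ?mulr_ge0 ?exprn_ge0 //.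
rewrite -(natr1 (2 * _)) natrM natrX exprS; have : 1 <= 2 ^+ j :> R by rewrite exprn_ege1 // ler1n.
clra.
Qed.

Lemma tail_sum a i j : (d < 2 * a)%N -> 
  \sum_(xi <- Bx (i + j) | xi \notin Bx i) (jw xi ^+ a)^-1 <= 2 * 5 ^+ d * 2^-1 ^+ i.
Proof.
move=> da; have w0 xi : 0 <= (jw xi ^+ a)^-1 by rewrite invr_ge0 jwX_ge0.
suff H : \sum_(xi <- Bx (i + j) | xi \notin Bx i) (jw xi ^+ a)^-1 <= 2 * 5 ^+ d * (2^-1 ^+ i - 2^-1 ^+ (i + j)).
  by apply: le_trans H _; rewrite ler_wpM2l ?mulr_ge0 ?exprn_ge0 // gerBl exprn_ge0 // invr_ge0.
elim: j => [|j IH].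
  by rewrite addn0 subrr mulr0 big_seq_cond big1 // => xi /andP[->].
rewrite addnS (bigID (fun xi => xi \in Bx (i + j))) /=.
have h1 : \sum_(xi <- Bx (i + j).+1 | (xi \notin Bx i) && (xi \in Bx (i + j))) (jw xi ^+ a)^-1 <=
          \sum_(xi <- Bx (i + j) | xi \notin Bx i) (jw xi ^+ a)^-1.
  rewrite -big_filter -[leRHS]big_filter; apply: ler_sum_sub => //; rewrite ?filter_uniq ?bx_uniq //.
  by move=> xi; rewrite !mem_filter => /andP[/andP[-> ->]].
have h2 : \sum_(xi <- Bx (i + j).+1 | (xi \notin Bx i) && (xi \notin Bx (i + j))) (jw xi ^+ a)^-1 <=
   5 ^+ d * 2^-1 ^+ (i + j).
  by apply: le_trans (shell_sum (i + j) da); apply: ler_psum => // xi _ /andP[].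
apply: le_trans (lerD (le_trans h1 IH) h2) _.
by rewrite (exprS _ (i + j)); set A := 5 ^+ d; set B := 2^-1 ^+ (i + j); clra.
Qed.

(** The number of points of the innermost box plus the geometric sum of the shells. *)
Definition S0 : R := 3 ^+ d + 2 * 5 ^+ d.

Lemma S0_gt0 : 0 < S0. Proof. by rewrite addr_gt0 ?mulr_gt0 ?exprn_gt0. Qed.

Lemma full_sum a P : (d < 2 * a)%N -> \sum_(xi <- bx P) (jw xi ^+ a)^-1 <= S0.
Proof.
move=> da; have w0 xi : 0 <= (jw xi ^+ a)^-1 by rewrite invr_ge0 jwX_ge0.
apply: (@le_trans _ _ (\sum_(xi <- Bx (0 + P)) (jw xi ^+ a)^-1)).
  apply: ler_sum_sub => //; rewrite ?bx_uniq //; apply: bx_sub; exact/ltnW/ltn_expl.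
rewrite (bigID (fun xi => xi \in Bx 0)) /=; apply: lerD; last first.
  by have := tail_sum 0 P da; rewrite expr0 mulr1.
apply: (@le_trans _ _ (\sum_(xi <- Bx 0) 1)).
  rewrite -big_filter; apply: (@le_trans _ _ (\sum_(xi <- [seq i <- Bx (0 + P) | i \in Bx 0]) 1)).
    by apply: ler_sum => xi _; rewrite invf_le1 ?exprn_gt0 ?jw_gt0 // exprn_ege1 // jw_ge1.
  apply: ler_sum_sub; rewrite ?filter_uniq ?bx_uniq //.
  by move=> xi; rewrite mem_filter => /andP[].
by rewrite big_const_seq count_predT size_bx iter_addr_0 -natrX.
Qed.

End Weights.

(** * Sobolev balls, their embedding and the algebra property *)

Section Energy.
Definition En s f P : R := \sum_(xi <- bx P) jw xi ^+ s * normc (ft f xi) ^+ 2.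

(** The ball of squared H^s norm [B], written with finite sums so that bounds pass through estimates
    without extended reals. *)
Definition Hs s f (B : R) := cp f /\ forall P, En s f P <= B.

Definition tail (a : Z -> R) j e := forall j', (j <= j')%N -> \sum_(xi <- Bx j' | xi \notin Bx j) a xi <= e.

Lemma En_ge0 s f P : 0 <= En s f P.
Proof. by apply: sumr_ge0 => xi _; rewrite mulr_ge0 ?sqr_ge0 // jwX_ge0. Qed.

Lemma En_mono s f P Q : (P <= Q)%N -> En s f P <= En s f Q.
Proof.
move=> PQ; apply: ler_sum_sub; rewrite ?bx_uniq //; first exact: bx_sub.
by move=> xi; rewrite mulr_ge0 ?sqr_ge0 // jwX_ge0.
Qed.

Lemma Hs_ge0 s f B : Hs s f B -> 0 <= B.
Proof. by move=> [_ /(_ 0%N)]; apply: le_trans; exact: En_ge0. Qed.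

Lemma En_sub s f B (r : seq Z) (P : pred Z) : Hs s f B -> uniq r ->
  \sum_(xi <- r | P xi) jw xi ^+ s * normc (ft f xi) ^+ 2 <= B.
Proof.
move=> [_ HB] ur; have [j rj] := mem_Bx_ex [seq i <- r | P i].
apply: le_trans (HB (2 ^ j)%N); rewrite -big_filter; apply: ler_sum_sub => //.
- exact: filter_uniq.
- exact: bx_uniq.
- by move=> xi; rewrite mulr_ge0 ?sqr_ge0 // jwX_ge0.
Qed.

(** Cauchy-Schwarz after moving a weight of order [a] between the factors. With [full_sum] it is the
    Sobolev embedding; with [tail_sum] it gives tails that are small uniformly over a ball. *)
Lemma weighted_sum a k f (w B : R) (r : seq Z) (P : pred Z) : uniq r -> Hs (k + a) f B ->
  \sum_(xi <- r | P xi) (jw xi ^+ a)^-1 <= w -> \sum_(xi <- r | P xi) jn xi ^+ k * normc (ft f xi) <= Num.sqrt (w * B).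
Proof.
move=> ur Hf hw; have B0 := Hs_ge0 Hf.
have w0 : 0 <= w by apply: le_trans hw; apply: sumr_ge0 => xi _; rewrite invr_ge0 jwX_ge0.
have j0 xi : jn xi ^+ a != 0 by rewrite expf_neq0 // gt_eqF // jn_gt0.
apply: le_trans (ler_norm _) _; rewrite -sqrtr_sqr ler_wsqrtr //.
have h := cauchy_schwarz r P (fun xi => (jn xi ^+ a)^-1) (fun xi => jn xi ^+ (k + a) * normc (ft f xi)).
apply: le_trans (le_trans h _).
  rewrite le_eqVlt; apply/orP; left; apply/eqP; congr (_ ^+ 2); apply: eq_bigr => xi _.
  by rewrite exprD mulrA [(_ ^+ a)^-1 * _]mulrCA mulVf ?mulr1.
apply: ler_pM; do ?[by apply: sumr_ge0 => xi _; exact: sqr_ge0].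
- by apply: le_trans hw; apply: ler_sum => xi _; rewrite exprVn -exprM mulnC exprM jn_sqr.
- apply: le_trans (En_sub P Hf ur); apply: ler_sum => xi _.
  by rewrite exprMn -exprM mulnC exprM jn_sqr.
Qed.

Lemma sqrt_mul_le (x y : R) : 0 <= x -> 0 <= y -> Num.sqrt (x * y) <= (x + y) / 2.
Proof.
move=> x0 y0; rewrite sqrtrM //; have := sqr_ge0 (Num.sqrt x - Num.sqrt y); rewrite sqrrB !sqr_sqrtr //.
by set z := _ * _; clra.
Qed.

Lemma X_bound a f B P : (d < 2 * a)%N -> Hs a.+1 f B ->
  \sum_(xi <- bx P) jn xi * normc (ft f xi) <= (S0 + B) / 2.
Proof.
move=> da H; apply: le_trans (@weighted_sum a 1 _ _ _ _ predT (bx_uniq P) H (full_sum P da)) _.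
by rewrite sqrt_mul_le ?(ltW S0_gt0) ?(Hs_ge0 H).
Qed.

Lemma pow_half_small (A e : R) : 0 < e -> exists j : nat, A * 2^-1 ^+ j <= e.
Proof.
move=> e0.
have h0 : 0 <= 2^-1 :> R by rewrite invr_ge0.
have h1 : 2^-1 < 1 :> R by rewrite invf_lt1 // ltr1n.
have h2 : 0 < e / (1 + `|A|) by rewrite divr_gt0 // ltr_pwDl.
have [n hn] := small_pow h0 h1 h2.
exists n; have P0 : 0 < 1 + `|A| by rewrite ltr_pwDl.
apply: (@le_trans _ _ ((1 + `|A|) * 2^-1 ^+ n)).
  by apply: ler_wpM2r; [rewrite exprn_ge0 // invr_ge0 | have := ler_norm A; clra].
by rewrite mulrC -ler_pdivlMr // ltW.
Qed.

Lemma weighted_tail a k (B e : R) : (d < 2 * a)%N -> 0 <= B -> 0 < e ->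
  exists j, forall f, Hs (k + a) f B -> tail (fun xi => jn xi ^+ k * normc (ft f xi)) j e.
Proof.
move=> da B0 e0; have [j hj] := pow_half_small (2 * 5 ^+ d * B) (exprn_gt0 2 e0).
exists j => f H j' jj; have := tail_sum j (j' - j) da; rewrite subnKC // => tl.
apply: le_trans (weighted_sum (bx_uniq _) H tl) _.
by rewrite -(ger0_norm (ltW e0)) -sqrtr_sqr ler_wsqrtr // mulrAC.
Qed.

Lemma X_tail a (B e : R) : (d < 2 * a)%N -> 0 <= B -> 0 < e ->
  exists j, forall f, Hs a.+1 f B -> tail (fun xi => jn xi * normc (ft f xi)) j e.
Proof. exact: (@weighted_tail a 1). Qed.

Lemma tail_le (a b : Z -> R) j e : (forall xi, a xi <= b xi) -> tail b j e -> tail a j e.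
Proof. by move=> ab H j' jj; apply: le_trans (H j' jj); apply: ler_sum. Qed.

Lemma tail_mono (a : Z -> R) i j e : (forall xi, 0 <= a xi) -> (i <= j)%N -> tail a i e -> tail a j e.
Proof.
move=> a0 ij H j' jj; apply: le_trans (H j' (leq_trans ij jj)).
by apply: ler_psum => // xi _; apply: contraNN; exact: Bx_sub.
Qed.

Lemma synB (c : Z -> C) j j' x : (j <= j')%N ->
  syn c (2 ^ j') x - syn c (2 ^ j) x = \sum_(xi <- Bx j' | xi \notin Bx j) pr (c xi) xi x.
Proof.
move=> jj; rewrite /syn -/(Bx j') -/(Bx j) (bigID (fun xi => xi \in Bx j)) /=.
have -> : \sum_(i <- Bx j' | i \in Bx j) pr (c i) i x = \sum_(i <- Bx j) pr (c i) i x.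
  rewrite -[LHS]big_filter; apply: perm_big; apply: uniq_perm; rewrite ?filter_uniq ?bx_uniq //.
  move=> xi; rewrite mem_filter; case h : (xi \in Bx j) => //=; exact: (Bx_sub jj h).
by rewrite addrAC subrr add0r.
Qed.

Lemma syn_tail (c : Z -> C) j j' e x : (j <= j')%N -> tail (fun xi => normc (c xi)) j e ->
  `|syn c (2 ^ j') x - syn c (2 ^ j) x| <= e.
Proof.
move=> jj H; rewrite synB //; apply: le_trans (ler_norm_sum _ _ _) _.
by apply: le_trans (H _ jj); apply: ler_sum => xi _; exact: pr_norm.
Qed.

Definition asum (c : Z -> C) := forall e, 0 < e -> exists j, tail (fun xi => normc (c xi)) j e.

Lemma seq_limit (v : nat -> R) : (forall e, 0 < e -> exists j, forall j', (j <= j')%N -> `|v j' - v j| <= e) ->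
  exists l : R, forall e, 0 < e -> exists j, forall j', (j <= j')%N -> `|l - v j'| <= e.
Proof.
move=> H; have cv : cvgn v.
  apply: cauchy_cvg; apply: cauchy_exP => e e0.
  have [j hj] := H (e / 2) (divr_gt0 e0 (ltr0Sn R 1)); exists (v j).
  exists j => // n /= jn; rewrite /ball /= distrC.
  by apply: le_lt_trans (hj n jn) _; move: e0; clra.
exists (limn v) => e e0; have /cvgrPdist_le/(_ e e0)[j _ hj] := cv.
by exists j => j' jj; exact: hj.
Qed.

(** Uniform limits keep continuity, periodicity and coefficients. The last clause keeps the rate
    explicit, so that one cutoff can serve a whole Sobolev ball. *)
Lemma syn_limit (c : Z -> C) : asum c -> herm c ->
  exists g, [/\ cp g, forall xi, ft g xi = c xi &
    forall j e x, tail (fun xi => normc (c xi)) j e -> `|g x - syn c (2 ^ j) x| <= e].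
Proof.
move=> Ac hc.
have cv x : exists l : R, forall e, 0 < e -> exists j, forall j', (j <= j')%N -> `|l - syn c (2 ^ j') x| <= e.
  apply: seq_limit => e e0; have [j hj] := Ac e e0.
  by exists j => j' jj; exact: syn_tail.
pose g x := projT1 (cid (cv x)).
have gP x e : 0 < e -> exists j, forall j', (j <= j')%N -> `|g x - syn c (2 ^ j') x| <= e.
  exact: (projT2 (cid (cv x))).
have gt j e x : tail (fun xi => normc (c xi)) j e -> `|g x - syn c (2 ^ j) x| <= e.
  move=> H; apply/ler_addgt0Pr => e' e'0; have [j1 h1] := gP x e' e'0.
  have h2 := h1 (maxn j j1) (leq_maxr _ _).
  have h3 := syn_tail x (leq_maxl j j1) H.
  have := ler_normD (g x - syn c (2 ^ maxn j j1) x) (syn c (2 ^ maxn j j1) x - syn c (2 ^ j) x).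
  by rewrite addrA subrK; move: h2 h3; clra.
have cg : continuous g.
  apply/contP => x e e0; have e3 : 0 < e / 3 by rewrite divr_gt0.
  have [j hj] := Ac _ e3.
  have /contP/(_ x (e / 3) e3)[dl d0 H] := @syn_cont c (2 ^ j).
  exists dl => // y yx; have h1 := gt _ _ y hj; have h2 := gt _ _ x hj; have h3 := H y yx.
  have -> : g y - g x = (g y - syn c (2 ^ j) y) + (syn c (2 ^ j) y - syn c (2 ^ j) x) - (g x - syn c (2 ^ j) x) by ring.
  move: h1 h2 h3; rewrite !ler_norml !ltr_norml => /andP[a1 b1] /andP[a2 b2] /andP[a3 b3].
  by apply/andP; split; move: a1 b1 a2 b2 a3 b3; clra.
exists g; split=> //.
  split=> // i x; apply/eqP; rewrite -subr_eq0 -normr_le0; apply/ler_addgt0Pr => e e0; rewrite add0r.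
  have e2 : 0 < e / 2 by rewrite divr_gt0.
  have [j hj] := Ac _ e2.
  have h1 := gt _ _ (x + (2 * pi) *: delta_mx 0 i) hj; have h2 := gt _ _ x hj.
  have [_ ps] := @syn_cp c (2 ^ j); rewrite ps in h1.
  have -> : g (x + (2 * pi) *: delta_mx 0 i) - g x = (g (x + (2 * pi) *: delta_mx 0 i) - syn c (2 ^ j) x) - (g x - syn c (2 ^ j) x) by ring.
  by apply: le_trans (ler_normB _ _) _; move: h1 h2; clra.
move=> xi; apply/eqP; rewrite -subr_eq0; apply/eqP/ComplexField.Normc.eq0_normc/eqP.
rewrite eq_le normc_ge0 andbT; apply/ler_addgt0Pr => e e0; rewrite add0r.
have [j0 h0] := Ac _ e0; have [j1 h1] := mem_Bx_ex [:: xi].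
have xj : xi \in Bx (maxn j0 j1) by apply: (Bx_sub (leq_maxr j0 j1)); apply: h1; rewrite inE.
have ht := tail_mono (fun xi => normc_ge0 _) (leq_maxl j0 j1) h0.
have := ft_syn (2 ^ maxn j0 j1) xi hc; rewrite -/(Bx _) xj => <-.
rewrite -ftB //; last exact: syn_cont.
by apply: ft_norm; [apply: contB => //; exact: syn_cont | move=> x; exact: gt].
Qed.

Lemma Hs_down s f (B : R) : Hs s.+1 f B -> Hs s f B.
Proof.
move=> [cf hE]; split=> // P; apply: le_trans (hE P); apply: ler_sum => xi _.
by rewrite ler_wpM2r ?sqr_ge0 // exprS ler_peMl ?jw_ge1 // jwX_ge0.
Qed.

Lemma Hs_asum_low a (da : (d < 2 * a)%N) f B : Hs a f B -> asum (ft f).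
Proof.
move=> Hf e e0; have [j hj] := weighted_tail 0 da (Hs_ge0 Hf) e0.
by exists j; apply: tail_le (hj f Hf) => xi; rewrite expr0 mul1r.
Qed.

Lemma Hs_asum a f B : (d < 2 * a)%N -> Hs a.+1 f B -> asum (ft f).
Proof. by move=> da /Hs_down; exact: Hs_asum_low. Qed.

Lemma ft_inj f g : cp f -> cp g -> (forall xi, ft f xi = ft g xi) -> f = g.
Proof.
move=> [cf pf] [cg pg] E; apply/funext => x; apply/eqP; rewrite -subr_eq0; apply/eqP.
apply: (@ft_eq0 (fun x => f x - g x)) => [|xi]; last by rewrite ftB // E subrr.
by split=> [|i y]; [exact: contB | rewrite pf pg].
Qed.

(** Injectivity of the coefficients identifies [f] with the limit of its own partial sums. *)
Lemma syn_approx f j e x : cp f -> asum (ft f) -> tail (fun xi => normc (ft f xi)) j e ->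
  `|f x - syn (ft f) (2 ^ j) x| <= e.
Proof.
move=> cf Af ht; have [g [cg gE gt]] := syn_limit Af (ft_herm cf.1).
have E : f = g by apply: ft_inj => // xi; rewrite gE.
by rewrite {1}E; exact: gt.
Qed.

Lemma syn_norm c P x : `|syn c P x| <= \sum_(p <- bx P) normc (c p).
Proof. by apply: le_trans (ler_norm_sum _ _ _) _; apply: ler_sum => p _; exact: pr_norm. Qed.

Lemma Hs_sup a (da : (d < 2 * a)%N) f B x : Hs a f B -> `|f x| <= Num.sqrt (S0 * B).
Proof.
move=> Hf; apply/ler_addgt0Pr => e e0; have af := Hs_asum_low da Hf; have [j hj] := af e e0.
have k1 := syn_approx x Hf.1 af hj.
have k2 : `|syn (ft f) (2 ^ j) x| <= Num.sqrt (S0 * B).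
  apply: le_trans (syn_norm _ _ _) _; have := @weighted_sum a 0 f _ _ _ predT (bx_uniq (2 ^ j)) Hf (full_sum _ da).
  by under eq_bigr do rewrite expr0 mul1r.
by move: k1 k2; rewrite !ler_norml; clra.
Qed.

Lemma cpM f g : cp f -> cp g -> cp (fun x => f x * g x).
Proof. by move=> [cf pf] [cg pg]; split=> [|i x]; [exact: contM | rewrite pf pg]. Qed.

Lemma cpB f g : cp f -> cp g -> cp (fun x => f x - g x).
Proof. by move=> [cf pf] [cg pg]; split=> [|i x]; [exact: contB | rewrite pf pg]. Qed.

Lemma cpD f g : cp f -> cp g -> cp (fun x => f x + g x).
Proof. by move=> [cf pf] [cg pg]; split=> [|i x]; [exact: contD | rewrite pf pg]. Qed.

Lemma cpZ (c : R) f : cp f -> cp (fun x => c * f x).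
Proof. by move=> [cf pf]; split=> [|i x]; [exact: contZl | rewrite pf]. Qed.

Lemma shift_sum (F : Z -> R) r q B : (forall xi, 0 <= F xi) -> (forall P, \sum_(xi <- bx P) F xi <= B) ->
  uniq r -> \sum_(xi <- r) F (xi - q) <= B.
Proof.
move=> F0 HB ur; rewrite -(big_map (fun xi => xi - q) predT F).
have [j hj] := mem_Bx_ex [seq xi - q | xi <- r].
apply: le_trans (HB (2 ^ j)%N); apply: ler_sum_sub => //; last exact: bx_uniq.
by rewrite map_inj_uniq //; exact: addIr.
Qed.

Lemma shift_sumN (F : Z -> R) r q B : (forall xi, 0 <= F xi) -> (forall P, \sum_(xi <- bx P) F xi <= B) ->
  uniq r -> \sum_(xi <- r) F (q - xi) <= B.
Proof.
move=> F0 HB ur; rewrite -(big_map (fun xi => q - xi) predT F).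
have [j hj] := mem_Bx_ex [seq q - xi | xi <- r].
apply: le_trans (HB (2 ^ j)%N); apply: ler_sum_sub => //; last exact: bx_uniq.
by rewrite map_inj_uniq // => x y /addrI/oppr_inj.
Qed.

Definition Cp s : R := 2 * 4 ^+ s * S0.

Lemma Cp_gt0 s : 0 < Cp s. Proof. by rewrite mulr_gt0 ?S0_gt0 // mulr_gt0 // exprn_gt0. Qed.

(** The weight at a sum is dominated by the sum of the weights, so one of the two inverse weights
    survives and is summable. *)
Lemma conv_weight s xi (r : seq Z) : (d < 2 * s)%N -> uniq r ->
  \sum_(p <- r) jw xi ^+ s / (jw p ^+ s * jw (xi - p) ^+ s) <= Cp s.
Proof.
move=> ds ur.
apply: (@le_trans _ _ (4 ^+ s * (\sum_(p <- r) (jw (xi - p) ^+ s)^-1 + \sum_(p <- r) (jw p ^+ s)^-1))).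
  rewrite -big_split /= mulr_sumr; apply: ler_sum => p _.
  have a0 := exprn_gt0 s (jw_gt0 p); have b0 := exprn_gt0 s (jw_gt0 (xi - p)).
  rewrite ler_pdivrMr ?mulr_gt0 //.
  have := @jwD s p (xi - p); rewrite (_ : p + (xi - p) = xi); last by rewrite addrC subrK.
  move=> /le_trans; apply.
  rewrite le_eqVlt; apply/orP; left; apply/eqP; field; by rewrite !gt_eqF.
have w0 p : 0 <= (jw p ^+ s)^-1 by rewrite invr_ge0 jwX_ge0.
have hS P := @full_sum s P ds.
have h1 := shift_sumN xi w0 hS ur.
have h2 : \sum_(p <- r) (jw p ^+ s)^-1 <= S0 by have := shift_sum 0 w0 hS ur; under eq_bigr do rewrite subr0.
apply: (@le_trans _ _ (4 ^+ s * (S0 + S0))); first by rewrite ler_wpM2l ?exprn_ge0 // lerD.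
by rewrite /Cp; set A := 4 ^+ s; clra.
Qed.

Lemma conv_energy s (A B : Z -> R) Ea Eb (r t : seq Z) : (d < 2 * s)%N -> uniq r -> uniq t ->
  (forall P, \sum_(p <- bx P) jw p ^+ s * A p ^+ 2 <= Ea) ->
  (forall P, \sum_(p <- bx P) jw p ^+ s * B p ^+ 2 <= Eb) ->
  \sum_(xi <- t) jw xi ^+ s * (\sum_(p <- r) A p * B (xi - p)) ^+ 2 <= Cp s * Ea * Eb.
Proof.
move=> ds ur ut hA hB.
have jp xi : 0 < jw xi ^+ s by rewrite exprn_gt0 // jw_gt0.
have fB0 p : 0 <= jw p ^+ s * B p ^+ 2 by rewrite mulr_ge0 ?sqr_ge0 // ltW.
have fA0 p : 0 <= jw p ^+ s * A p ^+ 2 by rewrite mulr_ge0 ?sqr_ge0 // ltW.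
have Eb0 : 0 <= Eb by apply: le_trans (hB 0%N); apply: sumr_ge0.
apply: (@le_trans _ _ (\sum_(xi <- t) Cp s * \sum_(p <- r) jw p ^+ s * A p ^+ 2 * (jw (xi - p) ^+ s * B (xi - p) ^+ 2))).
  apply: ler_sum => xi _.
  pose w p := Num.sqrt (jw p ^+ s * jw (xi - p) ^+ s).
  have w0 p : 0 < w p by rewrite sqrtr_gt0 mulr_gt0.
  have w2 p : w p ^+ 2 = jw p ^+ s * jw (xi - p) ^+ s by rewrite sqr_sqrtr // ltW // mulr_gt0.
  have := cauchy_schwarz r predT (fun p => (w p)^-1) (fun p => w p * (A p * B (xi - p))).
  under eq_bigr do rewrite mulKf ?gt_eqF //.
  move=> h; apply: le_trans (ler_wpM2l (ltW (jp xi)) h) _.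
  rewrite mulrA; apply: ler_pM.
  - by rewrite mulr_ge0 ?(ltW (jp xi)) //; apply: sumr_ge0 => p _; exact: sqr_ge0.
  - by apply: sumr_ge0 => p _; exact: sqr_ge0.
  - by apply: le_trans (@conv_weight s xi r ds ur); rewrite mulr_sumr; apply: ler_sum => p _; rewrite exprVn w2.
  - by apply: ler_sum => p _; rewrite exprMn w2; set a := jw p ^+ s; set b := jw _ ^+ s; clra.
rewrite -mulr_sumr -mulrA ler_wpM2l ?(ltW (Cp_gt0 s)) // exchange_big /=.
apply: (@le_trans _ _ (\sum_(p <- r) jw p ^+ s * A p ^+ 2 * Eb)).
  apply: ler_sum => p _; rewrite -mulr_sumr ler_wpM2l //.
  exact: (@shift_sum (fun p => jw p ^+ s * B p ^+ 2) t p Eb fB0 hB ut).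
rewrite -mulr_suml ler_wpM2r //.
by have := shift_sum 0 fA0 hA ur; under eq_bigr do rewrite subr0.
Qed.

Lemma normc_sum (I : Type) (r : seq I) (F : I -> C) : normc (\sum_(i <- r) F i) <= \sum_(i <- r) normc (F i).
Proof.
elim: r => [|i r IH]; first by rewrite !big_nil ComplexField.Normc.normc0.
by rewrite !big_cons; apply: le_trans (le_normcD _ _) _; rewrite lerD2l.
Qed.

(** Replacing [f] by a partial sum turns the convolution of coefficients into a finite sum, up to
    the sup norm of the remainder times that of [g]. *)
Lemma ft_mul_le f g xi : cp f -> asum (ft f) -> cp g -> forall e, 0 < e -> exists j0, forall j, (j0 <= j)%N ->
  normc (ft (fun x => f x * g x) xi) <= \sum_(p <- Bx j) normc (ft f p) * normc (ft g (xi - p)) + e.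
Proof.
move=> cf Af cg e e0; have [G G0 HG] := cp_bounded cg.
have e1 : 0 < e / (G + 1) by rewrite divr_gt0 // ltr_wpDl.
have [j0 h0] := Af _ e1; exists j0 => j jj.
have ht := tail_mono (fun xi => normc_ge0 _) jj h0.
have cs := @syn_cont (ft f) (2 ^ j).
have := ft_syn_mul (2 ^ j) xi (ft_herm cf.1) cg.1; rewrite -/(Bx j) => E.
have -> : ft (fun x => f x * g x) xi = ft (fun x => syn (ft f) (2 ^ j) x * g x) xi +
    ft (fun x => (f x - syn (ft f) (2 ^ j) x) * g x) xi.
  rewrite -ftD; [|exact: contM cs cg.1|exact: contM (contB cf.1 cs) cg.1].
  by congr ft; apply/funext => x; ring.
apply: le_trans (le_normcD _ _) _; apply: lerD.
  rewrite E; apply: le_trans (normc_sum _ _) _.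
  by apply: ler_sum => p _; rewrite ComplexField.Normc.normcM.
apply: ft_norm; first exact: contM (contB cf.1 cs) cg.1.
move=> x; rewrite normrM; apply: (@le_trans _ _ (e / (G + 1) * G)).
  by apply: ler_pM => //; exact: syn_approx.
rewrite mulrAC ler_pdivrMr ?ltr_wpDl //; move: e0; clra.
Qed.

Lemma Hs_mul s f g Bf Bg : (d < 2 * s)%N -> asum (ft f) -> Hs s f Bf -> Hs s g Bg ->
  Hs s (fun x => f x * g x) (Cp s * Bf * Bg).
Proof.
move=> ds Af Hf Hg; split; first exact: cpM Hf.1 Hg.1.
move=> P; apply/ler_addgt0Pr => e e0.
have [Bn hBn] : exists Bn : R, forall xi, normc (ft (fun x => f x * g x) xi) <= Bn.
  have [F F0 HF] := cp_bounded (cpM Hf.1 Hg.1); exists F => xi.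
  by apply: ft_norm => //; exact: (cpM Hf.1 Hg.1).1.
set W := \sum_(xi <- bx P) jw xi ^+ s.
have W0 : 0 <= W by apply: sumr_ge0 => xi _; rewrite jwX_ge0.
have Bn0 : 0 <= Bn by apply: le_trans (hBn 0); exact: normc_ge0.
(* Squaring an inequality with error [e1] between quantities controlled by [Bn] costs 2 Bn e1,
   summed against the total weight [W]. *)
pose e1 := e / (2 * (Bn + 1) * (W + 1)).
have e10 : 0 < e1 by rewrite divr_gt0 // !mulr_gt0 // ltr_wpDl.
have [j hj] : exists j, forall xi, xi \in bx P ->
   normc (ft (fun x => f x * g x) xi) <= \sum_(p <- Bx j) normc (ft f p) * normc (ft g (xi - p)) + e1.
  have H xi := ft_mul_le xi Hf.1 Af Hg.1 e10.
  pose J xi := projT1 (cid (H xi)); exists (\max_(xi <- bx P) J xi) => xi xP.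
  by apply: (projT2 (cid (H xi))); exact: (@leq_bigmax_seq _ _ predT J xi xP isT).
have conv := @conv_energy s (fun p => normc (ft f p)) (fun p => normc (ft g p)) Bf Bg (Bx j) (bx P)
   ds (bx_uniq _) (bx_uniq _) Hf.2 Hg.2.
apply: le_trans (lerD conv (lexx e)).
apply: (@le_trans _ _ (\sum_(xi <- bx P) (jw xi ^+ s * (\sum_(p <- Bx j) normc (ft f p) * normc (ft g (xi - p))) ^+ 2 + jw xi ^+ s * (2 * Bn * e1)))).
  rewrite /En big_seq [leRHS]big_seq; apply: ler_sum => xi xP; rewrite -mulrDr ler_wpM2l ?exprn_ge0 ?(ltW (jw_gt0 _)) //.
  set a := normc _; set b := \sum_(p <- _) _.
  have a0 : 0 <= a by exact: normc_ge0.
  have b0 : 0 <= b by apply: sumr_ge0 => p _; rewrite mulr_ge0 ?normc_ge0.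
  have ab : a <= b + e1 by exact: hj.
  have aB : a <= Bn by exact: hBn.
  have [ale|alt] := leP a b.
    apply: (@le_trans _ _ (b ^+ 2)); first by apply: lerXn2r; rewrite ?nnegrE.
    by rewrite lerDl; apply: mulr_ge0; [exact: mulr_ge0 | exact: ltW].
  have f1 : 0 <= (e1 - (a - b)) * (a + b) by apply: mulr_ge0; [move: ab; clra | exact: addr_ge0].
  have f2 : 0 <= e1 * (2 * Bn - (a + b)) by apply: mulr_ge0; [exact: ltW | move: aB alt; clra].
  by move: f1 f2; clra.
rewrite big_split /= lerD2l -mulr_suml -/W /e1.
rewrite (_ : W * _ = W * 2 * Bn * e / (2 * (Bn + 1) * (W + 1))); last by ring.
rewrite ler_pdivrMr ?mulr_gt0 ?ltr_wpDl //.
have := mulr_ge0 Bn0 W0; move: Bn0 W0 e0 => B1 W1 e0 BW.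
have := mulr_ge0 (ltW e0) BW; have := mulr_ge0 (ltW e0) B1; have := mulr_ge0 (ltW e0) W1.
move: e0; clra.
Qed.

End Energy.

(** * Elementary trigonometric inequalities *)

Section TrigInequalities.
Lemma sin_le_id (x : R) : 0 <= x -> sin x <= x.
Proof.
rewrite le_eqVlt => /predU1P[<-|x0]; first by rewrite sin0.
have cs : {within `[0, x], continuous (@sin R)} by apply: continuous_subspaceT; exact: continuous_sin.
have [c _] := MVT x0 (fun y _ => is_derive_sin y) cs.
rewrite sin0 !subr0 => ->; apply: ler_piMl; [exact: ltW | exact: cos_le1].
Qed.

Lemma sin_sqr_le (x : R) : sin x ^+ 2 <= x ^+ 2.
Proof.
wlog x0 : x / 0 <= x.
  by move=> H; have [/H//|/ltW xn] := leP 0 x; have := H (- x); rewrite oppr_ge0 sinN !sqrrN; apply.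
have h1 := sin_le_id x0.
have [s0|s0] := leP 0 (sin x); first by apply: lerXn2r; rewrite ?nnegrE.
have [x1|x1] := leP x 1; last first.
  have := cos2Dsin2 x; have := sqr_ge0 (cos x); have := ltW x1; move: x0 => x0 x1' a b.
  have : 1 <= x ^+ 2 by rewrite expr_ge1.
  by move: a b; clra.
have := @sin_ge0_pi R x; rewrite x0 /=.
have : x <= pi by apply: le_trans x1 _; have := @pihalf_ge1 R; have := @pi_gt0 R; clra.
by move=> -> /(_ isT); rewrite leNgt s0.
Qed.

Lemma cos_ge_quad (x : R) : 1 - x ^+ 2 / 2 <= cos x.
Proof.
have := sin_sqr_le (x / 2); rewrite cos_half cos2sin2 expr_div_n; move: (sin _ ^+ 2) (x ^+ 2) => a b; clra.
Qed.

Lemma sin_sqr_ge (x : R) : x ^+ 2 <= 1 -> x ^+ 2 * (1 - x ^+ 2) <= sin x ^+ 2.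
Proof.
wlog x0 : x / 0 <= x.
  by move=> H; have [/H//|/ltW xn] := leP 0 x; have := H (- x); rewrite oppr_ge0 sinN !sqrrN; apply.
move=> x1; move: x0; rewrite le_eqVlt => /predU1P[<-|x0]; first by rewrite sin0 expr0n mul0r.
have cs : {within `[0, x], continuous (@sin R)} by apply: continuous_subspaceT; exact: continuous_sin.
have [c] := MVT x0 (fun y _ => is_derive_sin y) cs.
rewrite in_itv /= sin0 !subr0 => /andP[c0 cx] ->.
rewrite exprMn mulrC ler_wpM2r ?sqr_ge0 //.
have cc := cos_ge_quad c.
have c2 : c ^+ 2 <= x ^+ 2 by apply: lerXn2r; rewrite ?nnegrE ltW.
have h : 1 - x ^+ 2 / 2 <= cos c by move: cc c2; clra.
have h0 : 0 <= 1 - x ^+ 2 / 2 by move: x1; clra.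
apply: (@le_trans _ _ ((1 - x ^+ 2 / 2) ^+ 2)).
  have := sqr_ge0 (x ^+ 2); set y := x ^+ 2; clra.
by apply: lerXn2r; rewrite ?nnegrE //; exact: le_trans h.
Qed.

Lemma prod_1B_le (I : Type) (r : seq I) (y : I -> R) : (forall i, 0 <= y i <= 1) ->
  1 - \sum_(i <- r) y i <= \prod_(i <- r) (1 - y i) /\ (\prod_(i <- r) (1 - y i)) * (1 + \sum_(i <- r) y i) <= 1.
Proof.
move=> y01; elim: r => [|i r [IH1 IH2]]; first by rewrite !big_nil; split; lra.
rewrite !big_cons; have /andP[a b] := y01 i.
have S0 : 0 <= \sum_(j <- r) y j by apply: sumr_ge0 => j _; case/andP: (y01 j).
have P0 : 0 <= \prod_(j <- r) (1 - y j) by apply: prodr_ge0 => j _; rewrite subr_ge0; case/andP: (y01 j).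
set S := \sum_(j <- r) _ in IH1 IH2 S0 *; set P := \prod_(j <- r) _ in IH1 IH2 P0 *.
split.
  have f1 : 0 <= (1 - y i) * (P - (1 - S)) by rewrite mulr_ge0 // subr_ge0.
  have f2 : 0 <= y i * S by rewrite mulr_ge0.
  by move: f1 f2; clra.
have f1 : 0 <= y i * (y i * P) by rewrite mulr_ge0 // mulr_ge0.
have f2 : 0 <= y i * S * P by rewrite mulr_ge0 // mulr_ge0.
by move: f1 f2 IH2; clra.
Qed.

End TrigInequalities.

(** * Partial sums of the series of (1 - s)^(-1/2) *)

Section GeneratingFunction.
Local Notation aN := (@aN R).

Definition AK (s : R) K : R := \sum_(i < K) aN i * s ^+ i.

(** Summation by parts: it reads the truncated symbol as (1 - s) times a truncation of (1 -
    s)^(-1/2), up to the mass of the omitted walks. *)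
Lemma abel_bN s K : \sum_(0 <= N < K) bN N * (1 - s ^+ N.+1) = (1 - s) * AK s K - aN K * (1 - s ^+ K).
Proof.
elim: K => [|K IH]; first by rewrite big_nil /AK big_ord0 expr0; ring.
by rewrite big_nat_recr //= IH /AK big_ord_recr /= /bN exprS; ring.
Qed.

Lemma triangle_sum (f : nat -> nat -> R) K :
  \sum_(n < K) \sum_(i < n.+1) f i (n - i)%N = \sum_(i < K) \sum_(j < K - i) f i j.
Proof.
elim: K => [|K IH]; first by rewrite !big_ord0.
rewrite big_ord_recr /= IH [RHS]big_ord_recr /= subSnn big_ord1.
rewrite big_ord_recr /= subnn addrA; congr (_ + _).
rewrite -big_split /=; apply: eq_bigr => i _.
by rewrite subSn ?big_ord_recr //= ltnW.
Qed.

Lemma geo_sum (s : R) K : (\sum_(n < K) s ^+ n) * (1 - s) = 1 - s ^+ K.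
Proof.
elim: K => [|K IH]; first by rewrite big_ord0 mul0r expr0 subrr.
by rewrite big_ord_recr /= mulrDl IH exprS; ring.
Qed.

Lemma conv_sum s K : \sum_(i < K) \sum_(j < K - i) aN i * s ^+ i * (aN j * s ^+ j) = \sum_(n < K) s ^+ n.
Proof.
rewrite -(triangle_sum (fun i j => aN i * s ^+ i * (aN j * s ^+ j))); apply: eq_bigr => n _.
rewrite -[RHS]mul1r -(@aN_conv R n) mulr_suml; apply: eq_bigr => i _.
have -> : s ^+ n = s ^+ i * s ^+ (n - i) by rewrite -exprD subnKC // -ltnS.
by ring.
Qed.

(** The square of index pairs below [K] contains the triangle i + j < K and lies in the triangle i +
    j < 2K. On triangles [aN_conv] turns the double sum into a geometric one. *)
Lemma AK_sqr s K : 0 <= s < 1 -> 1 - s ^+ K <= AK s K ^+ 2 * (1 - s) <= 1.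
Proof.
move=> /andP[s0 s1]; have s1' : 0 <= 1 - s by rewrite subr_ge0 ltW.
have t0 i j : 0 <= aN i * s ^+ i * (aN j * s ^+ j) by rewrite !mulr_ge0 ?exprn_ge0 // ltW // aN_gt0.
have AE : AK s K ^+ 2 = \sum_(i < K) \sum_(j < K) aN i * s ^+ i * (aN j * s ^+ j).
  by rewrite expr2 /AK mulr_suml; apply: eq_bigr => i _; rewrite mulr_sumr.
have wid (n m : nat) (F : nat -> R) : (forall j, 0 <= F j) -> (n <= m)%N -> \sum_(j < n) F j <= \sum_(j < m) F j.
  move=> F0 nm; rewrite -!(big_mkord xpredT F) (@big_cat_nat _ _ _ n 0 m) //= lerDl.
  by apply: sumr_ge0.
apply/andP; split.
  rewrite -geo_sum ler_wpM2r // -conv_sum AE; apply: ler_sum => i _.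
  by apply: (wid _ _ (fun j => aN i * s ^+ i * (aN j * s ^+ j))); rewrite ?leq_subr.
apply: (@le_trans _ _ ((\sum_(n < K + K) s ^+ n) * (1 - s))).
  rewrite ler_wpM2r // -conv_sum AE.
  apply: (@le_trans _ _ (\sum_(i < K) \sum_(j < K + K - i) aN i * s ^+ i * (aN j * s ^+ j))).
    apply: ler_sum => i _; apply: (wid _ _ (fun j => aN i * s ^+ i * (aN j * s ^+ j))) => //.
    by rewrite -addnBA ?leq_addr // ltnW.
  apply: (wid _ _ (fun i => \sum_(j < K + K - i) aN i * s ^+ i * (aN j * s ^+ j))); rewrite ?leq_addr //.
  by move=> i; apply: sumr_ge0.
by rewrite geo_sum gerBl exprn_ge0.
Qed.

Lemma pow_le_inv (s : R) K : 0 <= s < 1 -> s ^+ K * (K%:R * (1 - s)) <= 1.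
Proof.
move=> /andP[s0 s1]; suff H : s ^+ K * (1 + K%:R * (1 - s)) <= 1.
  by have := exprn_ge0 K s0; move: H; clra.
elim: K => [|K IH]; first by rewrite expr0 mul0r addr0 mul1r.
have h : 0 <= s ^+ K by exact: exprn_ge0.
have p1 : 0 <= s ^+ K * ((1 - s) * (1 - s)) by rewrite !mulr_ge0 // subr_ge0 ltW.
have p2 : 0 <= s ^+ K * (K%:R * ((1 - s) * (1 - s))) by rewrite !mulr_ge0 // subr_ge0 ltW.
by rewrite exprS -(natr1 K); move: IH p1 p2; clra.
Qed.

End GeneratingFunction.

(** * The symbol of the mesh operator *)

Section Symbol.

(** The kernel has symbol sqrt(1 - s) with s the product of squared cosines of p_i/(2n). As 1 - s is
    close to (|p|/2n)^2, the factor 2n normalizes the limit to |p|. *)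
Definition sig (n K : nat) p : R :=
  2 * n%:R * LK K (fun z => 1 - cos (dot (n%:R^-1 *: freq p) (freq z) : R)).

Lemma sig_ge0 n K p : 0 <= sig n K p.
Proof. by rewrite mulr_ge0 // LK_ge0 // => z; rewrite subr_ge0 cos_le1. Qed.

Lemma sigN n K p : sig n K (- p) = sig n K p.
Proof. by rewrite /sig; congr (_ * _); apply: LK_ext => z; rewrite freqN scalerN dotNl cosN. Qed.

Lemma sig_le n K p : (0 < n)%N -> sig n K p <= 2 * (d%:R + 3) * nz p.
Proof.
move=> n0; have nR : 0 < n%:R :> R by rewrite ltr0n.
have [->|pn] := eqVneq p 0.
  rewrite nz0 mulr0 /sig (_ : LK _ _ = LK K (fun _ : Z => 0)).
    by rewrite LK_cst mul0r mulr0.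
  by apply: LK_ext => z; rewrite freq0 scaler0 /dot big1 ?cos0 ?subrr // => i _; rewrite mxE mul0r.
have p0 : 0 < nz p by exact: nz_gt0.
pose r := 2 * n%:R / nz p; have r0 : 0 < r by rewrite divr_gt0 // mulr_gt0.
have h : LK K (fun z => 1 - cos (dot (n%:R^-1 *: freq p) (freq z) : R)) <= 2 * ((d%:R + 3) / r).
  apply: le_trans (ler_wpM2l (ler0n R 2) (LK_sqr K r0)); rewrite -LKZ; apply: LK_mono => z.
  set t := dot _ _; have tz : t ^+ 2 <= 4 * (nz z / r) ^+ 2.
    have -> : 4 * (nz z / r) ^+ 2 = (n%:R^-1 * nz p * nz z) ^+ 2 by rewrite /r; field; rewrite !gt_eqF.
    have e : `|t| <= n%:R^-1 * nz p * nz z.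
      rewrite /t dotZl normrM ger0_norm ?invr_ge0 // -mulrA ler_wpM2l ?invr_ge0 //.
      rewrite ler_norml dot_le andbT lerNl -dotNr; apply: le_trans (dot_le _ _) _.
      by rewrite enormN.
    rewrite -[leLHS]real_normK ?num_real //; apply: lerXn2r => //; rewrite nnegrE ?normr_ge0 //.
    exact: le_trans e.
  rewrite -[2]/(2%:R); have [h1|h1] := leP 1 ((nz z / r) ^+ 2).
    by rewrite mulr1; have := cos_geN1 t; clra.
  by have := cos_ge_quad t; move: tz; clra.
rewrite /sig; apply: le_trans (ler_wpM2l _ h) _; first by rewrite mulr_ge0 // ltW.
by rewrite le_eqVlt; apply/orP; left; apply/eqP; rewrite /r; field; rewrite !gt_eqF.
Qed.

(** Three errors: 1 - s against its quadratic part [q ^+ 2], the remainder s^K of the series, and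
    the mass [aN K] of omitted walks. K >= n^4 makes [aN K] at most n^(-2), hence of order 1/n after
    the factor 2n. *)
Lemma sig_near n K p : nz p <= n%:R -> (1 <= n)%N -> (n ^ 4 <= K)%N ->
  `|sig n K p - nz p| <= (nz p ^+ 3 + 8 * nz p + 2) / n%:R.
Proof.
move=> pn n1 nK; have nR : 0 < n%:R :> R by rewrite ltr0n.
have n1R : 1 <= n%:R :> R by rewrite ler1n.
have [p0|pn0] := eqVneq p 0.
  rewrite p0 (_ : sig n K 0 = 0) ?nz0 ?subr0 ?normr0 ?divr_ge0 ?expr0n ?mulr0 ?add0r //.
  by apply/eqP; rewrite eq_le sig_ge0 andbT; have := @sig_le n K 0 n1; rewrite nz0 mulr0.
have P1 : 1 <= nz p by exact: nz_ge1.
set P := nz p in pn P1 *; have P0 : 0 < P by lra.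
pose y (i : 'I_d) := sin ((n%:R^-1 *: freq p : 'rV[R]_d) 0 i / 2) ^+ 2.
pose s := \prod_(i < d) cos ((n%:R^-1 *: freq p : 'rV[R]_d) 0 i / 2) ^+ 2.
pose x (i : 'I_d) := (n%:R^-1 *: freq p : 'rV[R]_d) 0 i / 2.
have sE : s = \prod_(i < d) (1 - y i) by apply: eq_bigr => i _; rewrite cos2sin2.
have y01 i : 0 <= y i <= 1.
  rewrite sqr_ge0 /= /y; have := cos2Dsin2 ((n%:R^-1 *: freq p : 'rV[R]_d) 0 i / 2).
  by have := sqr_ge0 (cos ((n%:R^-1 *: freq p : 'rV[R]_d) 0 i / 2)); clra.
pose q := P / (2 * n%:R); have q0 : 0 < q by rewrite divr_gt0 // mulr_gt0.
have q12 : q <= 1 / 2 by rewrite /q ler_pdivrMr ?mulr_gt0 //; move: pn; clra.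
have xq : \sum_i x i ^+ 2 = q ^+ 2.
  have -> : q ^+ 2 = (2 * n%:R) ^- 2 * P ^+ 2 by rewrite /q; field; rewrite gt_eqF.
  rewrite /P /nz sqr_enorm /dot mulr_sumr; apply: eq_bigr => i _.
  by rewrite /x !mxE; field; rewrite gt_eqF.
have xle i : x i ^+ 2 <= q ^+ 2 by rewrite -xq (bigD1 i) //= lerDl; apply: sumr_ge0 => j _; exact: sqr_ge0.
have Yup : \sum_i y i <= q ^+ 2 by rewrite -xq; apply: ler_sum => i _; exact: sin_sqr_le.
have q2 : q ^+ 2 <= 1 / 4.
  have : 0 <= (1 / 2 - q) * (1 / 2 + q) by apply: mulr_ge0; move: q12 q0; clra.
  by clra.
have q20 : 0 < q ^+ 2 by exact: exprn_gt0.
have Ylo : q ^+ 2 * (1 - q ^+ 2) <= \sum_i y i.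
  rewrite -{1}xq mulr_suml; apply: ler_sum => i _.
  apply: (@le_trans _ _ (x i ^+ 2 * (1 - x i ^+ 2))); last first.
    by apply: sin_sqr_ge; apply: le_trans (xle i) _; move: q2; clra.
  by apply: ler_wpM2l; [exact: sqr_ge0 | have := xle i; clra].
have [s_lo s_up] := prod_1B_le (index_enum 'I_d) y01.
rewrite -sE in s_lo s_up; set Y := \sum_i y i in Yup Ylo s_lo s_up.
have Y0 : 0 <= Y by apply: sumr_ge0 => i _; case/andP: (y01 i).
have s0 : 0 <= s by apply: prodr_ge0 => i _; exact: sqr_ge0.
pose D := 1 - s.
have Dup : D <= q ^+ 2 by rewrite /D; move: s_lo Yup; clra.
have Dlo : q ^+ 2 * (1 - q ^+ 2) ^+ 2 <= D.
  have f1 : Y * (1 - Y) <= D.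
    have f2 : 0 <= (s - (1 - Y)) * Y by rewrite mulr_ge0 // subr_ge0.
    by rewrite /D; move: f2 s_up; clra.
  have f2 : q ^+ 2 * (1 - q ^+ 2) * (1 - q ^+ 2) <= Y * (1 - Y).
    apply: ler_pM => //; last by move: Yup; clra.
    - by rewrite mulr_ge0 ?sqr_ge0 // subr_ge0; move: q2; clra.
    - by rewrite subr_ge0; move: q2; clra.
  by apply: le_trans f1; rewrite expr2 mulrA.
have Dq : q ^+ 2 / 2 <= D.
  apply: le_trans Dlo; apply: ler_wpM2l; first exact: sqr_ge0.
  have : 0 <= (1 / 4 - q ^+ 2) * (7 / 4 - q ^+ 2) by apply: mulr_ge0; move: q2; clra.
  clra.
have D0 : 0 < D by apply: lt_le_trans Dq; rewrite divr_gt0.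
have s1 : s < 1 by move: D0; rewrite /D; clra.
have s01 : 0 <= s < 1 by rewrite s0.
have sigE : sig n K p = 2 * n%:R * (D * AK s K - aN K * (1 - s ^+ K)).
  rewrite /sig -abel_bN; congr (_ * _); rewrite /LK; apply: eq_bigr => N _; congr (_ * _).
  rewrite ENB EN_cst; congr (_ - _).
  have := @EN_cos R d N.+1 (n%:R^-1 *: freq p) 0; rewrite cos0 mulr1 => <-.
  by apply: EN_ext => z; rewrite addr0.
have /andP[A1 A2] := AK_sqr K s01; rewrite -/D in A1 A2.
have A0 : 0 <= AK s K by apply: sumr_ge0 => i _; rewrite mulr_ge0 ?exprn_ge0 // ltW // aN_gt0.
have DA0 : 0 <= D * AK s K by rewrite mulr_ge0 // ltW.
have KR : n%:R ^+ 4 <= K%:R :> R by rewrite -natrX ler_nat.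
have ak0 : 0 < aN K :> R := aN_gt0 K.
have ak : aN K * n%:R ^+ 2 <= 1 :> R.
  apply: aN_le; first exact: exprn_ge0.
  by rewrite -exprM; move: KR; clra.
have sK0 : 0 <= s ^+ K by exact: exprn_ge0.
have sK1 : s ^+ K <= 1 by apply: exprn_ile1 => //; exact: ltW.
(* Nonzero frequencies have 1 - s >= q^2/2 >= 1/(8 n^2), so K (1 - s) is at least n^2/8. *)
have sK : s ^+ K * n%:R ^+ 2 <= 8.
  have h1 := pow_le_inv K s01; rewrite -/D in h1.
  have h2 : n%:R ^+ 2 / 8 <= K%:R * D.
    apply: (@le_trans _ _ (n%:R ^+ 4 * (q ^+ 2 / 2))); last first.
      by apply: ler_pM => //; rewrite divr_ge0 // ltW.
    have -> : n%:R ^+ 4 * (q ^+ 2 / 2) = n%:R ^+ 2 / 8 * P ^+ 2 by rewrite /q; field; rewrite gt_eqF.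
    by rewrite ler_peMr ?divr_ge0 ?sqr_ge0 // exprn_ege1.
  have := ler_wpM2l sK0 h2; move: h1; clra.
have DAq : D * AK s K <= q.
  rewrite -ler_sqr ?nnegrE ?(ltW q0) // (_ : (D * AK s K) ^+ 2 = D * (AK s K ^+ 2 * D)); last by ring.
  by apply: le_trans Dup; apply: ler_piMr; [exact: ltW |].
have DAlo : q * (1 - q ^+ 2) * (1 - s ^+ K) <= D * AK s K.
  have u0 : 0 <= 1 - s ^+ K by rewrite subr_ge0.
  have v0 : 0 <= 1 - q ^+ 2 by rewrite subr_ge0; move: q2; clra.
  rewrite -ler_sqr ?nnegrE //; last by rewrite !mulr_ge0 // ltW.
  rewrite (_ : (D * AK s K) ^+ 2 = D * (AK s K ^+ 2 * D)); last by ring.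
  rewrite 2!exprMn.
  apply: ler_pM; [exact: mulr_ge0 (sqr_ge0 _) (sqr_ge0 _) | exact: sqr_ge0 | exact: Dlo |].
  by apply: le_trans A1; rewrite expr2; apply: ler_piMr => //; move: sK0; clra.
have nq : 2 * n%:R * q = P by rewrite /q; field; rewrite gt_eqF.
have na : 2 * n%:R * (aN K * (1 - s ^+ K)) <= 2 / n%:R.
  rewrite ler_pdivlMr // (_ : _ * n%:R = 2 * (1 - s ^+ K) * (aN K * n%:R ^+ 2)); last by ring.
  apply: (@le_trans _ _ (2 * (1 - s ^+ K) * 1)); last by move: sK0; clra.
  by apply: ler_wpM2l => //; rewrite mulr_ge0 // subr_ge0.
have na0 : 0 <= 2 * n%:R * (aN K * (1 - s ^+ K)) by rewrite !mulr_ge0 ?(ltW ak0) // ?subr_ge0 // ltW.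
have up : sig n K p <= P.
  rewrite sigE mulrBr -nq; have := ler_wpM2l (_ : 0 <= 2 * n%:R) DAq; rewrite mulr_ge0 ?(ltW nR) // => /(_ isT).
  by move: na0; clra.
have lo : P - (P ^+ 3 + 8 * P + 2) / n%:R <= sig n K p.
  rewrite sigE mulrBr; have h := ler_wpM2l (_ : 0 <= 2 * n%:R) DAlo; move: h; rewrite mulr_ge0 ?(ltW nR) // => /(_ isT).
  rewrite (_ : 2 * n%:R * _ = P * (1 - q ^+ 2) * (1 - s ^+ K)); last by rewrite -nq; ring.
  move=> h.
  have Pq : P * q ^+ 2 <= P ^+ 3 / n%:R.
    rewrite /q ler_pdivlMr // expr_div_n (_ : _ * _ * n%:R = P ^+ 3 * (4 * n%:R)^-1); last by field; rewrite gt_eqF.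
    by rewrite ler_piMr ?exprn_ge0 ?(ltW P0) // invf_le1 ?mulr_gt0 //; move: n1R; clra.
  have Ps : P * s ^+ K <= 8 * P / n%:R.
    rewrite ler_pdivlMr // -mulrA mulrC ler_wpM2r ?(ltW P0) //.
    apply: le_trans sK; rewrite ler_wpM2l // expr2 ler_peMr // ltW.
  have Pqs : 0 <= P * q ^+ 2 * s ^+ K by rewrite !mulr_ge0 ?sqr_ge0 // ltW.
  rewrite (_ : (P ^+ 3 + 8 * P + 2) / n%:R = P ^+ 3 / n%:R + 8 * P / n%:R + 2 / n%:R); last by field; rewrite gt_eqF.
  by move: h Pq Ps Pqs na; clra.
have e0 : 0 <= (P ^+ 3 + 8 * P + 2) / n%:R by rewrite divr_ge0 ?addr_ge0 ?mulr_ge0 ?exprn_ge0 ?(ltW P0) // ltW.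
by rewrite ler_norml; apply/andP; split; move: up lo e0; clra.
Qed.

Lemma sig_cvg j (e : R) : 0 < e -> exists n0, forall n K, (n0 <= n)%N -> (n ^ 4 <= K)%N ->
  forall p, p \in Bx j -> `|sig n K p - nz p| <= e.
Proof.
move=> e0.
pose Pm : R := \sum_(p <- Bx j) nz p.
have Pm0 : 0 <= Pm by apply: sumr_ge0 => p _; exact: nz_ge0.
have hP p : p \in Bx j -> nz p <= Pm.
  by move=> pj; rewrite /Pm (bigD1_seq p) ?bx_uniq //= lerDl; apply: sumr_ge0 => q _; exact: nz_ge0.
have [n0 H] := @ex_large_nat R [:: (Pm, 1); (Pm ^+ 3 + 8 * Pm + 2, e)] ltac:(by rewrite /= ltr01 e0).
exists n0 => n K /H [n1]; rewrite /= mul1r andbT => /andP[h1 h2] nK p pj.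
have nR : 0 < n%:R :> R by exact: lt_le_trans n1.
apply: le_trans (@sig_near n K p _ _ nK) _.
- exact: le_trans (hP p pj) h1.
- by rewrite -(ler_nat R).
rewrite ler_pdivrMr //; apply: le_trans h2; rewrite lerD2r; apply: lerD.
  by apply: lerXn2r; rewrite ?nnegrE ?nz_ge0 // hP.
by rewrite ler_wpM2l // hP.
Qed.

End Symbol.

(** * Fourier multipliers and convergence of the mesh operator *)

Section Multipliers.
Implicit Types (c : Z -> C) (s : Z -> R).

Definition mlt s c : Z -> C := fun p => (s p)%:C%C * c p.

Lemma herm_mlt s c : (forall p, s (- p) = s p) -> herm c -> herm (mlt s c).
Proof. by move=> se hc p; rewrite /mlt se hc; apply: complexP; rewrite ?(ReJ, ImJ) /=; case: (c p) => u v /=; ring. Qed.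

Lemma normc_mlt s c p : 0 <= s p -> normc (mlt s c p) = s p * normc (c p).
Proof. by move=> s0; rewrite /mlt ComplexField.Normc.normcM /= expr0n addr0 sqrtr_sqr ger0_norm. Qed.

Lemma norm_tri (u v : R) : `|u| <= `|v| + `|u - v|.
Proof. by have := ler_normD v (u - v); rewrite addrC subrK. Qed.

Lemma mlt_limit s (L B : R) a f : (d < 2 * a)%N -> (forall p, 0 <= s p <= L * jn p) -> (forall p, s (- p) = s p) ->
  Hs a.+1 f B -> exists g, [/\ cp g, forall xi, ft g xi = mlt s (ft f) xi &
    forall j e x, tail (fun p => jn p * normc (ft f p)) j e -> `|g x - syn (mlt s (ft f)) (2 ^ j) x| <= L * e].
Proof.
move=> da sL se Hf; have [cf _] := Hf.
have L0 : 0 <= L.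
  have /andP[h1 h2] := sL 0; have := le_trans h1 h2; rewrite pmulr_lge0 //; exact: jn_gt0.
have tl j e : tail (fun p => jn p * normc (ft f p)) j e -> tail (fun p => normc (mlt s (ft f) p)) j (L * e).
  move=> h j' jj'; apply: le_trans (ler_wpM2l L0 (h j' jj')); rewrite mulr_sumr; apply: ler_sum => p _.
  have /andP[h1 h2] := sL p; rewrite normc_mlt // mulrA ler_wpM2r //; exact: normc_ge0.
have [|| g [h1 h2 h3]] := @syn_limit (mlt s (ft f)).
- move=> e e0; have L1 : 0 < L + 1 by move: L0; clra.
  have [j hj] := @X_tail a B (e / (L + 1)) da (Hs_ge0 Hf) (divr_gt0 e0 L1).
  exists j => j' jj'; apply: le_trans (tl _ _ (hj f Hf) j' jj') _.
  by rewrite mulrCA ler_piMr ?(ltW e0) // ler_pdivrMr // mul1r; lra.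
- exact: herm_mlt (ft_herm cf.1).
by exists g; split=> // j e x /tl; exact: h3.
Qed.

Lemma syn_mlt_bound s (L B : R) a f j x : (d < 2 * a)%N -> (forall p, 0 <= s p <= L * jn p) -> Hs a.+1 f B ->
  `|syn (mlt s (ft f)) (2 ^ j) x| <= L * ((S0 + B) / 2).
Proof.
move=> da sL Hf; have L0 : 0 <= L.
  have /andP[h1 h2] := sL 0; have := le_trans h1 h2; rewrite pmulr_lge0 //; exact: jn_gt0.
apply: le_trans (syn_norm _ _ _) _; apply: le_trans (ler_wpM2l L0 (X_bound (2 ^ j) da Hf)).
rewrite mulr_sumr; apply: ler_sum => p _; have /andP[h1 h2] := sL p.
by rewrite normc_mlt // mulrA ler_wpM2r //; exact: normc_ge0.
Qed.

Definition is_absn f g := cp g /\ forall xi, ft g xi = mlt nz (ft f) xi.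

(** Chosen by its Fourier coefficients, hence equal to every function that has them; where none
    exists the value is the zero function. *)
Definition absn f : V -> R := xget (fun=> 0) [set g | is_absn f g].

Lemma nz_jn p : 0 <= nz p <= 1 * jn p.
Proof. by rewrite nz_ge0 mul1r nz_le_jn. Qed.

Lemma absn_eq f g : is_absn f g -> absn f = g.
Proof.
move=> h; rewrite /absn; case: xgetP => [g' _ [h1 h2]|/(_ g)//].
by apply: ft_inj => //; [exact: h.1 | move=> xi; rewrite h2 h.2].
Qed.

Lemma absn_spec a f B : (d < 2 * a)%N -> Hs a.+1 f B -> is_absn f (absn f) /\
  forall j e x, tail (fun p => jn p * normc (ft f p)) j e -> `|absn f x - syn (mlt nz (ft f)) (2 ^ j) x| <= e.
Proof.
move=> da Hf; have [g [h1 h2 h3]] := mlt_limit da nz_jn (@nzN R d) Hf.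
have gE : is_absn f g by [].
rewrite (absn_eq gE); split=> // j e x /h3; rewrite mul1r; exact.
Qed.

(** It acts on functions on the whole torus; each translate x + n^-1 Z^d is mapped into itself,
    which is how lattice estimates apply at every point. *)
Definition lamN n K f x : R := 2 * n%:R * LK K (fun z => f x - f (x + n%:R^-1 *: freq z)).

Lemma lamN_ext n K f g x : (forall y, f y = g y) -> lamN n K f x = lamN n K g x.
Proof. by move=> fg; rewrite /lamN; congr (_ * _); apply: LK_ext => z; rewrite !fg. Qed.

Lemma lamND n K f g x : lamN n K (fun y => f y + g y) x = lamN n K f x + lamN n K g x.
Proof. by rewrite /lamN -mulrDr -LKD; congr (_ * _); apply: LK_ext => z; ring. Qed.

Lemma lamNB n K f g x : lamN n K (fun y => f y - g y) x = lamN n K f x - lamN n K g x.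
Proof. by rewrite /lamN -mulrBr -LKB; congr (_ * _); apply: LK_ext => z; ring. Qed.

Lemma lamN_norm n K f e x : (forall y, `|f y| <= e) -> `|lamN n K f x| <= 4 * n%:R * e.
Proof.
move=> fe; have e0 : 0 <= e by exact: le_trans (fe 0).
rewrite /lamN normrM ger0_norm ?mulr_ge0 // (_ : 4 * n%:R * e = 2 * n%:R * (e + e)); last by ring.
rewrite ler_wpM2l ?mulr_ge0 //; apply: le_trans (LK_norm _ _) _; apply: LK_le_cst; first exact: addr_ge0.
by move=> z; apply: le_trans (ler_normB _ _) _; exact: lerD.
Qed.

Lemma lamN_sum n K (I : Type) (r : seq I) (F : I -> V -> R) x :
  lamN n K (fun y => \sum_(i <- r) F i y) x = \sum_(i <- r) lamN n K (F i) x.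
Proof.
elim: r => [|i r IH].
  rewrite big_nil /lamN (@LK_ext _ _ _ _ (fun=> 0)) ?LK_cst ?mul0r ?mulr0 //.
  by move=> z; rewrite !big_nil subrr.
by rewrite big_cons -IH -lamND; apply: lamN_ext => y; rewrite big_cons.
Qed.

Lemma lamN_pr n K c p x : lamN n K (pr (c p) p) x = pr (mlt (sig n K) c p) p x.
Proof.
have -> : pr (mlt (sig n K) c p) p x = sig n K p * pr (c p) p x by rewrite !prE /mlt; case: (c p) => u v /=; ring.
pose D := complex.Re (c p) * sin (dot (freq p) x) + complex.Im (c p) * cos (dot (freq p) x).
pose t z : R := dot (n%:R^-1 *: freq p) (freq z).
have h z : pr (c p) p x - pr (c p) p (x + n%:R^-1 *: freq z) = pr (c p) p x * (1 - cos (t z)) + D * sin (t z).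
  rewrite !prE dotDr dotZr -dotZl -/(t z) cosD sinD /D; ring.
rewrite /lamN (@LK_ext _ _ _ _ _ h) LKD !LKZ.
have -> : LK K (fun z => sin (t z)) = 0.
  have h2 : LK K (fun z => sin (t z)) = - LK K (fun z => sin (t z)).
    rewrite -{1}LK_even -LKN; apply: LK_ext => z.
    by rewrite /t freqN dotNr sinN.
  by move: h2; set X := LK _ _; clra.
by rewrite /sig; ring.
Qed.

Lemma lamN_syn n K c P x : lamN n K (syn c P) x = syn (mlt (sig n K) c) P x.
Proof. by rewrite /syn (@lamN_sum n K _ (bx P) (fun p => pr (c p) p)); apply: eq_bigr => p _; exact: lamN_pr. Qed.

Definition Lsig : R := 2 * (d%:R + 3).

Lemma Lsig_ge1 : 1 <= Lsig. Proof. by have := ler0n R d; rewrite /Lsig; lra. Qed.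

Lemma sig_jn n K p : (0 < n)%N -> 0 <= sig n K p <= Lsig * jn p.
Proof.
move=> n0; rewrite sig_ge0 /=; apply: le_trans (sig_le _ _ n0) _; rewrite ler_wpM2l ?nz_le_jn //.
Qed.

(** For fixed [n] the operator is bounded in sup norm by 4n, so it commutes with the limit of
    partial sums. The final error bound is uniform in [n] because the symbol is at most
    [Lsig * jn]. *)
Lemma lamN_spec n K a f B : (0 < n)%N -> (d < 2 * a)%N -> Hs a.+1 f B ->
  [/\ cp (lamN n K f), forall xi, ft (lamN n K f) xi = mlt (sig n K) (ft f) xi &
  forall j e x, tail (fun p => jn p * normc (ft f p)) j e ->
    `|lamN n K f x - syn (mlt (sig n K) (ft f)) (2 ^ j) x| <= Lsig * e].
Proof.
move=> n0 da Hf; have [g [h1 h2 h3]] := mlt_limit da (fun p => sig_jn K p n0) (@sigN n K) Hf.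
suff -> : lamN n K f = g by [].
apply/funext => x; apply/eqP; rewrite -subr_eq0 -normr_le0; apply/ler_addgt0Pr => e e0; rewrite add0r.
pose A := 4 * n%:R + Lsig.
have A0 : 0 < A by rewrite /A; have := Lsig_ge1; have := ler0n R n; lra.
have [j hj] := @X_tail a B (e / A) da (Hs_ge0 Hf) (divr_gt0 e0 A0).
have := hj f Hf => {}hj.
have t1 : tail (fun p => normc (ft f p)) j (e / A) by apply: tail_le hj => p; rewrite ler_peMl ?jn_ge1 // normc_ge0.
have app y := syn_approx y Hf.1 (Hs_asum da Hf) t1.
have k1 := @lamN_norm n K (fun y => f y - syn (ft f) (2 ^ j) y) _ x app.
rewrite lamNB lamN_syn in k1.
have k2 := h3 _ _ x hj.
have -> : e = 4 * n%:R * (e / A) + Lsig * (e / A) by rewrite /A; field; rewrite gt_eqF.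
apply: le_trans (lerD k1 k2); rewrite (distrC (g x)); set T := syn _ _ _.
have -> : lamN n K f x - g x = (lamN n K f x - T) + (T - g x) by ring.
exact: ler_normD.
Qed.

Lemma lamN_bound n K a f B x : (0 < n)%N -> (d < 2 * a)%N -> Hs a.+1 f B -> `|lamN n K f x| <= Lsig * ((S0 + B) / 2 + 1).
Proof.
move=> n0 da Hf; have [_ _ h] := lamN_spec K n0 da Hf.
have [j hj] := @X_tail a B 1 da (Hs_ge0 Hf) ltr01.
have k1 := h _ _ x (hj f Hf).
have k2 := syn_mlt_bound j x da (fun p => sig_jn K p n0) Hf.
have := lerD k2 k1; rewrite mulr1 mulrDr mulr1; apply: le_trans.
exact: norm_tri.
Qed.

Lemma absn_bound a f B x : (d < 2 * a)%N -> Hs a.+1 f B -> `|absn f x| <= (S0 + B) / 2 + 1.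
Proof.
move=> da Hf; have [_ h] := absn_spec da Hf.
have [j hj] := @X_tail a B 1 da (Hs_ge0 Hf) ltr01.
have k1 := h _ _ x (hj f Hf).
have k2 := syn_mlt_bound j x da nz_jn Hf; rewrite mul1r in k2.
apply: le_trans (lerD k2 k1).
exact: norm_tri.
Qed.

Lemma synB2 c c' P x : syn c P x - syn c' P x = syn (fun p => c p - c' p) P x.
Proof. by rewrite /syn -sumrB; apply: eq_bigr => p _; rewrite !prE; case: (c p) (c' p) => u v [u' v'] /=; ring. Qed.

(** High frequencies are small uniformly over the ball; on the finitely many remaining ones the
    symbols converge and the coefficients of [f] and [g] are close. *)
Lemma lamN_cvg a (B e : R) : (d < 2 * a)%N -> 0 <= B -> 0 < e -> exists n0, exists2 dl : R, 0 < dl &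
  forall f g n K, Hs a.+1 f B -> Hs a.+1 g B -> (forall y, `|f y - g y| <= dl) -> (n0 <= n)%N -> (n ^ 4 <= K)%N ->
  forall x, `|lamN n K f x - absn g x| <= e.
Proof.
move=> da B0 e0.
have L1 := Lsig_ge1.
have L0 : 0 < Lsig + 1 by lra.
have [j hj] := @X_tail a B (e / 2 / (Lsig + 1)) da B0 (divr_gt0 (divr_gt0 e0 (ltr0n _ 2)) L0).
have S00 := @S0_gt0.
have W0 : 0 < (S0 + B) / 2 by move: S00 B0; clra.
pose N : R := (\sum_(p <- Bx j) nz p) + 1.
have N0 : 0 < N by rewrite ltr_wpDl // sumr_ge0 // => p _; exact: nz_ge0.
have [n0 h0] := @sig_cvg j _ (divr_gt0 e0 (mulr_gt0 (ltr0n R 4) W0)).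
exists n0.+1; exists (e / (4 * N)); first by rewrite divr_gt0 // mulr_gt0.
move=> f g n K Hf Hg fg nn nK x.
have n1 : (0 < n)%N by exact: leq_trans nn.
have [_ _ h1] := lamN_spec K n1 da Hf; have [_ h2] := absn_spec da Hg.
have k1 := h1 _ _ x (hj f Hf); have k2 := h2 _ _ x (hj g Hg).
have [c1 _] := Hf; have [c2 _] := Hg.
have k3 : `|syn (mlt (sig n K) (ft f)) (2 ^ j) x - syn (mlt nz (ft g)) (2 ^ j) x| <= e / 2.
  rewrite synB2; apply: le_trans (syn_norm _ _ _) _.
  have dn p : normc (ft f p - ft g p) <= e / (4 * N).
    by rewrite -ftB; [apply: ft_norm => //; apply: contB; [exact: c1.1|exact: c2.1] | exact: c1.1 | exact: c2.1].
  have b1 : \sum_(p <- Bx j) normc (mlt (sig n K) (ft f) p - mlt nz (ft g) p) <=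
     \sum_(p <- Bx j) (e / (4 * ((S0 + B) / 2)) * (jn p * normc (ft f p)) + nz p * (e / (4 * N))).
    rewrite !big_seq; apply: ler_sum => p pj.
    have -> : mlt (sig n K) (ft f) p - mlt nz (ft g) p = (sig n K p - nz p)%:C%C * ft f p + (nz p)%:C%C * (ft f p - ft g p).
      rewrite /mlt; apply: complexP; case: (ft f p) (ft g p) => u v [u' v'] /=; ring.
    apply: le_trans (le_normcD _ _) _.
    have nM (t : R) (w : C) : normc (t%:C%C * w) = `|t| * normc w.
      by rewrite ComplexField.Normc.normcM /= expr0n addr0 sqrtr_sqr.
    rewrite (nM _ (ft f p)) (nM _ (ft f p - ft g p)); apply: lerD; last by rewrite ger0_norm ?nz_ge0 // ler_wpM2l ?nz_ge0.
    have h3 := h0 n K (ltnW nn) nK p pj.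
    apply: ler_pM; rewrite ?normc_ge0 //.
    by rewrite ler_peMl ?jn_ge1 // normc_ge0.
  apply: le_trans b1 _; rewrite big_split /= -mulr_sumr -mulr_suml.
  have b2 : e / (4 * ((S0 + B) / 2)) * \sum_(p <- Bx j) jn p * normc (ft f p) <= e / 4.
    have e4 : 0 <= e / (4 * ((S0 + B) / 2)) by rewrite divr_ge0 ?(ltW e0) // mulr_ge0 // ltW.
    apply: le_trans (ler_wpM2l e4 (X_bound _ da Hf)) _.
    rewrite le_eqVlt; apply/orP; left; apply/eqP; field; rewrite gt_eqF //; move: S00 B0; clra.
  have b3 : (\sum_(p <- Bx j) nz p) * (e / (4 * N)) <= e / 4.
    have -> : e / 4 = N * (e / (4 * N)) by field; rewrite gt_eqF.
    by rewrite ler_wpM2r ?divr_ge0 ?(ltW e0) ?mulr_ge0 ?(ltW N0) // /N lerDl.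
  by move: b2 b3; clra.
have := lerD (lerD k1 k2) k3.
have -> : Lsig * (e / 2 / (Lsig + 1)) + e / 2 / (Lsig + 1) + e / 2 = e by field; rewrite gt_eqF.
apply: le_trans; rewrite (distrC (absn g x)); set S := syn _ _ x; set T := syn _ _ x.
have -> : lamN n K f x - absn g x = (lamN n K f x - S) + (T - absn g x) + (S - T) by ring.
by apply: le_trans (ler_normD _ _) _; rewrite lerD2r ler_normD.
Qed.

End Multipliers.

(** * The nonlinear term and its mesh approximation *)

Section Nonlinearity.

Definition sq f : V -> R := fun x => f x * f x.
Definition QN n K f x : R := f x * lamN n K f x - lamN n K (sq f) x.
Definition QQ f x : R := f x * absn f x - absn (sq f) x.

Lemma QNE n K f x : QN n K f x =
  2 * n%:R * LK K (fun z => f (x + n%:R^-1 *: freq z) * (f (x + n%:R^-1 *: freq z) - f x)).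
Proof.
rewrite /QN /lamN [f x * _]mulrCA -mulrBr; congr (_ * _); rewrite -LKZ -LKB; apply: LK_ext => z.
by rewrite /sq; ring.
Qed.

Variable a : nat.
Hypothesis da : (d < 2 * a)%N.

Lemma da1 : (d < 2 * a.+1)%N. Proof. by apply: leq_trans da _; rewrite leq_mul2l leqnSn. Qed.

Lemma Hs_sq f B : Hs a.+1 f B -> Hs a.+1 (sq f) (Cp a.+1 * B * B).
Proof. by move=> Hf; exact: (Hs_mul da1 (Hs_asum da Hf) Hf Hf). Qed.

Lemma Hs_le (s : nat) f (B B' : R) : B <= B' -> Hs s f B -> Hs s f B'.
Proof. by move=> BB [h1 h2]; split=> // P; exact: le_trans BB. Qed.

Lemma Hs_norm f B x : Hs a.+1 f B -> `|f x| <= (S0 + B) / 2 + 1.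
Proof.
move=> Hf; apply: le_trans (Hs_sup da x (Hs_down Hf)) _.
by apply: le_trans (sqrt_mul_le (ltW S0_gt0) (Hs_ge0 Hf)) _; rewrite lerDl.
Qed.

Lemma QN_bound (B : R) : 0 <= B -> exists2 A : R, 0 <= A & forall n K f x, (0 < n)%N -> Hs a.+1 f B -> `|QN n K f x| <= A.
Proof.
move=> B0; have S00 := @S0_gt0; have L1 := @Lsig_ge1.
pose M := (S0 + B) / 2 + 1; pose B2 := Cp a.+1 * B * B; pose M2 := (S0 + B2) / 2 + 1.
have C0 := @Cp_gt0 a.+1.
have B20 : 0 <= B2 by apply: mulr_ge0 => //; apply: mulr_ge0 => //; exact: ltW.
have M0 : 0 <= M by rewrite /M; move: S00 B0; clra.
have M20 : 0 <= M2 by rewrite /M2; move: S00 B20; clra.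
have L0 : 0 <= @Lsig := le_trans ler01 L1.
exists (M * (@Lsig * M) + @Lsig * M2); first by rewrite addr_ge0 // mulr_ge0 // mulr_ge0.
move=> n K f x n0 Hf; rewrite /QN; apply: le_trans (ler_normB _ _) _; apply: lerD; last first.
  exact: (lamN_bound K x n0 da (Hs_sq Hf)).
by rewrite normrM; apply: ler_pM => //; [exact: Hs_norm Hf | exact: (lamN_bound K x n0 da Hf)].
Qed.

(** Consistency and continuity in the argument at once: [f] and [g] only have to be uniformly close
    within one Sobolev ball. *)
Lemma QN_cvg (B e : R) : 0 <= B -> 0 < e -> exists n0, exists2 dl : R, 0 < dl &
  forall f g n K, Hs a.+1 f B -> Hs a.+1 g B -> (forall y, `|f y - g y| <= dl) -> (n0 <= n)%N -> (n ^ 4 <= K)%N ->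
  forall x, `|QN n K f x - QQ g x| <= e.
Proof.
move=> B0 e0; have S00 := @S0_gt0.
pose M := (S0 + B) / 2 + 1; pose B2 := Cp a.+1 * B * B.
have C0 := @Cp_gt0 a.+1.
have B20 : 0 <= B2 by apply: mulr_ge0 => //; apply: mulr_ge0 => //; exact: ltW.
have M1 : 1 <= M by rewrite /M; move: S00 B0; clra.
have M0 : 0 < M by exact: lt_le_trans M1.
have [n1 [d1 d10 h1]] := lamN_cvg da B0 (divr_gt0 e0 (mulr_gt0 (ltr0n R 3) M0)).
have [n2 [d2 d20 h2]] := lamN_cvg da B20 (divr_gt0 e0 (ltr0n R 3)).
pose dl := Num.min d1 (Num.min (d2 / (2 * M)) (e / (3 * M))).
have dl0 : 0 < dl by rewrite /dl !lt_min d10 !divr_gt0 // mulr_gt0.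
exists (maxn n1 n2); exists dl => // f g n K Hf Hg fg; rewrite geq_max => /andP[nn1 nn2] nK x.
have dl1 : dl <= d1 by rewrite /dl ge_min lexx.
have dl2 : dl <= d2 / (2 * M) by rewrite /dl !ge_min lexx orbT.
have dl3 : dl <= e / (3 * M) by rewrite /dl !ge_min lexx !orbT.
have bf y : `|f y| <= M by exact: Hs_norm Hf.
have bg y : `|g y| <= M by exact: Hs_norm Hg.
have k1 := h1 f g n K Hf Hg (fun y => le_trans (fg y) dl1) nn1 nK x.
have fg2 y : `|sq f y - sq g y| <= d2.
  rewrite /sq (_ : _ - _ = (f y + g y) * (f y - g y)); last by ring.
  rewrite normrM (_ : d2 = (2 * M) * (d2 / (2 * M))); last by field; rewrite gt_eqF.
  apply: ler_pM => //; last by exact: le_trans (fg y) dl2.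
  by apply: le_trans (ler_normD _ _) _; have := bf y; have := bg y; clra.
have k2 := h2 (sq f) (sq g) n K (Hs_sq Hf) (Hs_sq Hg) fg2 nn2 nK x.
have ab := absn_bound x da Hg; rewrite -/M in ab.
rewrite /QN /QQ (_ : _ - _ = f x * (lamN n K f x - absn g x) + (f x - g x) * absn g x - (lamN n K (sq f) x - absn (sq g) x)); last by ring.
have -> : e = M * (e / (3 * M)) + e / (3 * M) * M + e / 3 by field; rewrite gt_eqF.
apply: le_trans (ler_normB _ _) _; apply: lerD => //; apply: le_trans (ler_normD _ _) _.
rewrite !normrM; apply: lerD; apply: ler_pM => //.
exact: le_trans (fg x) dl3.
Qed.

End Nonlinearity.

(** * An inequality for powers of the sides of a triangle *)

Section PowerInequalities.
Lemma pow_diff a (z y M : R) : 0 <= z <= M -> 0 <= y <= M -> `|z ^+ a.+1 - y ^+ a.+1| <= a.+1%:R * `|z - y| * M ^+ a.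
Proof.
move=> /andP[z0 zM] /andP[y0 yM]; have M0 : 0 <= M by exact: le_trans zM.
elim: a => [|a IH]; first by rewrite !expr1 mul1r expr0 mulr1.
have -> : z ^+ a.+2 - y ^+ a.+2 = z * (z ^+ a.+1 - y ^+ a.+1) + (z - y) * y ^+ a.+1 by rewrite !exprS; ring.
apply: le_trans (ler_normD _ _) _; rewrite !normrM (ger0_norm z0).
have h1 : z * `|z ^+ a.+1 - y ^+ a.+1| <= M * (a.+1%:R * `|z - y| * M ^+ a) by exact: ler_pM.
have h2 : `|z - y| * `|y ^+ a.+1| <= `|z - y| * M ^+ a.+1.
  by rewrite ler_wpM2l // ger0_norm ?exprn_ge0 //; apply: lerXn2r; rewrite ?nnegrE.
apply: le_trans (lerD h1 h2) _; rewrite le_eqVlt; apply/orP; left; apply/eqP.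
by rewrite -(natr1 a.+1) exprS; ring.
Qed.

(** If x <= y, the sides z and y differ by at most x, so their powers differ by a multiple of x y^a;
    x^(a+1) is no larger than x y^a. The extra factor x + y is at most 2y. *)
Lemma pow_commutator a (x y z : R) : 0 <= x -> 0 <= y -> 0 <= z -> z <= x + y -> x <= z + y -> y <= z + x ->
  (x + y) * `|z ^+ a.+1 - x ^+ a.+1 - y ^+ a.+1| <= 2 * (a.+1%:R * 2 ^+ a + 1) * (x * y ^+ a.+1 + y * x ^+ a.+1).
Proof.
move=> x0 y0 z0 h1 h2 h3; wlog xy : x y x0 y0 h1 h2 h3 / x <= y.
  move=> H; have [xy|/ltW yx] := leP x y; first exact: H.
  have := H y x y0 x0; rewrite [y + x]addrC (addrC (y * _)) => /(_ h1 h3 h2 yx).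
  by rewrite -addrA (addrC (- y ^+ _)) addrA.
set A := a.+1%:R * 2 ^+ a.
have A0 : 0 <= A by rewrite mulr_ge0.
have Y0 : 0 <= y ^+ a by exact: exprn_ge0.
have d1 : `|z ^+ a.+1 - y ^+ a.+1| <= A * (x * y ^+ a).
  have := @pow_diff a z y (2 * y); rewrite z0 y0 /=.
  have -> : z <= 2 * y by move: h1 xy; clra.
  have -> : y <= 2 * y by move: y0; clra.
  move=> /(_ isT isT) H; apply: le_trans H _; rewrite exprMn.
  rewrite (_ : A * (x * y ^+ a) = a.+1%:R * x * (2 ^+ a * y ^+ a)); last by rewrite /A; ring.
  apply: ler_wpM2r; first by apply: mulr_ge0.
  by apply: ler_wpM2l => //; rewrite ler_norml; move: h1 h3; clra.
have d2 : x ^+ a.+1 <= x * y ^+ a by rewrite exprS; apply: ler_wpM2l => //; apply: lerXn2r; rewrite ?nnegrE.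
have d3 : `|z ^+ a.+1 - x ^+ a.+1 - y ^+ a.+1| <= (A + 1) * (x * y ^+ a).
  rewrite (_ : _ - _ - _ = (z ^+ a.+1 - y ^+ a.+1) - x ^+ a.+1); last by ring.
  apply: le_trans (ler_normB _ _) _; rewrite (ger0_norm (exprn_ge0 _ x0)).
  by move: d1 d2; clra.
apply: (@le_trans _ _ (2 * y * ((A + 1) * (x * y ^+ a)))).
  by apply: ler_pM => //; [exact: addr_ge0 | move: xy; clra].
have p0 : 0 <= 2 * (A + 1) * (y * x ^+ a.+1).
  apply: mulr_ge0; first by move: A0; clra.
  by apply: mulr_ge0 => //; exact: exprn_ge0.
have p1 : 2 * y * ((A + 1) * (x * y ^+ a)) = 2 * (A + 1) * (x * y ^+ a.+1) by rewrite (exprS y); ring.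
by rewrite p1 mulrDr; move: p0; clra.
Qed.

End PowerInequalities.

(** * The scheme and its limit *)

Section EnergyEstimate.
Local Notation Re := complex.Re.
Implicit Types (u : V -> R) (c : Z -> C).

Lemma Re_le (z : C) : `|Re z| <= normc z.
Proof. by case: z => x y /=; rewrite -sqrtr_sqr ler_wsqrtr // lerDl sqr_ge0. Qed.

Lemma Re_sum (I : Type) (r : seq I) (F : I -> C) : Re (\sum_(i <- r) F i) = \sum_(i <- r) Re (F i).
Proof. by elim: r => [|i r IH]; rewrite ?big_nil ?big_cons // -IH; case: (F i) (\sum_(j <- r) F j) => ? ? []. Qed.

Definition ip (z w : C) : R := Re ((z^*)%C * w).

Lemma ip_le (z w : C) : `|ip z w| <= normc z * normc w.
Proof. by apply: le_trans (Re_le _) _; rewrite ComplexField.Normc.normcM normcJ. Qed.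

Lemma ipDr (z w w' : C) : ip z (w + w') = ip z w + ip z w'.
Proof. by rewrite /ip; case: z w w' => ? ? [? ?] [? ?] /=; ring. Qed.

Lemma ipZr (z : C) (t : R) (w : C) : ip z (t%:C%C * w) = t * ip z w.
Proof. by rewrite /ip; case: z w => ? ? [? ?] /=; ring. Qed.

Lemma ipZl (z : C) (t : R) (w : C) : ip (t%:C%C * z) w = t * ip z w.
Proof. by rewrite /ip; case: z w => ? ? [? ?] /=; ring. Qed.

Lemma ipzz (z : C) : ip z z = normc z ^+ 2.
Proof. by rewrite normcE /ip; case: z => ? ? /=; ring. Qed.

Lemma normc_sqrD (z : C) (t : R) (w : C) : normc (z + t%:C%C * w) ^+ 2 = normc z ^+ 2 + 2 * t * ip z w + t ^+ 2 * normc w ^+ 2.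
Proof. by rewrite !normcE /ip; case: z w => ? ? [? ?] /=; ring. Qed.

Lemma parseval c P g : herm c -> continuous g -> mean (fun x => syn c P x * g x) = \sum_(p <- bx P) ip (c p) (ft g p).
Proof.
move=> hc cg; transitivity (Re (ft (fun x => syn c P x * g x) 0)).
  rewrite ftE /=; congr mean; apply/funext => x.
  by rewrite freq0 /dot big1 ?cos0 ?mulr1 // => i _; rewrite mxE mul0r.
rewrite ft_syn_mul // Re_sum; apply: eq_bigr => p _.
by rewrite sub0r ft_opp // /ip; case: (c p) (ft g p) => ? ? [? ?] /=; ring.
Qed.

Definition bl P u := cp u /\ forall xi, xi \notin bx P -> ft u xi = 0.

Lemma bl_syn P u : bl P u -> u = syn (ft u) P.
Proof.
move=> [cu hu]; apply: ft_inj => //; first exact: syn_cp.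
move=> xi; rewrite ft_syn; last exact: ft_herm cu.1.
by case: ifPn => // /hu.
Qed.

Lemma syn_bl P c : herm c -> bl P (syn c P).
Proof. by move=> hc; split; [exact: syn_cp | move=> xi /negbTE xP; rewrite ft_syn // xP]. Qed.

Lemma normc0 : normc 0 = 0. Proof. exact: ComplexField.Normc.normc0. Qed.

Lemma bl_sum P u (F : Z -> R) (r : seq Z) : bl P u -> uniq r -> {subset bx P <= r} ->
  (forall xi, ft u xi = 0 -> F xi = 0) -> \sum_(xi <- r) F xi = \sum_(xi <- bx P) F xi.
Proof.
move=> [_ hu] ur sub F0; rewrite (bigID (mem (bx P))) /= addrC big1 ?add0r.
  rewrite -big_filter; apply: perm_big; apply: uniq_perm; rewrite ?filter_uniq ?bx_uniq // => xi.
  by rewrite mem_filter; case: (boolP (xi \in bx P)) => // /sub ->.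
by move=> xi xP; apply: F0; exact: hu.
Qed.

Lemma bl_En s P P' u : bl P u -> En s u P' <= En s u P.
Proof.
move=> hu; apply: (@le_trans _ _ (En s u (maxn P P'))); first exact: En_mono (leq_maxr _ _).
rewrite /En (bl_sum hu) ?bx_uniq //; first exact: bx_sub (leq_maxl _ _).
by move=> xi ->; rewrite normc0 expr0n mulr0.
Qed.

Lemma bl_Hs s P u : bl P u -> Hs s u (En s u P).
Proof. by move=> hu; split; [exact: hu.1 | move=> P'; exact: bl_En]. Qed.

Lemma bl_mul P P' u g : bl P u -> bl P' g -> bl (P + P') (fun x => u x * g x).
Proof.
move=> hu hg; have [cu _] := hu; have [cg hg0] := hg; split; first exact: cpM.
move=> xi xP; rewrite (bl_syn hu) ft_syn_mul; [|exact: ft_herm cu.1|exact: cg.1].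
rewrite big_seq big1 // => p pP; rewrite hg0 ?mulr0 //; apply: contra xP.
rewrite !mem_bx in pP * => /forallP h; apply/forallP => i; have := forallP pP i; have := h i.
by rewrite !mxE; move: (xi _ _) (p _ _) => s t; lia.
Qed.

Lemma bl_lam P u n K : bl P u -> bl P (lamN n K u).
Proof.
move=> hu; have -> : lamN n K u = syn (mlt (sig n K) (ft u)) P.
  by apply/funext => x; rewrite {1}(bl_syn hu) lamN_syn.
apply: syn_bl; apply: herm_mlt; [exact: sigN | exact: ft_herm hu.1.1].
Qed.

Lemma bl_lamE P u n K xi : bl P u -> ft (lamN n K u) xi = mlt (sig n K) (ft u) xi.
Proof.
move=> hu; have -> : lamN n K u = syn (mlt (sig n K) (ft u)) P.
  by apply/funext => x; rewrite {1}(bl_syn hu) lamN_syn.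
rewrite ft_syn; last by apply: herm_mlt; [exact: sigN | exact: ft_herm hu.1.1].
by case: ifPn => // /hu.2 h; rewrite /mlt h mulr0.
Qed.

(** The difference of the two sides is a positive average of squares (g(x) - g(x + z/n))^2: the mesh
    form of the Cordoba-Cordoba inequality. *)
Lemma lamN_convex n K g x : lamN n K (sq g) x <= 2 * (g x * lamN n K g x).
Proof.
rewrite /lamN -subr_ge0.
have -> : 2 * (g x * (2 * n%:R * LK K (fun z => g x - g (x + n%:R^-1 *: freq z)))) -
  2 * n%:R * LK K (fun z => sq g x - sq g (x + n%:R^-1 *: freq z)) =
  2 * n%:R * LK K (fun z => (g x - g (x + n%:R^-1 *: freq z)) ^+ 2).
  rewrite (_ : 2 * (g x * _) = 2 * n%:R * (2 * g x * LK K (fun z => g x - g (x + n%:R^-1 *: freq z)))); last by ring.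
  rewrite -mulrBr -LKZ -LKB; congr (_ * _); apply: LK_ext => z; rewrite /sq; ring.
by apply: mulr_ge0; [exact: mulr_ge0 | apply: LK_ge0 => z; exact: sqr_ge0].
Qed.

Lemma mean_lam_sym P P' u g n K : bl P u -> bl P' g ->
  mean (fun x => u x * lamN n K g x) = mean (fun x => lamN n K u x * g x).
Proof.
move=> hu hg; have hl := bl_lam n K hu; have hu1 := bl_lam n K hg.
have e1 : (fun x => u x * lamN n K g x) = (fun x => syn (ft u) P x * lamN n K g x) by rewrite -(bl_syn hu).
have e2 : (fun x => lamN n K u x * g x) = (fun x => syn (ft (lamN n K u)) P x * g x) by rewrite -(bl_syn hl).
rewrite e1 e2 !parseval; [|exact: ft_herm hl.1.1|exact: hg.1.1|exact: ft_herm hu.1.1|exact: hu1.1.1].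
by apply: eq_bigr => p _; rewrite (bl_lamE _ _ _ hg) (bl_lamE _ _ _ hu) /mlt ipZr ipZl.
Qed.

Variable a : nat.
Let w p : R := jn p ^+ a.+1.

Definition CA : R := 2 * Lsig * (2 * (a.+1%:R * 2 ^+ a + 1)).

(** The difference of symbols costs one power of frequency, and the weight defect gains it back: the
    bound carries the full weight on one factor and one derivative on the other. *)
Lemma commutator_le n K p q : (0 < n)%N ->
  `|(sig n K p - sig n K (p + q)) * (w (p + q) - w p - w q)| <= CA * (jn p * w q + jn q * w p).
Proof.
move=> n0; have L0 : 0 <= Lsig := le_trans ler01 (Lsig_ge1 : 1 <= Lsig).
have s1 : `|sig n K p - sig n K (p + q)| <= 2 * Lsig * (jn p + jn q).
  have /andP[a1 a2] := @sig_jn n K p n0; have /andP[b1 b2] := @sig_jn n K (p + q) n0.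
  have := ler_wpM2l L0 (@jnD p q); have := mulr_ge0 L0 (@jn_ge0 q).
  rewrite ler_norml; move: a1 a2 b1 b2; clear.
  set X := jn p; set Y := jn q; set W := jn (p + q); nra.
have t1 : jn p <= jn (p + q) + jn q by have := @jnD (p + q) (- q); rewrite addrK jnN.
have t2 : jn q <= jn (p + q) + jn p by have := @jnD (p + q) (- p); rewrite addrC addKr jnN.
have := pow_commutator a (@jn_ge0 p) (jn_ge0 q) (jn_ge0 (p + q)) (jnD p q) t1 t2.
rewrite -/(w p) -/(w q) -/(w (p + q)) normrM => h.
apply: le_trans (ler_wpM2r (normr_ge0 _) s1) _; rewrite -[leLHS]mulrA /CA -[leRHS]mulrA.
by apply: ler_wpM2l => //; exact: mulr_ge0.
Qed.

(** The factor carrying one derivative is summed in l^1; the two carrying the full weight are paired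
    by the arithmetic-geometric inequality, and shifts do not change their l^2 sums. *)
Lemma energy_commutator P u : bl P u ->
  \sum_(xi <- bx P) normc (ft u xi) * w xi * \sum_(p <- bx P)
     (jn p * w (xi - p) + jn (xi - p) * w p) * (normc (ft u p) * normc (ft u (xi - p)))
  <= 2 * (\sum_(p <- bx P) jn p * normc (ft u p)) * En a.+1 u P.
Proof.
move=> hu; set X := \sum_(p <- bx P) jn p * normc (ft u p); set E := En _ _ _.
pose al p := jn p * normc (ft u p); pose be p := w p * normc (ft u p).
have al0 p : 0 <= al p by apply: mulr_ge0; [exact: jn_ge0 | exact: normc_ge0].
have beE P' : \sum_(p <- bx P') be p ^+ 2 <= E.
  apply: le_trans (bl_En a.+1 P' hu); apply: ler_sum => p _.
  by rewrite /be exprMn /w -exprM mulnC exprM jn_sqr.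
have alX P' : \sum_(p <- bx P') al p <= X.
  apply: (@le_trans _ _ (\sum_(p <- bx (maxn P P')) al p)).
    by apply: ler_sum_sub; rewrite ?bx_uniq //; apply: bx_sub; exact: leq_maxr.
  rewrite (bl_sum hu) ?bx_uniq //; first by apply: bx_sub; exact: leq_maxl.
  by move=> xi h; rewrite /al h normc0 mulr0.
have X0 : 0 <= X by apply: sumr_ge0 => p _; exact: al0.
have amgm (s t : R) : s * t <= (s ^+ 2 + t ^+ 2) / 2 by have := sqr_ge0 (s - t); clra.
have h1 : \sum_(xi <- bx P) \sum_(p <- bx P) be xi * (al p * be (xi - p)) <= X * E.
  rewrite exchange_big /= /X mulr_suml; apply: ler_sum => p _; rewrite -/(al p).
  apply: (@le_trans _ _ (al p * \sum_(xi <- bx P) (be xi ^+ 2 / 2 + be (xi - p) ^+ 2 / 2))).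
    rewrite mulr_sumr; apply: ler_sum => xi _; rewrite mulrCA; apply: ler_wpM2l => //.
    by have := amgm (be xi) (be (xi - p)); clra.
  apply: ler_wpM2l => //; rewrite big_split /= -!mulr_suml.
  have b1 := beE P.
  have b2 : \sum_(xi <- bx P) be (xi - p) ^+ 2 <= E.
    by apply: (@shift_sum (fun q => be q ^+ 2)); rewrite ?bx_uniq // => q; exact: sqr_ge0.
  by move: b1 b2; clra.
have h2 : \sum_(xi <- bx P) \sum_(p <- bx P) be xi * (al (xi - p) * be p) <= X * E.
  apply: (@le_trans _ _ (\sum_(xi <- bx P) \sum_(p <- bx P) be xi ^+ 2 / 2 * al (xi - p) +
     \sum_(xi <- bx P) \sum_(p <- bx P) be p ^+ 2 / 2 * al (xi - p))).
    rewrite -big_split /=; apply: ler_sum => xi _; rewrite -big_split /=; apply: ler_sum => p _.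
    have := ler_wpM2r (al0 (xi - p)) (amgm (be xi) (be p)); clra.
  have b1 : \sum_(xi <- bx P) \sum_(p <- bx P) be xi ^+ 2 / 2 * al (xi - p) <= E / 2 * X.
    apply: (@le_trans _ _ (\sum_(xi <- bx P) be xi ^+ 2 / 2 * X)).
      apply: ler_sum => xi _; rewrite -mulr_sumr; apply: ler_wpM2l; first by rewrite divr_ge0 ?sqr_ge0.
      by apply: shift_sumN; rewrite ?bx_uniq.
    by rewrite -mulr_suml; apply: ler_wpM2r => //; rewrite -mulr_suml; have := beE P; clra.
  have b2 : \sum_(xi <- bx P) \sum_(p <- bx P) be p ^+ 2 / 2 * al (xi - p) <= E / 2 * X.
    rewrite exchange_big /=; apply: (@le_trans _ _ (\sum_(p <- bx P) be p ^+ 2 / 2 * X)).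
      apply: ler_sum => p _; rewrite -mulr_sumr; apply: ler_wpM2l; first by rewrite divr_ge0 ?sqr_ge0.
      by apply: shift_sum; rewrite ?bx_uniq.
    by rewrite -mulr_suml; apply: ler_wpM2r => //; rewrite -mulr_suml; have := beE P; clra.
  by move: b1 b2; clra.
have -> : 2 * X * E = X * E + X * E by ring.
apply: le_trans (lerD h1 h2); rewrite -big_split le_eqVlt; apply/orP; left; apply/eqP.
apply: eq_bigr => xi _;
rewrite mulr_sumr -big_split; apply: eq_bigr => p _; rewrite /al /be.
by move: (normc _) (normc _) (normc _) => ? ? ?; rewrite /=; ring.
Qed.

(** The left side is 2 (I1 - I2). Symmetry of the operator, u >= 0 and [lamN_convex] give I1 <= 2
    I2, hence 2 (I1 - I2) <= I1, and I1 contains no derivative of [W]. *)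
Lemma energy_main P u n K W : (0 < n)%N -> bl P u -> (forall x, 0 <= u x) ->
  W = syn (mlt w (ft u)) P ->
  2 * (mean (fun x => W x * (lamN n K W x * u x + lamN n K u x * W x)) - 2 * mean (fun x => lamN n K W x * (u x * W x)))
  <= Lsig * (\sum_(p <- bx P) jn p * normc (ft u p)) * En a.+1 u P.
Proof.
move=> n0 hu u0 WE; set X := \sum_(p <- bx P) jn p * normc (ft u p).
have hmW : herm (mlt w (ft u)) by apply: herm_mlt; [move=> p; rewrite /w jnN | exact: ft_herm hu.1.1].
have hW : bl P W by rewrite WE; exact: syn_bl.
have hLW := bl_lam n K hW; have hLu := bl_lam n K hu; have hWW := bl_mul hW hW; have hLWW := bl_lam n K hWW.
have [[cu _] _] := hu; have [[cW _] _] := hW; have [[cLW _] _] := hLW; have [[cLu _] _] := hLu.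
have [[cWW _] _] := hWW; have [[cLWW _] _] := hLWW.
pose I1 := mean (fun x => lamN n K u x * (W x * W x)).
pose I2 := mean (fun x => u x * (W x * lamN n K W x)).
have e1 : mean (fun x => W x * (lamN n K W x * u x + lamN n K u x * W x)) = I1 + I2.
  rewrite -meanD; [congr mean; apply/funext => x; ring | |]; apply: contM => //; exact: contM.
have e2 : mean (fun x => lamN n K W x * (u x * W x)) = I2 by congr mean; apply/funext => x; ring.
have e3 : I1 <= 2 * I2.
  rewrite /I1 -(mean_lam_sym n K hu hWW) -meanZ; last by apply: contM => //; exact: contM.
  apply: mean_le; [exact: contM | by apply: contZl; apply: contM => //; exact: contM |].
  move=> x; have := ler_wpM2l (u0 x) (lamN_convex n K W x); rewrite /sq; clra.
have lu x : `|lamN n K u x| <= Lsig * X.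
  rewrite {1}(bl_syn hu) lamN_syn; apply: le_trans (syn_norm _ _ _) _; rewrite /X mulr_sumr; apply: ler_sum => p _.
  have /andP[s1 s2] := @sig_jn n K p n0; rewrite normc_mlt // mulrA; apply: ler_wpM2r => //; exact: normc_ge0.
have eW : mean (fun x => W x * W x) = En a.+1 u P.
  rewrite {1}WE parseval // /En [LHS]big_seq [RHS]big_seq; apply: eq_bigr => p pP.
  rewrite WE ft_syn // pP ipzz normc_mlt; last by apply: exprn_ge0; exact: jn_ge0.
  by rewrite exprMn /w -exprM mulnC exprM jn_sqr.
have e4 : I1 <= Lsig * X * En a.+1 u P.
  rewrite -eW -meanZ //; apply: mean_le; [exact: contM | exact: contZl |] => x.
  apply: ler_wpM2r; first by rewrite -expr2 sqr_ge0.
  by apply: le_trans (lu x); exact: ler_norm.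
by rewrite e1 e2; move: e3 e4; clra.
Qed.

Definition CE : R := 2 * CA + Lsig / 2.

(** The weight w(xi) of the output is replaced by w(p) + w(xi - p): the replacement is the
    symmetrized term of [energy_main], the defect is the commutator. *)
Lemma energy_identity P u n K : (0 < n)%N -> bl P u -> (forall x, 0 <= u x) ->
  2 * \sum_(xi <- bx P) jw xi ^+ a.+1 * ip (ft u xi) (ft (QN n K u) xi)
  <= 2 * CE * (\sum_(p <- bx P) jn p * normc (ft u p)) * En a.+1 u P.
Proof.
move=> n0 hu u0; set X := \sum_(p <- bx P) jn p * normc (ft u p); set E := En _ _ _.
pose W := syn (mlt w (ft u)) P; pose c := ft u; pose s := sig n K.
have hc : herm c by exact: ft_herm hu.1.1.
have hmW : herm (mlt w c) by apply: herm_mlt => // p; rewrite /w jnN.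
have hW : bl P W by exact: syn_bl.
have hLW := bl_lam n K hW; have hLu := bl_lam n K hu.
have [[cu _] _] := hu; have [[cW _] _] := hW; have [[cLW _] _] := hLW; have [[cLu _] _] := hLu.
have huu := bl_mul hu hu; have huW := bl_mul hu hW.
have [[cuu _] _] := huu; have [[cuW _] _] := huW; have [[cLuu _] _] := bl_lam n K huu.
have ftW q : ft W q = mlt w c q by rewrite /W ft_syn //; case: ifPn => // /hu.2 h; rewrite /mlt /c h mulr0.
have fLu q : ft (lamN n K u) q = mlt s c q by rewrite (bl_lamE _ _ _ hu).
have fLW q : ft (lamN n K W) q = mlt s (mlt w c) q by rewrite (bl_lamE _ _ _ hW) /mlt ftW.
have mulE f g xi : bl P f -> continuous g -> ft (fun x => f x * g x) xi = \sum_(p <- bx P) ft f p * ft g (xi - p).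
  by move=> hf cg; rewrite {1}(bl_syn hf) ft_syn_mul //; exact: ft_herm hf.1.1.
have fQ xi : ft (QN n K u) xi = \sum_(p <- bx P) (s p - s xi)%:C%C * (c p * c (xi - p)).
  rewrite /QN ftB; [|exact: contM|exact: cLuu].
  rewrite (_ : ft (fun x => u x * lamN n K u x) xi = ft (fun x => lamN n K u x * u x) xi); last first.
    by congr (ft _ _); apply/funext => x; exact: mulrC.
  rewrite (mulE _ _ _ hLu cu) (bl_lamE _ _ _ huu) /mlt (mulE _ _ _ hu cu) mulr_sumr -sumrB; apply: eq_bigr => p _.
  rewrite fLu /mlt -/c -/s; move: (c p) (c (xi - p)) (s p) (s xi) => [? ?] [? ?] ? ?.
  by apply: complexP => /=; ring.
pose G xi := ft (fun x => lamN n K W x * u x + lamN n K u x * W x) xi - 2 * (s xi)%:C%C * ft (fun x => u x * W x) xi.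
(* The product u W is expanded once with each factor as the synthesized one ([k1] and [k2]); this
   accounts for the factor 2 in [G]. *)
have fG xi : G xi = \sum_(p <- bx P) ((s p - s xi) * (w p + w (xi - p)))%:C%C * (c p * c (xi - p)).
  rewrite /G ftD; [|exact: contM|exact: contM].
  have k1 : ft (fun x => u x * W x) xi = \sum_(p <- bx P) (w p)%:C%C * (c p * c (xi - p)).
    rewrite (_ : (fun x => u x * W x) = (fun x => W x * u x)); last by apply/funext => x; exact: mulrC.
    by rewrite (mulE _ _ _ hW cu); apply: eq_bigr => p _; rewrite ftW /mlt mulrA.
  have k2 : ft (fun x => u x * W x) xi = \sum_(p <- bx P) (w (xi - p))%:C%C * (c p * c (xi - p)).
    by rewrite (mulE _ _ _ hu cW); apply: eq_bigr => p _; rewrite ftW /mlt mulrCA.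
  have -> : 2 * (s xi)%:C%C * ft (fun x => u x * W x) xi = (s xi)%:C%C * ft (fun x => u x * W x) xi + (s xi)%:C%C * ft (fun x => u x * W x) xi.
    by rewrite -mulrDl; congr (_ * _); rewrite mulr_natl mulr2n.
  rewrite {1}k1 k2 (mulE _ _ _ hLW cu) (mulE _ _ _ hLu cW) !mulr_sumr -!big_split /= -sumrB; apply: eq_bigr => p _.
  rewrite fLW fLu ftW /mlt -/c; move: (c p) (c (xi - p)) (s p) (s xi) (w p) (w (xi - p)) => [? ?] [? ?] ? ? ? ?.
  by apply: complexP => /=; ring.
have main : 2 * \sum_(xi <- bx P) w xi * ip (c xi) (G xi) <= Lsig * X * E.
  apply: le_trans (energy_main K n0 hu u0 (erefl W)); rewrite -/c le_eqVlt; apply/orP; left; apply/eqP; congr (2 * _).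
  rewrite {1}/W parseval //; last by apply: contD; exact: contM.
  rewrite (_ : (fun x => lamN n K W x * (u x * W x)) = (fun x => syn (ft (lamN n K W)) P x * (u x * W x))); last by rewrite -(bl_syn hLW).
  rewrite parseval //; last exact: ft_herm.
  rewrite mulr_sumr -sumrB; apply: eq_bigr => xi _.
  rewrite fLW /G /mlt !ipZl.
  move: (ft (fun x => _ + _) xi) (ft (fun x => u x * W x) xi) (c xi) => [? ?] [? ?] [? ?].
  by rewrite /ip /=; ring.
have err : \sum_(xi <- bx P) w xi * ip (c xi) ((w xi)%:C%C * ft (QN n K u) xi - G xi) <= CA * (2 * X * E).
  have CA0 : 0 <= CA.
    have h := (Lsig_ge1 : 1 <= Lsig); rewrite /CA; apply: mulr_ge0; first by apply: mulr_ge0 => //; exact: le_trans h.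
    by apply: mulr_ge0 => //; apply: addr_ge0 => //; apply: mulr_ge0 => //; exact: exprn_ge0.
  apply: le_trans (ler_wpM2l CA0 (energy_commutator hu)); rewrite mulr_sumr; apply: ler_sum => xi _.
  have w0 q : 0 <= w q by apply: exprn_ge0; exact: jn_ge0.
  apply: (@le_trans _ _ (w xi * (normc (c xi) * \sum_(p <- bx P) CA * ((jn p * w (xi - p) + jn (xi - p) * w p) * (normc (c p) * normc (c (xi - p))))))); last first.
    by rewrite -mulr_sumr le_eqVlt; apply/orP; left; apply/eqP; rewrite /c; ring.
  apply: ler_wpM2l => //; apply: le_trans (ler_norm _) _; apply: le_trans (ip_le _ _) _.
  apply: ler_wpM2l; first exact: normc_ge0.
  rewrite fQ fG mulr_sumr -sumrB; apply: le_trans (normc_sum _ _) _; apply: ler_sum => p _.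
  have -> : (w xi)%:C%C * ((s p - s xi)%:C%C * (c p * c (xi - p))) - ((s p - s xi) * (w p + w (xi - p)))%:C%C * (c p * c (xi - p))
    = ((s p - s xi) * (w xi - w p - w (xi - p)))%:C%C * (c p * c (xi - p)).
    by move: (c p) (c (xi - p)) (s p) (s xi) (w p) (w xi) (w (xi - p)) => [? ?] [? ?] ? ? ? ? ?; apply: complexP => /=; ring.
  have nM (t : R) (z : C) : normc (t%:C%C * z) = `|t| * normc z.
    by rewrite ComplexField.Normc.normcM /= expr0n addr0 sqrtr_sqr.
  rewrite nM (ComplexField.Normc.normcM (c p)) mulrA.
  apply: ler_wpM2r; first by apply: mulr_ge0; exact: normc_ge0.
  have := @commutator_le n K p (xi - p) n0; rewrite (_ : p + (xi - p) = xi); [exact | by rewrite addrC subrK].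
have -> : \sum_(xi <- bx P) jw xi ^+ a.+1 * ip (c xi) (ft (QN n K u) xi) =
  \sum_(xi <- bx P) w xi * ip (c xi) ((w xi)%:C%C * ft (QN n K u) xi - G xi) + \sum_(xi <- bx P) w xi * ip (c xi) (G xi).
  rewrite -big_split /=; apply: eq_bigr => xi _; rewrite -mulrDr -ipDr subrK (ipZr _ (w xi)) mulrA; congr (_ * _).
  by rewrite /w -exprMn -expr2 jn_sqr.
by rewrite /CE; move: main err; clra.
Qed.

Hypothesis da : (d < 2 * a)%N.

Lemma CA_ge0 : 0 <= CA.
Proof.
have h := (Lsig_ge1 : 1 <= Lsig); rewrite /CA; apply: mulr_ge0; first by apply: mulr_ge0 => //; exact: le_trans h.
by apply: mulr_ge0 => //; apply: addr_ge0 => //; apply: mulr_ge0 => //; exact: exprn_ge0.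
Qed.

Lemma CE_ge0 : 0 <= CE.
Proof. by have := CA_ge0; have := (Lsig_ge1 : 1 <= Lsig); rewrite /CE; lra. Qed.

Lemma bl_QN P u n K : bl P u -> bl (P + P) (QN n K u).
Proof.
move=> hu; have h1 := bl_mul hu (bl_lam n K hu); have h2 := bl_lam n K (bl_mul hu hu).
split; first by apply: cpB; [exact: h1.1 | exact: h2.1].
by move=> xi xP; rewrite /QN ftB ?(h1.2 _ xP) ?(h2.2 _ xP) ?subr0 //; [exact: h1.1.1 | exact: h2.1.1].
Qed.

Lemma sig_le4 n K p : sig n K p <= 4 * n%:R.
Proof.
rewrite /sig (_ : 4 * n%:R = 2 * n%:R * 2); last by ring.
rewrite ler_wpM2l ?mulr_ge0 //; apply: LK_le_cst => // z.
by have := cos_geN1 (dot (n%:R^-1 *: freq p) (freq z) : R); lra.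
Qed.

Lemma Hs_lam P u n K B : bl P u -> Hs a.+1 u B -> Hs a.+1 (lamN n K u) ((4 * n%:R) ^+ 2 * B).
Proof.
move=> hu [_ h]; split; first exact: (bl_lam n K hu).1.
move=> P'; apply: le_trans (ler_wpM2l (sqr_ge0 _) (h P')); rewrite /En mulr_sumr; apply: ler_sum => p _.
rewrite (bl_lamE _ _ _ hu) normc_mlt ?sig_ge0 // exprMn mulrCA; apply: ler_wpM2r.
  by apply: mulr_ge0; [exact: jwX_ge0 | exact: sqr_ge0].
by apply: lerXn2r; rewrite ?nnegrE ?sig_ge0 ?mulr_ge0 // sig_le4.
Qed.

Lemma En_QN P u n K B P' : bl P u -> Hs a.+1 u B -> En a.+1 (QN n K u) P' <= 64 * n%:R ^+ 2 * Cp a.+1 * B ^+ 2.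
Proof.
move=> hu Hu; have h1 := Hs_mul (da1 da) (Hs_asum da Hu) Hu (Hs_lam n K hu Hu).
have h2 := Hs_lam n K (bl_mul hu hu) (Hs_sq da Hu).
have e1 := h1.2 P'; have e2 := h2.2 P'.
apply: (@le_trans _ _ (2 * (En a.+1 (fun x => u x * lamN n K u x) P' + En a.+1 (lamN n K (sq u)) P'))); last first.
  by move: e1 e2; set X := En _ _ _; set Y := En _ _ _; clra.
have key p : jw p ^+ a.+1 * normc (ft (QN n K u) p) ^+ 2 <=
    2 * (jw p ^+ a.+1 * normc (ft (fun x => u x * lamN n K u x) p) ^+ 2) + 2 * (jw p ^+ a.+1 * normc (ft (lamN n K (sq u)) p) ^+ 2).
  rewrite {1}/QN ftB; [|exact: h1.1.1|exact: h2.1.1]; move: (ft _ p) (ft _ p) => A D.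
  rewrite (_ : _ + _ = jw p ^+ a.+1 * (2 * (normc A ^+ 2 + normc D ^+ 2))); last by ring.
  apply: ler_wpM2l; first exact: jwX_ge0.
  rewrite !normcE; case: A D => [x y] [z t] /=.
  have := sqr_ge0 (x + z); have := sqr_ge0 (y + t); clra.
rewrite mulrDr /En !mulr_sumr -big_split; apply: ler_sum => p _; exact: key.
Qed.

(** A bound for the growth rate of the energy on a ball: the first term comes from
    [energy_identity], the second from the square of the Euler increment. *)
Definition CC (B : R) : R := CE * (S0 + B) * B + 64 * Cp a.+1 * B ^+ 2.

Lemma CC_ge0 B : 0 <= B -> 0 <= CC B.
Proof.
move=> B0; apply: addr_ge0; last by apply: mulr_ge0; [apply: mulr_ge0 => //; exact: ltW (Cp_gt0 _) | exact: sqr_ge0].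
by apply: mulr_ge0 => //; apply: mulr_ge0; [exact: CE_ge0 | apply: addr_ge0 => //; exact: ltW (S0_gt0)].
Qed.

(** The quadratic part of an Euler step is tau^2 times an energy of order n^2, so tau n^2 <= 1
    brings it to order tau. Each step doubles the frequency box, but the estimate does not depend on
    [P]. *)
Lemma energy_step P u n K (tau B : R) : (0 < n)%N -> 0 <= tau -> tau * n%:R ^+ 2 <= 1 -> bl P u -> (forall x, 0 <= u x) ->
  En a.+1 u P <= B ->
  let u' x := u x + tau * QN n K u x in bl (P + P) u' /\ En a.+1 u' (P + P) <= En a.+1 u P + tau * CC B.
Proof.
move=> n0 tau0 taun hu u0 EB u'; have hQ := bl_QN n K hu.
have E0 : 0 <= En a.+1 u P by exact: En_ge0.
have Hu := bl_Hs a.+1 hu.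
have ftu' xi : ft u' xi = ft u xi + tau%:C%C * ft (QN n K u) xi.
  rewrite /u' ftD; [|exact: hu.1.1|by apply: contZl; exact: hQ.1.1].
  by rewrite ftZ //; exact: hQ.1.1.
have sub : {subset bx P <= bx (P + P)} by apply: bx_sub; exact: leq_addr.
split.
  split; first by apply: cpD; [exact: hu.1 | apply: cpZ; exact: hQ.1].
  move=> xi xP; rewrite ftu' (hQ.2 _ xP) mulr0 addr0; apply: hu.2; apply: contra xP; exact: sub.
have E' : En a.+1 u' (P + P) = En a.+1 u P + tau * (2 * \sum_(xi <- bx P) jw xi ^+ a.+1 * ip (ft u xi) (ft (QN n K u) xi))
   + tau ^+ 2 * En a.+1 (QN n K u) (P + P).
  rewrite /En -(bl_sum hu (bx_uniq _) sub); last by move=> xi ->; rewrite normc0 expr0n mulr0.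
  rewrite -(bl_sum hu (bx_uniq _) sub); last by move=> xi ->; rewrite /ip rmorph0 mul0r mulr0.
  rewrite !mulr_sumr -!big_split; apply: eq_bigr => xi _.
  by rewrite ftu' normc_sqrD; move: (normc _) (normc _) (ip _ _) => ? ? ?; rewrite /=; ring.
have h1 := energy_identity K n0 hu u0.
have h2 := En_QN n K (P + P) hu Hu.
have XB : \sum_(p <- bx P) jn p * normc (ft u p) <= (S0 + B) / 2.
  exact: (X_bound P da (Hs_le EB Hu)).
have h3 : 2 * CE * (\sum_(p <- bx P) jn p * normc (ft u p)) * En a.+1 u P <= CE * (S0 + B) * B.
  rewrite (_ : CE * (S0 + B) * B = 2 * CE * ((S0 + B) / 2) * B); last by field.
  apply: ler_pM => //.
    apply: mulr_ge0; first by apply: mulr_ge0 => //; exact: CE_ge0.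
    by apply: sumr_ge0 => p _; apply: mulr_ge0; [exact: jn_ge0 | exact: normc_ge0].
  by apply: ler_wpM2l => //; apply: mulr_ge0 => //; exact: CE_ge0.
have h4 : tau ^+ 2 * En a.+1 (QN n K u) (P + P) <= tau * (64 * Cp a.+1 * B ^+ 2).
  rewrite expr2 -mulrA; apply: ler_wpM2l => //.
  apply: le_trans (ler_wpM2l tau0 h2) _.
  rewrite (_ : tau * _ = (tau * n%:R ^+ 2) * (64 * Cp a.+1 * En a.+1 u P ^+ 2)); last by ring.
  have C0 : 0 <= 64 * Cp a.+1 by apply: mulr_ge0 => //; exact: ltW (Cp_gt0 _).
  have : En a.+1 u P ^+ 2 <= B ^+ 2 by apply: lerXn2r; rewrite ?nnegrE //; exact: le_trans EB.
  move=> /(ler_wpM2l C0) h; apply: le_trans h; apply: ler_piMl => //.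
  by apply: mulr_ge0 => //; exact: sqr_ge0.
have h5 := ler_wpM2l tau0 (le_trans h1 h3).
by rewrite E' /CC mulrDr -addrA lerD2l; apply: lerD.
Qed.

Lemma energy_iter n K (tau B0 B : R) (u : nat -> V -> R) P : (0 < n)%N -> 0 <= B -> 0 <= tau -> tau * n%:R ^+ 2 <= 1 ->
  bl P (u 0%N) -> (forall j x, 0 <= u j x) -> (forall j x, u j.+1 x = u j x + tau * QN n K (u j) x) ->
  En a.+1 (u 0%N) P <= B0 -> forall j, B0 + j%:R * tau * CC B <= B ->
  Hs a.+1 (u j) (B0 + j%:R * tau * CC B).
Proof.
move=> n0 B1 tau0 taun hu u0 rec E0 j hj.
suff : exists Pj, bl Pj (u j) /\ En a.+1 (u j) Pj <= B0 + j%:R * tau * CC B.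
  by move=> [Pj [h1 h2]]; apply: Hs_le h2 _; exact: bl_Hs.
elim: j hj => [|j IH] hj; first by exists P; rewrite !mul0r addr0.
have st : B0 + j.+1%:R * tau * CC B = B0 + j%:R * tau * CC B + tau * CC B by rewrite -(natr1 j); ring.
have t0 : 0 <= tau * CC B by apply: mulr_ge0 => //; exact: CC_ge0.
have hj' : B0 + j%:R * tau * CC B <= B by move: hj t0; rewrite st; clra.
have [Pj [h1 h2]] := IH hj'.
have [k1 k2] := @energy_step Pj (u j) n K tau B n0 tau0 taun h1 (u0 j) (le_trans h2 hj').
exists (Pj + Pj)%N.
have -> : u j.+1 = (fun x => u j x + tau * QN n K (u j) x) by apply/funext => x.
by split=> //; rewrite st; apply: le_trans k2 _; rewrite lerD2r.
Qed.

End EnergyEstimate.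

(** * Lipschitz bounds from Sobolev bounds *)

Section Lipschitz.
Implicit Types (v : V -> R).

Lemma pr_lip (c : C) p x h : `|pr c p (x + h) - pr c p x| <= nz p * normc c * enorm h.
Proof.
have e0 : 0 <= nz p * normc c * enorm h by rewrite !mulr_ge0 ?nz_ge0 ?normc_ge0 ?enorm_ge0.
rewrite -ler_sqr ?nnegrE // real_normK ?num_real // !prE dotDr cosD sinD.
set t := dot (freq p) h; set th := dot (freq p) x.
have ht : t ^+ 2 <= nz p ^+ 2 * enorm h ^+ 2.
  have h1 : `|t| <= nz p * enorm h.
    rewrite ler_norml /t dot_le andbT lerNl -dotNr; apply: le_trans (dot_le _ _) _; by rewrite enormN.
  by rewrite -exprMn -(real_normK (num_real t)); apply: lerXn2r; rewrite ?nnegrE ?normr_ge0 // mulr_ge0 ?nz_ge0 ?enorm_ge0.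
rewrite -mulrA mulrCA exprMn normcE exprMn.
apply: (@le_trans _ _ ((complex.Re c ^+ 2 + complex.Im c ^+ 2) * t ^+ 2)); last first.
  by rewrite ler_wpM2l // addr_ge0 ?sqr_ge0.
have c1 := cos2Dsin2 t; have c2 := cos2Dsin2 th; have c3 := cos_ge_quad t.
apply: (@le_trans _ _ ((complex.Re c ^+ 2 + complex.Im c ^+ 2) * (2 - 2 * cos t))); last first.
  by rewrite ler_wpM2l ?addr_ge0 ?sqr_ge0 //; move: c3; clra.
move: (complex.Re c) (complex.Im c) (cos t) (sin t) (cos th) (sin th) c1 c2 => a b u v r s c1 c2.
have -> : 2 - 2 * u = (1 - u) ^+ 2 + v ^+ 2 by move: c1; clra.
have -> : a ^+ 2 + b ^+ 2 = (a * r - b * s) ^+ 2 + (a * s + b * r) ^+ 2.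
  rewrite -[LHS]mulr1 -c2; ring.
set X := a * r - b * s; set Y := a * s + b * r.
have -> : a * (r * u - s * v) - b * (s * u + r * v) - X = - (X * (1 - u) + Y * v) by rewrite /X /Y; ring.
by rewrite sqrrN; have := sqr_ge0 (X * v - Y * (1 - u)); clra.
Qed.

Variable a : nat.
Hypothesis da : (d < 2 * a)%N.

Lemma Hs_lip f B x h : Hs a.+1 f B -> `|f (x + h) - f x| <= (S0 + B) / 2 * enorm h.
Proof.
move=> Hf; apply/ler_addgt0Pr => e e0.
have [j hj] := @X_tail a B (e / 2) da (Hs_ge0 Hf) (divr_gt0 e0 (ltr0n _ 2)).
have t1 : tail (fun p => normc (ft f p)) j (e / 2).
  by apply: tail_le (hj f Hf) => p; rewrite ler_peMl ?jn_ge1 // normc_ge0.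
have k y := syn_approx y Hf.1 (Hs_asum da Hf) t1.
have k1 := k (x + h); have k2 := k x.
have k3 : `|syn (ft f) (2 ^ j) (x + h) - syn (ft f) (2 ^ j) x| <= (S0 + B) / 2 * enorm h.
  rewrite /syn -sumrB; apply: le_trans (ler_norm_sum _ _ _) _.
  apply: le_trans (ler_wpM2r (enorm_ge0 h) (X_bound (2 ^ j) da Hf)); rewrite mulr_suml; apply: ler_sum => p _.
  apply: le_trans (pr_lip _ _ _ _) _; rewrite ler_wpM2r ?enorm_ge0 // ler_wpM2r ?normc_ge0 // nz_le_jn //.
move: k1 k2 k3; rewrite !ler_norml; clra.
Qed.

End Lipschitz.

(** * Stability of the explicit scheme *)

Section Scheme.
Implicit Types (v w : V -> R).

(* With [w = f - v], [f y (f y - f x) - v y (v y - v x) = (f y + v y - v x) (w y - w x) + (v y - v x) w x];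
   the first factor is nonnegative for [y] near [x], where it can only help. *)
Lemma stab_step n K (tau m M Mv Lv A W : R) f v : (0 < n)%N -> 0 <= tau -> 0 < m -> 0 < Lv -> 0 <= W ->
  (forall x, m <= f x <= M) -> (forall x, `|v x| <= Mv) -> (forall x h, `|v (x + h) - v x| <= Lv * enorm h) ->
  (forall x, `|lamN n K v x| <= A) -> tau * (2 * n%:R * (M + 2 * Mv)) <= 1 -> (forall x, `|f x - v x| <= W) ->
  forall x, `|f x + tau * QN n K f x - (v x + tau * QN n K v x)| <= (1 + tau * (A + 8 * Mv * (d%:R + 3) * Lv / m)) * W.
Proof.
move=> n0 tau0 m0 L0 W0 fr vb vl lv cfl fv x.
have nR : 0 < n%:R :> R by rewrite ltr0n.
have Mv0 : 0 <= Mv by exact: le_trans (vb 0).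
pose y z := x + n%:R^-1 *: freq z; pose w t := f t - v t.
pose F z := f (y z) + v (y z) - v x.
pose Fp z := Num.max (F z) 0; pose Fm z := Num.max (- F z) 0.
have FE z : F z = Fp z - Fm z.
  by rewrite /Fp /Fm; case: (leP (F z) 0) => h1; case: (leP (- F z) 0) => h2; move: h1 h2; clra.
have Fp0 z : 0 <= Fp z by rewrite le_max lexx orbT.
have Fm0 z : 0 <= Fm z by rewrite le_max lexx orbT.
have m_le_M : 0 <= M by have /andP[h1 h2] := fr 0; exact: le_trans (le_trans (ltW m0) h1) h2.
have vd z : `|v (y z) - v x| <= 2 * Mv by apply: le_trans (ler_normB _ _) _; have := vb (y z); have := vb x; clra.
have FpM z : Fp z <= M + 2 * Mv.
  rewrite ge_max; apply/andP; split; last by move: m_le_M Mv0; clra.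
  by have /andP[_ h1] := fr (y z); have := vd z; rewrite ler_norml /F; move: h1; clra.
pose r := m / Lv; have r0 : 0 < r by exact: divr_gt0.
have FmM z : Fm z <= 2 * Mv * Num.min 1 ((nz z / (r * n%:R)) ^+ 2).
  have h1 := vd z; have /andP[h2 _] := fr (y z).
  have [h3|h3] := ltP (nz z) (r * n%:R).
    have h4 : `|v (y z) - v x| < m.
      apply: le_lt_trans (vl _ _) _; rewrite enormZ ger0_norm ?invr_ge0 ?(ltW nR) // -/(nz z) mulrCA.
      by rewrite mulrC ltr_pdivrMr // mulrC -ltr_pdivlMr // mulrAC.
    rewrite ge_max; apply/andP; split.
      apply: (@le_trans _ _ 0); first by move: h4; rewrite ltr_norml /F; move: h2; clra.
      by rewrite mulr_ge0 ?mulr_ge0 // le_min ler01 sqr_ge0.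
    by rewrite mulr_ge0 ?mulr_ge0 // le_min ler01 sqr_ge0.
  have rn : 0 < r * n%:R by exact: mulr_gt0.
  rewrite min_l ?mulr1; last by apply: exprn_ege1; rewrite ler_pdivlMr // mul1r.
  rewrite ge_max; apply/andP; split; last by exact: mulr_ge0.
  by move: h1; rewrite ler_norml /F; move: h2 m0; clra.
have LFm : 2 * n%:R * LK K Fm <= 4 * Mv * (d%:R + 3) * Lv / m.
  have h1 : LK K Fm <= 2 * Mv * ((d%:R + 3) / (r * n%:R)).
    apply: le_trans (LK_mono K FmM) _; rewrite LKZ; apply: ler_wpM2l; first exact: mulr_ge0.
    by apply: LK_sqr; exact: mulr_gt0.
  apply: le_trans (ler_wpM2l _ h1) _; first by apply: mulr_ge0.
  by rewrite /r le_eqVlt; apply/orP; left; apply/eqP; field; rewrite !gt_eqF.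
pose th := tau * (2 * n%:R * LK K Fp).
have th1 : th <= 1.
  apply: le_trans cfl; apply: ler_wpM2l => //; apply: ler_wpM2l; first exact: mulr_ge0.
  by apply: LK_le_cst => //; apply: addr_ge0 => //; exact: mulr_ge0.
have th1' : 0 <= 1 - th by rewrite subr_ge0.
have E : f x + tau * QN n K f x - (v x + tau * QN n K v x) =
  (w x * (1 - th) + tau * (2 * n%:R * LK K (fun z => Fp z * w (y z))))
  - tau * (2 * n%:R * LK K (fun z => Fm z * (w (y z) - w x))) - tau * (w x * lamN n K v x).
  have -> : f x + tau * QN n K f x - (v x + tau * QN n K v x) = w x + tau * (QN n K f x - QN n K v x) by rewrite /w; ring.
  have -> : QN n K f x - QN n K v x = 2 * n%:R * (LK K (fun z => Fp z * w (y z)) - w x * LK K Fp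
     - LK K (fun z => Fm z * (w (y z) - w x)) - w x * LK K (fun z => v x - v (y z))).
    rewrite !QNE -mulrBr; congr (_ * _); rewrite -!LKZ -!LKB; apply: LK_ext => z.
    have := FE z; rewrite /F /w -/(y z) => h.
    have -> : Fp z = f (y z) + v (y z) - v x + Fm z by move: h; clra.
    ring.
  rewrite /lamN /th -/(y _); ring.
rewrite E; set T1 := w x * (1 - th) + _; set T2 := tau * _; set T3 := tau * _.
have wW t : `|w t| <= W := fv t.
have b1 : `|T1| <= W.
  have h1 : `|LK K (fun z => Fp z * w (y z))| <= LK K Fp * W.
    apply: le_trans (LK_norm _ _) _; rewrite mulrC -LKZ; apply: LK_mono => z.
    by rewrite normrM ger0_norm // mulrC; apply: ler_wpM2r.
  apply: le_trans (ler_normD _ _) _; rewrite !normrM (ger0_norm tau0) (ger0_norm th1') (ger0_norm (ltW nR)) (ger0_norm (ler0n R 2)).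
  have h2 : `|w x| * (1 - th) <= W * (1 - th) by apply: ler_wpM2r => //; rewrite subr_ge0.
  have h3 : tau * (2 * n%:R * `|LK K (fun z => Fp z * w (y z))|) <= th * W.
    rewrite /th -!mulrA; apply: ler_wpM2l => //; apply: ler_wpM2l => //; apply: ler_wpM2l => //.
  by move: h2 h3; clra.
have b2 : `|T2| <= tau * (8 * Mv * (d%:R + 3) * Lv / m) * W.
  have h1 : `|LK K (fun z => Fm z * (w (y z) - w x))| <= LK K Fm * (2 * W).
    apply: le_trans (LK_norm _ _) _; rewrite mulrC -LKZ; apply: LK_mono => z.
    rewrite normrM ger0_norm // mulrC; apply: ler_wpM2r => //; apply: le_trans (ler_normB _ _) _.
    by have := wW (y z); have := wW x; clra.
  rewrite /T2 !normrM (ger0_norm tau0) (ger0_norm (ltW nR)) (ger0_norm (ler0n R 2)) -[leRHS]mulrA; apply: ler_wpM2l => //.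
  apply: (@le_trans _ _ (2 * n%:R * (LK K Fm * (2 * W)))); first by apply: ler_wpM2l => //; exact: mulr_ge0.
  rewrite (_ : 8 * _ * _ * _ / _ = 4 * Mv * (d%:R + 3) * Lv / m * 2); last by field; rewrite gt_eqF.
  by rewrite [leLHS]mulrA -[leRHS]mulrA; apply: ler_wpM2r => //; exact: mulr_ge0.
have b3 : `|T3| <= tau * A * W.
  rewrite /T3 normrM (ger0_norm tau0) -[leRHS]mulrA; apply: ler_wpM2l => //; rewrite normrM mulrC; apply: ler_pM => //; exact: lv.
apply: le_trans (ler_normB _ _) _; apply: le_trans (lerD (ler_normB _ _) (lexx _)) _.
by move: b1 b2 b3; clra.
Qed.

(** The maximum principle needs tau n small and the energy estimate tau n^2 <= 1; the cube gives
    both, with room to absorb constants for large [n]. *)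
Definition tau n : R := (n%:R ^+ 3)^-1.

Definition evol n g j : V -> R := iter j (fun f x => f x + tau n * QN n (n ^ 4) f x) g.

Lemma evolS n g j x : evol n g j.+1 x = evol n g j x + tau n * QN n (n ^ 4) (evol n g j) x.
Proof. by []. Qed.

Lemma tau_gt0 n : (0 < n)%N -> 0 < tau n.
Proof. by move=> n0; rewrite invr_gt0 exprn_gt0 // ltr0n. Qed.

Lemma tau3 n : (0 < n)%N -> tau n * n%:R ^+ 3 = 1.
Proof. by move=> n0; rewrite mulVf // expf_neq0 // pnatr_eq0 -lt0n. Qed.

Lemma tau2 n (c : R) : (0 < n)%N -> c <= n%:R ^+ 2 -> tau n * (n%:R * c) <= 1.
Proof.
move=> n0 h; apply: (@le_trans _ _ (tau n * n%:R ^+ 3)); last by rewrite tau3.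
by apply: ler_wpM2l; [exact: ltW (tau_gt0 n0) | rewrite exprS; exact: ler_wpM2l].
Qed.

Definition lat n x0 f : Z -> R := fun z => f (x0 + n%:R^-1 *: freq z).

Lemma QN_lat n K x0 f z : QN n K f (x0 + n%:R^-1 *: freq z) = 2 * n%:R * Q K (lat n x0 f) (lat n x0 f) z.
Proof. by rewrite QNE; congr (_ * _); apply: LK_ext => k; rewrite /lat freqD scalerDr addrA. Qed.

Lemma evol_lat n g j x0 z : lat n x0 (evol n g j.+1) z =
  lat n x0 (evol n g j) z + 2 * n%:R * tau n * Q (n ^ 4) (lat n x0 (evol n g j)) (lat n x0 (evol n g j)) z.
Proof. by rewrite {1}/lat evolS QN_lat /lat; ring. Qed.

Lemma evol_range (m M : R) n g : 0 < m -> m <= M -> (0 < n)%N -> 2 * M <= n%:R ^+ 2 -> (forall x, m <= g x <= M) ->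
  forall j x, m <= evol n g j x <= M.
Proof.
move=> m0 mM n0 nM g0; elim=> [|j IH] x; first exact: g0.
have := @max_principle R d (n ^ 4) m M (2 * n%:R * tau n) (lat n x (evol n g j)) (lat n x (evol n g j.+1)) m0 mM.
move=> H; have E0 f : lat n x f 0 = f x by rewrite /lat freq0 scaler0 addr0.
rewrite -(E0 (evol n g j.+1)); apply: H.
- by rewrite !mulr_ge0 // ltW // tau_gt0.
- by have := tau2 n0 nM; set X := n%:R; clra.
- by move=> z; exact: IH.
- by move=> z; exact: evol_lat.
Qed.

Variable a : nat.
Hypothesis da : (d < 2 * a)%N.

(* Solutions of [v' = QQ v] on [0, T], the derivative being uniform in x and t. *)
Definition WS (T B : R) (v : R -> V -> R) :=
  (forall t, 0 <= t <= T -> Hs a.+1 (v t) B) /\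
  forall e, 0 < e -> exists2 dl : R, 0 < dl & forall s t, 0 <= s <= T -> 0 <= t <= T -> `|s - t| <= dl ->
    forall x, `|v s x - v t x - (s - t) * QQ (v t) x| <= e * `|s - t|.

(** Consistency along [v] and [stab_step], summed by the discrete Gronwall inequality. All
    regularity is asked of [v]; of the scheme only its range is used, so any datum close to [v 0] in
    sup norm is allowed. *)
Lemma WS_stability (T B m M e : R) (v : R -> V -> R) : WS T B v -> 0 <= T -> 0 < m -> m <= M -> 0 < e ->
  exists n0, exists2 dl : R, 0 < dl & forall n g, (n0 <= n)%N -> (forall x, m <= g x <= M) ->
    (forall x, `|g x - v 0 x| <= dl) -> forall j, j%:R * tau n <= T -> forall x, `|evol n g j x - v (j%:R * tau n) x| <= e.
Proof.
move=> [Hv star] T0 m0 mM e0.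
have B0 : 0 <= B by apply: Hs_ge0 (Hv 0 _); rewrite lexx.
have S00 := @S0_gt0; have L1 := @Lsig_ge1.
pose Mv := (S0 + B) / 2 + 1; pose Lv := (S0 + B) / 2; pose A := @Lsig * Mv.
have Lv0 : 0 < Lv by rewrite /Lv; move: S00 B0; clra.
have Mv0 : 0 < Mv by rewrite /Mv -/Lv; move: Lv0; clra.
have A0 : 0 <= A by apply: mulr_ge0; [exact: le_trans L1 | exact: ltW].
pose Cst := A + 8 * Mv * (d%:R + 3) * Lv / m.
have C0 : 0 <= Cst.
  apply: addr_ge0 => //; apply: divr_ge0; last exact: ltW.
  by rewrite !mulr_ge0 // ?addr_ge0 // ltW.
pose X := expR (T * Cst).
have X0 : 0 < X by exact: expR_gt0.
have e1 : 0 < e / ((T + 1) * X) by rewrite divr_gt0 // mulr_gt0 // ltr_wpDl.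
pose e2 := e / ((T + 1) * X); rewrite -/e2 in e1.
have [dl dl0 hdl] := star _ (divr_gt0 e1 (ltr0n R 2)).
have [n1 [dl1 dl10 hQ]] := QN_cvg da B0 (divr_gt0 e1 (ltr0n R 2)).
have [n2 h2] := @ex_large_nat R [:: (1, dl); (2 * M, 1); (2 * (M + 2 * Mv), 1)] ltac:(by rewrite /= dl0 ltr01).
exists (maxn (maxn n1 n2) 1); exists e2 => // n g; rewrite !geq_max => /andP[/andP[nn1 nn2] n0] gr gv.
have [n1R] := h2 n nn2; rewrite /= !mul1r andbT => /and3P[q1 q2 q3].
have nR : 0 < n%:R :> R by rewrite ltr0n.
have n12 : n%:R <= n%:R ^+ 2 :> R by rewrite expr2 ler_peMl // ltW.
have t0 := tau_gt0 n0.
have tdl : tau n <= dl.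
  rewrite -(ler_pM2r (exprn_gt0 3 nR)) (tau3 n0); apply: le_trans q1 _; apply: ler_wpM2l; first exact: ltW.
  by rewrite (_ : 3 = 2 + 1)%N // exprSr ler_peMl ?(ltW nR) // exprn_ege1.
have range := evol_range m0 mM n0 (le_trans q2 n12) gr.
(* The local error [tau n * e2] has two halves: the time difference of [v] and the consistency of
   [QN]. *)
have step j : j.+1%:R * tau n <= T -> forall W, 0 <= W -> (forall x, `|evol n g j x - v (j%:R * tau n) x| <= W) ->
    forall x, `|evol n g j.+1 x - v (j.+1%:R * tau n) x| <= (1 + tau n * Cst) * W + tau n * e2.
  move=> hj W W0 hW x; pose t := j%:R * tau n; pose s := j.+1%:R * tau n.
  have st : s - t = tau n by rewrite /s /t -(natr1 j); ring.
  have tT : 0 <= t <= T.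
    by rewrite /t mulr_ge0 ?(ltW t0) //=; apply: le_trans hj; rewrite ler_wpM2r ?(ltW t0) // ler_nat.
  have sT : 0 <= s <= T by rewrite /s mulr_ge0 ?(ltW t0).
  have Ht := Hv t tT.
  have := hdl s t sT tT; rewrite st gtr0_norm // => /(_ tdl x) k1.
  have k2 := hQ (v t) (v t) n (n ^ 4)%N Ht Ht ltac:(by move=> y; rewrite subrr normr0 ltW) nn1 (leqnn _) x.
  have k3 := @stab_step n (n ^ 4) (tau n) m M Mv Lv A W (evol n g j) (v t) n0 (ltW t0) m0 Lv0 W0 (range j)
    (fun y => Hs_norm da y Ht) (fun y h => Hs_lip da y h Ht) (fun y => lamN_bound (n ^ 4) y n0 da Ht) ltac:(
    by have := tau2 n0 (le_trans q3 n12); set Y := n%:R; clra) hW x.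
  rewrite -/Cst in k3.
  have k4 : `|tau n * (QN n (n ^ 4) (v t) x - QQ (v t) x)| <= tau n * (e2 / 2).
    by rewrite normrM gtr0_norm // ler_wpM2l // ltW.
  rewrite evolS -/s.
  move: k1 k3 k4; rewrite !ler_norml; clra.
have main j : j%:R * tau n <= T -> forall x, `|evol n g j x - v (j%:R * tau n) x| <= (e2 + j%:R * tau n * e2) * (1 + tau n * Cst) ^+ j.
  have c1 : 1 <= 1 + tau n * Cst by rewrite lerDl mulr_ge0 // ltW.
  elim: j => [|j IH] hj x.
    by rewrite !mul0r addr0 expr0 mulr1; exact: gv.
  have hj' : j%:R * tau n <= T by apply: le_trans hj; rewrite ler_wpM2r ?(ltW t0) // ler_nat.
  have c0 : 0 <= 1 + tau n * Cst := le_trans ler01 c1.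
  have W0 : 0 <= (e2 + j%:R * tau n * e2) * (1 + tau n * Cst) ^+ j.
    by apply: mulr_ge0; [apply: addr_ge0; [exact: ltW|apply: mulr_ge0; [apply: mulr_ge0; [by []|exact: ltW]|exact: ltW]] | exact: exprn_ge0].
  apply: le_trans (step j hj _ W0 (IH hj') x) _.
  have h1 : tau n * e2 * 1 <= tau n * e2 * (1 + tau n * Cst) ^+ j.+1.
    by apply: ler_wpM2l; [rewrite mulr_ge0 // ltW | exact: exprn_ege1].
  rewrite -(natr1 j) exprS in h1 *; move: h1; set Y := _ ^+ j; set c := 1 + _; clear; move=> h1.
  have -> : (e2 + (j%:R + 1) * tau n * e2) * (c * Y) = c * ((e2 + j%:R * tau n * e2) * Y) + tau n * e2 * (c * Y) by ring.
  by rewrite lerD2l -[leLHS]mulr1.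
move=> j hj x; apply: le_trans (main j hj x) _.
have h1 : (1 + tau n * Cst) ^+ j <= X.
  apply: (@le_trans _ _ (expR (tau n * Cst) ^+ j)).
    apply: lerXn2r; rewrite ?nnegrE ?expR_ge0 ?expR_ge1Dx //.
    by rewrite addr_ge0 // mulr_ge0 // ltW.
  by rewrite -expRM_natl ler_expR mulrA ler_wpM2r.
apply: (@le_trans _ _ ((T + 1) * e2 * X)).
  apply: ler_pM => //.
  - by apply: addr_ge0; [exact: ltW | apply: mulr_ge0; [apply: mulr_ge0; [by [] | exact: ltW]|exact: ltW]].
  - by apply: exprn_ge0; rewrite addr_ge0 // mulr_ge0 // ltW.
  - by rewrite addrC mulrDl mul1r lerD2r ler_wpM2r // ltW.
by rewrite /e2 le_eqVlt; apply/orP; left; apply/eqP; field; rewrite !gt_eqF // ltr_wpDl.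
Qed.

End Scheme.

(** * Limits along an ultrafilter on the integers *)

Section UltraLimits.
(** One ultrafilter finer than the filter at infinity gives limits at all times and frequencies
    simultaneously, in place of diagonal subsequences. *)
Lemma ultra_nat : exists U : set_system nat, UltraFilter U /\ forall n0, U [set n | (n0 <= n)%N].
Proof.
have [U [UU sub]] := @ultraFilterLemma nat \oo _.
by exists U; split=> // n0; apply: sub; exact: nbhs_infty_ge.
Qed.

Lemma ultra_bounded (U : set_system nat) (s : nat -> R) (M : R) : UltraFilter U -> U [set n | `|s n| <= M] ->
  exists l : R, forall e : R, 0 < e -> U [set n | `|s n - l| <= e].
Proof.
move=> UU sM; have sM' : (s @ U) `[- M, M]%classic by rewrite /fmap /=; apply: filterS sM => n; rewrite /= in_itv /= -ler_norml.
have [l [_ hl]] := @segment_compact R (- M) M (s @ U) _ sM'; exists l => e e0.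
have [//|hc] := in_ultra_setVsetC [set n | `|s n - l| <= e] UU.
have [|y [/= h1 h2]] := hl (~` ball l e) (ball l e) _ (nbhsx_ballx l e e0); last by case: h1.
rewrite /fmap /=; apply: filterS hc => n h1 h2; apply: h1; move: h2.
by rewrite /ball /= distrC => /ltW.
Qed.

Lemma filter_all (I : eqType) (F : set_system nat) (s : seq I) (A : I -> set nat) : Filter F ->
  (forall i, F (A i)) -> F [set n | forall i, i \in s -> A i n].
Proof.
move=> FF FA; elim: s => [|i s IH]; first by apply: filterS (filterT : F setT).
apply: filterS (filterI (FA i) IH) => n [/= h1 h2] k; rewrite inE => /predU1P[->//|]; exact: h2.
Qed.

End UltraLimits.

(** * Compactness of Sobolev balls in the uniform norm *)

Section WeakLimit.
Implicit Types (v : V -> R).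

Lemma Im_le (z : C) : `|complex.Im z| <= normc z.
Proof. by case: z => x y /=; rewrite -sqrtr_sqr ler_wsqrtr // lerDr sqr_ge0. Qed.

Lemma normc_triangle (z w : C) : normc z <= normc w + normc (z - w).
Proof. by have := le_normcD w (z - w); rewrite addrC subrK. Qed.

Lemma normcB (z w : C) : normc (z - w) = normc (w - z).
Proof. by rewrite -opprB; case: (w - z) => ? ? /=; rewrite !sqrrN. Qed.

Lemma normcN (z : C) : normc (- z) = normc z.
Proof. by case: z => ? ? /=; rewrite !sqrrN. Qed.

Lemma sum_share (I : Type) (s : seq I) (P : pred I) (e : R) : 0 <= e -> \sum_(p <- s | P p) e / ((size s)%:R + 1) <= e.
Proof.
move=> e0.
have c0 : 0 <= e / ((size s)%:R + 1) by rewrite divr_ge0 // ltW.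
rewrite big_const_seq iter_addr_0 -(mulr_natr _ (count P s)); apply: (@le_trans _ _ (e / ((size s)%:R + 1) * (size s)%:R)).
  by apply: ler_wpM2l => //; rewrite ler_nat; exact: count_size.
rewrite mulrAC ler_pdivrMr //; apply: ler_wpM2l => //; by rewrite lerDl.
Qed.

Lemma Hs_closed s g (B : R) : cp g -> (forall e : R, 0 < e -> exists h : V -> R, Hs s h B /\ forall x, `|h x - g x| <= e) -> Hs s g B.
Proof.
move=> cg app; split=> // P.
have B0 : 0 <= B by have [h [Hh _]] := app 1 ltr01; exact: Hs_ge0 Hh.
apply/ler_addgt0Pr => e e0.
(* From (y + e1)^2 <= (1 + de) y^2 + (1 + 1/de) e1^2: [de] is small against the energy bound, then
   [e1] against the total weight of the box. *)
pose de := e / (2 * (B + 1)).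
have B1 : 0 < B + 1 by rewrite ltr_wpDl.
have de0 : 0 < de by rewrite divr_gt0 // mulr_gt0.
pose J : R := \sum_(p <- bx P) jw p ^+ s.
have J0 : 0 <= J by apply: sumr_ge0 => p _; exact: jwX_ge0.
have W0 : 0 < (1 + de^-1) * (J + 1) by apply: mulr_gt0; [apply: addr_gt0; rewrite ?invr_gt0 | rewrite ltr_wpDl].
pose e2 := e / 2 / ((1 + de^-1) * (J + 1)).
have e20 : 0 < e2 by rewrite divr_gt0 // divr_gt0.
pose e1 := Num.min 1 e2; have e10 : 0 < e1 by rewrite lt_min ltr01.
have e1e2 : e1 ^+ 2 <= e2.
  have h1 : e1 <= 1 by rewrite ge_min lexx.
  have h2 : e1 <= e2 by rewrite ge_min lexx orbT.
  by apply: le_trans h2; rewrite expr2 ger_pMl.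
have [h [Hh hg]] := app e1 e10.
have k p : jw p ^+ s * normc (ft g p) ^+ 2 <= (1 + de) * (jw p ^+ s * normc (ft h p) ^+ 2) + (1 + de^-1) * e2 * jw p ^+ s.
  have w0 : 0 <= jw p ^+ s by exact: jwX_ge0.
  rewrite [X in _ <= X + _]mulrCA [X in _ <= _ + X]mulrC -mulrDr; apply: ler_wpM2l => //.
  have h1 := normc_triangle (ft g p) (ft h p).
  have h2 : normc (ft g p - ft h p) <= e1.
    rewrite normcB -ftB; [|exact: Hh.1.1|exact: cg.1].
    by apply: ft_norm => //; apply: contB; [exact: Hh.1.1|exact: cg.1].
  have h3 : normc (ft g p) ^+ 2 <= (normc (ft h p) + e1) ^+ 2.
    by apply: lerXn2r; rewrite ?nnegrE ?normc_ge0 ?addr_ge0 ?normc_ge0 ?(ltW e10) //; apply: le_trans h1 _; rewrite lerD2l.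
  apply: le_trans h3 _; move: (normc (ft h p)) => y.
  have h4 : (1 + de^-1) * e1 ^+ 2 <= (1 + de^-1) * e2 by rewrite ler_wpM2l // addr_ge0 // invr_ge0 ltW.
  have h5 : 0 <= de * (y - e1 / de) ^+ 2 by rewrite mulr_ge0 ?sqr_ge0 // ltW.
  have h6 : de * (y - e1 / de) ^+ 2 = de * y ^+ 2 - 2 * y * e1 + de^-1 * e1 ^+ 2 by field; rewrite gt_eqF.
  by move: h4 h5; rewrite h6; clra.
have := Hh.2 P; rewrite /En => hB.
apply: (@le_trans _ _ ((1 + de) * (\sum_(p <- bx P) jw p ^+ s * normc (ft h p) ^+ 2) + (1 + de^-1) * e2 * J)).
  by rewrite /J !mulr_sumr -big_split; apply: ler_sum => p _; exact: k.
have b1 : (1 + de) * \sum_(p <- bx P) jw p ^+ s * normc (ft h p) ^+ 2 <= B + e / 2.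
  apply: le_trans (ler_wpM2l _ hB) _; first by rewrite addr_ge0 // ltW.
  rewrite mulrDl mul1r lerD2l /de mulrAC ler_pdivrMr ?mulr_gt0 //; move: e0 B0; clear; nra.
have b2 : (1 + de^-1) * e2 * J <= e / 2.
  have : (1 + de^-1) * e2 * (J + 1) = e / 2 by rewrite mulrAC mulrC /e2 divfK // gt_eqF.
  have : 0 <= (1 + de^-1) * e2 by rewrite mulr_ge0 ?(ltW e20) // addr_ge0 // invr_ge0 ltW.
  by clra.
by move: b1 b2; clra.
Qed.

Variable a : nat.
Hypothesis da : (d < 2 * a)%N.

(** Coefficients converge one by one by boundedness; the tails are small uniformly over the ball, so
    the limit coefficients are summable and the convergence is uniform. *)
Lemma weak_limit (U : set_system nat) (B : R) (f : nat -> V -> R) : UltraFilter U -> U [set n | Hs a.+1 (f n) B] ->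
  exists g, Hs a.+1 g B /\ forall e : R, 0 < e -> U [set n | forall x, `|f n x - g x| <= e].
Proof.
move=> UU HU; have B0 : 0 <= B by have [n Hn] := filter_ex HU; exact: Hs_ge0 Hn.
pose Mv := (S0 + B) / 2 + 1.
have bc xi : U [set n | normc (ft (f n) xi) <= Mv].
  by apply: filterS HU => n Hn /=; apply: ft_norm; [exact: Hn.1.1 | move=> x; exact: (Hs_norm da x Hn)].
have ex xi : exists z : C, forall e : R, 0 < e -> U [set n | normc (ft (f n) xi - z) <= e].
  have [x hx] := @ultra_bounded U (fun n => complex.Re (ft (f n) xi)) Mv UU ltac:(
    by apply: filterS (bc xi) => n h; exact: le_trans (Re_le _) h).
  have [y hy] := @ultra_bounded U (fun n => complex.Im (ft (f n) xi)) Mv UU ltac:(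
    by apply: filterS (bc xi) => n h; exact: le_trans (Im_le _) h).
  exists (x +i* y)%C => e e0; apply: filterS (filterI (hx _ (divr_gt0 e0 (ltr0n R 2))) (hy _ (divr_gt0 e0 (ltr0n R 2)))) => n [h1 h2].
  have key (z : C) : `|complex.Re z - x| <= e / 2 -> `|complex.Im z - y| <= e / 2 -> normc (z - (x +i* y)%C) <= e.
    case: z => u w /= {}h1 {}h2.
    rewrite -(@ler_sqr R) ?nnegrE ?sqrtr_ge0 ?(ltW e0) // sqr_sqrtr ?addr_ge0 ?sqr_ge0 //.
    have k (t : R) : `|t| <= e / 2 -> t ^+ 2 <= (e / 2) ^+ 2.
      by move=> h; rewrite -(real_normK (num_real t)); apply: lerXn2r; rewrite ?nnegrE ?normr_ge0 // divr_ge0 // ltW.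
    by have := k _ h1; have := k _ h2; have := sqr_ge0 e; rewrite expr_div_n; clra.
  exact: key.
have [c hc] := choice ex.
have near j e : 0 < e -> U [set n | Hs a.+1 (f n) B /\ forall xi, xi \in Bx j -> normc (ft (f n) xi - c xi) <= e].
  by move=> e0; apply: filterI => //; apply: filter_all => xi; exact: hc.
have size1 j : 0 < (size (Bx j))%:R + 1 :> R by rewrite ltr_wpDl.
have tl (j : nat) (e : R) : 0 < e -> (forall h : V -> R, Hs a.+1 h B -> tail (fun p => normc (ft h p)) j (e / 2)) -> tail (fun p => normc (c p)) j e.
  move=> e0 ht j' jj'.
  have [n [Hn hn]] := filter_ex (near j' _ (divr_gt0 (divr_gt0 e0 (ltr0n R 2)) (size1 j'))).
  have := ht _ Hn j' jj' => h1.
  apply: (@le_trans _ _ (\sum_(xi <- Bx j' | xi \notin Bx j) (normc (ft (f n) xi) + e / 2 / ((size (Bx j'))%:R + 1)))).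
    rewrite big_seq_cond [leRHS]big_seq_cond; apply: ler_sum => xi /andP[xj _].
    by apply: le_trans (normc_triangle _ (ft (f n) xi)) _; rewrite lerD2l normcB; exact: hn.
  have h2 := sum_share (Bx j') (fun xi => xi \notin Bx j) (ltW (divr_gt0 e0 (ltr0n R 2))).
  by rewrite [leLHS]big_split; have := lerD h1 h2; rewrite -mulrDl -mulr2n -(mulr_natr e) mulfK.
have XT (e : R) : 0 < e -> exists j, forall h : V -> R, Hs a.+1 h B -> tail (fun p => normc (ft h p)) j e.
  move=> e0; have [j hj] := @X_tail a B e da B0 e0; exists j => h Hh.
  by apply: tail_le (hj h Hh) => p; rewrite ler_peMl ?jn_ge1 // normc_ge0.
have ac : asum c by move=> e e0; have [j hj] := XT _ (divr_gt0 e0 (ltr0n R 2)); exists j; exact: tl.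
have hm : herm c.
  move=> p; apply/eqP; rewrite -subr_eq0; apply/eqP; apply: ComplexField.Normc.eq0_normc.
  apply/eqP; rewrite eq_le normc_ge0 andbT; apply/ler_addgt0Pr => e e0; rewrite add0r.
  have [n [Hn [h1 h2]]] := filter_ex (filterI HU (filterI (hc p _ (divr_gt0 e0 (ltr0n R 2))) (hc (- p) _ (divr_gt0 e0 (ltr0n R 2))))).
  rewrite /= in h1 h2; rewrite ft_opp in h2; last exact: Hn.1.1.
  have -> : c (- p) - ((c p)^*)%C = - (((ft (f n) p)^*)%C - c (- p)) + ((ft (f n) p - c p)^*)%C.
    by case: (c p) (c (- p)) (ft (f n) p) => ? ? [? ?] [? ?]; apply: complexP => /=; ring.
  apply: le_trans (le_normcD _ _) _; rewrite normcJ.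
  rewrite normcN; have := lerD h2 h1; rewrite -mulrDl -mulr2n -(mulr_natr e) mulfK //.
have [g [cg fg hg]] := syn_limit ac hm.
have unif e : 0 < e -> U [set n | forall x, `|f n x - g x| <= e].
  move=> e0; pose e4 := e / 4; have e40 : 0 < e4 by exact: divr_gt0.
  have [j hj] := XT _ (divr_gt0 e40 (ltr0n R 2)).
  apply: filterS (near j _ (divr_gt0 e40 (size1 j))) => n [Hn hn] x /=.
  have k1 := syn_approx x Hn.1 (Hs_asum da Hn) (hj _ Hn).
  have k2 := hg j e4 x (tl _ _ e40 hj).
  have k3 : `|syn (ft (f n)) (2 ^ j) x - syn c (2 ^ j) x| <= e4.
    rewrite synB2; apply: le_trans (syn_norm _ _ _) _.
    apply: (@le_trans _ _ (\sum_(p <- Bx j) e4 / ((size (Bx j))%:R + 1))).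
      by rewrite !big_seq; apply: ler_sum => p; exact: hn.
    exact: sum_share (ltW e40).
  by move: k1 k2 k3; rewrite /e4 !ler_norml; move: e0; clra.
exists g; split=> //; apply: Hs_closed => // e e0.
have [n [Hn hn]] := filter_ex (filterI HU (unif e e0)).
by exists (f n); split.
Qed.

Lemma discrete_increment (y q : nat -> R) (t Q e : R) i j : 0 <= t -> (i <= j)%N -> (forall k, y k.+1 = y k + t * q k) ->
  (forall k, (i <= k < j)%N -> `|q k - Q| <= e) -> `|y j - y i - t * (j%:R - i%:R) * Q| <= e * (t * (j%:R - i%:R)).
Proof.
move=> t0 ij rec; elim: j ij => [|j IH] ij hq.
  by move: ij; rewrite leqn0 => /eqP ->; rewrite !subrr !mulr0 mul0r subrr normr0.
move: ij; rewrite leq_eqVlt => /predU1P[->|]; first by rewrite !subrr !mulr0 mul0r subrr normr0.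
rewrite ltnS => ij.
have h1 := IH ij (fun k hk => hq k ltac:(by case/andP: hk => -> /ltnW)).
have h2 : `|t * (q j - Q)| <= t * e by rewrite normrM ger0_norm //; apply: ler_wpM2l => //; apply: hq; rewrite ij /=.
rewrite rec -(natr1 j).
have -> : y j + t * q j - y i - t * (j%:R + 1 - i%:R) * Q = (y j - y i - t * (j%:R - i%:R) * Q) + t * (q j - Q) by ring.
by apply: le_trans (ler_normD _ _) _; move: h1 h2; clra.
Qed.

End WeakLimit.

(** * Local existence from the scheme *)

Section LocalExistence.
Variable a : nat.
Hypothesis da : (d < 2 * a)%N.
Local Notation CC := (@CC a).

(** The bound that grows from [B0], and not merely [B], is retained at every time: it is what yields
    continuity in norm at time 0. *)
Lemma local_existence u0 (B0 B T m M : R) : 0 < m -> m <= M -> (forall x, m <= u0 x <= M) -> Hs a.+1 u0 B0 -> 0 <= T -> 0 <= B ->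
  B0 + T * CC B <= B ->
  exists v, [/\ WS a T B v, v 0 = u0 & forall t, 0 <= t <= T -> Hs a.+1 (v t) (B0 + t * CC B)].
Proof.
move=> m0 mM ur H0 T0 Bge0 TB.
have [cu _] := H0.
have M0 : 0 < M by exact: lt_le_trans mM.
have CB0 : 0 <= CC B by exact: CC_ge0.
have [U [UU Uoo]] := ultra_nat.
(* The energy estimate needs band-limited data. Truncation does not increase the energy and enlarges
   the range only slightly, whence the margins m/2 and 2M. *)
pose g n := syn (ft u0) (2 ^ n).
have hu0 : herm (ft u0) by exact: ft_herm cu.1.
have gclose e : 0 < e -> U [set n | forall x, `|g n x - u0 x| <= e].
  move=> e0; have [j hj] := Hs_asum da H0 e0.
  apply: filterS (Uoo j) => n /= jn x; rewrite distrC; apply: syn_approx => //; first exact: Hs_asum da H0.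
  by apply: tail_mono hj => // xi; exact: normc_ge0.
have mM2 : m / 2 <= 2 * M by move: m0 mM; clra.
have [n1 hn1] := @ex_large_nat R [:: (4 * M, 1)] ltac:(by rewrite /= ltr01).
have e1 : 0 < Num.min (m / 2) M by rewrite lt_min divr_gt0.
pose idx n (t : R) := Num.truncn (t * n%:R ^+ 3).
have idxP n t : (0 < n)%N -> 0 <= t -> (idx n t)%:R * tau n <= t /\ t < (idx n t)%:R * tau n + tau n.
  move=> n0 t0; have n3 : 0 < n%:R ^+ 3 :> R by rewrite exprn_gt0 // ltr0n.
  have /andP[h1 h2] := truncn_itv (mulr_ge0 t0 (ltW n3)).
  split; first by rewrite /tau ler_pdivrMr.
  by rewrite /tau -[X in _ + X]mul1r -mulrDl natr1 ltr_pdivlMr.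
pose f n t := evol n (g n) (idx n t).
have good : U [set n | [/\ (0 < n)%N, (forall j x, m / 2 <= evol n (g n) j x <= 2 * M) &
    forall j, j%:R * tau n <= T -> Hs a.+1 (evol n (g n) j) (B0 + j%:R * tau n * CC B)]].
  apply: filterS (filterI (Uoo (maxn n1 1)) (gclose _ e1)) => n [/=]; rewrite geq_max => /andP[nn1 n0] hg.
  have [n1R /= /andP[]] := hn1 n nn1; rewrite mul1r => q1 _.
  have nR : 0 < n%:R :> R by rewrite ltr0n.
  have q2 : 2 * (2 * M) <= n%:R ^+ 2 by apply: (@le_trans _ _ n%:R); [move: q1; clra | rewrite expr2 ler_peMl // ltW].
  have gr x : m / 2 <= g n x <= 2 * M.
    have := hg x; rewrite le_min => /andP[h1 h2]; have /andP[h3 h4] := ur x.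
    by move: h1 h2; rewrite !ler_norml; move: h3 h4; clra.
  have rg := evol_range (divr_gt0 m0 (ltr0n R 2)) mM2 n0 q2 gr.
  split=> // j jT.
  apply: (@energy_iter a da n (n ^ 4) (tau n) B0 B (evol n (g n)) (2 ^ n)) => //.
  - exact: ltW (tau_gt0 n0).
  - have := @tau2 n n%:R n0; rewrite -expr2; apply; rewrite expr2 ler_peMl // ltW.
  - exact: syn_bl.
  - by move=> k x; have /andP[h1 _] := rg k x; apply: le_trans h1; rewrite divr_ge0 // ltW.
  - apply: le_trans (H0.2 (2 ^ n)%N); rewrite /En !big_seq; apply: ler_sum => p pP.
    by rewrite ft_syn // pP.
  - by apply: le_trans TB; rewrite lerD2l ler_wpM2r.
have HB n j : (forall j, j%:R * tau n <= T -> Hs a.+1 (evol n (g n) j) (B0 + j%:R * tau n * CC B)) -> j%:R * tau n <= T -> Hs a.+1 (evol n (g n) j) B.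
  by move=> h jT; apply: Hs_le (h j jT); apply: le_trans TB; rewrite lerD2l ler_wpM2r.
have ex t : exists v, 0 <= t <= T -> Hs a.+1 v (B0 + t * CC B) /\ forall e : R, 0 < e -> U [set n | forall x, `|f n t x - v x| <= e].
  case: (boolP (0 <= t <= T)) => tT; last by exists (fun=> 0).
  have /andP[t0 t1] := tT.
  have [|v [h1 h2]] := @weak_limit a da U (B0 + t * CC B) (fun n => f n t) UU; last by exists v.
  apply: filterS good => n [n0 rg Hn] /=; have [k1 k2] := idxP n t n0 t0.
  by apply: Hs_le (Hn _ (le_trans k1 t1)); rewrite lerD2l ler_wpM2r.
have [v hv] := choice ex.
have HvB t : 0 <= t <= T -> Hs a.+1 (v t) B.
  by move=> tT; apply: Hs_le (hv t tT).1; apply: le_trans TB; rewrite lerD2l ler_wpM2r //; case/andP: tT.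
exists v; split; last by move=> t /hv[].
- split=> // e e0.
  have [A A0 hA] := QN_bound da Bge0.
  have [n2 [dl dl0 hQ]] := QN_cvg da Bge0 (divr_gt0 e0 (ltr0n R 2)).
  have A1 : 0 < A + 1 by rewrite ltr_wpDl.
  pose del := dl / (4 * (A + 1)).
  have del0 : 0 < del by rewrite divr_gt0 // mulr_gt0.
  exists del => // s t sT tT st x.
  have [/andP[s0 s1] /andP[t0 t1]] := (sT, tT).
  (* [eta] absorbs the rounding of [s] and [t] to mesh times and the distance to the limit. For |s -
     t| <= [del] every iterate in between stays within [dl] of v t, so each increment is [tau n]
     times a value close to QQ (v t). *)
  apply/ler_addgt0Pr => eta eta0.
  pose N := e / 2 + `|QQ (v t) x| + 1.
  have [n3 hn3] := @ex_large_nat R [:: (1, del); (N, eta / 3)] ltac:(by rewrite /= del0 divr_gt0).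
  have m0' : 0 < Num.min (eta / 3) (dl / 2) by rewrite lt_min !divr_gt0.
  have [n [[n0 rg Hn] [[hs ht] /= hn]]] := filter_ex (filterI good (filterI (filterI ((hv s sT).2 _ m0') ((hv t tT).2 _ m0')) (Uoo (maxn n2 n3)))).
  move: hn; rewrite geq_max => /andP[nn2 nn3].
  have [n1R] := hn3 n nn3; rewrite /= andbT => /andP[q1 q2].
  have nR : 0 < n%:R :> R by rewrite ltr0n.
  have ta0 := @tau_gt0 n n0.
  have ta1 c y : c <= y * n%:R -> 0 <= y -> tau n * c <= y.
    move=> h y0; apply: le_trans (ler_wpM2l (ltW ta0) h) _; rewrite mulrCA; apply: ler_piMr => //.
    apply: (@le_trans _ _ (tau n * n%:R ^+ 3)); last by rewrite tau3.
    apply: ler_wpM2l; first exact: ltW.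
    by rewrite exprS; apply: ler_peMr; [exact: ltW | exact: exprn_ege1].
  have t_del : tau n <= del by have := ta1 1 del q1 (ltW del0); rewrite mulr1.
  have t_N : tau n * N <= eta / 3 by apply: ta1 => //; rewrite divr_ge0 // ltW.
  set j := idx n s; set i := idx n t.
  have [j1 j2] := idxP n s n0 s0; have [i1 i2] := idxP n t n0 t0; rewrite -/j in j1 j2; rewrite -/i in i1 i2.
  have jT : j%:R * tau n <= T by exact: le_trans s1.
  have iT : i%:R * tau n <= T by exact: le_trans t1.
  have HH k : (k <= maxn i j)%N -> Hs a.+1 (evol n (g n) k) B.
    move=> kk; apply: HB => //; have : k%:R * tau n <= (maxn i j)%:R * tau n by rewrite ler_wpM2r ?(ltW ta0) // ler_nat.
    by move=> h; apply: le_trans h _; rewrite /maxn; case: ifP.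
  have small : tau n * `|j%:R - i%:R| <= `|s - t| + tau n.
    rewrite -(ger0_norm (ltW ta0)) -normrM (ger0_norm (ltW ta0)) ler_norml.
    have := ler_norm (s - t); have := ler_norm (t - s); rewrite distrC.
    by move: j1 j2 i1 i2; clra.
  have del_dl : A * (del + del) <= dl / 2.
    by rewrite /del (_ : A * _ = A / (A + 1) * (dl / 2)); [apply: ler_piMl; [rewrite divr_ge0 // ltW | rewrite ler_pdivrMr // mul1r lerDl] | field; rewrite gt_eqF].
  have step (k l : nat) y : (k <= l)%N -> (l <= maxn i j)%N -> `|evol n (g n) l y - evol n (g n) k y| <= A * (tau n * (l%:R - k%:R)).
    move=> kl lm; have := @discrete_increment (fun k => evol n (g n) k y) (fun k => QN n (n ^ 4) (evol n (g n) k) y) (tau n) 0 A k l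
      (ltW ta0) kl (fun k => evolS n (g n) k y).
    rewrite mulr0 subr0; apply => k' /andP[_ h]; rewrite subr0; apply: hA => //; apply: HH; exact: leq_trans (ltnW h) lm.
  have near_t k : (minn i j <= k <= maxn i j)%N -> forall y, `|evol n (g n) k y - v t y| <= dl.
    move=> /andP[k1 k2] y.
    have h1 : `|evol n (g n) k y - evol n (g n) i y| <= dl / 2.
      apply: le_trans del_dl.
      have b1 : `|k%:R - i%:R| <= `|j%:R - i%:R| :> R.
        move: k1 k2; rewrite /minn /maxn; case: (ltnP i j) => ij k1 k2.
          by rewrite !ger0_norm ?subr_ge0 ?ler_nat ?(ltnW ij) // lerD2r ler_nat.
        by rewrite !ler0_norm ?subr_le0 ?ler_nat // lerN2 lerD2r ler_nat.
      have b2 : A * (tau n * `|k%:R - i%:R|) <= A * (del + del).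
        apply: ler_wpM2l => //; apply: le_trans (ler_wpM2l (ltW ta0) b1) _; apply: le_trans small _; exact: lerD.
      apply: le_trans b2; have [ki|ik] := leqP k i.
        by rewrite distrC (distrC k%:R) (ger0_norm (_ : 0 <= i%:R - k%:R)) ?subr_ge0 ?ler_nat //; apply: step; rewrite // leq_maxl.
      by rewrite (ger0_norm (_ : 0 <= k%:R - i%:R)) ?subr_ge0 ?ler_nat 1?ltnW //; apply: step => //; exact: ltnW.
    have := ht y; rewrite -/i le_min => /andP[_ h2]; rewrite -/i in h2.
    by move: h1 h2; rewrite /f -/i !ler_norml; clra.
  have Qc k : (minn i j <= k <= maxn i j)%N -> `|QN n (n ^ 4) (evol n (g n) k) x - QQ (v t) x| <= e / 2.
    by move=> kk; apply: hQ => //; [apply: HH; case/andP: kk | exact: HvB | exact: near_t].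
  have inc : `|evol n (g n) j x - evol n (g n) i x - tau n * (j%:R - i%:R) * QQ (v t) x| <= e / 2 * (tau n * `|j%:R - i%:R|).
    have D := @discrete_increment (fun k => evol n (g n) k x) (fun k => QN n (n ^ 4) (evol n (g n) k) x) (tau n) (QQ (v t) x) (e / 2).
    have [ij|ji] := leqP i j.
      rewrite (ger0_norm (_ : 0 <= j%:R - i%:R)) ?subr_ge0 ?ler_nat //; apply: D => //; first exact: ltW.
      by move=> k /andP[k1 /ltnW k2]; apply: Qc; rewrite (minn_idPl ij) (maxn_idPr ij) k1.
    rewrite (ler0_norm (_ : j%:R - i%:R <= 0)) ?subr_le0 ?ler_nat 1?ltnW // opprB.
    have -> : evol n (g n) j x - evol n (g n) i x - tau n * (j%:R - i%:R) * QQ (v t) x =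
      - (evol n (g n) i x - evol n (g n) j x - tau n * (i%:R - j%:R) * QQ (v t) x) by ring.
    rewrite normrN.
    apply: D => //; [exact: ltW | exact: ltnW |].
    by move=> k /andP[k1 /ltnW k2]; apply: Qc; rewrite (minn_idPr (ltnW ji)) (maxn_idPl (ltnW ji)) k1.
  have := hs x; have := ht x; rewrite !le_min => /andP[w1 _] /andP[w2 _].
  rewrite /f -/i in w1; rewrite /f -/j in w2.
  have dQ : `|(tau n * (j%:R - i%:R) - (s - t)) * QQ (v t) x| <= tau n * `|QQ (v t) x|.
    rewrite normrM; apply: ler_wpM2r => //; rewrite ler_norml; move: j1 j2 i1 i2; clra.
  have inc2 : e / 2 * (tau n * `|j%:R - i%:R|) <= e / 2 * (`|s - t| + tau n) by apply: ler_wpM2l => //; rewrite divr_ge0 // ltW.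
  have est : 0 <= e * `|s - t| by rewrite mulr_ge0 // ltW.
  have -> : v s x - v t x - (s - t) * QQ (v t) x = - (evol n (g n) j x - v s x) + (evol n (g n) i x - v t x)
    + (evol n (g n) j x - evol n (g n) i x - tau n * (j%:R - i%:R) * QQ (v t) x) + (tau n * (j%:R - i%:R) - (s - t)) * QQ (v t) x by ring.
  have N4 (b1 b2 b3 b4 : R) : `|b1 + b2 + b3 + b4| <= `|b1| + `|b2| + `|b3| + `|b4|.
    by do 2 (apply: le_trans (ler_normD _ _) _; rewrite lerD2r); exact: ler_normD.
  apply: le_trans (N4 _ _ _ _) _; rewrite normrN; move: t_N; rewrite /N; move: w1 w2 (le_trans inc inc2) dQ est ta0; clra.
- have h0 : 0 <= (0 : R) <= T by apply/andP; split.
  apply/funext => x; apply/eqP; rewrite -subr_eq0 -normr_le0; apply/ler_addgt0Pr => e e0; rewrite add0r.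
  have [n [h1 h2]] := filter_ex (filterI ((hv 0 h0).2 _ (divr_gt0 e0 (ltr0n R 2))) (gclose _ (divr_gt0 e0 (ltr0n R 2)))).
  have := h1 x; have := h2 x; rewrite /f /idx mul0r truncn0 /=.
  by rewrite !ler_norml; clra.
Qed.

End LocalExistence.

(** * Shifts, differences and their Fourier coefficients *)

Section Shifts.
Implicit Types (v : V -> R).

Lemma exE (b : R) : normc (ex b) = 1.
Proof. by rewrite /= cos2Dsin2 sqrtr1. Qed.

Lemma exN (b : R) : ex (- b) = ((ex b)^*)%C.
Proof. by rewrite /ex cosN sinN. Qed.

Lemma exD (b c : R) : ex (b + c) = ex b * ex c.
Proof. by rewrite /ex cosD sinD; apply: complexP => /=; ring. Qed.

Lemma cp_shift f h : cp f -> cp (fun x => f (x + h)).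
Proof.
move=> [cf pf]; split; last by move=> i x; rewrite addrAC pf.
apply/contP => x e e0; have /contP H := cf; have [dl dl0 hdl] := H (x + h) e e0; exists dl => // y xy.
by apply: hdl; rewrite opprD addrACA subrr addr0.
Qed.

Lemma ft_shift f h xi : cp f -> asum (ft f) -> ft (fun x => f (x + h)) xi = ex (dot (freq xi) h) * ft f xi.
Proof.
move=> cf af; have cs := cp_shift h cf.
apply/eqP; rewrite -subr_eq0; apply/eqP; apply: ComplexField.Normc.eq0_normc.
apply/eqP; rewrite eq_le normc_ge0 andbT; apply/ler_addgt0Pr => e e0; rewrite add0r.
have [j1 hj1] := af e e0; have [j2 hj2] := mem_Bx_ex [:: xi].
pose j := maxn j1 j2.
have xj : xi \in Bx j by apply: (Bx_sub (leq_maxr j1 j2)); apply: hj2; rewrite inE.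
have hj : tail (fun p => normc (ft f p)) j e by apply: tail_mono hj1; [move=> p; exact: normc_ge0 | exact: leq_maxl].
pose c p := ex (dot (freq p) h) * ft f p.
have hc : herm c.
  move=> p; rewrite /c ft_opp ?(freqN p); last exact: cf.1.
  by rewrite dotNl exN; case: (ex _) (ft f p) => ? ? [? ?]; apply: complexP => /=; ring.
have E x : syn c (2 ^ j) x = syn (ft f) (2 ^ j) (x + h).
  apply: eq_bigr => p _; rewrite /pr /c dotDr exD; congr complex.Re.
  by rewrite -mulrA mulrCA [ex (dot _ h) * _]mulrC.
have := @ft_syn c (2 ^ j) xi hc; rewrite xj -/(c xi) => <-.
rewrite -ftB; [|exact: cs.1 | exact: syn_cont].
apply: ft_norm; first by apply: contB; [exact: cs.1 | exact: syn_cont].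
by move=> x; rewrite E; exact: syn_approx.
Qed.

Definition dR h f : V -> R := fun x => f (x + h) - f x.

Lemma normcM (z w : C) : normc (z * w) = normc z * normc w.
Proof. exact: ComplexField.Normc.normcM. Qed.

Variable a : nat.
Hypothesis da : (d < 2 * a)%N.

Lemma Hs_dR f h (B : R) : Hs a.+1 f B -> Hs a.+1 (dR h f) (4 * B) /\ forall xi, ft (dR h f) xi = (ex (dot (freq xi) h) - 1) * ft f xi.
Proof.
move=> Hf; have cf := Hf.1; have cs := cp_shift h cf.
have E xi : ft (dR h f) xi = (ex (dot (freq xi) h) - 1) * ft f xi.
  rewrite /dR ftB; [|exact: cs.1|exact: cf.1].
  by rewrite (ft_shift h xi cf (Hs_asum da Hf)) mulrBl mul1r.
split=> //; split; first exact: cpB.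
move=> P; apply: le_trans (ler_wpM2l (ler0n R 4) (Hf.2 P)); rewrite /En mulr_sumr; apply: ler_sum => xi _.
rewrite E normcM exprMn mulrCA; apply: ler_wpM2r.
  by apply: mulr_ge0; [exact: jwX_ge0 | exact: sqr_ge0].
rewrite (_ : 4 = 2 ^+ 2); last by rewrite -natrX.
apply: lerXn2r; rewrite ?nnegrE ?normc_ge0 //; apply: le_trans (le_normcD _ _) _.
by rewrite normcN exE ComplexField.Normc.normc1.
Qed.

Lemma Hs_dRk f h (B : R) k : Hs a.+1 f B -> (exists B', Hs a.+1 (iter k (dR h) f) B') /\
  forall xi, ft (iter k (dR h) f) xi = (ex (dot (freq xi) h) - 1) ^+ k * ft f xi.
Proof.
move=> Hf; elim: k => [|k [[B' IH1] IH2]]; first by split; [exists B | move=> xi; rewrite expr0 mul1r].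
have [h1 h2] := Hs_dR h IH1; split; first by exists (4 * B').
by move=> xi; rewrite iterS h2 IH2 mulrA -exprS.
Qed.

Lemma dR_close f g h (e : R) k : (forall x, `|f x - g x| <= e) -> forall x, `|iter k (dR h) f x - iter k (dR h) g x| <= 2 ^+ k * e.
Proof.
move=> fg; elim: k => [|k IH] x; first by rewrite expr0 mul1r.
have := IH (x + h); have := IH x; rewrite iterS /dR iterS /dR exprS -mulrA.
by rewrite !ler_norml; clra.
Qed.

Lemma dk_lat n x f z k y : dk k z (lat n x f) y = iter k (dR (n%:R^-1 *: freq z)) f (x + n%:R^-1 *: freq y).
Proof.
elim: k y => [|k IH] y; first by [].
by rewrite dkS /dl !IH iterS /dR freqD scalerDr addrA.
Qed.

Lemma ex_sub1 (t : R) : 1 <= t <= 3 / 2 -> 1 / 2 <= normc (ex t - 1).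
Proof.
move=> /andP[t1 t2]; rewrite -(@ler_sqr R) ?nnegrE ?normc_ge0 // normcE /=.
have h1 := cos2Dsin2 t; have h2 := cos_half t; have h3 := cos2Dsin2 (t / 2).
have x1 : 1 / 4 <= (t / 2) ^+ 2 by nra.
have x2 : (t / 2) ^+ 2 <= 9 / 16 by nra.
have := @sin_sqr_ge (t / 2); move: x1 x2; set y := (t / 2) ^+ 2 => x1 x2.
have -> : y <= 1 by move: x2; clra.
move=> /(_ isT); have : 3 / 16 <= y * (1 - y) by nra.
by move: h1 h2 h3; clra.
Qed.

(** The step is taken along the axis of the largest coordinate of [xi], which is at least |xi|/d.
    The phase advances by at most 1/2 per mesh step, so some multiple lands in [1, 3/2], where the
    phase factor stays away from 1. *)
Lemma lattice_direction xi : (0 < d)%N -> xi != 0 -> exists n0, forall n, (n0 <= n)%N -> exists z,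
  1 / 2 <= normc (ex (dot (freq xi) (n%:R^-1 *: freq z)) - 1) /\ nz z / n%:R <= 2 * d%:R / nz xi.
Proof.
move=> d0 xi0; have nx := @nz_ge1 R d xi xi0.
have dR0 : 0 < d%:R :> R by rewrite ltr0n.
have [i hi] : exists i, nz xi <= d%:R * `|(freq xi : V) 0 i|.
  have [i _ hi] := @arg_maxnP 'I_d (Ordinal d0) xpredT (fun i => absz (xi ord0 i)) isT.
  exists i; apply: le_trans (enorm_le_sum _) _; rewrite mulr_natl -[X in _ *+ X]card_ord -sumr_const.
  by apply: ler_sum => j _; rewrite !mxE -!intr_norm -!natr_absz ler_nat; exact: hi.
set X := `|_| in hi; have X0 : 0 < X by rewrite -(pmulr_rgt0 _ dR0); apply: lt_le_trans hi; exact: lt_le_trans nx.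
have [n0 h0] := @ex_large_nat R [:: (2 * X, 1)] ltac:(by rewrite /= ltr01).
have {}h0 n : (n0 <= n)%N -> 1 <= n%:R :> R /\ 2 * X <= n%:R by move=> /h0 [n1 /=]; rewrite mul1r andbT.
exists n0 => n /h0 [n1 nX].
have nR : 0 < n%:R :> R by exact: lt_le_trans n1.
pose y := 3 / 2 * (n%:R / X); have y0 : 0 <= y by rewrite mulr_ge0 ?divr_ge0 // ltW.
have /andP[k1 k2] := truncn_itv y0; set k := Num.truncn y in k1 k2.
rewrite -(natr1 k) in k2.
exists (if 0 <= (freq xi : V) 0 i then delta_mx 0 i *+ k else - (delta_mx 0 i *+ k)).
have tE : dot (freq xi) (n%:R^-1 *: freq (if 0 <= (freq xi : V) 0 i then delta_mx 0 i *+ k else - (delta_mx 0 i *+ k))) = k%:R * X / n%:R :> R.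
  rewrite dotZr /X; case: ifPn => [s0|]; last rewrite -ltNge => s0.
    by rewrite freqMn freq_delta dotZr dot_delta ger0_norm //; ring.
  by rewrite freqN freqMn freq_delta dotNr dotZr dot_delta ltr0_norm //; ring.
have zE : nz (if 0 <= (freq xi : V) 0 i then delta_mx 0 i *+ k else - (delta_mx 0 i *+ k)) = k%:R.
  by case: ifP => _; rewrite ?nzN nzMn /nz freq_delta enorm_delta mulr1.
have yX : y * X = 3 / 2 * n%:R by rewrite /y; field; rewrite gt_eqF.
rewrite tE zE; split.
  apply: ex_sub1; rewrite ler_pdivlMr // ler_pdivrMr // mul1r -yX; apply/andP; split; last by rewrite ler_pM2r.
  have : y * X < (k%:R + 1) * X by rewrite ltr_pM2r.
  by rewrite yX; move: nX; clra.
rewrite ler_pdivrMr // mulrAC ler_pdivlMr; last exact: lt_le_trans nx.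
apply: (@le_trans _ _ (k%:R * (d%:R * X))); first by rewrite ler_wpM2l.
have : k%:R * X <= 3 / 2 * n%:R by rewrite -yX ler_pM2r.
move=> /(ler_wpM2l (ltW dR0)); have : 0 <= d%:R * n%:R :> R by rewrite mulr_ge0 // ltW.
by clra.
Qed.

End Shifts.

(** * From lattice regularity to smoothness of the limit *)

Section Smoothing.
Variable a : nat.
Hypothesis da : (d < 2 * a)%N.
Hypothesis d0 : (0 < d)%N.

Definition idx n (t : R) := Num.truncn (t * n%:R ^+ 3).

Lemma idxP n t : (0 < n)%N -> 0 <= t -> (idx n t)%:R * tau n <= t /\ t < (idx n t)%:R * tau n + tau n.
Proof.
move=> n0 t0; have n3 : 0 < n%:R ^+ 3 :> R by rewrite exprn_gt0 // ltr0n.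
have /andP[h1 h2] := truncn_itv (mulr_ge0 t0 (ltW n3)).
rewrite -(natr1 (Num.truncn _)) in h2; split; first by rewrite /tau ler_pdivrMr.
by rewrite /tau -[X in _ + X]mul1r -mulrDl ltr_pdivlMr.
Qed.

Lemma QQ_bound (B : R) : 0 <= B -> exists2 A : R, 0 <= A & forall f x, Hs a.+1 f B -> `|QQ f x| <= A.
Proof.
move=> B0; have [A A0 hA] := QN_bound da B0; have [n0 [dl dl0 h]] := QN_cvg da B0 (@ltr01 R).
exists (A + 1); first exact: addr_ge0.
move=> f x Hf.
have h1 := h f f n0.+1 (n0.+1 ^ 4)%N Hf Hf ltac:(by move=> y; rewrite subrr normr0 ltW) (leqnSn n0) (leqnn _) x.
have h2 := hA n0.+1 (n0.+1 ^ 4)%N f x isT Hf.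
by move: h1 h2; rewrite !ler_norml; clra.
Qed.

Lemma QQ_cvg (B e : R) : 0 <= B -> 0 < e -> exists2 dl : R, 0 < dl &
  forall f g, Hs a.+1 f B -> Hs a.+1 g B -> (forall y, `|f y - g y| <= dl) -> forall x, `|QQ f x - QQ g x| <= e.
Proof.
move=> B0 e0; have [n0 [dl dl0 h]] := QN_cvg da B0 (divr_gt0 e0 (ltr0n R 2)).
exists dl => // f g Hf Hg fg x.
have h1 := h f f n0 (n0 ^ 4)%N Hf Hf ltac:(by move=> y; rewrite subrr normr0 ltW) (leqnn _) (leqnn _) x.
have h2 := h f g n0 (n0 ^ 4)%N Hf Hg fg (leqnn _) (leqnn _) x.
by move: h1 h2; rewrite !ler_norml; clra.
Qed.

Lemma WS_lip (T B : R) (v : R -> V -> R) : 0 <= B -> WS a T B v -> exists2 L : R, 0 <= L & exists2 dl : R, 0 < dl &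
  forall s t, 0 <= s <= T -> 0 <= t <= T -> `|s - t| <= dl -> forall x, `|v s x - v t x| <= L * `|s - t|.
Proof.
move=> B0 [Hv star]; have [A A0 hA] := QQ_bound B0; have [dl dl0 h] := star 1 ltr01.
exists (A + 1); first exact: addr_ge0.
exists dl => // s t sT tT st x; have h1 := h s t sT tT st x.
have h2 : `|(s - t) * QQ (v t) x| <= A * `|s - t| by rewrite normrM mulrC ler_wpM2r //; exact: hA (Hv t tT).
by move: h1 h2; rewrite !ler_norml; clra.
Qed.

Lemma WS_limit (T B m M e : R) (v : R -> V -> R) u0 : WS a T B v -> 0 <= T -> 0 < m -> m <= M -> v 0 = u0 ->
  (forall x, m <= u0 x <= M) -> 0 < e -> exists n0, forall n, (n0 <= n)%N -> forall t, 0 <= t <= T -> forall x, `|evol n u0 (idx n t) x - v t x| <= e.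
Proof.
move=> Wv T0 m0 mM v0 ur e0; have [Hv _] := Wv.
have B0 : 0 <= B by apply: Hs_ge0 (Hv 0 _); apply/andP; split.
have [n1 [dl dl0 h1]] := WS_stability da Wv T0 m0 mM (divr_gt0 e0 (ltr0n R 2)).
have [L L0 [dl2 dl20 h2]] := WS_lip B0 Wv.
have [n2 h3] := @ex_large_nat R [:: (1, dl2); (L, e / 2)] ltac:(by rewrite /= dl20 divr_gt0).
exists (maxn (maxn n1 n2) 1) => n; rewrite !geq_max => /andP[/andP[nn1 nn2] n0] t tT x.
have [n1R] := h3 n nn2; rewrite /= andbT => /andP[q1 q2].
have nR : 0 < n%:R :> R by rewrite ltr0n.
have t0 := @tau_gt0 n n0.
have tle (c y : R) : 0 <= y -> c <= y * n%:R -> tau n * c <= y.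
  move=> y0 h; apply: le_trans (ler_wpM2l (ltW t0) h) _; rewrite mulrCA; apply: ler_piMr => //.
  apply: (@le_trans _ _ (tau n * n%:R ^+ 3)); last by rewrite tau3.
  apply: ler_wpM2l; first exact: ltW.
  by rewrite exprS; apply: ler_peMr; [exact: ltW | exact: exprn_ege1].
have [/andP[tge tT'] ] := (tT, I); have [i1 i2] := idxP n0 tge; move=> _.
set s := (idx n t)%:R * tau n in i1 i2.
have sT : s <= T by exact: le_trans tT'.
have s0 : 0 <= s <= T by rewrite sT andbT mulr_ge0 // ltW.
have st : `|s - t| <= tau n by rewrite ler_norml; move: i1 i2; clra.
have k1 := h1 n u0 nn1 ur ltac:(by move=> y; rewrite v0 subrr normr0 ltW) (idx n t) sT x.
have st2 : `|s - t| <= dl2 by apply: le_trans st _; have := tle 1 dl2 (ltW dl20) q1; rewrite mulr1.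
have k2 := h2 s t s0 tT st2 x.
have k3 : L * `|s - t| <= e / 2.
  by apply: le_trans (ler_wpM2l L0 st) _; rewrite mulrC; apply: tle => //; rewrite divr_ge0 // ltW.
by rewrite -/s in k1; move: k1 k2 k3; rewrite !ler_norml; clra.
Qed.

Lemma WS_range (T B m M : R) (v : R -> V -> R) u0 : WS a T B v -> 0 <= T -> 0 < m -> m <= M -> v 0 = u0 ->
  (forall x, m <= u0 x <= M) -> forall t, 0 <= t <= T -> forall x, m <= v t x <= M.
Proof.
move=> Wv T0 m0 mM v0 ur t tT x.
have [n1 h1] := @ex_large_nat R [:: (2 * M, 1)] ltac:(by rewrite /= ltr01).
have rg e : 0 < e -> m <= v t x + e /\ v t x - e <= M.
  move=> e0; have [n2 h2] := WS_limit Wv T0 m0 mM v0 ur e0.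
  have nn1 : (n1 <= (maxn n1 n2).+1)%N by apply: leqW; exact: leq_maxl.
  have nn2 : (n2 <= (maxn n1 n2).+1)%N by apply: leqW; exact: leq_maxr.
  have [n1R /= /andP[]] := h1 _ nn1; rewrite mul1r => q1 _.
  have q2 : 2 * M <= (maxn n1 n2).+1%:R ^+ 2 by apply: le_trans q1 _; rewrite expr2 ler_peMl //.
  have /andP[r1 r2] := evol_range m0 mM (ltn0Sn _) q2 ur (idx (maxn n1 n2).+1 t) x.
  by have := h2 _ nn2 t tT x; rewrite ler_norml; move: r1 r2; clra.
apply/andP; split; apply/ler_addgt0Pr => e e0; have [h2 h3] := rg e e0 => //.
by move: h3; clra.
Qed.

(** A k-th difference multiplies the coefficient at [xi] by the k-th power of a factor of modulus at
    least 1/2, while its sup norm is of order (|z|/n)^s with |z|/n at most 2d/|xi|. The mesh is sent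
    to zero for fixed [xi], so the thresholds that depend on [xi] and on the Sobolev bound [B]
    disappear. *)
Lemma WS_decay (s : nat) (m M t0 : R) : (2 <= s)%N -> 0 < m -> m <= M -> 0 < t0 -> exists2 Cs : R, 0 <= Cs &
  forall (T B : R) (v : R -> V -> R) u0, WS a T B v -> v 0 = u0 -> (forall x, m <= u0 x <= M) ->
  forall t, t0 <= t <= T -> forall xi, xi != 0 -> normc (ft (v t) xi) <= Cs / nz xi ^+ s.
Proof.
move=> s2 m0 mM t00.
have [Cs Cs0 reg] := @lattice_regularity R d s m M (t0 / 2) d0 s2 m0 mM (divr_gt0 t00 (ltr0n R 2)).
pose k := (2 * s).+1; pose D := 2 ^+ k * (Cs * (2 * d%:R) ^+ s).
exists D; first by rewrite /D !mulr_ge0 ?exprn_ge0 // mulr_ge0.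
move=> T B v u0 Wv v0 ur t /andP[t1 t2] xi xi0.
have tge : 0 <= t := le_trans (ltW t00) t1.
have T0 : 0 <= T := le_trans tge t2.
have tT : 0 <= t <= T by rewrite tge t2.
have [Hv _] := Wv; have Ht := Hv t tT.
have H0 : Hs a.+1 u0 B by rewrite -v0; apply: Hv; apply/andP; split.
have nx : 0 < nz xi by exact: lt_le_trans (nz_ge1 xi0).
have S00 := @S0_gt0; have B0 := Hs_ge0 H0.
have l0 : 0 <= (S0 + B) / 2 by rewrite divr_ge0 // addr_ge0 // ltW.
have [n1 h1] := reg _ l0; have [n2 h2] := @lattice_direction xi d0 xi0.
apply/ler_addgt0Pr => e e0.
pose e1 := e / (2 ^+ k * 2 ^+ k).
have p2 : 0 < 2 ^+ k :> R by exact: exprn_gt0.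
have e10 : 0 < e1 by rewrite divr_gt0 // mulr_gt0.
have [n3 h3] := WS_limit Wv T0 m0 mM v0 ur e10.
have [n4 h4] := @ex_large_nat R [:: (1, t0 / 2)] ltac:(by rewrite /= divr_gt0).
pose n := (maxn (maxn n1 n2) (maxn n3 n4)).+1.
have nn1 : (n1 <= n)%N by apply: leqW; rewrite !leq_max leqnn ?orbT.
have nn2 : (n2 <= n)%N by apply: leqW; rewrite !leq_max leqnn ?orbT.
have nn3 : (n3 <= n)%N by apply: leqW; rewrite !leq_max leqnn ?orbT.
have nn4 : (n4 <= n)%N by apply: leqW; rewrite !leq_max leqnn ?orbT.
have n0 : (0 < n)%N by [].
clearbody n.
have [n1R] := h4 n nn4; rewrite /= andbT => q1.
have nR : 0 < n%:R :> R by rewrite ltr0n.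
have ta0 := @tau_gt0 n n0.
have ta1 : tau n <= t0 / 2.
  have := ler_wpM2l (ltW ta0) q1; rewrite mulr1 mulrCA => h; apply: le_trans h _; apply: ler_piMr.
    by rewrite divr_ge0 // ltW.
  apply: (@le_trans _ _ (tau n * n%:R ^+ 3)); last by rewrite tau3.
  by rewrite ler_wpM2l ?(ltW ta0) // exprS ler_peMr ?(ltW nR) // exprn_ege1.
have [i1 i2] := idxP n0 tge.
have it : t0 / 2 <= (idx n t)%:R * tau n by move: i2 t1 ta1; clra.
have [z [z1 z2]] := h2 n nn2.
set h := n%:R^-1 *: freq z in z1.
have bnd x : `|iter k (dR h) (evol n u0 (idx n t)) x| <= Cs * (nz z / n%:R) ^+ s.
  have := h1 n (n ^ 4)%N (tau n) (fun j => lat n x (evol n u0 j)) nn1 ta0 ltac:(by rewrite tau3) (leqnn _)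
    ltac:(by move=> y; exact: ur) _ (fun j => evol_lat n u0 j x) (idx n t) it 0 z.
  rewrite dk_lat freq0 scaler0 addr0; apply.
  move=> y z'; rewrite /lat freqD scalerDr addrA; apply: le_trans (ler_norm _) _; apply: le_trans (Hs_lip da _ _ H0) _.
  by rewrite enormZ ger0_norm ?invr_ge0 ?(ltW nR) // (mulrC n%:R^-1).
have bnd2 x : `|iter k (dR h) (v t) x| <= Cs * (nz z / n%:R) ^+ s + 2 ^+ k * e1.
  have := dR_close h k (h3 n nn3 t tT) x; have := bnd x; rewrite !ler_norml; clra.
have [[B' HB'] fE] := Hs_dRk da h k Ht.
have nb := ft_norm xi HB'.1.1 bnd2.
rewrite fE normcM in nb.
have pw (w : C) j : normc (w ^+ j) = normc w ^+ j.
  by elim: j => [|j IH]; rewrite ?expr0 ?ComplexField.Normc.normc1 // !exprS normcM IH.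
rewrite pw in nb.
have c1 : (1 / 2) ^+ k * normc (ft (v t) xi) <= Cs * (2 * d%:R / nz xi) ^+ s + 2 ^+ k * e1.
  apply: (@le_trans _ _ (Cs * (nz z / n%:R) ^+ s + 2 ^+ k * e1)).
    apply: le_trans nb; apply: ler_wpM2r; first exact: normc_ge0.
    by apply: lerXn2r; rewrite ?nnegrE ?normc_ge0 // divr_ge0.
  rewrite lerD2r; apply: ler_wpM2l => //; apply: lerXn2r => //; rewrite nnegrE.
    by rewrite divr_ge0 ?nz_ge0 // ltW.
  by rewrite divr_ge0 ?mulr_ge0 // ltW.
have := ler_wpM2l (ltW p2) c1; rewrite mulrA -exprMn (_ : 2 * (1 / 2) = 1); last by field.
rewrite expr1n mul1r; move=> c2; apply: le_trans c2 _.
rewrite le_eqVlt; apply/orP; left; apply/eqP; rewrite expr_div_n mulrDr; congr (_ + _); first by rewrite /D !mulrA.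
by rewrite mulrA /e1 mulrC divfK // gt_eqF // mulr_gt0.
Qed.

Lemma WS_smooth (r : nat) (m M t0 : R) : 0 < m -> m <= M -> 0 < t0 -> exists2 Br : R, 0 <= Br &
  forall (T B : R) (v : R -> V -> R) u0, WS a T B v -> v 0 = u0 -> (forall x, m <= u0 x <= M) ->
  forall t, t0 <= t <= T -> Hs r (v t) Br.
Proof.
(* Decay of order r + a + 2 leaves, after the weight of order [r], at least the summable inverse
   weight of order [a]. *)
move=> m0 mM t00; pose s := (r + a).+2.
have [Cs Cs0 dec] := @WS_decay s m M t0 isT m0 mM t00.
have M0 : 0 < M by exact: lt_le_trans mM.
exists (M ^+ 2 + Cs ^+ 2 * 2 ^+ s * S0).
  by rewrite addr_ge0 ?sqr_ge0 // mulr_ge0 ?(ltW S0_gt0) // mulr_ge0 ?sqr_ge0 ?exprn_ge0.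
move=> T B v u0 Wv v0 ur t /andP[t1 t2].
have tge : 0 <= t := le_trans (ltW t00) t1.
have T0 : 0 <= T := le_trans tge t2.
have tT : 0 <= t <= T by rewrite tge t2.
have [Hv _] := Wv; have Ht := Hv t tT.
split; first exact: Ht.1.
move=> P; rewrite /En.
have z0 : 0 \in bx P by rewrite mem_bx; apply/forallP => i; rewrite mxE.
rewrite (bigD1_seq 0) ?bx_uniq //=; apply: lerD.
  rewrite /jw nz0 expr0n addr0 expr1n mul1r; apply: lerXn2r; rewrite ?nnegrE ?normc_ge0 ?(ltW M0) //.
  apply: ft_norm; first exact: Ht.1.1.
  move=> x; have /andP[r1 r2] := WS_range Wv T0 m0 mM v0 ur tT x.
  by rewrite ler_norml; move: r1 r2 m0; clra.
apply: (@le_trans _ _ (\sum_(i <- bx P) Cs ^+ 2 * 2 ^+ s * (jw i ^+ a)^-1)); last first.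
  rewrite -mulr_sumr; apply: ler_wpM2l; last exact: full_sum.
  by rewrite mulr_ge0 ?sqr_ge0 ?exprn_ge0.
rewrite [leRHS](bigID (fun i => i != 0)) /= -[leLHS]addr0; apply: lerD; last first.
  apply: sumr_ge0 => p _; apply: mulr_ge0; first by rewrite mulr_ge0 ?sqr_ge0 ?exprn_ge0.
  by rewrite invr_ge0 jwX_ge0.
apply: ler_sum => p p0; have := dec T B v u0 Wv v0 ur t ltac:(by rewrite t1 t2) p p0.
have np := nz_ge1 p0 (R := R); have j1 := @jw_ge1 p.
move=> h; have h2 : normc (ft (v t) p) ^+ 2 <= Cs ^+ 2 / (nz p ^+ 2) ^+ s.
  rewrite -exprM mulnC exprM -expr_div_n; apply: lerXn2r; rewrite ?nnegrE ?normc_ge0 //.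
  by rewrite divr_ge0 // exprn_ge0 // nz_ge0.
have h3 : jw p <= 2 * nz p ^+ 2 by have := exprn_ege1 2 np; rewrite /jw; lra.
have j0 := @jw_gt0 p.
have h4 : (nz p ^+ 2) ^- s <= 2 ^+ s * jw p ^- s.
  rewrite -(@ler_pM2r _ ((nz p ^+ 2) ^+ s)) ?exprn_gt0 ?(lt_le_trans ltr01 np) // mulVf ?gt_eqF ?exprn_gt0 ?(lt_le_trans ltr01 np) //.
  rewrite mulrAC -exprMn ler_pdivlMr ?exprn_gt0 // mul1r; apply: lerXn2r => //; rewrite nnegrE ?(ltW j0) //.
  by rewrite mulr_ge0 ?sqr_ge0.
apply: (@le_trans _ _ (jw p ^+ r * (Cs ^+ 2 * (2 ^+ s * jw p ^- s)))).
  apply: ler_wpM2l; first by rewrite exprn_ge0 // ltW.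
  apply: le_trans h2 _; apply: ler_wpM2l => //; exact: sqr_ge0.
rewrite (_ : jw p ^+ r * _ = Cs ^+ 2 * 2 ^+ s * (jw p ^+ r / jw p ^+ s)); last by ring.
apply: ler_wpM2l; first by rewrite mulr_ge0 ?sqr_ge0 ?exprn_ge0.
rewrite /s -addnS -addnS exprD invfM mulrA mulfV ?gt_eqF ?exprn_gt0 // mul1r.
rewrite lef_pV2 ?posrE; [|exact: exprn_gt0|exact: exprn_gt0].
exact: (ler_weXn2l j1 (leqW (leqnSn a))).
Qed.

End Smoothing.

(** * Global solutions and uniqueness *)

Section GlobalSolution.
Variable a : nat.
Hypothesis da : (d < 2 * a)%N.
Hypothesis d0 : (0 < d)%N.

Lemma WS_restrict (T T' B : R) (v : R -> V -> R) : T' <= T -> WS a T B v -> WS a T' B v.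
Proof.
move=> TT [h1 h2]; have sub t : 0 <= t <= T' -> 0 <= t <= T by move=> /andP[-> h]; exact: le_trans TT.
split=> [t /sub/h1//|e /h2[dl dl0 h]]; exists dl => // s t /sub ss /sub tt; exact: h.
Qed.

Lemma WS_shift (S T B : R) (v : R -> V -> R) : 0 <= S -> WS a (S + T) B v -> WS a T B (fun t => v (S + t)).
Proof.
move=> S0 [h1 h2]; have sub t : 0 <= t <= T -> 0 <= S + t <= S + T by move=> /andP[t0 tT]; rewrite addr_ge0 //= lerD2l.
split=> [t /sub/h1//|e /h2[dl dl0 h]]; exists dl => // s t /sub ss /sub tt st x.
have := h _ _ ss tt; rewrite opprD addrACA subrr add0r; exact.
Qed.

(** Only pairs of times on both sides of the junction need care: the increment is split at [S], and
    the derivative at [S] is compared with that at [t] by continuity of [QQ]. *)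
Lemma WS_concat (S T B1 B2 : R) (v1 v2 : R -> V -> R) : 0 <= S -> 0 <= T -> WS a S B1 v1 -> WS a T B2 v2 -> v2 0 = v1 S ->
  WS a (S + T) (Num.max B1 B2) (fun t => if t <= S then v1 t else v2 (t - S)).
Proof.
move=> S0 T0 W1 W2 v21; have [H1 st1] := W1; have [H2 st2] := W2.
set B := Num.max B1 B2; set v := fun t => _.
have B1B : B1 <= B by rewrite /B le_max lexx.
have B2B : B2 <= B by rewrite /B le_max lexx orbT.
have SS : 0 <= S <= S by rewrite S0 lexx.
have B0 : 0 <= B by apply: le_trans B1B; exact: Hs_ge0 (H1 S SS).
have r1 t : 0 <= t <= S + T -> t <= S -> 0 <= t <= S by move=> /andP[-> _].
have r2 t : 0 <= t <= S + T -> S <= t -> 0 <= t - S <= T by move=> /andP[_ h1] h2; rewrite subr_ge0 h2 lerBlDl.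
have vS t : S <= t -> v t = v2 (t - S).
  rewrite /v le_eqVlt => /predU1P[<-|h]; first by rewrite lexx subrr v21.
  by rewrite leNgt h.
have v1S t : t <= S -> v t = v1 t by rewrite /v => ->.
have Hv t : 0 <= t <= S + T -> Hs a.+1 (v t) B.
  move=> tT; have [tS|/ltW St] := leP t S.
    by rewrite (v1S _ tS); apply: Hs_le (H1 t (r1 t tT tS)).
  by rewrite (vS _ St); apply: Hs_le (H2 _ (r2 t tT St)).
split=> // e e0; have e2 := divr_gt0 e0 (ltr0n R 2).
have [d1 d10 h1] := st1 _ e2; have [d2 d20 h2] := st2 _ e2.
have [dq dq0 hq] := QQ_cvg da B0 e2.
have [L1 L10 [d3 d30 h3]] := WS_lip da (Hs_ge0 (H1 S SS)) W1.
have T00 : 0 <= (0 : R) <= T by rewrite lexx T0.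
have [L2 L20 [d4 d40 h4]] := WS_lip da (Hs_ge0 (H2 0 T00)) W2.
have [X X1 hX] := @ex_large R [:: (L1, dq); (L2, dq); (1, d1); (1, d2); (1, d3); (1, d4)] ltac:(by rewrite /= dq0 d10 d20 d30 d40).
have := hX X (lexx X); rewrite /= andbT => /and5P[q1 q2 q3 q4 /andP[q5 q6]].
have X0 : 0 < X by exact: lt_le_trans X1.
have dle (c y r : R) : c <= y * X -> 0 <= c -> r <= X^-1 -> c * r <= y.
  by move=> h c0 hr; apply: le_trans (ler_wpM2l c0 hr) _; rewrite ler_pdivrMr.
exists X^-1; first by rewrite invr_gt0.
move=> s t sT tT st x.
have st' (y : R) : 1 <= y * X -> `|s - t| <= y by move=> h; have := dle 1 y _ h ler01 st; rewrite mul1r.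
have [/andP[sge sle] /andP[tge tle]] := (sT, tT).
have [tS|St] := leP t S; have [sS|Ss] := leP s S.
- rewrite !v1S //; apply: le_trans (h1 s t (r1 s sT sS) (r1 t tT tS) (st' _ q3) x) _.
  by rewrite ler_wpM2r // ler_pdivrMr // ler_peMr ?(ltW e0) // ler1n.
- rewrite (v1S _ tS) (vS _ (ltW Ss)).
  have a1 : `|S - t| <= `|s - t| by rewrite !ger0_norm ?subr_ge0 ?(le_trans tS (ltW Ss)) // lerD2r ltW.
  have a2 : `|(s - S) - 0| <= `|s - t| by rewrite subr0 !ger0_norm ?subr_ge0 ?(le_trans tS (ltW Ss)) ?(ltW Ss) // lerD2l lerN2.
  have k1 := h1 S t SS (r1 t tT tS) (le_trans a1 (st' _ q3)) x.
  have k2 := h2 (s - S) 0 (r2 s sT (ltW Ss)) T00 (le_trans a2 (st' _ q4)) x.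
  rewrite subr0 v21 in k2.
  have k3 : `|QQ (v1 S) x - QQ (v1 t) x| <= e / 2.
    apply: hq; [exact: Hs_le (H1 S SS) | exact: Hs_le (H1 t (r1 t tT tS)) |] => y.
    by apply: le_trans (h3 S t SS (r1 t tT tS) (le_trans a1 (st' _ q5)) y) _; apply: dle => //; exact: le_trans st.
  have k4 : `|(s - S) * (QQ (v1 S) x - QQ (v1 t) x)| <= e / 2 * `|s - S| by rewrite normrM mulrC ler_wpM2r.
  have k5 : `|s - S| + `|S - t| = `|s - t| by rewrite !ger0_norm ?subr_ge0 ?(le_trans tS (ltW Ss)) ?(ltW Ss) //; ring.
  have -> : v2 (s - S) x - v1 t x - (s - t) * QQ (v1 t) x = (v2 (s - S) x - v1 S x - (s - S) * QQ (v1 S) x)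
    + (v1 S x - v1 t x - (S - t) * QQ (v1 t) x) + (s - S) * (QQ (v1 S) x - QQ (v1 t) x) by ring.
  apply: le_trans (ler_normD _ _) _; apply: le_trans (lerD (ler_normD _ _) (lexx _)) _.
  have := mulr_ge0 (ltW e0) (normr_ge0 (S - t)); rewrite -k5; move: k1 k2 k4; clra.
- rewrite (v1S _ sS) (vS _ (ltW St)).
  have a1 : `|s - S| <= `|s - t| by rewrite !ler0_norm ?subr_le0 ?(le_trans sS (ltW St)) // lerN2 lerD2l lerN2 ltW.
  have a2 : `|0 - (t - S)| <= `|s - t| by rewrite sub0r opprB !ler0_norm ?subr_le0 ?(le_trans sS (ltW St)) ?(ltW St) // lerN2 lerD2r.
  have k1 := h1 s S (r1 s sT sS) SS (le_trans a1 (st' _ q3)) x.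
  have k2 := h2 0 (t - S) T00 (r2 t tT (ltW St)) (le_trans a2 (st' _ q4)) x.
  have k3 : `|QQ (v2 0) x - QQ (v2 (t - S)) x| <= e / 2.
    apply: hq; [exact: Hs_le (H2 0 T00) | exact: Hs_le (H2 _ (r2 t tT (ltW St))) |] => y.
    by apply: le_trans (h4 0 (t - S) T00 (r2 t tT (ltW St)) (le_trans a2 (st' _ q6)) y) _; apply: dle => //; exact: le_trans st.
  rewrite v21 in k2 k3.
  have k4 : `|(s - S) * (QQ (v1 S) x - QQ (v2 (t - S)) x)| <= e / 2 * `|s - S| by rewrite normrM mulrC ler_wpM2r.
  have k5 : `|s - S| + `|0 - (t - S)| = `|s - t|.
    rewrite sub0r opprB !ler0_norm ?subr_le0 ?(le_trans sS (ltW St)) ?(ltW St) //; ring.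
  have -> : v1 s x - v2 (t - S) x - (s - t) * QQ (v2 (t - S)) x = (v1 s x - v1 S x - (s - S) * QQ (v1 S) x)
    + (v1 S x - v2 (t - S) x - (0 - (t - S)) * QQ (v2 (t - S)) x) + (s - S) * (QQ (v1 S) x - QQ (v2 (t - S)) x) by ring.
  apply: le_trans (ler_normD _ _) _; apply: le_trans (lerD (ler_normD _ _) (lexx _)) _.
  have := mulr_ge0 (ltW e0) (normr_ge0 (0 - (t - S))); rewrite -k5; move: k1 k2 k4; clra.
- rewrite (vS _ (ltW Ss)) (vS _ (ltW St)).
  have E : s - t = (s - S) - (t - S) by ring.
  have := h2 (s - S) (t - S) (r2 s sT (ltW Ss)) (r2 t tT (ltW St)); rewrite -E => /(_ (st' _ q4) x).
  move=> k; apply: le_trans k _; apply: ler_wpM2r => //.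
  by rewrite ler_pdivrMr // ler_peMr ?(ltW e0) // ler1n.
Qed.

(** A lifespan for data of energy [B0], on which the energy stays below 2 B0 + 1. *)
Definition T1 (B0 : R) : R := (B0 + 1) / (@CC a (2 * B0 + 1) + 1).

Lemma T1_ok (B0 : R) : 0 <= B0 -> 0 < T1 B0 /\ B0 + T1 B0 * @CC a (2 * B0 + 1) <= 2 * B0 + 1.
Proof.
move=> B00; have b : 0 <= 2 * B0 + 1 by lra.
have C0 := @CC_ge0 a _ b; have C1 : 0 < @CC a (2 * B0 + 1) + 1 by rewrite ltr_wpDl.
have b1 : 0 < B0 + 1 by rewrite ltr_wpDl.
split; first exact: divr_gt0.
have : T1 B0 * @CC a (2 * B0 + 1) <= B0 + 1.
  by rewrite /T1 mulrAC ler_pdivrMr //; apply: ler_wpM2l; [exact: ltW | rewrite lerDl].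
by clra.
Qed.

(** After the first interval the smoothing estimate bounds the energy at every later time by one
    [B1], because the range never grows. Hence each restart lasts the same time [T1 B1]. *)
Lemma global_WS u0 (B0 m M : R) : 0 < m -> m <= M -> (forall x, m <= u0 x <= M) -> Hs a.+1 u0 B0 ->
  forall T, exists B v, WS a T B v /\ v 0 = u0.
Proof.
move=> m0 mM ur H0.
have B00 := Hs_ge0 H0; have [t10 t1] := T1_ok B00.
have b0 : 0 <= 2 * B0 + 1 by lra.
have [v1 [w1 w2 w3]] := local_existence da m0 mM ur H0 (ltW t10) b0 t1.
have [B1 B10 sm] := WS_smooth da d0 a.+1 m0 mM t10.
have [t20 t2] := T1_ok B10.
have b1 : 0 <= 2 * B1 + 1 by lra.
have main k : exists B v, WS a (T1 B0 + k%:R * T1 B1) B v /\ v 0 = u0.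
  elim: k => [|k [B [v [h1 h2]]]]; first by exists (2 * B0 + 1), v1; rewrite mul0r addr0.
  set S := T1 B0 + _ in h1.
  have S1 : T1 B0 <= S by rewrite lerDl mulr_ge0 // ltW.
  have S0 : 0 <= S := le_trans (ltW t10) S1.
  have SS : 0 <= S <= S by rewrite S0 lexx.
  have HS : Hs a.+1 (v S) B1 by apply: (sm S B v u0 h1 h2 ur); rewrite S1 lexx.
  have rS := WS_range da h1 S0 m0 mM h2 ur SS.
  have [v' [k1 k2 _]] := local_existence da m0 mM rS HS (ltW t20) b1 t2.
  have := WS_concat S0 (ltW t20) h1 k1 k2 => h3.
  eexists; eexists; split.
    rewrite -(natr1 k) mulrDl mul1r addrA; exact: h3.
  by rewrite /= S0.
move=> T; pose k := (Num.truncn (T / T1 B1)).+1.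
have [B [v [h1 h2]]] := main k; exists B, v; split=> //; apply: WS_restrict h1.
have [Tn|T0] := leP T 0.
  by apply: (le_trans Tn); rewrite addr_ge0 ?(ltW t10) // mulr_ge0 // ltW.
have /andP[_ h] := truncn_itv (divr_ge0 (ltW T0) (ltW t20)).
rewrite ltr_pdivrMr // in h; apply: le_trans (ltW h) _; by rewrite lerDr ltW.
Qed.

Definition is_usol u0 (t : R) g := forall e, 0 < e -> exists n0, forall n, (n0 <= n)%N -> forall x, `|evol n u0 (idx n t) x - g x| <= e.

(* The limit of the scheme; the value is the junk constant 0 if there is none. *)
Definition usol u0 (t : R) : V -> R := xget (fun=> 0) [set g | is_usol u0 t g].

Lemma usol_eq u0 t g : is_usol u0 t g -> usol u0 t = g.
Proof.
move=> h; rewrite /usol; case: xgetP => [g' _ h'|/(_ g)//].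
apply/funext => x; apply/eqP; rewrite -subr_eq0 -normr_le0; apply/ler_addgt0Pr => e e0; rewrite add0r.
have [n1 k1] := h _ (divr_gt0 e0 (ltr0n R 2)); have [n2 k2] := h' _ (divr_gt0 e0 (ltr0n R 2)).
have := k1 _ (leq_maxl n1 n2) x; have := k2 _ (leq_maxr n1 n2) x; rewrite !ler_norml; clra.
Qed.

Lemma WS_unique (T B m M : R) (v : R -> V -> R) u0 : WS a T B v -> 0 < m -> m <= M -> v 0 = u0 ->
  (forall x, m <= u0 x <= M) -> forall t, 0 <= t <= T -> v t = usol u0 t.
Proof.
move=> Wv m0 mM v0 ur t tT; apply/esym; apply: usol_eq => e e0.
have T0 : 0 <= T by case/andP: tT; exact: le_trans.
by have [n0 h] := WS_limit da Wv T0 m0 mM v0 ur e0; exists n0 => n nn x; exact: h.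
Qed.

Lemma usol_WS u0 (B0 m M : R) : 0 < m -> m <= M -> (forall x, m <= u0 x <= M) -> Hs a.+1 u0 B0 ->
  usol u0 0 = u0 /\ forall T, exists B, WS a T B (usol u0).
Proof.
move=> m0 mM ur H0; have G := global_WS m0 mM ur H0; split.
  have [B [v [h1 h2]]] := G 0; rewrite -[RHS]h2; apply/esym.
  by apply: (WS_unique h1 m0 mM h2 ur); rewrite lexx.
move=> T; have [B [v [Wv h3]]] := G T; exists B; have [h1 h2] := Wv.
have E t : 0 <= t <= T -> v t = usol u0 t by exact: (WS_unique Wv m0 mM h3 ur).
split=> [t tT|e /h2[dl dl0 h]]; first by rewrite -E //; exact: h1.
by exists dl => // s t sT tT st x; rewrite -!E //; exact: h.
Qed.

Lemma usol_energy u0 (B0 m M : R) : 0 < m -> m <= M -> (forall x, m <= u0 x <= M) -> Hs a.+1 u0 B0 ->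
  exists T1 C : R, [/\ 0 < T1, 0 <= C & forall t, 0 <= t <= T1 -> Hs a.+1 (usol u0 t) (B0 + t * C)].
Proof.
move=> m0 mM ur H0.
have B00 := Hs_ge0 H0; have [t10 t1] := T1_ok B00.
have b0 : 0 <= 2 * B0 + 1 by lra.
have [v1 [w1 w2 w3]] := local_existence da m0 mM ur H0 (ltW t10) b0 t1.
exists (T1 B0), (@CC a (2 * B0 + 1)); split=> //; first exact: CC_ge0.
by move=> t tT; rewrite -(WS_unique w1 m0 mM w2 ur tT); exact: w3.
Qed.

End GlobalSolution.

(** * Sobolev norms in extended reals and bounds on finite sums *)

Section SobolevNorm.
Implicit Types (s : nat).

Lemma esum_le_bx (b : Z -> R) (c : R) : (forall xi, 0 <= b xi) -> (forall P, \sum_(xi <- bx P) b xi <= c) ->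
  (\esum_(xi in [set: Z]) (b xi)%:E <= c%:E)%E.
Proof.
move=> b0 hb; apply: ge_ereal_sup => _ [A [finA _] <-].
rewrite fsbig_finite // sumEFin lee_fin.
have [j hj] := mem_Bx_ex (finmap.enum_fset (fset_set A)).
by apply: le_trans (hb (2 ^ j)%N); apply: ler_sum_sub; rewrite ?bx_uniq ?finmap.fset_uniq.
Qed.

Lemma esum_ge_bx (b : Z -> R) P : (forall xi, 0 <= b xi) -> ((\sum_(xi <- bx P) b xi)%:E <= \esum_(xi in [set: Z]) (b xi)%:E)%E.
Proof.
move=> b0; apply: ereal_sup_ubound; exists [set` bx P]; first by split=> //; exact: finite_seq.
by rewrite -fsbig_seq ?bx_uniq // sumEFin.
Qed.

Lemma sobolev_norm_le s f (e : R) : 0 <= e -> (forall P, En s f P <= e ^+ 2) -> (sobolev_norm s f <= e%:E)%E.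
Proof.
move=> e0 hE.
have t0 xi : 0 <= (1 + enorm (freq xi : V) ^+ 2) ^+ s * normc (fourier f xi) ^+ 2.
  by rewrite mulr_ge0 ?sqr_ge0 // exprn_ge0 // addr_ge0 // sqr_ge0.
have h := esum_le_bx t0 hE.
have -> : e%:E = ((e ^+ 2)%:E `^ 2^-1)%E by rewrite poweR_EFin powR12_sqrt ?sqr_ge0 // sqrtr_sqr ger0_norm.
rewrite /sobolev_norm; apply: gt0_ler_poweR => //; rewrite in_itv /= leey andbT.
  by apply: esum_ge0 => xi _; rewrite lee_fin.
by rewrite lee_fin sqr_ge0.
Qed.

Lemma sobolev_norm_En s f (e : R) P : (sobolev_norm s f <= e%:E)%E -> En s f P <= e ^+ 2.
Proof.
move=> h.
have t0 xi : 0 <= (1 + enorm (freq xi : V) ^+ 2) ^+ s * normc (fourier f xi) ^+ 2.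
  by rewrite mulr_ge0 ?sqr_ge0 // exprn_ge0 // addr_ge0 // sqr_ge0.
have h1 := esum_ge_bx P t0; move: h h1; rewrite /sobolev_norm.
case: (esum _ _) => [r| |].
- rewrite poweR_EFin !lee_fin => h h1.
  have E0 : 0 <= En s f P by exact: En_ge0.
  have r0 : 0 <= r by exact: le_trans h1.
  rewrite powR12_sqrt // in h; apply: le_trans h1 _; rewrite -(sqr_sqrtr r0); apply: lerXn2r => //.
    by rewrite nnegrE sqrtr_ge0.
  by rewrite nnegrE; apply: le_trans h; exact: sqrtr_ge0.
- by rewrite poweRyr // leye_eq.
- by rewrite leeNy_eq.
Qed.

Lemma sobolev_Hs s f : sobolev s f -> exists B, Hs s f B.
Proof.
move=> [cf pf]; case E: (sobolev_norm s f) => [r| |] // _; last first.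
  by have := poweR_ge0 (\esum_(xi in [set: Z])
     ((1 + enorm (freq xi : V) ^+ 2) ^+ s * normc (fourier f xi) ^+ 2)%:E) 2^-1; move: E; rewrite /sobolev_norm => ->.
by exists (r ^+ 2); split=> // P; apply: sobolev_norm_En; rewrite E.
Qed.

Lemma Hs_sobolev s f (B : R) : Hs s f B -> sobolev s f.
Proof.
move=> Hf; have B0 := Hs_ge0 Hf; have [[cf pf] hE] := Hf; split=> //.
apply: (@le_lt_trans _ _ (Num.sqrt B)%:E); last exact: ltry.
by apply: sobolev_norm_le; [exact: sqrtr_ge0 | move=> P; rewrite sqr_sqrtr].
Qed.

Lemma cvg_ereal0 (T : Type) (F : set_system T) (g : T -> \bar R) : Filter F ->
  (forall e : R, 0 < e -> F [set t | (0 <= g t <= e%:E)%E]) -> g @ F --> 0%E.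
Proof.
move=> FF H; apply/fine_cvgP; split.
  apply: filterS (H 1 ltr01) => t /= /andP[h1 h2]; rewrite ge0_fin_numE //; exact: le_lt_trans h2 (ltry _).
apply/cvgrPdist_le => e e0; apply: filterS (H e e0) => t /= /andP[h1 h2].
have fg : g t \is a fin_num by rewrite ge0_fin_numE //; exact: le_lt_trans h2 (ltry _).
by rewrite sub0r normrN ger0_norm ?fine_ge0 // -lee_fin fineK.
Qed.

Lemma cvg_ereal0E (T : Type) (F : set_system T) (g : T -> \bar R) (e : R) : Filter F ->
  g @ F --> 0%E -> 0 < e -> F [set t | (g t <= e%:E)%E].
Proof.
move=> FF /fine_cvgP[h1 /cvgrPdist_le h2] e0; apply: filterS (filterI h1 (h2 e e0)) => t /= [k1].
by rewrite sub0r normrN => k2; rewrite -(fineK k1) lee_fin; exact: le_trans (ler_norm _) k2.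
Qed.

Lemma sobolev_norm_ge0 s f : (0 <= sobolev_norm s f)%E.
Proof. exact: poweR_ge0. Qed.

(** Uniform closeness handles the frequencies in the box, the two tails the rest; 5 = 1 + 2 + 2. *)
Lemma tail_diff s P (e1 eta : R) f g : cp f -> cp g ->
  (forall P', \sum_(xi <- bx P' | xi \notin bx P) jw xi ^+ s * normc (ft f xi) ^+ 2 <= e1) ->
  (forall P', \sum_(xi <- bx P' | xi \notin bx P) jw xi ^+ s * normc (ft g xi) ^+ 2 <= e1) ->
  (forall x, `|f x - g x| <= eta) -> eta ^+ 2 * \sum_(xi <- bx P) jw xi ^+ s <= e1 ->
  forall P', En s (fun x => f x - g x) P' <= 5 * e1.
Proof.
move=> cf cg tf tg fg J P'.
have w0 xi : 0 <= jw xi ^+ s by rewrite jwX_ge0.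
rewrite /En (bigID (fun xi => xi \in bx P)) /=.
have h1 : \sum_(xi <- bx P' | xi \in bx P) jw xi ^+ s * normc (ft (fun x => f x - g x) xi) ^+ 2 <= e1.
  apply: le_trans J; rewrite mulr_sumr.
  apply: (@le_trans _ _ (\sum_(xi <- bx P' | xi \in bx P) eta ^+ 2 * jw xi ^+ s)).
    apply: ler_sum => xi _; rewrite mulrC ler_wpM2r //; apply: lerXn2r; rewrite ?nnegrE ?normc_ge0 //.
      exact: le_trans (fg 0).
    by apply: ft_norm => //; apply: contB; [exact: cf.1 | exact: cg.1].
  rewrite -big_filter; apply: ler_sum_sub; rewrite ?filter_uniq ?bx_uniq //.
    by move=> xi; rewrite mem_filter => /andP[].
  by move=> xi; rewrite mulr_ge0 ?sqr_ge0.
have h2 : \sum_(xi <- bx P' | xi \notin bx P) jw xi ^+ s * normc (ft (fun x => f x - g x) xi) ^+ 2 <= 2 * e1 + 2 * e1.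
  apply: le_trans (lerD (ler_wpM2l (ler0n R 2) (tf P')) (ler_wpM2l (ler0n R 2) (tg P'))).
  rewrite !mulr_sumr -big_split; apply: ler_sum => xi _.
  rewrite ftB; [|exact: cf.1|exact: cg.1].
  have : normc (ft f xi - ft g xi) ^+ 2 <= 2 * normc (ft f xi) ^+ 2 + 2 * normc (ft g xi) ^+ 2.
    move: (ft f xi) (ft g xi) => A D; rewrite !normcE; case: A D => [x y] [z t] /=.
    by have := sqr_ge0 (x + z); have := sqr_ge0 (y + t); clra.
  move=> /(ler_wpM2l (w0 xi)) h; apply: le_trans h _; rewrite mulrDr; apply: lerD; by rewrite mulrCA.
by move: h1 h2; clra.
Qed.

Lemma sqr_lower (A D eta M : R) : 0 <= A -> 0 <= D -> 0 <= eta -> A <= D + eta -> A <= M -> A ^+ 2 - 2 * M * eta <= D ^+ 2.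
Proof. by move=> A0 D0 e0 k1 k2; have [AD|DA] := leP A D; nra. Qed.

Lemma tail_higher s P P' f (B : R) : (0 < P)%N -> Hs s.+1 f B ->
  \sum_(xi <- bx P' | xi \notin bx P) jw xi ^+ s * normc (ft f xi) ^+ 2 <= B / P%:R.
Proof.
move=> P0 Hf; have PR : 0 < P%:R :> R by rewrite ltr0n.
rewrite ler_pdivlMr // mulr_suml.
apply: le_trans (_ : \sum_(xi <- bx P' | xi \notin bx P) jw xi ^+ s.+1 * normc (ft f xi) ^+ 2 <= _).
  apply: ler_sum => xi xP; rewrite mulrAC; apply: ler_wpM2r; first exact: sqr_ge0.
  rewrite exprSr; apply: ler_wpM2l; first by rewrite jwX_ge0.
  have [i hi] : exists i, (P < absz (xi 0%R i))%N.
    apply: contrapT => H; move/negP: xP; apply; rewrite mem_bx; apply/forallP => i.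
    by rewrite leqNgt; apply/negP => h; apply: H; exists i.
  have h1 := normr_le_enorm (freq xi : V) i; rewrite mxE -intr_norm -natr_absz in h1.
  have h2 : P%:R <= (absz (xi 0%R i))%:R :> R by rewrite ler_nat ltnW.
  have h3 : P%:R <= nz xi by exact: le_trans h1.
  have P1 : 1 <= P%:R :> R by rewrite ler1n.
  have n1 : 1 <= nz xi := le_trans P1 h3.
  have : P%:R <= nz xi ^+ 2 by rewrite expr2; apply: (le_trans h3); apply: ler_peMl => //; exact: nz_ge0.
  by rewrite -[jw xi]/(1 + nz xi ^+ 2); lra.
exact: (En_sub _ Hf (bx_uniq _)).
Qed.

End SobolevNorm.

(** * Continuity in time with values in the Sobolev space *)

Section SolutionContinuity.
Variable a : nat.
Hypothesis da : (d < 2 * a)%N.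
Hypothesis d0 : (0 < d)%N.
Variables (u0 : V -> R) (B0 m M : R).
Hypotheses (m0 : 0 < m) (mM : m <= M) (ur : forall x, m <= u0 x <= M) (H0 : Hs a.+1 u0 B0).
Local Notation u := (usol u0).

Lemma usol_lip (T : R) : exists2 L : R, 0 <= L & exists2 dl : R, 0 < dl &
  forall s t, 0 <= s <= T -> 0 <= t <= T -> `|s - t| <= dl -> forall x, `|u s x - u t x| <= L * `|s - t|.
Proof.
have [_ G] := usol_WS da d0 m0 mM ur H0; have [B W] := G (Num.max T 0).
have TT : 0 <= Num.max T 0 by rewrite le_max lexx orbT.
have B1 : 0 <= B by have [h _] := W; apply: Hs_ge0 (h 0 _); rewrite lexx.
have [L L0 [dl dl0 h]] := WS_lip da B1 W; exists L => //; exists dl => // s t sT tT.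
by apply: h; rewrite le_max; [case/andP: sT => -> -> | case/andP: tT => -> ->].
Qed.

Lemma usol_smooth (r : nat) (t0 : R) : 0 < t0 -> exists2 B : R, 0 <= B & forall t, t0 <= t -> Hs r (u t) B.
Proof.
move=> t00; have [B B1 h] := WS_smooth da d0 r m0 mM t00; exists B => // t tt.
have [u00 G] := usol_WS da d0 m0 mM ur H0; have [B' W] := G t.
by apply: (h t B' u u0 W u00 ur); rewrite tt lexx.
Qed.

(** Uniform convergence controls low frequencies. High ones are controlled by smoothing when t > 0;
    at t = 0 no extra derivative is available, and the energy bound, started from the exact norm of
    the datum, prevents energy from appearing in the tail. *)
Lemma usol_continuous (t e : R) : 0 <= t -> 0 < e -> exists2 dl : R, 0 < dl &
  forall s, 0 <= s -> `|s - t| <= dl -> forall P, En a.+1 (fun x => u s x - u t x) P <= e.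
Proof.
move=> tge e0.
have cpu s : 0 <= s -> cp (u s).
  move=> s0; have [_ G] := usol_WS da d0 m0 mM ur H0; have [B [h _]] := G s.
  by have [] := h s ltac:(by rewrite s0 lexx).
have [L L0 [dl dl0 hL]] := usol_lip (t + 1).
have e5 : 0 < e / 5 by exact: divr_gt0.
have nearP P : exists2 eta : R, 0 < eta & exists2 dl' : R, 0 < dl' & [/\ dl' <= 1,
    eta * (1 + \sum_(xi <- bx P) jw xi ^+ a.+1) <= e / 5 / (6 * (M + 1)),
    eta ^+ 2 * \sum_(xi <- bx P) jw xi ^+ a.+1 <= e / 5 & 
    forall s, 0 <= s -> `|s - t| <= dl' -> forall x, `|u s x - u t x| <= eta].
  have M0 : 0 < M by exact: lt_le_trans mM.
  set J := \sum_(xi <- bx P) _.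
  have J0 : 0 <= J by apply: sumr_ge0 => xi _; rewrite jwX_ge0.
  have M6 : 0 < 6 * (M + 1) by rewrite mulr_gt0 // ltr_wpDl // ltW.
  have [eta eta0 /=] := @ex_small R [:: (1, 1); (1 + J, e / 5 / (6 * (M + 1))); (J, e / 5)] ltac:(by rewrite /= ltr01 !divr_gt0).
  rewrite andbT mul1r => /and3P[q1 q2 q3].
  have [dl' dl'0 /=] := @ex_small R [:: (1, 1); (1, dl); (L, eta)] ltac:(by rewrite /= ltr01 dl0 eta0).
  rewrite andbT !mul1r => /and3P[r1 r2 r3].
  exists eta => //; exists dl' => //; split=> //; first by rewrite mulrC.
    by rewrite mulrC; apply: le_trans q3; rewrite expr2 mulrA ler_piMr // mulr_ge0 // ltW.
  move=> s s0 st x; apply: le_trans (hL s t _ _ (le_trans st r2) x) _.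
  - by rewrite s0 /=; have := le_trans (ler_norm _) (le_trans st r1); lra.
  - by rewrite tge /= lerDl.
  - by apply: le_trans r3; rewrite ler_wpM2l.
have [tpos|t_le0] := ltP 0 t.
  have [Br Br0 hBr] := usol_smooth a.+2 (divr_gt0 tpos (ltr0n R 2)).
  have [n0 hn0] := @ex_large_nat R [:: (Br, e / 5)] ltac:(by rewrite /= e5).
  have /= := hn0 n0.+1 (leqnSn _); rewrite andbT => -[_ q1].
  have [eta eta0 [dl' dl'0 [r1 r2 r3 r4]]] := nearP n0.+1.
  exists (Num.min dl' (t / 2)); first by rewrite lt_min dl'0 divr_gt0.
  move=> s s0; rewrite le_min => /andP[st1 st2] P; rewrite (_ : e = 5 * (e / 5)); last by field.
  have b5 : Br / n0.+1%:R <= e / 5 by rewrite ler_pdivrMr.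
  apply: (@tail_diff a.+1 n0.+1 (e / 5) eta (u s) (u t)) => //.
  - exact: cpu.
  - exact: cpu.
  - move=> P'; apply: le_trans b5; apply: tail_higher => //; apply: hBr.
    by move: st2; rewrite ler_norml; lra.
  - by move=> P'; apply: le_trans b5; apply: tail_higher => //; apply: hBr; move: tpos; lra.
  - exact: r4.
have t_0 : t = 0 by apply/eqP; rewrite eq_le t_le0.
have [u00 _] := usol_WS da d0 m0 mM ur H0.
(* The supremum is the squared norm of [u0]. A box is chosen that carries almost all of it, so the
   tail of [u s] has at most the excess of its energy over that amount. *)
pose S := [set En a.+1 u0 P | P in [set: nat]].
have hS : has_sup S by split; [exists (En a.+1 u0 0), 0%N | exists B0 => _ [P _ <-]; exact: H0.2].
have Bs : Hs a.+1 u0 (sup S) by split; [exact: H0.1 | move=> P; apply: sup_upper_bound => //; exists P].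
have [_ [P _ <-] hP] := sup_adherent (divr_gt0 e5 (ltr0n R 3)) hS.
have [T1 [C [T10 C0 hC]]] := usol_energy da m0 mM ur Bs.
have [eta eta0 [dl' dl'0 [r1 r2 r3 r4]]] := nearP P.
have [dl3 dl30 /=] := @ex_small R [:: (1, dl'); (1, T1); (C, e / 5 / 3)] ltac:(by rewrite /= dl'0 T10 !divr_gt0).
rewrite andbT !mul1r => /and3P[q1 q2 q3].
exists dl3 => // s s0 st P'; rewrite (_ : e = 5 * (e / 5)); last by field.
have sdl : s <= dl3 by move: st; rewrite t_0 subr0 ger0_norm.
apply: (@tail_diff a.+1 P (e / 5) eta (u s) (u t)) => //.
- exact: cpu.
- exact: cpu.
- move=> P2; have Hs' := hC s ltac:(by rewrite s0; exact: le_trans q2).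
  have h1 : \sum_(xi <- bx P) jw xi ^+ a.+1 * normc (ft (u s) xi) ^+ 2 + \sum_(xi <- bx P2 | xi \notin bx P) jw xi ^+ a.+1 * normc (ft (u s) xi) ^+ 2 <= sup S + s * C.
    rewrite -[X in _ + X]big_filter -big_cat; apply: (En_sub xpredT Hs').
    rewrite cat_uniq bx_uniq filter_uniq ?bx_uniq // andbT /=; apply/hasPn => xi; rewrite mem_filter; by case/andP.
  have h2 : En a.+1 u0 P - e / 5 / 3 <= \sum_(xi <- bx P) jw xi ^+ a.+1 * normc (ft (u s) xi) ^+ 2.
    set J := \sum_(xi <- bx P) jw xi ^+ a.+1 in r2 r3.
    have M0 : 0 < M by exact: lt_le_trans mM.
    apply: (@le_trans _ _ (En a.+1 u0 P - \sum_(xi <- bx P) 2 * M * eta * jw xi ^+ a.+1)).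
      rewrite lerD2l lerN2 -mulr_sumr -/J.
      have : eta * (1 + J) * (6 * (M + 1)) <= e / 5 by rewrite -ler_pdivlMr // mulr_gt0 // ltr_wpDl // ltW.
      have J0 : 0 <= J by apply: sumr_ge0 => xi _; rewrite jwX_ge0.
      have := mulr_ge0 (mulr_ge0 (ltW eta0) J0) (ltW M0); have := mulr_ge0 (ltW eta0) J0; have := mulr_ge0 (ltW eta0) (ltW M0).
      by move: eta0; lra.
    rewrite /En -sumrB; apply: ler_sum => xi _; rewrite [X in _ - X]mulrC -mulrBr; apply: ler_wpM2l.
      by rewrite jwX_ge0.
    have k1 : normc (ft u0 xi) <= normc (ft (u s) xi) + eta.
      apply: le_trans (normc_triangle _ (ft (u s) xi)) _; rewrite lerD2l normcB.
      have c1 := (cpu s s0).1; have c2 := H0.1.1.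
      rewrite -ftB //; apply: ft_norm; first exact: contB.
      by move=> x; have := r4 s s0 (le_trans st q1) x; rewrite t_0 u00.
    have k2 : normc (ft u0 xi) <= M.
      apply: ft_norm; first exact: H0.1.1.
      by move=> x; have /andP[w1 w2] := ur x; rewrite ger0_norm //; exact: le_trans (ltW m0) w1.
    exact: (sqr_lower (normc_ge0 _) (normc_ge0 _) (ltW eta0) k1 k2).
  have h3 : s * C <= e / 5 / 3 by apply: le_trans q3; rewrite mulrC ler_wpM2l.
  by move: h1 h2 h3 hP; lra.
- move=> P2; rewrite t_0 u00.
  have h1 : \sum_(xi <- bx P) jw xi ^+ a.+1 * normc (ft u0 xi) ^+ 2 + \sum_(xi <- bx P2 | xi \notin bx P) jw xi ^+ a.+1 * normc (ft u0 xi) ^+ 2 <= sup S.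
    rewrite -[X in _ + X]big_filter -big_cat; apply: (En_sub xpredT Bs).
    rewrite cat_uniq bx_uniq filter_uniq ?bx_uniq // andbT /=; apply/hasPn => xi; rewrite mem_filter; by case/andP.
  by move: h1 hP e5; rewrite /En; lra.
- by apply: r4 => //; exact: le_trans q1.
Qed.

End SolutionContinuity.

(** * Mean value inequalities for pointwise derivatives *)

Section MeanValue.
(** Real induction: the supremum of the points where [A] holds can always be passed, unless it is
    [q]. It replaces a compactness argument on the interval. *)
Lemma creeping (p q : R) (A : R -> Prop) : p <= q -> A p ->
  (forall c, p <= c <= q -> exists2 dl : R, 0 < dl & forall s s', p <= s <= c -> c <= s' <= q -> c - dl <= s -> s' <= c + dl -> A s -> A s') ->
  A q.
Proof.
move=> pq Ap step; pose S := [set s | p <= s <= q /\ A s].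
have Sp : S p by split; rewrite ?lexx.
have hS : has_sup S by split; [exists p | exists q => s [/andP[]]].
have c1 : p <= sup S by exact: (ub_le_sup hS.2 Sp).
have c2 : sup S <= q by apply: ge_sup; [exact: hS.1 | move=> s [/andP[]]].
have [|dl dl0 h] := step (sup S); first by rewrite c1.
have [s [/andP[s1 s2] As] s3] := sup_adherent dl0 hS.
have sc : s <= sup S by apply: (ub_le_sup hS.2); split; rewrite ?s1.
pose s' := Num.min q (sup S + dl).
have k1 : sup S <= s' by rewrite /s' le_min c2 lerDl ltW.
have k2 : s' <= q by rewrite /s' ge_min lexx.
have As' : A s'.
  apply: (h s s') => //; [by rewrite s1 | by rewrite k1 | exact: ltW | by rewrite /s' ge_min lexx orbT].
have : s' <= sup S by apply: (ub_le_sup hS.2); split=> //; rewrite k2 andbT; exact: le_trans k1.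
rewrite /s' ge_min => /orP[qc|]; last by rewrite gerDl leNgt dl0.
suff <- : s' = q by [].
by apply/eqP; rewrite eq_le k2 /=; exact: le_trans k1.
Qed.

(** The derivative is given only point by point, relative to the interval and with no continuity. A
    slack [e] in the slope lets the inequality creep past each point and is removed at the end. *)
Lemma mean_value_pointwise (phi g : R -> R) (p q G K : R) : p <= q ->
  (forall c e, p <= c <= q -> 0 < e -> exists2 dl : R, 0 < dl & forall r, p <= r <= q -> `|r - c| <= dl ->
     `|phi r - phi c - (r - c) * g c| <= e * `|r - c|) ->
  (forall r, p <= r <= q -> `|g r - G| <= K) -> `|phi q - phi p - (q - p) * G| <= K * (q - p).
Proof.
move=> pq dphi gK; apply/ler_addgt0Pr => eta eta0.
have Q0 : 0 < q - p + 1 by rewrite ltr_wpDl // subr_ge0.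
have e0 : 0 < eta / (q - p + 1) by rewrite divr_gt0.
set e := eta / (q - p + 1) in e0.
suff h : `|phi q - phi p - (q - p) * G| <= (K + e) * (q - p).
  apply: le_trans h _; rewrite mulrDl lerD2l /e mulrAC ler_pdivrMr // ler_wpM2l ?(ltW eta0) // lerDl //.
apply: (@creeping p q (fun s => `|phi s - phi p - (s - p) * G| <= (K + e) * (s - p))) => //.
  by rewrite !subrr mul0r subr0 normr0 mulr0.
move=> c cpq; have [dl dl0 h] := dphi c e cpq e0; exists dl => // s s' /andP[s1 s2] /andP[s3 s4] s5 s6 IH.
have /andP[c1 c2] := cpq.
have k1 := h s; rewrite s1 (le_trans s2 c2) in k1.
have {}k1 := k1 isT ltac:(by rewrite ler0_norm ?subr_le0 //; move: s5; clra).
have k2 := h s'; rewrite s4 (le_trans c1 s3) in k2.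
have {}k2 := k2 isT ltac:(by rewrite ger0_norm ?subr_ge0 //; move: s6; clra).
rewrite (ler0_norm (_ : s - c <= 0)) ?subr_le0 // in k1; rewrite (ger0_norm (_ : 0 <= s' - c)) ?subr_ge0 // in k2.
have k3 : `|(s' - s) * (g c - G)| <= (s' - s) * K.
  have ss : 0 <= s' - s by rewrite subr_ge0; exact: le_trans s3.
  by rewrite normrM (ger0_norm ss) ler_wpM2l // gK.
by move: IH k1 k2 k3; rewrite !ler_norml; clra.
Qed.

Lemma mean_value (phi g : R -> R) (lo hi s t G K : R) : lo <= s <= hi -> lo <= t <= hi ->
  (forall c e, lo <= c <= hi -> 0 < e -> exists2 dl : R, 0 < dl & forall r, lo <= r <= hi -> `|r - c| <= dl ->
     `|phi r - phi c - (r - c) * g c| <= e * `|r - c|) ->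
  (forall r, `|r - t| <= `|s - t| -> lo <= r <= hi -> `|g r - G| <= K) ->
  `|phi s - phi t - (s - t) * G| <= K * `|s - t|.
Proof.
move=> /andP[s0 s1] /andP[t0 t1] dphi gK.
have loc (p q : R) : lo <= p -> q <= hi -> forall c e, p <= c <= q -> 0 < e -> exists2 dl : R, 0 < dl & forall r, p <= r <= q ->
    `|r - c| <= dl -> `|phi r - phi c - (r - c) * g c| <= e * `|r - c|.
  move=> lp qh c e /andP[c1 c2] /(dphi c) [|dl dl0 h]; first by rewrite (le_trans lp c1) (le_trans c2 qh).
  by exists dl => // r /andP[r1 r2]; apply: h; rewrite (le_trans lp r1) (le_trans r2 qh).
have [ts|/ltW st] := leP t s.
  rewrite (ger0_norm (_ : 0 <= s - t)) ?subr_ge0 //; apply: mean_value_pointwise ts (loc _ _ t0 s1) _.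
  move=> r /andP[r1 r2]; apply: gK; last by rewrite (le_trans t0 r1) (le_trans r2 s1).
  by rewrite !ger0_norm ?subr_ge0 ?(le_trans r1 r2) // lerD2r.
rewrite (ler0_norm (_ : s - t <= 0)) ?subr_le0 // opprB.
have -> : phi s - phi t - (s - t) * G = - (phi t - phi s - (t - s) * G) by ring.
rewrite normrN; apply: mean_value_pointwise st (loc _ _ s0 t1) _.
move=> r /andP[r1 r2]; apply: gK; last by rewrite (le_trans s0 r1) (le_trans r2 t1).
by rewrite !ler0_norm ?subr_le0 ?(le_trans r1 r2) // lerN2 lerD2r.
Qed.

End MeanValue.

(** * The nonlinear term between Sobolev spaces *)

Section QuadraticTerm.
Implicit Types (s : nat).

Lemma Hs_sum2 s f g e (A B : R) : Hs s f A -> Hs s g B -> cp e ->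
  (forall xi, normc (ft e xi) ^+ 2 <= 2 * normc (ft f xi) ^+ 2 + 2 * normc (ft g xi) ^+ 2) -> Hs s e (2 * A + 2 * B).
Proof.
move=> [_ hf] [_ hg] ce he; split=> // P.
apply: le_trans (lerD (ler_wpM2l (ler0n R 2) (hf P)) (ler_wpM2l (ler0n R 2) (hg P))).
rewrite /En !mulr_sumr -big_split; apply: ler_sum => xi _.
have w0 : 0 <= jw xi ^+ s by rewrite jwX_ge0.
by have := ler_wpM2l w0 (he xi) => h; apply: le_trans h _; rewrite mulrDr; apply: lerD; rewrite mulrCA.
Qed.

Lemma Hs_sub s f g (A B : R) : Hs s f A -> Hs s g B -> Hs s (fun x => f x - g x) (2 * A + 2 * B).
Proof.
move=> Hf Hg; have cf := Hf.1.1; have cg := Hg.1.1; apply: (Hs_sum2 Hf Hg (cpB Hf.1 Hg.1)) => xi.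
rewrite ftB //; move: (ft f xi) (ft g xi) => C D.
rewrite !normcE; case: C D => [x y] [z t] /=.
by have := sqr_ge0 (x + z); have := sqr_ge0 (y + t); clra.
Qed.

Lemma Hs_add s f g (A B : R) : Hs s f A -> Hs s g B -> Hs s (fun x => f x + g x) (2 * A + 2 * B).
Proof.
move=> Hf Hg; have cf := Hf.1.1; have cg := Hg.1.1; apply: (Hs_sum2 Hf Hg (cpD Hf.1 Hg.1)) => xi.
rewrite ftD //; move: (ft f xi) (ft g xi) => C D.
rewrite !normcE; case: C D => [x y] [z t] /=.
by have := sqr_ge0 (x - z); have := sqr_ge0 (y - t); clra.
Qed.

Lemma is_absnB f g f' g' : cp f -> cp g -> is_absn f f' -> is_absn g g' -> is_absn (fun x => f x - g x) (fun x => f' x - g' x).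
Proof.
move=> cf cg [cf' hf] [cg' hg]; split; first exact: cpB.
move=> xi; rewrite ftB ?hf ?hg; [|exact: cf'.1|exact: cg'.1].
by rewrite /mlt ftB ?mulrBr //; [exact: cf.1|exact: cg.1].
Qed.

Lemma Hs_is_absn s f g (B : R) : Hs s.+1 f B -> is_absn f g -> Hs s g B.
Proof.
move=> [cf hE] [cg hg]; split=> // P; apply: le_trans (hE P); apply: ler_sum => xi _.
rewrite hg normc_mlt ?nz_ge0 // exprMn mulrA; apply: ler_wpM2r; first exact: sqr_ge0.
rewrite (exprSr (jw xi)); apply: ler_wpM2l; last by rewrite lerDr.
by rewrite jwX_ge0.
Qed.

Variable a : nat.
Hypothesis da : (d < 2 * a)%N.

Lemma Hs_absn f (B : R) : Hs a.+1 f B -> is_absn f (absn f) /\ Hs a (absn f) B.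
Proof. by move=> Hf; have [h _] := absn_spec da Hf; split=> //; exact: Hs_is_absn Hf h. Qed.

Definition QB (B : R) : R := 2 * (Cp a * B * B) + 2 * (Cp a.+1 * B * B).

Lemma Hs_QQB f (B : R) : Hs a.+1 f B -> Hs a (QQ f) (QB B).
Proof.
move=> Hf; have [h1 h2] := Hs_absn Hf; have [h3 h4] := Hs_absn (Hs_sq da Hf).
by apply: Hs_sub h4; exact: (Hs_mul da (Hs_asum da Hf) (Hs_down Hf) h2).
Qed.

Lemma Hs_QQ f (B : R) : Hs a.+1 f B -> exists B', Hs a (QQ f) B'.
Proof. by move=> /Hs_QQB h; exists (QB B). Qed.

Definition KQ (B : R) : R := 8 * Cp a * B + 8 * Cp a.+1 * B.

Lemma KQ_ge0 (B : R) : 0 <= B -> 0 <= KQ B.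
Proof. by move=> B0; rewrite addr_ge0 // mulr_ge0 // mulr_ge0 // ltW // Cp_gt0. Qed.

(** With e = f - g, the difference is e |nabla| f + g |nabla| e - |nabla| (e (f + g)). Each term is
    linear in [e], and only one derivative is lost. *)
Lemma QQ_diff f g (B E : R) : Hs a.+1 f B -> Hs a.+1 g B -> Hs a.+1 (fun x => f x - g x) E ->
  Hs a (fun x => QQ f x - QQ g x) (KQ B * E).
Proof.
move=> Hf Hg He; have [f1 f2] := Hs_absn Hf; have [g1 g2] := Hs_absn Hg.
have [F1 F2] := Hs_absn (Hs_sq da Hf); have [G1 G2] := Hs_absn (Hs_sq da Hg).
have p1 := Hs_mul da (Hs_asum da He) (Hs_down He) f2.
have p2 := Hs_mul da (Hs_asum da Hg) (Hs_down Hg) (Hs_is_absn He (is_absnB Hf.1 Hg.1 f1 g1)).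
have p3 := Hs_mul (da1 da) (Hs_asum da He) He (Hs_add Hf Hg).
have p4 : is_absn (fun x => (f x - g x) * (f x + g x)) (fun x => absn (sq f) x - absn (sq g) x).
  rewrite (_ : (fun x => (f x - g x) * (f x + g x)) = (fun x => sq f x - sq g x)).
    by apply: is_absnB => //; apply: cpM; [exact: Hf.1|exact: Hf.1|exact: Hg.1|exact: Hg.1].
  by apply/funext => x; rewrite /sq; ring.
have p5 := Hs_is_absn p3 p4.
have := Hs_sub (Hs_add p1 p2) p5.
rewrite (_ : (fun x => _ - _) = (fun x => QQ f x - QQ g x)); last by apply/funext => x; rewrite /QQ; ring.
by apply: Hs_le; rewrite le_eqVlt; apply/orP; left; apply/eqP; rewrite /KQ; ring.
Qed.

End QuadraticTerm.

(** * Truncated Sobolev pairings *)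

Section Pairing.

(** The H^s inner product with fixed coefficients [w], cut to a box: a real functional through which
    the scalar mean value inequality is applied to Sobolev-valued functions. *)
Definition lf s P (w : Z -> R[i]) f : R := \sum_(xi <- bx P) jw xi ^+ s * ip (w xi) (ft f xi).

Lemma lfD s P w f g : continuous f -> continuous g -> lf s P w (fun x => f x + g x) = lf s P w f + lf s P w g.
Proof. by move=> cf cg; rewrite /lf -big_split; apply: eq_bigr => xi _; rewrite ftD // ipDr mulrDr. Qed.

Lemma lfZ s P w (c : R) f : continuous f -> lf s P w (fun x => c * f x) = c * lf s P w f.
Proof. by move=> cf; rewrite /lf mulr_sumr; apply: eq_bigr => xi _; rewrite ftZ // (ipZr _ c) mulrCA. Qed.

Lemma lfB s P w f g : continuous f -> continuous g -> lf s P w (fun x => f x - g x) = lf s P w f - lf s P w g.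
Proof.
move=> cf cg; have := @lfD s P w f (fun x => (-1) * g x) cf (contZl cg); rewrite lfZ // mulN1r => <-.
by congr lf; apply/funext => x; rewrite mulN1r.
Qed.

Lemma lf_norm s P w f (e : R) : continuous f -> (forall x, `|f x| <= e) -> `|lf s P w f| <= (\sum_(xi <- bx P) jw xi ^+ s * normc (w xi)) * e.
Proof.
move=> cf fe; apply: le_trans (ler_norm_sum _ _ _) _; rewrite mulr_suml; apply: ler_sum => xi _.
have w0 : 0 <= jw xi ^+ s by rewrite jwX_ge0.
rewrite normrM (ger0_norm w0) -mulrA; apply: ler_wpM2l => //; apply: le_trans (ip_le _ _) _.
by apply: ler_wpM2l; [exact: normc_ge0 | exact: ft_norm].
Qed.

Lemma lf_sqr s P w f : lf s P w f ^+ 2 <= (\sum_(xi <- bx P) jw xi ^+ s * normc (w xi) ^+ 2) * En s f P.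
Proof.
have w0 xi : 0 <= jw xi ^+ s by rewrite jwX_ge0.
have n0 xi : 0 <= jn xi ^+ s by rewrite exprn_ge0 // jn_ge0.
have E (c : Z -> R) : \sum_(xi <- bx P) jw xi ^+ s * c xi ^+ 2 = \sum_(xi <- bx P) (jn xi ^+ s * c xi) ^+ 2.
  by apply: eq_bigr => xi _; rewrite exprMn -exprM mulnC exprM jn_sqr.
rewrite /En E (E (fun xi => normc (ft f xi))); apply: le_trans (cauchy_schwarz _ _ _ _).
rewrite -[leLHS]real_normK ?num_real //; apply: lerXn2r; rewrite ?nnegrE ?normr_ge0 //.
  by apply: sumr_ge0 => xi _; apply: mulr_ge0; apply: mulr_ge0; rewrite ?normc_ge0.
apply: le_trans (ler_norm_sum _ _ _) _; apply: ler_sum => xi _.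
rewrite normrM (ger0_norm (w0 xi)); apply: le_trans (ler_wpM2l (w0 xi) (ip_le _ _)) _.
have -> : jw xi ^+ s = jn xi ^+ s * jn xi ^+ s by rewrite -jn_sqr -exprM mulnC exprM expr2.
by rewrite le_eqVlt; apply/orP; left; apply/eqP; ring.
Qed.

End Pairing.

(** * The time derivative in the Sobolev norm *)

Section SolutionDerivative.
Variable a : nat.
Hypothesis da : (d < 2 * a)%N.

Lemma sqrt_absorb (X e t : R) : 0 <= X -> 0 <= e -> 0 <= t -> X <= Num.sqrt (X * e) * t -> X <= e * t ^+ 2.
Proof.
move=> X0 e0 t0 h; have [->|Xn] := eqVneq X 0; first by rewrite mulr_ge0 ?sqr_ge0.
have Xp : 0 < X by rewrite lt_neqAle eq_sym Xn.
have : X ^+ 2 <= (Num.sqrt (X * e) * t) ^+ 2 by apply: lerXn2r; rewrite ?nnegrE // mulr_ge0 // sqrtr_ge0.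
rewrite exprMn sqr_sqrtr ?mulr_ge0 // expr2 -mulrA ler_pM2l //.
Qed.

(** Duality: the functional is built from the coefficients of the increment [D] itself, so its value
    on [D] is the energy X of [D]. The mean value inequality and Cauchy-Schwarz give X <= sqrt(X e)
    |s - t|, hence the claim. *)
Lemma WS_increment (T B t e : R) (v : R -> V -> R) s P : WS a T B v -> 0 <= s <= T -> 0 <= t <= T -> 0 <= e ->
  (forall r, `|r - t| <= `|s - t| -> 0 <= r <= T -> Hs a (fun x => QQ (v r) x - QQ (v t) x) e) ->
  En a (fun x => v s x - v t x - (s - t) * QQ (v t) x) P <= e * `|s - t| ^+ 2.
Proof.
move=> [Hv star] sT tT e0 hQ.
have cv r : 0 <= r <= T -> continuous (v r) by move=> /Hv h; exact: h.1.1.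
have cQ r : 0 <= r <= T -> continuous (QQ (v r)) by move=> /Hv/(Hs_QQ da)[B' h]; exact: h.1.1.
pose D x := v s x - v t x - (s - t) * QQ (v t) x.
pose w := ft D; pose phi r := lf a P w (v r); pose g r := lf a P w (QQ (v r)).
have ED : En a D P = phi s - phi t - (s - t) * g t.
  rewrite /phi /g -lfZ; last exact: cQ.
  rewrite -lfB; [|exact: cv|exact: cv].
  rewrite -lfB; [|by apply: contB; exact: cv|by apply: contZl; exact: cQ].
  by rewrite /En /lf; apply: eq_bigr => xi _; rewrite -(ipzz (ft D xi)).
have X0 : 0 <= En a D P by exact: En_ge0.
apply: sqrt_absorb => //.
have dphi c e1 : 0 <= c <= T -> 0 < e1 -> exists2 dl : R, 0 < dl & forall r, 0 <= r <= T -> `|r - c| <= dl ->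
     `|phi r - phi c - (r - c) * g c| <= e1 * `|r - c|.
  move=> cT e10; pose S := \sum_(xi <- bx P) jw xi ^+ a * normc (w xi).
  have S0 : 0 <= S by apply: sumr_ge0 => xi _; rewrite mulr_ge0 ?normc_ge0 // jwX_ge0.
  have [dl dl0 hd] := star (e1 / (S + 1)) ltac:(by rewrite divr_gt0 // ltr_wpDl).
  exists dl => // r rT rc.
  rewrite /phi /g -lfZ; last exact: cQ.
  rewrite -lfB; [|exact: cv|exact: cv].
  rewrite -lfB; [|by apply: contB; exact: cv|by apply: contZl; exact: cQ].
  apply: le_trans (lf_norm _ _ _ _ (hd r c rT cT rc)) _.
    by apply: contB; [by apply: contB; exact: cv|by apply: contZl; exact: cQ].
  rewrite -/S mulrA; apply: ler_wpM2r => //; rewrite mulrCA; apply: ler_piMr; first exact: ltW.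
  by rewrite ler_pdivrMr ?ltr_wpDl // mul1r lerDl.
have gK r : `|r - t| <= `|s - t| -> 0 <= r <= T -> `|g r - g t| <= Num.sqrt (En a D P * e).
  move=> rt rT; have [h1 h2] := hQ r rt rT.
  rewrite /g -lfB; [|exact: cQ|exact: cQ].
  rewrite -(@ler_sqr R) ?nnegrE ?sqrtr_ge0 // real_normK ?num_real // sqr_sqrtr ?mulr_ge0 //.
  by apply: le_trans (lf_sqr _ _ _ _) _; rewrite -[X in X * _]/(En a D P); apply: ler_wpM2l.
rewrite -/D [leLHS](_ : _ = `|phi s - phi t - (s - t) * g t|); last by rewrite -ED ger0_norm.
exact: mean_value sT tT dphi gK.
Qed.

Hypothesis d0 : (0 < d)%N.

Lemma usol_derivative u0 (B0 m M t e : R) : 0 < m -> m <= M -> (forall x, m <= u0 x <= M) -> Hs a.+1 u0 B0 -> 0 <= t -> 0 < e ->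
  exists2 dl : R, 0 < dl & forall s, 0 <= s -> `|s - t| <= dl ->
    (forall P, En a (fun x => QQ (usol u0 s) x - QQ (usol u0 t) x) P <= e) /\
    (s != t -> forall P, En a (fun x => (usol u0 s x - usol u0 t x) / (s - t) - QQ (usol u0 t) x) P <= e).
Proof.
move=> m0 mM ur H0 t0 e0.
have [_ G] := usol_WS da d0 m0 mM ur H0; have [B W] := G (t + 1); have [Hv _] := W.
have tT : 0 <= t <= t + 1 by rewrite t0 /= lerDl.
have B1 : 0 <= B by exact: Hs_ge0 (Hv t tT).
have K0 := KQ_ge0 a (B1 : 0 <= B).
have K1 : 0 < @KQ a B + 1 by rewrite ltr_wpDl.
have [dl dl0 hc] := usol_continuous da d0 m0 mM ur H0 t0 (divr_gt0 e0 K1).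
have inT s : 0 <= s -> `|s - t| <= Num.min dl 1 -> 0 <= s <= t + 1.
  move=> s0; rewrite le_min => /andP[_ h]; rewrite s0 /=.
  by have := le_trans (ler_norm _) h; lra.
have hQ s : 0 <= s -> `|s - t| <= Num.min dl 1 -> Hs a (fun x => QQ (usol u0 s) x - QQ (usol u0 t) x) e.
  move=> s0 st; have sT := inT s s0 st; move: st; rewrite le_min => /andP[st _].
  have Hs' := Hv s sT; have Ht := Hv t tT.
  apply: Hs_le (QQ_diff da Hs' Ht (_ : Hs a.+1 _ (e / (@KQ a B + 1)))).
    by rewrite mulrCA; apply: ler_piMr; [exact: ltW | rewrite ler_pdivrMr // mul1r lerDl].
  by split; [exact: cpB Hs'.1 Ht.1 | exact: hc].
exists (Num.min dl 1); first by rewrite lt_min dl0 ltr01.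
move=> s s0 st; split; first by move=> P; exact: (hQ s s0 st).2.
move=> sn P; have snt : s - t != 0 by rewrite subr_eq0.
have Hs' := Hv s (inT s s0 st); have Ht := Hv t tT; have [B' HQ] := Hs_QQ da Ht.
have h := @WS_increment (t + 1) B t e (usol u0) s P W (inT s s0 st) tT (ltW e0) ltac:(
  by move=> r rt /andP[r0 _]; apply: hQ => //; exact: le_trans st).
set D := fun x => _ in h.
have cD : continuous D by apply: contB; [apply: contB; [exact: Hs'.1.1|exact: Ht.1.1] | apply: contZl; exact: HQ.1.1].
rewrite (_ : (fun x => _) = (fun x => (s - t)^-1 * D x)); last first.
  by apply/funext => x; rewrite /D; field.
have -> : En a (fun x => (s - t)^-1 * D x) P = (s - t) ^- 2 * En a D P.
  rewrite /En mulr_sumr; apply: eq_bigr => xi _; rewrite ftZ // normcM exprMn mulrCA; congr (_ * _).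
  by rewrite normcE /= expr0n addr0 exprVn.
rewrite real_normK ?num_real // in h.
have p2 : 0 < (s - t) ^+ 2 by rewrite exprn_even_gt0.
by rewrite mulrC ler_pdivrMr.
Qed.

Lemma usol_is_solution u0 (B0 m M : R) : 0 < m -> m <= M -> (forall x, m <= u0 x <= M) -> Hs a.+1 u0 B0 ->
  is_solution a.+1 u0 +oo%E (usol u0).
Proof.
move=> m0 mM ur H0; have [u00 G] := usol_WS da d0 m0 mM ur H0.
have HB t : 0 <= t -> exists B, Hs a.+1 (usol u0 t) B.
  by move=> t0; have [B [h _]] := G t; exists B; apply: h; rewrite t0 lexx.
have wit (F : set_system R) (t : R) (J : set R) (A : set R) (dl : R) : 0 < dl -> (forall s, J s -> `|s - t| <= dl -> A s) -> within J (nbhs t) A.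
  move=> dl0 h; rewrite /within /=; apply/nbhs_ballP; exists dl => //= s; rewrite /ball /= => st Js.
  by apply: h => //; rewrite distrC ltW.
have wit' (t : R) (J : set R) (A : set R) (dl : R) : 0 < dl -> (forall s, J s -> s != t -> `|s - t| <= dl -> A s) -> within J t^' A.
  move=> dl0 h; rewrite /within /= /dnbhs /within /=; apply/nbhs_ballP; exists dl => //= s; rewrite /ball /= => st sn Js.
  by apply: h => //; rewrite distrC ltW.
have e2 (e : R) : 0 < e -> 0 < e ^+ 2 by move=> e0; exact: exprn_gt0.
split=> //.
  split=> [t [t0 _]|t [t0 _]]; first by have [B h] := HB t t0; exact: Hs_sobolev h.
  apply: cvg_ereal0 => e e0.
  have [dl dl0 hc] := usol_continuous da d0 m0 mM ur H0 t0 (e2 e e0).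
  apply: (wit setT t _ _ dl dl0) => s [s0 _] st /=.
  by rewrite sobolev_norm_ge0 /=; apply: sobolev_norm_le; [exact: ltW | exact: hc].
exists (fun t => QQ (usol u0 t)); split.
- split=> [t [t0 _]|t [t0 _]].
    by have [B h] := HB t t0; have [B' h'] := Hs_QQ da h; exact: Hs_sobolev h'.
  apply: cvg_ereal0 => e e0.
  have [dl dl0 hc] := usol_derivative m0 mM ur H0 t0 (e2 e e0).
  apply: (wit setT t _ _ dl dl0) => s [s0 _] st /=.
  by rewrite sobolev_norm_ge0 /=; apply: sobolev_norm_le; [exact: ltW | exact: (hc s s0 st).1].
- move=> t [t0 _]; apply: cvg_ereal0 => e e0.
  have [dl dl0 hc] := usol_derivative m0 mM ur H0 t0 (e2 e e0).
  apply: (wit' t _ _ dl dl0) => s [s0 _] sn st /=.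
  by rewrite sobolev_norm_ge0 /=; apply: sobolev_norm_le; [exact: ltW | exact: (hc s s0 st).2].
- move=> t [t0 _]; have [B h] := HB t t0.
  have [[[c1 c2] c3] _] := Hs_absn da h; have [[[k1 k2] k3] _] := Hs_absn da (Hs_sq da h).
  have E : sq (usol u0 t) = (fun x => usol u0 t x ^+ 2) by apply/funext => x; rewrite expr2.
  exists (absn (usol u0 t)), (absn (sq (usol u0 t))); split.
  + by split.
  + by rewrite -E; split.
  + by move=> x; rewrite /QQ; ring.
Qed.

End SolutionDerivative.

(** * Solutions in the sense of the statement are limits of the scheme *)

Section Uniqueness.

Lemma within_nbhs (J A : set R) (t : R) : within J (nbhs t) A -> exists2 dl : R, 0 < dl & forall s, J s -> `|s - t| <= dl -> A s.
Proof.
rewrite /within /= => /nbhs_ballP[dl /= dl0 h]; exists (dl / 2); first by rewrite divr_gt0.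
move=> s Js st; apply: h => //; rewrite /ball /= distrC; apply: le_lt_trans st _.
by move: dl0; clra.
Qed.

Lemma within_dnbhs (J A : set R) (t : R) : within J t^' A -> exists2 dl : R, 0 < dl & forall s, J s -> s != t -> `|s - t| <= dl -> A s.
Proof.
rewrite /within /= /dnbhs /within /= => /nbhs_ballP[dl /= dl0 h]; exists (dl / 2); first by rewrite divr_gt0.
move=> s Js sn st; apply: h => //; rewrite /ball /= distrC; apply: le_lt_trans st _.
by move: dl0; clra.
Qed.

(** The definition gives a derivative at each time separately. The equation identifies it with [QQ],
    which is uniformly continuous on Sobolev balls in the sup norm; the mean value inequality then
    makes the derivative uniform in time. *)
Lemma solution_WS a u0 (T : \bar R) (v : R -> V -> R) (t : R) : (d < 2 * a)%N -> is_solution a.+1 u0 T v -> 0 <= t -> (t%:E < T)%E ->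
  exists B, WS a t B v.
Proof.
move=> da [v0 [cH cv] [ut [[dH _] dv eqn]]] t0 tT.
pose J := [set t : R | 0 <= t /\ (t%:E < T)%E].
have inJ s : 0 <= s <= t -> J s by move=> /andP[s0 st]; split=> //; apply: le_lt_trans tT; rewrite lee_fin.
have [B HB] : exists B, forall s, 0 <= s <= t -> Hs a.+1 (v s) B.
  (* Continuity in H^m bounds the norm near each time, and creeping turns this into one bound on the
     compact interval. *)
  apply: (@creeping 0 t (fun c => exists B, forall s, 0 <= s <= c -> Hs a.+1 (v s) B)) => //.
    have [B h] := sobolev_Hs (cH 0 (inJ 0 ltac:(by rewrite lexx))); exists B => s.
    by rewrite -eq_le => /eqP <-.
  move=> c ct; have Jc := inJ c ct; have [B h] := sobolev_Hs (cH c Jc).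
  have [dl dl0 hd] := within_nbhs (cvg_ereal0E _ (cv c Jc) (@ltr01 R)).
  exists dl => // s s' /andP[s1 s2] /andP[s3 s4] s5 s6 [B1 h1].
  exists (Num.max B1 (2 * 1 + 2 * B)) => r /andP[r0 rs'].
  have [rs|sr] := leP r s.
    by apply: Hs_le (h1 r _); rewrite ?le_max ?lexx // r0.
  have Jr : J r by apply: inJ; rewrite r0; exact: le_trans s4.
  have [Br hr] := sobolev_Hs (cH r Jr).
  have rc : `|r - c| <= dl by rewrite ler_norml; move: s5 s6 sr rs'; clra.
  have hd' : Hs a.+1 (fun x => v r x - v c x) 1.
    split; first exact: cpB hr.1 h.1.
    by move=> P; have := sobolev_norm_En P (hd r Jr rc); rewrite expr1n.
  apply: Hs_le (_ : Hs a.+1 (v r) (2 * 1 + 2 * B)); first by rewrite le_max lexx orbT.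
  have := Hs_add hd' h; congr (Hs _ _ _); apply/funext => x; by rewrite subrK.
have B0 : 0 <= B by apply: Hs_ge0 (HB 0 _); rewrite lexx.
have utE s : 0 <= s <= t -> ut s = QQ (v s).
  move=> /inJ Js; have [w [z [h1 h2 h3]]] := eqn s Js.
  have w1 : absn (v s) = w by apply: absn_eq; case: h1 => ? ? ?; split.
  have z1 : absn (sq (v s)) = z.
    apply: absn_eq; have -> : sq (v s) = (fun x => v s x ^+ 2) by apply/funext => x; rewrite expr2.
    by case: h2 => ? ? ?; split.
  apply/funext => x; rewrite /QQ w1 z1; have := h3 x; set A := ut s x; clra.
have [A A0 hA] := QQ_bound da B0.
(* The derivative in H^(m-1) is uniform in [x] by Sobolev embedding, but [dl] still depends on
   [c]. *)
have deriv c (e : R) : 0 <= c <= t -> 0 < e -> exists2 dl : R, 0 < dl & forall r, 0 <= r <= t -> `|r - c| <= dl -> forall x,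
    `|v r x - v c x - (r - c) * QQ (v c) x| <= e * `|r - c|.
  move=> ct e0; have Jc := inJ c ct.
  have S00 := @S0_gt0.
  have e1 : 0 < e / Num.sqrt S0 by rewrite divr_gt0 // sqrtr_gt0.
  have [dl dl0 hd] := within_dnbhs (cvg_ereal0E _ (dv c Jc) e1).
  exists dl => // r rt rc x; have [->|rn] := eqVneq r c; first by rewrite !subrr mul0r subr0 normr0 mulr0.
  have Jr := inJ r rt; have := hd r Jr rn rc => /= h.
  have rcn : r - c != 0 by rewrite subr_eq0.
  pose D x := (v r x - v c x) / (r - c) - ut c x.
  have HD : Hs a D ((e / Num.sqrt S0) ^+ 2).
    split; last by move=> P; exact: sobolev_norm_En h.
    have [Bu hu] := sobolev_Hs (dH c Jc).
    apply: cpB; last exact: hu.1.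
    rewrite (_ : (fun x => _) = (fun x => (r - c)^-1 * (v r x - v c x))); last by apply/funext => y; rewrite mulrC.
    by apply: cpZ; exact: cpB (HB r rt).1 (HB c ct).1.
  have := Hs_sup da x HD; rewrite sqrtrM ?(ltW S00) // sqrtr_sqr (ger0_norm (ltW e1)) mulrC divfK ?gt_eqF ?sqrtr_gt0 // => k.
  have -> : v r x - v c x - (r - c) * QQ (v c) x = D x * (r - c) by rewrite /D -(utE c ct); field.
  by rewrite normrM ler_wpM2r.
have mv x r s (G K : R) : 0 <= r <= t -> 0 <= s <= t -> (forall y, `|y - r| <= `|s - r| -> 0 <= y <= t -> `|QQ (v y) x - G| <= K) ->
    `|v s x - v r x - (s - r) * G| <= K * `|s - r|.
  move=> rT sT; apply: (mean_value (phi := fun y => v y x) (g := fun y => QQ (v y) x)) sT rT _ => c e cT e0.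
  by have [dl dl0 h] := deriv c e cT e0; exists dl => // y yT yc; exact: h.
have lip r s x : 0 <= r <= t -> 0 <= s <= t -> `|v s x - v r x| <= A * `|s - r|.
  move=> rT sT; have := mv x r s 0 A rT sT; rewrite mulr0 subr0; apply=> y _ yT.
  by rewrite subr0; apply: hA; exact: HB.
exists B; split=> // e e0.
have [dq dq0 hq] := QQ_cvg da B0 e0.
have A1 : 0 < A + 1 by rewrite ltr_wpDl.
exists (dq / (A + 1)); first by rewrite divr_gt0.
have Adq y : y <= dq / (A + 1) -> A * y <= dq.
  move=> h; apply: le_trans (ler_wpM2l A0 h) _; rewrite mulrCA; apply: ler_piMr; first exact: ltW.
  by rewrite ler_pdivrMr // mul1r lerDl.
move=> s r sT rT sr x; apply: mv => // y ys yT.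
by apply: hq; [exact: HB | exact: HB |] => z; apply: le_trans (lip r y z rT yT) (Adq _ (le_trans ys sr)).
Qed.

Lemma solution_unique a u0 (T : \bar R) (v : R -> V -> R) (m M t : R) : (d < 2 * a)%N ->
  0 < m -> m <= M -> (forall x, m <= u0 x <= M) ->
  is_solution a.+1 u0 T v -> 0 <= t -> (t%:E < T)%E -> v t = usol u0 t.
Proof.
move=> da m0 mM ur sol t0 tT; have [B W] := solution_WS da sol t0 tT; have [v0 _ _] := sol.
by apply: (WS_unique da W m0 mM v0 ur); rewrite t0 lexx.
Qed.

End Uniqueness.

(** * Derivatives and norms *)

Section Derivatives.
Implicit Types (i : 'I_d).

Lemma sin_sub_le (s : R) : `|sin s - s| <= s ^+ 2.
Proof.
wlog s0 : s / 0 <= s.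
  move=> H; have [/H//|/ltW sn] := leP 0 s; have := H (- s).
  by rewrite oppr_ge0 sinN sqrrN -opprD normrN; apply.
have := sin_le_id s0; move=> h1; rewrite ler0_norm ?subr_le0 // opprB.
move: s0; rewrite le_eqVlt => /predU1P[<-|s0]; first by rewrite sin0 subr0 expr0n.
have cs : {within `[0, s], continuous (@sin R)} by apply: continuous_subspaceT; exact: continuous_sin.
have [c] := MVT s0 (fun y _ => is_derive_sin y) cs.
rewrite in_itv /= sin0 !subr0 => /andP[c0 c1] ->.
have k1 := cos_ge_quad c; have k2 := cos_geN1 c.
have k3 : 1 - cos c <= c.
  have [c2|c2] := leP c 2; last by move: k2 c2; clra.
  have : c ^+ 2 <= 2 * c by rewrite expr2 ler_wpM2r // ltW.
  by move: k1; clra.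
have : s * (1 - cos c) <= s * s by apply: ler_wpM2l; [exact: ltW | exact: le_trans k3 (ltW c1)].
by clear; nra.
Qed.

Definition dsym i xi : C := (0 +i* (xi 0%R i)%:~R)%C.

Lemma normc_dsym i xi : normc (dsym i xi) <= jn xi.
Proof.
rewrite /= expr0n add0r sqrtr_sqr.
have := normr_le_enorm (freq xi : V) i; rewrite mxE => h; apply: le_trans h _; exact: nz_le_jn.
Qed.

(** The remainder is the mode times e^(is) - 1 - is, whose real and imaginary parts are each at most
    s^2, with s = t p_i. *)
Lemma pr_taylor (c : C) p x i (t : R) :
  `|pr c p (x + t *: delta_mx 0 i) - pr c p x - t * pr (dsym i p * c) p x| <= 2 * t ^+ 2 * (jn p ^+ 2 * normc c).
Proof.
set s := t * (p 0%R i)%:~R.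
have ds : dot (freq p) (x + t *: delta_mx 0 i) = dot (freq p) x + s by rewrite dotDr dotZr dot_delta mxE.
pose w : C := ((cos s - 1) +i* (sin s - s))%C.
have -> : pr c p (x + t *: delta_mx 0 i) - pr c p x - t * pr (dsym i p * c) p x = complex.Re (c * ex (dot (freq p) x) * w).
  rewrite !prE ds cosD sinD /dsym /w /ex; case: c => u v /=.
  move: (cos (dot _ _)) (sin (dot _ _)) => A B; rewrite /s; ring.
apply: le_trans (Re_le _) _; rewrite !normcM exE mulr1.
have sj : s ^+ 2 <= t ^+ 2 * jn p ^+ 2.
  rewrite /s exprMn; apply: ler_wpM2l; first exact: sqr_ge0.
  have := normc_dsym i p; rewrite /= expr0n add0r sqrtr_sqr => h.
  by rewrite -(real_normK (num_real ((p 0%R i)%:~R : R))); apply: lerXn2r; rewrite ?nnegrE ?jn_ge0.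
have hw : normc w <= 2 * s ^+ 2.
  have h1 : `|cos s - 1| <= s ^+ 2 / 2 by have := cos_ge_quad s; have := cos_le1 s; rewrite ler_norml; clra.
  have h2 := sin_sub_le s.
  have h3 : normc w <= `|cos s - 1| + `|sin s - s|.
    rewrite -(@ler_sqr R) ?nnegrE ?normc_ge0 ?addr_ge0 // normcE /= -(real_normK (num_real (cos s - 1))) -(real_normK (num_real (sin s - s))).
    by have := mulr_ge0 (normr_ge0 (cos s - 1)) (normr_ge0 (sin s - s)); clra.
  by have := sqr_ge0 s; move: h1 h2 h3; clra.
rewrite mulrC [leRHS]mulrA; apply: ler_wpM2r; first exact: normc_ge0.
by apply: le_trans hw _; rewrite -mulrA; apply: ler_wpM2l.
Qed.

Variable a : nat.
Hypothesis da : (d < 2 * a)%N.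

Lemma Hs_weaken s r f (B : R) : (s <= r)%N -> Hs r f B -> Hs s f B.
Proof. by move=> sr; rewrite -(subnK sr); elim: (r - s)%N => [|j IH] // /Hs_down; exact: IH. Qed.

(** The Taylor remainders of the modes sum to a multiple of t^2 once the coefficients are summable
    against the second power of frequency. That takes order 2 + a, whence the condition on [r]. *)
Lemma Hs_derive r f (B : R) i : (a.+1 <= r)%N -> Hs r.+1 f B -> exists g, [/\ Hs r g B,
  forall xi, ft g xi = dsym i xi * ft f xi & forall x, is_derive x (delta_mx 0 i : V) f (g x)].
Proof.
move=> ar Hf; have [cf _] := Hf.
have Hf2 : Hs (2 + a) f B by apply: Hs_weaken Hf; rewrite add2n ltnS.
have Hf1 : Hs a.+1 f B by apply: Hs_weaken Hf; exact: ltnW.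
pose c xi := dsym i xi * ft f xi.
have hc : herm c.
  move=> p; rewrite /c /dsym ft_opp; last exact: cf.1.
  by rewrite mxE mulrNz; case: (ft f p) => u v; apply: complexP => /=; ring.
have cl p : normc (c p) <= jn p * normc (ft f p).
  by rewrite /c normcM; apply: ler_wpM2r; [exact: normc_ge0 | exact: normc_dsym].
have tl j e : tail (fun p => jn p * normc (ft f p)) j e -> tail (fun p => normc (c p)) j e by apply: tail_le.
have [|g [cg fg hg]] := @syn_limit c _ hc.
  by move=> e e0; have [j hj] := @X_tail a B e da (Hs_ge0 Hf) e0; exists j; apply: tl; exact: hj.
exists g; split=> //.
  split=> // P; apply: le_trans (Hf.2 P); apply: ler_sum => xi _.
  rewrite fg (exprS (jw xi)) [jw xi * _]mulrC -mulrA; apply: ler_wpM2l; first by rewrite jwX_ge0.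
  rewrite -jn_sqr -exprMn; apply: lerXn2r; rewrite ?nnegrE ?normc_ge0 ?mulr_ge0 ?jn_ge0 ?normc_ge0 //; exact: cl.
set N := Num.sqrt (S0 * B).
have taylor x (t : R) : `|f (x + t *: delta_mx 0 i) - f x - t * g x| <= 2 * t ^+ 2 * N.
  apply/ler_addgt0Pr => e e0.
  have e1 : 0 < e / (2 + `|t|) by rewrite divr_gt0 // ltr_wpDr.
  have [j hj] := @X_tail a B _ da (Hs_ge0 Hf) e1.
  have := hj f Hf1 => {}hj.
  have t1 : tail (fun p => normc (ft f p)) j (e / (2 + `|t|)).
    by apply: tail_le hj => p; rewrite ler_peMl ?jn_ge1 // normc_ge0.
  have k1 := syn_approx (x + t *: delta_mx 0 i) cf (Hs_asum da Hf1) t1.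
  have k2 := syn_approx x cf (Hs_asum da Hf1) t1.
  have k3 := hg j _ x (tl _ _ hj).
  have k4 : `|syn (ft f) (2 ^ j) (x + t *: delta_mx 0 i) - syn (ft f) (2 ^ j) x - t * syn c (2 ^ j) x| <= 2 * t ^+ 2 * N.
    rewrite /syn mulr_sumr -!sumrB; apply: le_trans (ler_norm_sum _ _ _) _.
    have w := @weighted_sum a 2 f _ _ _ predT (bx_uniq (2 ^ j)) Hf2 (full_sum _ da).
    apply: le_trans (ler_wpM2l _ w); last by rewrite mulr_ge0 ?sqr_ge0.
    by rewrite mulr_sumr; apply: ler_sum => p _; exact: pr_taylor.
  have k5 : `|t * (g x - syn c (2 ^ j) x)| <= `|t| * (e / (2 + `|t|)) by rewrite normrM ler_wpM2l.
  have E : 2 * (e / (2 + `|t|)) + `|t| * (e / (2 + `|t|)) = e by field; rewrite gt_eqF // ltr_wpDr.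
  move: k1 k2 k4 k5 E; set A := syn _ _ (x + _); set D := syn _ _ x; set W := syn _ _ x.
  by rewrite !ler_norml; clra.
move=> x.
have cvg : h^-1 *: (f (h *: (delta_mx 0 i : V) + x) - f x) @[h --> 0^'] --> g x.
  apply/cvgrPdist_le => e e0.
  have [eta eta0 /=] := @ex_small R [:: (2 * N, e)] ltac:(by rewrite /= e0).
  rewrite andbT => q1; rewrite /dnbhs /within /=; apply/nbhs_ballP; exists eta => //= h; rewrite /ball /= sub0r normrN => hh hn.
  have T := taylor x h; rewrite (addrC x) in T.
  have -> : g x - h^-1 *: (f (h *: delta_mx 0 i + x) - f x) = - (h^-1 * (f (h *: delta_mx 0 i + x) - f x - h * g x)).
    by rewrite [h^-1 *: _]/(h^-1 * _) mulrBr mulKf // opprB.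
  rewrite normrN normrM normfV.
  have h0 : 0 < `|h| by rewrite normr_gt0.
  rewrite mulrC ler_pdivrMr //; apply: le_trans T _.
  rewrite -(real_normK (num_real h)) expr2 mulrA mulrAC; apply: ler_wpM2r; first exact: ltW.
  rewrite mulrAC; apply: le_trans q1; apply: ler_wpM2l; last exact: ltW.
  by rewrite mulr_ge0 // sqrtr_ge0.
apply: DeriveDef; first by apply/cvg_ex; exists (g x).
by apply: cvg_lim cvg; exact: norm_hausdorff.
Qed.

Definition psym (s : seq 'I_d) xi : C := \prod_(i <- s) dsym i xi.

Lemma Hs_pderivs (s : seq 'I_d) r f (B : R) : (a.+1 <= r)%N -> Hs (size s + r) f B ->
  [/\ Hs r (pderivs s f) B & forall xi, ft (pderivs s f) xi = psym s xi * ft f xi].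
Proof.
elim: s r => [|i s IH] r ar Hf; first by split=> // xi; rewrite /psym big_nil mul1r.
have Hf' : Hs (size s + r.+1) f B by rewrite addnS.
have [h1 h2] := IH r.+1 (leqW ar) Hf'; have [g [g1 g2 g3]] := Hs_derive i ar h1.
have -> : pderivs (i :: s) f = g by apply/funext => x; rewrite /pderivs /= -/(pderivs s f); have [_ ->] := g3 x.
by split=> // xi; rewrite g2 h2 /psym big_cons mulrA.
Qed.

Lemma pderivs_derivable (s : seq 'I_d) f (B : R) i x : Hs (size s + a.+2) f B -> derivable (pderivs s f) x (delta_mx 0 i).
Proof. by move=> Hf; have [h1 _] := Hs_pderivs (leqnSn _) Hf; have [g [_ _ g3]] := Hs_derive i (leqnn _) h1; have [] := g3 x. Qed.

Lemma Hs_class_C k f (B : R) : Hs (k + a.+2) f B -> class_C k f.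
Proof.
move=> Hf s; split=> [sk|sk i x].
  have Hf' : Hs (size s + a.+2) f B by apply: Hs_weaken Hf; rewrite leq_add2r.
  by have [h _] := Hs_pderivs (leqnSn _) Hf'; exact: h.1.1.
by apply: (@pderivs_derivable s f B); apply: Hs_weaken Hf; rewrite leq_add2r ltnW.
Qed.

(** Both sides are continuous with the same Fourier coefficients, which avoids following
    derivability through the iterated limits. *)
Lemma pderivsB (s : seq 'I_d) f g (A B : R) x : Hs (size s + a.+1) f A -> Hs (size s + a.+1) g B ->
  pderivs s f x - pderivs s g x = pderivs s (fun y => f y - g y) x.
Proof.
move=> Hf Hg; have [f1 f2] := Hs_pderivs (leqnn _) Hf; have [g1 g2] := Hs_pderivs (leqnn _) Hg.
have [h1 h2] := Hs_pderivs (leqnn _) (Hs_sub Hf Hg).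
have c1 := f1.1.1; have c2 := g1.1.1; have c3 := Hf.1.1; have c4 := Hg.1.1.
suff E : (fun x => pderivs s f x - pderivs s g x) = pderivs s (fun y => f y - g y) by exact: (congr1 (fun F => F x) E).
apply: ft_inj; [exact: cpB f1.1 g1.1 | exact: h1.1 |] => xi.
by rewrite ftB // f2 g2 h2 ftB // mulrBr.
Qed.

End Derivatives.

(** * Lipschitz dependence on time in high Sobolev norms *)

Section TimeRegularity.

Lemma Hs_scale s (c : R) f (B : R) : Hs s f B -> Hs s (fun x => c * f x) (c ^+ 2 * B).
Proof.
move=> [cf Hf]; split=> [|P]; first exact: cpZ.
apply: le_trans (ler_wpM2l (sqr_ge0 c) (Hf P)); rewrite /En mulr_sumr; apply: ler_sum => xi _.
have k0 : normc (c%:C%C) = `|c| by rewrite /= expr0n addr0 sqrtr_sqr.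
rewrite (ftZ _ _ cf.1) (normcM (c%:C%C) (ft f xi)) k0 exprMn (real_normK (num_real c)) mulrCA.
exact: lexx.
Qed.

(** [WS_increment] at the higher index [A], with the crude bound 4 QB for the variation of [QQ];
    then 10 = 2 * 4 + 2. The origin of time is moved to [t1], from where the higher norm is
    bounded. *)
Lemma WS_time_lip (a A : nat) (v : R -> V -> R) (t1 B s t : R) : (d < 2 * A)%N ->
  (forall T, exists B', WS a T B' v) -> 0 <= t1 -> (forall r, t1 <= r -> Hs A.+1 (v r) B) ->
  t1 <= s -> t1 <= t -> Hs A (fun x => v s x - v t x) (10 * QB A B * (s - t) ^+ 2).
Proof.
move=> dA W t10 Hv t1s t1t.
pose T := Num.max (s - t1) (t - t1); pose w r := v (t1 + r).
have WT : WS A T B w.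
  have [B' /(WS_shift t10)[_ star]] := W (t1 + T).
  by split=> // r /andP[r0 _]; apply: Hv; rewrite lerDl.
have sT : 0 <= s - t1 <= T by rewrite subr_ge0 t1s /T le_max lexx.
have tT : 0 <= t - t1 <= T by rewrite subr_ge0 t1t /T le_max lexx orbT.
have HQ r : 0 <= r <= T -> Hs A (QQ (w r)) (QB A B) by move=> rT; apply: Hs_QQB => //; exact: (WT.1 r rT).
have Q0 : 0 <= QB A B := Hs_ge0 (HQ _ tT).
have inc P := @WS_increment A dA T B (t - t1) (2 * QB A B + 2 * QB A B) w (s - t1) P WT sT tT ltac:(by rewrite addr_ge0 ?mulr_ge0) (fun r _ rT => Hs_sub (HQ r rT) (HQ _ tT)).
have ws : w (s - t1) = v s by rewrite /w addrC subrK.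
have wt : w (t - t1) = v t by rewrite /w addrC subrK.
have st : s - t1 - (t - t1) = s - t by ring.
rewrite ws wt st in inc.
have HQt := HQ _ tT; rewrite wt in HQt.
have HD : Hs A (fun x => v s x - v t x - (s - t) * QQ (v t) x) ((2 * QB A B + 2 * QB A B) * `|s - t| ^+ 2).
  split=> //; apply: cpB; last exact: (Hs_scale (s - t) HQt).1.
  by apply: cpB; [exact: (Hv s t1s).1 | exact: (Hv t t1t).1].
have := Hs_add HD (Hs_scale (s - t) HQt).
rewrite (real_normK (num_real (s - t))).
rewrite (_ : 2 * _ + _ = 10 * QB A B * (s - t) ^+ 2); last by ring.
by congr (Hs _ _ _); apply/funext => x; rewrite subrK.
Qed.

End TimeRegularity.

(** * Hoelder and Lipschitz norms from Sobolev bounds *)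

Section NormBounds.
Implicit Types (y : V).

Lemma enorm_le_coord n (X : 'rV[R]_n) (b : R) : (forall i, `|X 0 i| <= b) -> enorm X <= n%:R * b.
Proof.
move=> h; apply: le_trans (enorm_le_sum X) _; apply: le_trans (ler_sum _ (fun i _ => h i)) _.
by rewrite sumr_const card_ord mulr_natl.
Qed.

(** The Lipschitz bound serves distances up to 1, the sup bound the larger ones; at r = 0 the
    quotient is 0 by convention. *)
Lemma holder_quotient (D P L r : R) : 0 <= D -> D <= P -> D <= L * r -> 0 <= r -> 0 <= L -> D / r `^ 2^-1 <= P + L.
Proof.
move=> D0 DP DL r0 L0; have P0 := le_trans D0 DP; rewrite (powR12_sqrt r0).
move: r0; rewrite le_eqVlt => /predU1P[<-|r0]; first by rewrite sqrtr0 invr0 mulr0 addr_ge0.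
have q0 : 0 < Num.sqrt r by rewrite sqrtr_gt0.
rewrite ler_pdivrMr // mulrDl.
have [r1|/ltW r1] := leP r 1.
  apply: le_trans DL _; apply: le_trans (_ : L * Num.sqrt r <= _); last by rewrite lerDr mulr_ge0 ?(ltW q0).
  apply: ler_wpM2l => //; rewrite -{1}(sqr_sqrtr (ltW r0)) expr2 ler_piMl ?(ltW q0) //.
  by rewrite -[leRHS]sqrtr1 ler_wsqrtr.
apply: le_trans DP _; apply: le_trans (_ : P * Num.sqrt r <= _); last by rewrite lerDl mulr_ge0 ?(ltW q0).
by rewrite ler_peMr // -[leLHS]sqrtr1 ler_wsqrtr.
Qed.

Lemma lipschitz_quotient (D L r : R) : D <= L * r -> 0 <= r -> 0 <= L -> D / r `^ 1 <= L.
Proof.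
move=> DL r0 L0; rewrite (powRr1 r0).
move: r0; rewrite le_eqVlt => /predU1P[<-|r0]; first by rewrite invr0 mulr0.
by rewrite ler_pdivrMr.
Qed.

Definition ntensor (j : nat) : R := #|{: j.-tuple 'I_d}|%:R.

Variables (a k : nat) (J : set R) (u : R -> V -> R) (B K : R).
Hypothesis da : (d < 2 * a)%N.
Hypothesis B0 : 0 <= B.
Hypothesis Hu : forall t, J t -> Hs (k + a.+2) (u t) B.
Hypothesis Hd : forall s t, J s -> J t -> Hs (k + a.+2) (fun x => u s x - u t x) (K * (s - t) ^+ 2).

Let S := Num.sqrt (S0 * B).
Let L1 := (S0 + B) / 2.
Let L2 := Num.sqrt (S0 * K).

Let S_ge0 : 0 <= S. Proof. exact: sqrtr_ge0. Qed.
Let L1_ge0 : 0 <= L1. Proof. by rewrite divr_ge0 // addr_ge0 // ltW // S0_gt0. Qed.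
Let L2_ge0 : 0 <= L2. Proof. exact: sqrtr_ge0. Qed.
Let n_ge0 j : 0 <= ntensor j. Proof. exact: ler0n. Qed.

Lemma pderivs_Hs_low (s : seq 'I_d) f E : (size s <= k)%N -> Hs (k + a.+2) f E -> Hs a.+1 (pderivs s f) E.
Proof.
move=> sk Hf; have Hf' : Hs (size s + a.+1) f E by apply: Hs_weaken Hf; rewrite leq_add.
by case: (Hs_pderivs da (leqnn _) Hf').
Qed.

Lemma pderivs_sup (s : seq 'I_d) t x : (size s <= k)%N -> J t -> `|pderivs s (u t) x| <= S.
Proof. by move=> sk Jt; apply: (Hs_sup da); apply: Hs_down; exact: pderivs_Hs_low (Hu Jt). Qed.

Lemma pderivs_space (s : seq 'I_d) t x y : (size s <= k)%N -> J t ->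
  `|pderivs s (u t) x - pderivs s (u t) y| <= L1 * enorm (x - y).
Proof.
move=> sk Jt; have := Hs_lip da y (x - y) (pderivs_Hs_low sk (Hu Jt)).
by rewrite addrCA subrr addr0.
Qed.

Lemma pderivs_time (s : seq 'I_d) t t' x : (size s <= k)%N -> J t -> J t' ->
  `|pderivs s (u t) x - pderivs s (u t') x| <= L2 * `|t - t'|.
Proof.
move=> sk Jt Jt'.
have low f E : Hs (k + a.+2) f E -> Hs (size s + a.+1) f E by apply: Hs_weaken; rewrite leq_add.
rewrite (pderivsB da x (low _ _ (Hu Jt)) (low _ _ (Hu Jt'))).
have := Hs_sup da x (Hs_down (pderivs_Hs_low sk (Hd Jt Jt'))).
by rewrite mulrA [_ * _ ^+ 2]mulrC sqrtrM ?sqr_ge0 // sqrtr_sqr mulrC.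
Qed.

Lemma nabla_sup j t x : (j <= k)%N -> J t -> enorm (nabla j (u t) x) <= ntensor j * S.
Proof.
by move=> jk Jt; apply: enorm_le_coord => i; rewrite mxE; apply: pderivs_sup; rewrite ?size_tuple.
Qed.

Definition holder_const : R :=
  \sum_(j < k.+1) ntensor j * S + ntensor k * (2 * S + L1) + (S + (2 * S + L2)).

Definition lip_const : R := ntensor k * S + ntensor k * (L1 + L2).

Lemma holder_norm_bound t : J t ->
  (holder_norm k 2^-1 (u t) <= (\sum_(j < k.+1) ntensor j * S + ntensor k * (2 * S + L1))%:E)%E.
Proof.
move=> Jt; rewrite /holder_norm asboolT; last exact: (Hs_class_C da (Hu Jt)).
rewrite EFinD; apply: leeD.
  rewrite -sumEFin; apply: lee_sum => j _; apply: ge_ereal_sup => _ [x _ <-]; rewrite lee_fin.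
  by apply: nabla_sup; rewrite // -ltnS.
apply: ge_ereal_sup => _ [[x y] _ <-] /=; rewrite lee_fin mulrDr; apply: holder_quotient.
- exact: enorm_ge0.
- apply: le_trans (enormB _ _) _; rewrite (mulrC 2) mulrA mulr_natr mulr2n.
  by apply: lerD; apply: nabla_sup.
- rewrite /space_dist -mulrA; apply: enorm_le_coord => i; rewrite !mxE; apply: pderivs_space; rewrite ?size_tuple //.
- exact: enorm_ge0.
- by rewrite mulr_ge0.
Qed.

Lemma holder_time_bound x : (holder_time_norm 2^-1 J (fun t => u t x) <= (S + (2 * S + L2))%:E)%E.
Proof.
rewrite /holder_time_norm EFinD.
have s0 : (size ([::] : seq 'I_d) <= k)%N by [].
have e1 (c b : R) : `|c| <= b -> enorm (const_mx c : 'rV_1) <= b.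
  by move=> h; rewrite -[b]mul1r; apply: enorm_le_coord => i; rewrite mxE.
apply: leeD.
  by apply: ge_ereal_sup => _ [t Jt <-]; rewrite lee_fin; apply: e1; exact: (pderivs_sup x s0 Jt).
apply: ge_ereal_sup => _ [[t t'] [/= Jt Jt'] <-] /=; rewrite lee_fin.
have -> : (const_mx (u t x) - const_mx (u t' x) : 'rV[R]_1) = const_mx (u t x - u t' x) by apply/rowP => i; rewrite !mxE.
apply: holder_quotient => //.
- exact: enorm_ge0.
- apply: e1; apply: le_trans (ler_normB _ _) _; rewrite mulr_natl mulr2n.
  by apply: lerD; [exact: (pderivs_sup x s0 Jt) | exact: (pderivs_sup x s0 Jt')].
- by apply: e1; exact: (pderivs_time x s0 Jt Jt').
- exact: normr_ge0.
Qed.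

Lemma holder_xt_bound : (holder_xt_norm k 2^-1 J u <= holder_const%:E)%E.
Proof.
rewrite /holder_xt_norm /holder_const EFinD; apply: leeD.
  by apply: ge_ereal_sup => _ [t Jt <-]; exact: holder_norm_bound.
by apply: ge_ereal_sup => _ [x _ <-]; exact: holder_time_bound.
Qed.

Lemma lip_nabla_bound : (lip_nabla_norm k J u <= lip_const%:E)%E.
Proof.
rewrite /lip_nabla_norm asboolT; last by move=> t Jt; exact: (Hs_class_C da (Hu Jt)).
rewrite /lip_const EFinD; apply: leeD.
  by apply: ge_ereal_sup => _ [[x t] [_ /= Jt] <-]; rewrite lee_fin; exact: nabla_sup.
apply: ge_ereal_sup => _ [[[x t] [y t']] [[_ /= Jt] [_ /= Jt']] <-] /=; rewrite lee_fin.
set r := spacetime_dist _ _; have r0 : 0 <= r by exact: sqrtr_ge0.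
have rx : enorm (x - y) <= r by rewrite -(ger0_norm (enorm_ge0 (x - y))) -sqrtr_sqr ler_wsqrtr // lerDl sqr_ge0.
have rt : `|t - t'| <= r by rewrite -sqrtr_sqr ler_wsqrtr // lerDr sqr_ge0.
apply: lipschitz_quotient => //; last by rewrite mulr_ge0 // addr_ge0.
rewrite -mulrA; apply: enorm_le_coord => i; rewrite !mxE mulrDl.
set s := tval _; have sk : (size s <= k)%N by rewrite size_tuple.
(* First in space at the time [t], then in time at the point [y]. *)
rewrite -(subrK (pderivs s (u t) y) (pderivs s (u t) x)) -addrA; apply: le_trans (ler_normD _ _) _; apply: lerD.
  by apply: le_trans (pderivs_space x y sk Jt) _; apply: ler_wpM2l.
by apply: le_trans (pderivs_time y sk Jt Jt') _; apply: ler_wpM2l.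
Qed.

End NormBounds.

(** * Minimum and maximum of the datum *)

Section RangeBounds.
(** The reciprocal is again continuous and periodic, hence bounded, which keeps the infimum away
    from 0. *)
Lemma positive_range (f : 'rV[R]_d -> R) : cp f -> (forall x, 0 < f x) ->
  [/\ 0 < inf (range f), inf (range f) <= sup (range f) & forall x, inf (range f) <= f x <= sup (range f)].
Proof.
move=> cf fp.
have ci : cp (fun x => (f x)^-1).
  split=> [x|i x]; last by rewrite cf.2.
  by apply: (@cvgV R _ (nbhs x) _ f (f x) _ (cf.1 x)); rewrite gt_eqF.
have [B B0 hB] := cp_bounded ci; have [D D0 hD] := cp_bounded cf.
have hs : has_sup (range f) by split; [exists (f 0), 0 | exists D => _ [x _ <-]; exact: le_trans (ler_norm _) (hD x)].
have hi : has_inf (range f) by split; [exists (f 0), 0 | exists 0 => _ [x _ <-]; exact: ltW].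
have fr x : inf (range f) <= f x <= sup (range f) by rewrite (ge_inf hi.2) /= ?(ub_le_sup hs.2) //; exists x.
split=> //; last by have /andP[h1 h2] := fr 0; exact: le_trans h2.
have B1 : 0 < B + 1 by rewrite ltr_wpDl.
apply: lt_le_trans (_ : (B + 1)^-1 <= _); first by rewrite invr_gt0.
apply: lb_le_inf; first exact: hi.1.
move=> _ [x _ <-]; rewrite -[leRHS]invrK lef_pV2 ?posrE ?invr_gt0 //.
by apply: le_trans (ler_norm _) (le_trans (hB x) _); rewrite lerDl.
Qed.

End RangeBounds.

(** * Constants as functions of the admissible quantities *)

Section Constants.
Hypothesis d0 : (0 < d)%N.

(* The least index a with d < 2a: constants taken at it do not depend on the
   Sobolev index of the initial datum. *)
Definition crit : nat := (d %/ 2).+1.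

Lemma crit_gt : (d < 2 * crit)%N. Proof. by rewrite /crit; lia. Qed.

(** One constant is selected for the whole class of data with values in [m, M], so it is a function
    of the displayed arguments alone. [smoothing_constP] shows that the selection does not fall on
    the default 0. *)
Definition smoothing_const (r : nat) (t0 m M : R) : R :=
  xget 0 [set B | 0 <= B /\ forall (u0 : V -> R) (B0 : R), (forall x, m <= u0 x <= M) -> Hs crit.+1 u0 B0 ->
    forall t, t0 <= t -> Hs r (usol u0 t) B].

Lemma smoothing_constP r (t0 m M : R) : 0 < t0 -> 0 < m -> m <= M ->
  0 <= smoothing_const r t0 m M /\ forall (u0 : V -> R) (B0 : R), (forall x, m <= u0 x <= M) -> Hs crit.+1 u0 B0 ->
    forall t, t0 <= t -> Hs r (usol u0 t) (smoothing_const r t0 m M).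
Proof.
move=> t00 m0 mM; have [B Bge0 h] := WS_smooth crit_gt d0 r m0 mM t00.
apply: (@xgetPex _ 0 [set B | 0 <= B /\ forall (u0 : V -> R) (B0 : R), (forall x, m <= u0 x <= M) ->
  Hs crit.+1 u0 B0 -> forall t, t0 <= t -> Hs r (usol u0 t) B]).
exists B; split=> // u0 B0 ur H0 t tt.
have [us0 W] := usol_WS crit_gt d0 m0 mM ur H0; have [B' WB] := W t.
by apply: h WB us0 ur _ _; rewrite tt lexx.
Qed.

Definition time_const (k : nat) (t0 m M : R) : R := 10 * @QB (k + crit.+2) (smoothing_const (k + crit.+2).+1 t0 m M).

Lemma usol_norm_bounds (u0 : V -> R) (B0 t0 T m M : R) k : 0 < t0 -> 0 < m -> m <= M ->
  (forall x, m <= u0 x <= M) -> Hs crit.+1 u0 B0 ->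
  let B := smoothing_const (k + crit.+2).+1 t0 m M in let K := time_const k t0 m M in
  (holder_xt_norm k 2^-1 `]t0, T[ (usol u0) <= (@holder_const k B K)%:E)%E /\
  (lip_nabla_norm k `]t0, T[ (usol u0) <= (@lip_const k B K)%:E)%E.
Proof.
move=> t00 m0 mM ur H0 B K; have [Bge0 hB] := smoothing_constP (k + crit.+2).+1 t00 m0 mM.
have Hv t : t0 <= t -> Hs (k + crit.+2).+1 (usol u0 t) B by move=> tt; exact: hB ur H0 t tt.
have Jt t : `]t0, T[%classic t -> t0 <= t by rewrite /= in_itv /= => /andP[/ltW].
have Hu t : `]t0, T[%classic t -> Hs (k + crit.+2) (usol u0 t) B by move=> /Jt/Hv; exact: Hs_down.
have dk : (d < 2 * (k + crit.+2))%N by have := crit_gt; lia.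
have [_ W] := usol_WS crit_gt d0 m0 mM ur H0.
have Hd s t : `]t0, T[%classic s -> `]t0, T[%classic t ->
    Hs (k + crit.+2) (fun x => usol u0 s x - usol u0 t x) (K * (s - t) ^+ 2).
  by move=> /Jt ts /Jt tt; exact: (WS_time_lip dk W (ltW t00) Hv ts tt).
split; [exact: (holder_xt_bound crit_gt Bge0 Hu Hd) | exact: (lip_nabla_bound crit_gt Bge0 Hu Hd)].
Qed.

End Constants.

End Torus.

Theorem theorem2p5 (R : realType) (d : nat) (hd : (1 <= d)%N) :
  exists C1 C2 : nat -> R -> R -> R -> R -> R,
  forall (m : nat) (u0 : 'rV[R]_d -> R),
    d%:R / 2 + 1 < m%:R :> R ->
    sobolev m u0 ->
    (forall x, 0 < u0 x) ->
    exists u : R -> 'rV[R]_d -> R,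
      [/\ is_solution m u0 +oo%E u,
          (forall (T : \bar R) (v : R -> 'rV[R]_d -> R), (0 < T)%E ->
             is_solution m u0 T v ->
             forall t, 0 <= t -> (t%:E < T)%E -> v t = u t) &
          forall (T : R) (k : nat), 0 < T ->
            exists alpha : R,
              (0 < alpha < 1) /\
              forall t0 : R, 0 < t0 < T ->
                (holder_xt_norm k alpha `]t0, T[ u
                   <= (C1 k t0 T (inf (range u0)) (sup (range u0)))%:E)%E /\
                (lip_nabla_norm k `]t0, T[ u
                   <= (C2 k t0 T (inf (range u0)) (sup (range u0)))%:E)%E].
Proof.
pose B k (t0 m M : R) := @smoothing_const R d (k + (@crit d).+2).+1 t0 m M.
exists (fun k t0 T m M => @holder_const R d k (B k t0 m M) (@time_const R d k t0 m M)).
exists (fun k t0 T m M => @lip_const R d k (B k t0 m M) (@time_const R d k t0 m M)).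
(* With m = a + 1, the hypothesis on m reads d < 2a; the case m = 0 contradicts it. *)
move=> [|a] u0 dm su up.
  by exfalso; have : 0 <= d%:R / 2 :> R by []; move: dm; lra.
have da : (d < 2 * a)%N.
  rewrite -(ltr_nat R) natrM; move: dm; rewrite -[a.+1]addn1 natrD; lra.
have [B0 H0] := sobolev_Hs su; have [m0 mM ur] := positive_range H0.1 up.
exists (usol u0); split.
- exact: (usol_is_solution da hd m0 mM ur H0).
- by move=> T v _ sol t t0 tT; exact: (solution_unique da m0 mM ur sol t0 tT).
(* The same exponent 1/2 serves every [k] and [T]: all bounds interpolate between bounded and
   Lipschitz. *)
- move=> T k _; exists 2^-1; split; first by apply/andP; split; lra.
  move=> t0 /andP[t00 _]; apply: (usol_norm_bounds hd T k t00 m0 mM ur (B0 := B0)).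
  (* The datum is viewed at the critical index, where the constants were chosen. *)
  by apply: Hs_weaken H0; rewrite /crit; lia.
Qed.
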